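(* Let the standing assumptions (1)--(4) of the context hold. Each of the following conditions (i), (ii), (iii) implies that $\mu$ is $(\overline{T}_t)_{t>0}$-invariant, or equivalently, that $(T'_t)_{t>0}$ is conservative: (i) $a_{ij},\ g_i-\beta^{\rho,A}_i\in L^1(\mathbb{R}^d,\mu)$, $1\le i,j\le d$. (ii) There exist $u\in C^2(\mathbb{R}^d)$ and $\alpha>0$ such that $\lim_{\|x\|\to\infty}u(x)=\infty$ and $$\tfrac12\sum_{i,j=1}^da_{ij}\partial_{ij}u+\langle\beta^{\rho,A}-\mathbf{B},\nabla u\rangle\le\alpha u\quad\mu\text{-a.e.}$$ (iii) There exists $M\ge0$ such that $$-\frac{\langle A(x)x,x\rangle}{\|x\|^2+1}+\tfrac12\mathrm{trace}(A(x))+\langle(\beta^{\rho,A}-\mathbf{B})(x),x\rangle\le M(\|x\|^2+1)\big(\ln(\|x\|^2+1)+1\big)$$ for $\mu$-a.e. $x\in\mathbb{R}^d$.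
   Context: Function spaces. For open $V\subset\mathbb{R}^d$, $H^{1,2}_0(V,\mu)$ is the closure of $C_0^\infty(V)$ in $L^2(V,\mu)$ w.r.t. the norm $(\int_V u^2d\mu+\int_V\|\nabla u\|^2d\mu)^{1/2}$, and $H^{1,2}_{loc}(V,\mu)$ is the space of all $u$ with $u\chi\in H^{1,2}_0(V,\mu)$ for all $\chi\in C_0^\infty(V)$. A subscript $b$ denotes the (essentially) bounded elements of a function space. Standing assumptions ($d\ge1$): (1) $\mu=\rho\,dx$, $\rho=\varphi^2$ with $\varphi\in H^{1,2}_{loc}(\mathbb{R}^d)$, and $\mathrm{supp}(\mu)=\mathbb{R}^d$. (2) $A=(a_{ij})_{1\le i,j\le d}$ with $a_{ji}=a_{ij}\in H^{1,2}_{loc}(\mathbb{R}^d,\mu)$ is locally strictly elliptic: for every relatively compact $V$ there is $\nu_V>0$ with $\nu_V^{-1}\|\xi\|^2\le\langle A(x)\xi,\xi\rangle\le\nu_V\|\xi\|^2$ for all $\xi\in\mathbb{R}^d$, $x\in V$. (3) $\mathbf{G}=(g_1,\dots,g_d)\in L^2_{loc}(\mathbb{R}^d,\mathbb{R}^d,\mu)$. (4) $\int_{\mathbb{R}^d}\big(\tfrac12\sum_{i,j}a_{ij}\partial_{ij}u+\langle\mathbf{G},\nabla u\rangle\big)d\mu=0$ for all $u\in C_0^\infty(\mathbb{R}^d)$. Notation. $\beta^{\rho,A}_i=\tfrac12\sum_{j=1}^d\big(\partial_ja_{ij}+a_{ij}\tfrac{\partial_j\rho}{\rho}\big)$, $\beta^{\rho,A}=(\beta^{\rho,A}_1,\dots,\beta_d^{\rho,A})$,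 $\mathbf{B}=\mathbf{G}-\beta^{\rho,A}$ (so $\beta^{\rho,A}-\mathbf{B}=2\beta^{\rho,A}-\mathbf{G}$). The semigroups. For a relatively compact open $V$, let $(L^{0,V},D(L^{0,V}))$ be the self-adjoint generator on $L^2(V,\mu)$ of the Dirichlet form $\tfrac12\int_V\langle A\nabla u,\nabla v\rangle d\mu$, $u,v\in H^{1,2}_0(V,\mu)$. The operator $L^{0,V}u+\langle\mathbf{B},\nabla u\rangle$, $u\in D(L^{0,V})_b$, is closable on $L^1(V,\mu)$ and its closure generates a sub-Markovian $C_0$-semigroup of contractions on $L^1(V,\mu)$; let $\overline{G}^V_\alpha$ be its resolvent, and for $f\in L^1(\mathbb{R}^d,\mu)$ put $\overline{G}^V_\alpha f:=\overline{G}^V_\alpha(f1_V)$ (zero outside $V$). For any increasing sequence $(V_n)$ of relatively compact open sets with union $\mathbb{R}^d$, $\overline{G}_\alpha f=\lim_n\overline{G}_\alpha^{V_n}f$ exists in $L^1(\mathbb{R}^d,\mu)$, is independent of $(V_n)$, and is the resolvent of a sub-Markovian $C_0$-semigroup of contractions $(\overline{T}_t)_{t>0}$ on $L^1(\mathbb{R}^d,\mu)$, whose generator extends $\big(\tfrac12\sum a_{ij}\partial_{ij}+\sum g_i\partial_i,C_0^\infty(\mathbb{R}^d)\big)$. Replacing $\mathbf{B}$ by $-\mathbf{B}$ in this construction gives a sub-Markovian $C_0$-semigroup of contractions $(\overline{T}'_t)_{t>0}$ on $L^1(\mathbb{R}^d,\mu)$; $(T'_t)_{t>0}$ denotes the sub-Markovian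 semigroup on all $L^s(\mathbb{R}^d,\mu)$, $s\in[1,\infty]$, obtained by restricting $(\overline{T}'_t)$ to $L^1(\mathbb{R}^d,\mu)_b$ and extending; one has $\int\overline{T}_tu\,v\,d\mu=\int u\,T'_tv\,d\mu$ for $u,v\in L^1(\mathbb{R}^d,\mu)_b$. Definitions. $\mu$ is $(\overline{T}_t)_{t>0}$-invariant if $\int\overline{T}_tf\,d\mu=\int f\,d\mu$ for all $f\in L^1(\mathbb{R}^d,\mu)_b$, $f\ge0$, $t>0$. $(T'_t)_{t>0}$ is conservative if $T'_t1_{\mathbb{R}^d}=1$ $\mu$-a.e. for one (and hence all) $t>0$. *)

(* Defs.v *)
From HB Require Import structures.
From mathcomp Require Import all_boot all_order all_algebra.
From mathcomp Require Import all_classical all_reals all_analysis.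

Set Implicit Arguments.
Unset Strict Implicit.
Unset Printing Implicit Defensive.

Import Order.TTheory GRing.Theory Num.Theory.
Import numFieldNormedType.Exports.

Local Open Scope classical_set_scope.
Local Open Scope ring_scope.

(* The product sigma-algebra on row vectors, i.e. the Borel sigma-algebra of
   R^n when T is R. *)
Definition measure_rV_display : measure_display -> measure_display.
Proof. exact. Qed.

Section measurable_rV.
Context {d} {T : measurableType d}.
Variable n : nat.

Let coords : 'I_n -> 'rV[T]_n -> T := fun i x => x ord0 i.

Let rV_set0 : g_sigma_preimage coords set0.
Proof. exact: sigma_algebra0. Qed.

Let rV_setC A : g_sigma_preimage coords A -> g_sigma_preimage coords (~` A).
Proof. exact: sigma_algebraC. Qed.

Let rV_bigcup (F : _^nat) : (forall i, g_sigma_preimage coords (F i)) ->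
  g_sigma_preimage coords (\bigcup_i (F i)).
Proof. exact: sigma_algebra_bigcup. Qed.

HB.instance Definition _ := @isMeasurable.Build (measure_rV_display d)
  'rV[T]_n (g_sigma_preimage coords) rV_set0 rV_setC rV_bigcup.

Lemma measurable_coord (i : 'I_n) :
  measurable_fun [set: 'rV[T]_n] (fun x : 'rV[T]_n => x ord0 i).
Proof.
move=> _ Y mY; rewrite setTI; apply: sub_sigma_algebra => /=.
rewrite -bigcup_seq/=; exists i => /=; first by rewrite mem_index_enum.
by exists Y => //; rewrite setTI.
Qed.

Lemma measurable_fun_rVP d1 (T1 : measurableType d1) (f : T1 -> 'rV[T]_n) :
  (forall i, measurable_fun [set: T1] (fun t => f t ord0 i)) ->
  measurable_fun [set: T1] f.
Proof.
move=> mf _ A; rewrite setTI.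
suff: g_sigma_preimage coords `<=` [set B | measurable (f @^-1` B)] by apply.
apply: smallest_sub.
  split=> [|B /= mB|F /= mF].
  - by rewrite /= preimage_set0; exact: measurable0.
  - by rewrite setTD preimage_setC; exact: measurableC.
  - by rewrite preimage_bigcup; exact: bigcupT_measurable.
rewrite -bigcup_seq => B [i _ [C mC <-]] /=.
rewrite setTI -comp_preimage.
by have := mf i measurableT _ mC; rewrite setTI.
Qed.

End measurable_rV.

Section lebesgue_rV.
Context {R : realType}.

Definition consrV n (p : R * 'rV[R]_n) : 'rV[R]_n.+1 :=
  \row_i (if unlift ord0 i is Some j then p.2 ord0 j else p.1).

Lemma consrV0 n (p : R * 'rV[R]_n) : consrV p ord0 ord0 = p.1.
Proof. by rewrite mxE unlift_none. Qed.

Lemma consrVS n (p : R * 'rV[R]_n) i : consrV p ord0 (lift ord0 i) = p.2 ord0 i.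
Proof. by rewrite mxE liftK. Qed.

Lemma measurable_consrV n : measurable_fun setT (@consrV n).
Proof.
apply: measurable_fun_rVP => i; case: (unliftP ord0 i) => [j ->|->].
  rewrite (_ : (fun _ => _) = (fun x : 'rV[R]_n => x ord0 j) \o snd).
    by apply: measurableT_comp => //; exact: measurable_coord.
  by apply/funext => p /=; rewrite consrVS.
rewrite (_ : (fun _ => _) = fst); first exact: measurable_fst.
by apply/funext => p /=; rewrite consrV0.
Qed.

Definition unconsrV n (x : 'rV[R]_n.+1) : R * 'rV[R]_n :=
  (x ord0 ord0, \row_i x ord0 (lift ord0 i)).

Lemma consrVK n : cancel (@consrV n) (@unconsrV n).
Proof.
move=> [a x]; rewrite /unconsrV consrV0; congr pair.
by apply/rowP => i; rewrite mxE consrVS.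
Qed.

Lemma measurable_unconsrV n : measurable_fun setT (@unconsrV n).
Proof.
apply: measurable_fun_pair; first exact: measurable_coord.
apply: measurable_fun_rVP => i.
rewrite (_ : (fun _ => _) = (fun x : 'rV[R]_n.+1 => x ord0 (lift ord0 i))).
  exact: measurable_coord.
by apply/funext => x; rewrite mxE.
Qed.

Section step.
Variables (n : nat) (m : {sigma_finite_measure set 'rV[R]_n -> \bar R}).

Definition lebesgue_step : set 'rV[R]_n.+1 -> \bar R :=
  pushforward (@lebesgue_measure R \x m)%E (@consrV n).

HB.instance Definition _ := Measure.copy lebesgue_step
  (measure_function_pushforward__canonical__measure_function_Measure
    (@lebesgue_measure R \x m)%E (@measurable_consrV n)).

Let lebesgue_step_sigma_finite : sigma_finite setT lebesgue_step.
Proof.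
have /sigma_finiteP[F [TF ndF Foo]] := sigma_finiteT (@lebesgue_measure R).
have /sigma_finiteP[G [TG ndG Goo]] := sigma_finiteT m.
exists (fun k => @unconsrV n @^-1` (F k `*` G k)).
  rewrite -preimage_bigcup -[LHS](preimage_setT (@unconsrV n)); congr (_ @^-1` _).
  apply/esym; rewrite -subTset => -[x y] _.
  have [k _ Fkx] : (\bigcup_k F k) x by rewrite -TF.
  have [l _ Gly] : (\bigcup_k G k) y by rewrite -TG.
  exists (maxn k l) => //; split.
  - by move: x Fkx; exact/subsetPset/ndF/leq_maxl.
  - by move: y Gly; exact/subsetPset/ndG/leq_maxr.
move=> k; have [mF Fk] := Foo k; have [mG Gk] := Goo k; split.
  by rewrite -[X in measurable X]setTI; apply: measurable_unconsrV => //;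
     exact: measurableX.
rewrite /lebesgue_step /pushforward -comp_preimage.
rewrite (_ : _ \o _ = id) ?preimage_id; last first.
  by apply/funext => p /=; rewrite consrVK.
by rewrite product_measure1E// lte_mul_pinfty// ge0_fin_numE.
Qed.

HB.instance Definition _ := Measure_isSigmaFinite.Build _ _ _ lebesgue_step
  lebesgue_step_sigma_finite.

End step.

(* Lebesgue measure on R^n, as the n-fold product of Lebesgue measure on R. *)
Fixpoint lebesgue_rV n : {sigma_finite_measure set 'rV[R]_n -> \bar R} :=
  if n is n'.+1 then lebesgue_step (lebesgue_rV n') else dirac (0 : 'rV[R]_0).

Lemma lebesgue_rV_box n (a b : 'rV[R]_n) : (forall i, a ord0 i <= b ord0 i) ->
  lebesgue_rV n [set x | forall i, x ord0 i \in `[a ord0 i, b ord0 i]] =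
  (\prod_(i < n) (b ord0 i - a ord0 i))%:E.
Proof.
elim: n a b => [|n IH] a b ab.
  rewrite big_ord0 /= diracE mem_set//; by case.
rewrite /= /lebesgue_step /pushforward.
set A := (X in product_measure1 _ _ X = _).
have -> : A = `[a ord0 ord0, b ord0 ord0] `*`
   [set x : 'rV[R]_n | forall i, x ord0 i \in
     `[(unconsrV a).2 ord0 i, (unconsrV b).2 ord0 i]].
  apply/seteqP; split=> [p /= h|p /= [h0 h] i].
    split; first by have := h ord0; rewrite consrV0.
    by move=> i; have := h (lift ord0 i); rewrite consrVS !mxE.
  case: (unliftP ord0 i) => [j ->|->]; last by rewrite consrV0.
  by rewrite consrVS; have := h j; rewrite !mxE.
rewrite product_measure1E//=; last first.
  rewrite (_ : [set _ | _] = \bigcap_(i in [set: 'I_n])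
    (fun x : 'rV[R]_n => x ord0 i) @^-1`
      `[(unconsrV a).2 ord0 i, (unconsrV b).2 ord0 i]).
    apply: fin_bigcap_measurable => // i _.
    by rewrite -[X in measurable X]setTI; exact: measurable_coord.
  by apply/seteqP; split=> x /= h i => [_|]; [exact: h|exact: (h i I)].
rewrite IH; last by move=> i; rewrite !mxE.
rewrite lebesgue_measure_itv/= lte_fin big_ord_recl EFinM.
congr (_ * _)%E; last by congr EFin; apply: eq_bigr => i _; rewrite !mxE.
have := ab ord0; rewrite le_eqVlt => /orP[/eqP->|->].
  by rewrite ltxx subrr.
by rewrite EFinB.
Qed.

End lebesgue_rV.

Section smooth_functions.
Context {R : realType} {d : nat}.
Local Notation E := 'rV[R]_d.

Definition dot (x y : E) : R := \sum_i x ord0 i * y ord0 i.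
Definition enorm (x : E) : R := Num.sqrt (dot x x).

Definition partial (i : 'I_d) (f : E -> R) (x : E) : R :=
  'D_(delta_mx ord0 i : E) f x.
Definition gradient (f : E -> R) (x : E) : E := \row_i partial i f x.

Fixpoint Ck (k : nat) (f : E -> R) : Prop :=
  continuous f /\
  if k is k'.+1 then
    forall i, (forall x, derivable f x (delta_mx ord0 i : E)) /\
              Ck k' (partial i f)
  else True.

Definition Cc_smooth (V : set E) (f : E -> R) : Prop :=
  [/\ forall k, Ck k f,
      compact (closure [set x | f x != 0]) &
      closure [set x | f x != 0] `<=` V].

(* 1/2 sum_ij a_ij d_ij u + <b, grad u> *)
Definition diffop (A : E -> 'M[R]_d) (b : E -> E) (u : E -> R) (x : E) : R :=
  2^-1 * (\sum_i \sum_j A x i j * partial i (partial j u) x) +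
  dot (b x) (gradient u x).

(* <M x, y>; x *m M^T is the row vector of M x *)
Definition mxdot (M : 'M[R]_d) (x y : E) : R := dot (x *m M^T) y.

Definition relcompact_open (V : set E) : Prop := open V /\ compact (closure V).

Definition locally_elliptic (A : E -> 'M[R]_d) : Prop :=
  forall V, relcompact_open V ->
  exists2 nu : R, 0 < nu &
    forall xi x, V x -> nu^-1 * dot xi xi <= mxdot (A x) xi xi <= nu * dot xi xi.

End smooth_functions.

Section function_spaces.
Context {R : realType} {d : nat}.
Local Notation E := 'rV[R]_d.
Implicit Types (mu : {measure set E -> \bar R}) (V K : set E) (p : \bar R).

(* Elements of L^p(V, mu) are represented by functions on R^d whose values
   outside V are irrelevant *)
Definition Lp mu p V (f : E -> R) : Prop := f \_ V \in Lfun mu p.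
Definition Lpnorm mu p V (f : E -> R) : \bar R := Lnorm mu p (EFin \o f \_ V).

Definition Lploc mu p (f : E -> R) : Prop :=
  measurable_fun setT f /\ forall K, compact K -> Lp mu p K f.

(* u is in H^{1,2}_0(V, mu) with gradient w: as L^2 is complete, a limit in
   L^2(V, mu) of a sequence which is Cauchy in the H^{1,2} norm is one whose
   gradients converge in L^2(V, mu) *)
Definition H0_grad mu V (u : E -> R) (w : E -> E) : Prop :=
  [/\ Lp mu 2%:E V u,
      forall i, Lp mu 2%:E V (fun x => w x ord0 i) &
      exists un : nat -> E -> R,
        [/\ forall n, Cc_smooth V (un n),
            Lpnorm mu 2%:E V (fun x => un n x - u x) @[n --> \oo] --> 0%E &
            forall i, Lpnorm mu 2%:E V
              (fun x => partial i (un n) x - w x ord0 i) @[n --> \oo] --> 0%E]].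

Definition H0 mu V (u : E -> R) : Prop := exists w, H0_grad mu V u w.

Definition Hloc mu (u : E -> R) : Prop :=
  forall chi, Cc_smooth setT chi -> H0 mu setT (fun x => u x * chi x).

(* The gradient of u in H^{1,2}_loc(R^d, mu) is determined mu-a.e. by
   grad (u chi) = chi grad u + u grad chi *)
Definition Hloc_grad mu (u : E -> R) (w : E -> E) : Prop :=
  forall chi, Cc_smooth setT chi ->
    H0_grad mu setT (fun x => u x * chi x)
      (fun x => chi x *: w x + u x *: gradient chi x).

Definition wgrad mu (u : E -> R) : E -> E := xget (fun=> 0) (Hloc_grad mu u).

(* Distributional gradient with respect to Lebesgue measure *)
Definition distr_grad (f : E -> R) (w : E -> E) : Prop :=
  forall i, Lploc (lebesgue_rV d) 1 (fun x => w x ord0 i) /\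
  forall psi, Cc_smooth setT psi ->
    (\int[lebesgue_rV d]_x (f x * partial i psi x))%R =
    (- \int[lebesgue_rV d]_x (w x ord0 i * psi x))%R.

Definition dgrad (f : E -> R) : E -> E := xget (fun=> 0) (distr_grad f).

Definition beta mu (rho : E -> R) (A : E -> 'M[R]_d) (x : E) : E :=
  \row_i (2^-1 * \sum_j (wgrad mu (fun y => A y i j) x ord0 j +
                         A x i j * (dgrad rho x ord0 j / rho x))).

End function_spaces.

Section semigroups.
Context {R : realType} {d : nat}.
Local Notation E := 'rV[R]_d.
Variable mu : {measure set E -> \bar R}.
Implicit Types (V : set E) (S : R -> (E -> R) -> E -> R).

Record submarkov_semigroup V S : Prop := {
  semigroup_L1 : forall t f, 0 < t -> Lp mu 1 V f -> Lp mu 1 V (S t f);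
  semigroup_ae : forall t f g, 0 < t -> Lp mu 1 V f -> Lp mu 1 V g ->
    f = g %[ae mu in V] -> S t f = S t g %[ae mu in V];
  semigroup_linear : forall t a f g, 0 < t -> Lp mu 1 V f -> Lp mu 1 V g ->
    S t (fun x => a * f x + g x) = (fun x => a * S t f x + S t g x)
      %[ae mu in V];
  semigroupD : forall s t f, 0 < s -> 0 < t -> Lp mu 1 V f ->
    S (s + t) f = S s (S t f) %[ae mu in V];
  semigroup_contraction : forall t f, 0 < t -> Lp mu 1 V f ->
    (Lpnorm mu 1 V (S t f) <= Lpnorm mu 1 V f)%E;
  semigroup_C0 : forall f, Lp mu 1 V f ->
    Lpnorm mu 1 V (fun x => S t f x - f x) @[t --> 0^'+] --> 0%E;
  semigroup_submarkov : forall t f, 0 < t -> Lp mu 1 V f ->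
    (\forall x \ae mu, V x -> 0 <= f x <= 1) ->
    \forall x \ae mu, V x -> 0 <= S t f x <= 1 }.

(* f = L u for the generator L of S *)
Definition generator V S (u f : E -> R) : Prop :=
  [/\ Lp mu 1 V u, Lp mu 1 V f &
      Lpnorm mu 1 V (fun x => (S t u x - u x) / t - f x) @[t --> 0^'+] --> 0%E].

(* g = (alpha - L)^-1 f *)
Definition resolvent V S (alpha : R) (f g : E -> R) : Prop :=
  generator V S g (fun x => alpha * g x - f x).

(* h = L^{0,V} u *)
Definition dirichlet_generator (A : E -> 'M[R]_d) V (u h : E -> R) : Prop :=
  exists w, [/\ H0_grad mu V u w, Lp mu 2%:E V h &
    forall v z, H0_grad mu V v z ->
      (2^-1 * \int[mu]_(x in V) mxdot (A x) (w x) (z x))%R =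
      (- \int[mu]_(x in V) (h x * v x))%R].

(* f = L^{0,V} u + <B, grad u> for u in D(L^{0,V})_b *)
Definition local_operator (A : E -> 'M[R]_d) (B : E -> E) V (u f : E -> R) :
    Prop :=
  exists w h, [/\ H0_grad mu V u w, dirichlet_generator A V u h,
    Lp mu +oo%E V u, Lp mu 1 V f &
    f = (fun x => h x + dot (B x) (w x)) %[ae mu in V]].

Definition L1_graph_closure V (L : (E -> R) -> (E -> R) -> Prop)
    (u f : E -> R) : Prop :=
  [/\ Lp mu 1 V u, Lp mu 1 V f & exists un fn : nat -> E -> R,
    [/\ forall n, L (un n) (fn n),
        Lpnorm mu 1 V (fun x => un n x - u x) @[n --> \oo] --> 0%E &
        Lpnorm mu 1 V (fun x => fn n x - f x) @[n --> \oo] --> 0%E]].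

(* S is generated by the closure on L^1(V, mu) of the local operator *)
Definition local_semigroup (A : E -> 'M[R]_d) (B : E -> E) V S : Prop :=
  submarkov_semigroup V S /\
  forall u f, generator V S u f <-> L1_graph_closure V (local_operator A B V) u f.

Definition exhaustion (Vn : nat -> set E) : Prop :=
  [/\ forall n, relcompact_open (Vn n),
      forall n, Vn n `<=` Vn n.+1 &
      \bigcup_n Vn n = setT].

(* T is the semigroup on L^1(R^d, mu) whose resolvent is the limit of the
   resolvents on relatively compact open sets *)
Definition constructed_semigroup (A : E -> 'M[R]_d) (B : E -> E)
    (T : R -> (E -> R) -> E -> R) : Prop :=
  submarkov_semigroup setT T /\
  forall Vn, exhaustion Vn ->
  exists2 S : nat -> R -> (E -> R) -> E -> R,
    forall n, local_semigroup A B (Vn n) (S n) &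
    forall alpha f, 0 < alpha -> Lp mu 1 setT f ->
    exists2 g : nat -> E -> R,
      forall n, resolvent (Vn n) (S n) alpha f (g n) &
      exists2 g0 : E -> R, resolvent setT T alpha f g0 &
        Lpnorm mu 1 setT (fun x => (g n \_ (Vn n)) x - g0 x) @[n --> \oo] --> 0%E.

Definition invariant_measure (T : R -> (E -> R) -> E -> R) : Prop :=
  forall t f, 0 < t -> Lp mu 1 setT f -> Lp mu +oo%E setT f ->
    (\forall x \ae mu, 0 <= f x) ->
    (\int[mu]_x (T t f x)%:E = \int[mu]_x (f x)%:E)%E.

Definition monotone_approx (f : E -> R) (fn : nat -> E -> R) : Prop :=
  [/\ forall n, Lp mu 1 setT (fn n) /\ Lp mu +oo%E setT (fn n),
      forall n, \forall x \ae mu, 0 <= fn n x <= fn n.+1 x &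
      \forall x \ae mu, fn n x @[n --> \oo] --> f x].

(* g is the value at f of the extension to L^oo of a positive operator P given
   on L^1_b: the extension is continuous along increasing sequences *)
Definition Loo_extension (P : (E -> R) -> E -> R) (f g : E -> R) : Prop :=
  [/\ Lp mu +oo%E setT f, Lp mu +oo%E setT g &
  forall p q : nat -> E -> R,
    monotone_approx f^\+ p -> monotone_approx f^\- q ->
    \forall x \ae mu, (P (p n) x - P (q n) x) @[n --> \oo] --> g x].

Definition conservative_at (t : R) (T : R -> (E -> R) -> E -> R) : Prop :=
  Loo_extension (T t) (cst 1) (cst 1).

End semigroups.

(* Main.v *)
(* Resolvents on bounded domains have no gradient, only approximants in the domain of the local
   operator. Truncating an approximant by a fixed smooth bounded function that is the identity on
   the range of the limit gives elements of H^{1,2}_0 that solve the weak equation up to an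
   arbitrarily small multiple of the supremum norm of the test function; the truncation error is
   the energy in the truncated region, which is small because B is divergence free.

   Testing with functions that increase to 1 shows that alpha G_alpha preserves the integral:
   scaled cutoffs under (i), the functions ((1 - u/m)^+)^3 of a Lyapunov function u under (ii), and
   condition (iii) is (ii) for u = ln (1 + |x|^2) + 1 up to constants. Since
   T_t G_alpha f = G_alpha T_t f, the integral of T_t G_alpha f is then constant in t, which gives
   the invariance. Testing the two weak equations with each other yields the duality of the
   resolvents, hence of the semigroups, and the duality applied to functions increasing to 1
   translates invariance of T into conservativeness of T'. *)
From mathcomp Require Import all_boot all_order all_algebra.
From mathcomp Require Import all_classical all_reals all_analysis.
From mathcomp Require Import measurable_realfun ess_sup_inf.
From mathcomp Require Import ring lra.
Require Import Defs.

Set Implicit Arguments.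
Unset Strict Implicit.
Unset Printing Implicit Defensive.

Import Order.TTheory GRing.Theory Num.Theory.
Import numFieldNormedType.Exports.

Local Open Scope classical_set_scope.
Local Open Scope ring_scope.

(** * Integrable and square integrable functions *)

(** The constructed objects are given only through semigroups on L^1 and closures of graphs, and
    this shapes the proof in three ways. The gradient of an element of H^{1,2}_0 is a second
    component of a limit; that the function determines it is closability, which rests on integration
    by parts for mu with the logarithmic derivative of the density and on the du Bois-Reymond lemma.
    The drift is only in L^2, so that <B, grad u> v is integrable for bounded v: its antisymmetry
    goes through the product rule for bounded elements of H^{1,2}_0, and truncations are C^2 splines
    because the chain rule is applied to their derivatives as well. The passage between resolvents
    and semigroups uses iterates S_h^k on a grid of step t/(N+1): the semigroup is a contraction and
    commutes with its resolvents, so the remainders of all difference quotients along the grid are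
    bounded by the first one, and N+1 errors of size h e add up to t e. Most limits are replaced by
    estimates valid for every small e ([eps_zero]), which avoids subsequences. *)

Lemma sqr_normr (R : realDomainType) (x : R) : `|x| ^+ 2 = x ^+ 2.
Proof. exact: real_normK (num_real x). Qed.

Lemma cvg_EFinW {R : realFieldType} {I : Type} {F : set_system I} {FF : Filter F} (f : I -> R) (a : R) :
  f x @[x --> F] --> a -> (EFin \o f) x @[x --> F] --> a%:E.
Proof. by move=> h; apply/fine_cvgP; split => //; exact: nearW. Qed.

Section real_integrals.
Context {disp : measure_display} {T : measurableType disp} {R : realType}.
Variable mu : {measure set T -> \bar R}.
Implicit Types (D : set T) (f g h w : T -> R).

(** Real-valued norms make every estimate an inequality between real numbers. As [Rintegral] sends
    an infinite integral to 0, [n1] and [n2] are meaningful only together with [L1] and [L2], which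
    therefore accompany them everywhere. *)
Definition L1 D f := mu.-integrable D (EFin \o f).
Definition L2 D f := measurable_fun D f /\ L1 D (fun x => f x ^+ 2).
Definition n1 D f : R := \int[mu]_(x in D) `|f x|.
Definition n2 D f : R := Num.sqrt (\int[mu]_(x in D) (f x ^+ 2)).

Lemma L1_meas D f : L1 D f -> measurable_fun D f.
Proof. by move=> /integrableP[/measurable_EFinP]. Qed.

Lemma L1P D f : L1 D f <-> measurable_fun D f /\
  (\int[mu]_(x in D) `|f x|%:E < +oo)%E.
Proof.
split=> [/integrableP[/measurable_EFinP ? ?]//|[? ?]].
by apply/integrableP; split=> //; exact/measurable_EFinP.
Qed.

Lemma L1_dom D f g : measurable D -> measurable_fun D f -> L1 D g ->
  (\forall x \ae mu, D x -> `|f x| <= g x) -> L1 D f.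
Proof.
move=> mD mf /L1P[mg ig] fg; apply/L1P; split => //.
apply: le_lt_trans ig; apply: ae_ge0_le_integral => //=.
- by apply/measurable_EFinP; apply: measurableT_comp.
- by apply/measurable_EFinP; apply: measurableT_comp.
- apply: filterS fg => x /[apply] fgx; rewrite lee_fin.
  exact: (le_trans fgx (ler_norm _)).
Qed.

Lemma L1_eq D f g : measurable D -> (forall x, D x -> f x = g x) ->
  L1 D f -> L1 D g.
Proof.
by move=> mD fg; apply: eq_integrable => // x /set_mem Dx /=; rewrite fg.
Qed.

Lemma L1D D f g : measurable D -> L1 D f -> L1 D g ->
  L1 D (fun x => f x + g x).
Proof. by move=> mD If Ig; have := integrableD mD If Ig. Qed.

Lemma L1N D f : measurable D -> L1 D f -> L1 D (fun x => - f x).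
Proof. by move=> mD If; have := integrableN If. Qed.

Lemma L1B D f g : measurable D -> L1 D f -> L1 D g ->
  L1 D (fun x => f x - g x).
Proof. by move=> mD If Ig; exact: L1D (L1N mD Ig). Qed.

Lemma L1Z D k f : measurable D -> L1 D f -> L1 D (fun x => k * f x).
Proof. by move=> mD If; have := integrableZl mD k If. Qed.

Lemma L1_abs D f : measurable D -> L1 D f -> L1 D (fun x => `|f x|).
Proof. by move=> mD If; have := integrable_norm If. Qed.

Lemma L1_0 D : L1 D (fun=> 0).
Proof. exact: integrable0. Qed.

Lemma L1_sum (I : Type) (s : seq I) (F : I -> T -> R) D : measurable D ->
  (forall i, L1 D (F i)) -> L1 D (fun x => \sum_(i <- s) F i x).
Proof.
move=> mD IF; elim: s => [|i s IH].
  by apply: (L1_eq mD _ (L1_0 D)) => x _; rewrite big_nil.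
by apply: (L1_eq mD _ (L1D mD (IF i) IH)) => x _; rewrite big_cons.
Qed.

Lemma L1S D E f : measurable D -> measurable E -> E `<=` D -> L1 D f -> L1 E f.
Proof. by move=> mD mE ED; apply: integrableS. Qed.

Lemma L1_bM D f g M : measurable D -> measurable_fun D f -> L1 D g ->
  (\forall x \ae mu, D x -> `|f x| <= M) -> L1 D (fun x => f x * g x).
Proof.
move=> mD mf Ig fM; have Ig' := L1Z `|M| mD (L1_abs mD Ig).
apply: (L1_dom mD _ Ig') => //.
  by apply: measurable_funM => //; exact: L1_meas Ig.
apply: filterS fM => x /[apply] fM; rewrite normrM ler_wpM2r//.
exact: le_trans (ler_norm _).
Qed.

Lemma int_eq_ae D f g : measurable D -> measurable_fun D f ->
  measurable_fun D g -> (\forall x \ae mu, D x -> f x = g x) ->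
  \int[mu]_(x in D) f x = \int[mu]_(x in D) g x.
Proof.
move=> mD mf mg fg; rewrite /Rintegral; congr fine.
apply: ae_eq_integral => //; try exact/measurable_EFinP.
by apply: filterS fg => x /[apply] ->.
Qed.

Lemma int_eq D f g : (forall x, D x -> f x = g x) ->
  \int[mu]_(x in D) f x = \int[mu]_(x in D) g x.
Proof. by move=> fg; apply: eq_Rintegral => x /set_mem; exact: fg. Qed.

Lemma int_ge0_ae D f : measurable D -> measurable_fun D f ->
  (\forall x \ae mu, D x -> 0 <= f x) -> 0 <= \int[mu]_(x in D) f x.
Proof.
move=> mD mf f0; rewrite (@int_eq_ae _ _ (fun x => `|f x|))//.
- by apply: Rintegral_ge0.
- exact: measurableT_comp.
- by apply: filterS f0 => x /[apply] /ger0_norm ->.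
Qed.

Lemma int_le_ae D f g : measurable D -> L1 D f -> L1 D g ->
  (\forall x \ae mu, D x -> f x <= g x) ->
  \int[mu]_(x in D) f x <= \int[mu]_(x in D) g x.
Proof.
move=> mD If Ig fg; rewrite -subr_ge0 -RintegralB//.
have IB := L1B mD Ig If; apply: int_ge0_ae => //; first exact: L1_meas IB.
by apply: filterS fg => x /[apply]; rewrite subr_ge0.
Qed.

Lemma n1_ge0 D f : 0 <= n1 D f.
Proof. exact: Rintegral_ge0. Qed.

Lemma n2_ge0 D f : 0 <= n2 D f.
Proof. exact: sqrtr_ge0. Qed.

Lemma n2_sqr D f : n2 D f ^+ 2 = \int[mu]_(x in D) (f x ^+ 2).
Proof. by rewrite sqr_sqrtr//; apply: Rintegral_ge0 => x _; exact: sqr_ge0. Qed.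

Lemma int_le_n1 D f : measurable D -> L1 D f ->
  `|\int[mu]_(x in D) f x| <= n1 D f.
Proof. exact: le_normr_Rintegral. Qed.

Lemma n1_le D f g : measurable D -> L1 D f -> L1 D g ->
  (\forall x \ae mu, D x -> `|f x| <= `|g x|) -> n1 D f <= n1 D g.
Proof. by move=> mD If Ig fg; apply: int_le_ae => //; exact: L1_abs. Qed.

Lemma n1D D f g : measurable D -> L1 D f -> L1 D g ->
  n1 D (fun x => f x + g x) <= n1 D f + n1 D g.
Proof.
move=> mD If Ig; rewrite /n1 -RintegralD//; try exact: L1_abs.
apply: int_le_ae => //; [exact/L1_abs/L1D|by apply: L1D => //; exact: L1_abs|].
by apply/nearW => x _; exact: ler_normD.
Qed.

Lemma n1Z D k f : measurable D -> L1 D f -> n1 D (fun x => k * f x) = `|k| * n1 D f.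
Proof.
move=> mD If; rewrite /n1 -RintegralZl//; last exact: L1_abs.
by apply: int_eq => x _; rewrite normrM.
Qed.

Lemma n1N D f : n1 D (fun x => - f x) = n1 D f.
Proof. by apply: int_eq => x _; rewrite normrN. Qed.

Lemma n1BC D f g : n1 D (fun x => f x - g x) = n1 D (fun x => g x - f x).
Proof. by apply: int_eq => x _; rewrite distrC. Qed.

Lemma n1B D f g : measurable D -> L1 D f -> L1 D g ->
  n1 D (fun x => f x - g x) <= n1 D f + n1 D g.
Proof. by move=> mD If Ig; rewrite -(n1N D g); apply: n1D => //; exact: L1N. Qed.

Lemma n1_eq_ae D f g : measurable D -> L1 D f -> L1 D g ->
  (\forall x \ae mu, D x -> f x = g x) -> n1 D f = n1 D g.
Proof.
move=> mD If Ig fg; apply: int_eq_ae => //.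
- exact/L1_meas/L1_abs.
- exact/L1_meas/L1_abs.
- by apply: filterS fg => x /[apply] ->.
Qed.

Lemma n1_0_ae D f : measurable D -> L1 D f -> n1 D f = 0 ->
  \forall x \ae mu, D x -> f x = 0.
Proof.
move=> mD If n0.
have : (\int[mu]_(x in D) `|(EFin \o f) x|)%E = 0%E.
  rewrite -[LHS]fineK ?[X in X%:E]n0//.
  by have := integrable_fin_num mD (L1_abs mD If).
move/(ae_eq_integral_abs mu mD (measurable_int mu If)).
by apply: filterS => x /= /[apply] -[].
Qed.

Lemma L2_meas D f : L2 D f -> measurable_fun D f. Proof. by case. Qed.

Lemma L2_dom D f g c : measurable D -> measurable_fun D f -> L2 D g ->
  (\forall x \ae mu, D x -> `|f x| <= c * `|g x|) -> L2 D f.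
Proof.
move=> mD mf [mg ig] fg; split => //.
apply: (L1_dom mD _ (L1Z (c ^+ 2) mD ig)); first exact: measurable_funX.
apply: filterS fg => x /[apply] fgx.
rewrite ger0_norm ?sqr_ge0// -[leLHS]sqr_normr -[X in _ * X]sqr_normr -exprMn.
by rewrite lerXn2r// nnegrE// (le_trans _ fgx).
Qed.

Lemma L2_eq D f g : measurable D -> (forall x, D x -> f x = g x) ->
  L2 D f -> L2 D g.
Proof.
move=> mD fg [mf If]; split; first by apply: eq_measurable_fun mf => x /set_mem /fg.
by apply: L1_eq If => // x /fg ->.
Qed.

Lemma L2_mul D f g : measurable D -> L2 D f -> L2 D g -> L1 D (fun x => f x * g x).
Proof.
move=> mD [mf If] [mg Ig]; apply: (L1_dom mD _ (L1D mD If Ig)).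
  exact: measurable_funM.
apply/nearW => x _; rewrite normrM -[f x ^+ 2]sqr_normr -[g x ^+ 2]sqr_normr.
have := sqr_ge0 (`|f x| - `|g x|); have := normr_ge0 (f x); have := normr_ge0 (g x).
nra.
Qed.

Lemma L2Z D k f : measurable D -> L2 D f -> L2 D (fun x => k * f x).
Proof.
move=> mD L2f; apply: (@L2_dom _ _ f `|k|) => //.
  by apply: measurable_funM => //; exact: L2_meas.
by apply/nearW => x _; rewrite normrM.
Qed.

Lemma L2D D f g : measurable D -> L2 D f -> L2 D g -> L2 D (fun x => f x + g x).
Proof.
move=> mD [mf If] [mg Ig]; split; first exact: measurable_funD.
apply: (L1_dom mD _ (L1Z 2 mD (L1D mD If Ig))).
  by apply: measurable_funX; exact: measurable_funD.
apply/nearW => x _; rewrite ger0_norm ?sqr_ge0//.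
have := sqr_ge0 (f x - g x); nra.
Qed.

Lemma L2N D f : measurable D -> L2 D f -> L2 D (fun x => - f x).
Proof. by move=> mD /(L2Z (-1) mD); apply: L2_eq => // x _; rewrite mulN1r. Qed.

Lemma L2B D f g : measurable D -> L2 D f -> L2 D g -> L2 D (fun x => f x - g x).
Proof. by move=> mD If Ig; apply: L2D => //; exact: L2N. Qed.

Lemma L2_0 D : L2 D (fun=> 0).
Proof.
split; first exact: measurable_cst.
by have := L1_0 D; under [X in _ -> L1 _ X]eq_fun do rewrite expr0n.
Qed.

Lemma L2_sum (I : Type) (s : seq I) (F : I -> T -> R) D : measurable D ->
  (forall i, L2 D (F i)) -> L2 D (fun x => \sum_(i <- s) F i x).
Proof.
move=> mD IF; elim: s => [|i s IH].
  by apply: (L2_eq mD _ (L2_0 D)) => x _; rewrite big_nil.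
by apply: (L2_eq mD _ (L2D mD (IF i) IH)) => x _; rewrite big_cons.
Qed.

Lemma L2_bM D f g M : measurable D -> measurable_fun D f -> L2 D g ->
  (\forall x \ae mu, D x -> `|f x| <= M) -> L2 D (fun x => f x * g x).
Proof.
move=> mD mf Ig fM; apply: (@L2_dom _ _ g M) => //.
  by apply: measurable_funM => //; exact: L2_meas.
by apply: filterS fM => x /[apply] fM; rewrite normrM ler_wpM2r.
Qed.

Lemma L2S D E f : measurable D -> measurable E -> E `<=` D -> L2 D f -> L2 E f.
Proof.
move=> mD mE ED [mf If]; split; first exact: measurable_funS mf.
exact: L1S If.
Qed.

(** The quadratic polynomial in [t] given by the integral of [(f + t g)^2] is nonnegative, so its
    discriminant is not positive. *)
Lemma cauchy_schwarz D f g : measurable D -> L2 D f -> L2 D g ->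
  `|\int[mu]_(x in D) (f x * g x)| <= n2 D f * n2 D g.
Proof.
move=> mD Lf Lg.
set b := \int[mu]_(x in D) (f x * g x).
have If := Lf.2; have Ig := Lg.2; have Ifg := L2_mul mD Lf Lg.
suff: b ^+ 2 <= n2 D f ^+ 2 * n2 D g ^+ 2.
  rewrite -exprMn -(sqr_normr b) => h.
  by rewrite -(@ler_pXn2r _ 2)// ?nnegrE// mulr_ge0// n2_ge0.
rewrite !n2_sqr; set a := (X in X * _); set c := (X in _ * X).
have q (t : R) : 0 <= a + 2 * t * b + t ^+ 2 * c.
  rewrite /a /b /c -RintegralZl// -RintegralZl// -RintegralD//; last exact: L1Z.
  rewrite -RintegralD//; [|by apply: L1D => //; exact: L1Z|exact: L1Z].
  apply: Rintegral_ge0 => x _.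
  by rewrite (_ : _ + _ = (f x + t * g x) ^+ 2) ?sqr_ge0//; ring.
have c0 : 0 <= c by apply: Rintegral_ge0 => x _; exact: sqr_ge0.
have a0 : 0 <= a by apply: Rintegral_ge0 => x _; exact: sqr_ge0.
(* For [c = 0] the polynomial is affine; if [b] were nonzero, the chosen [t] would give it the value
   -1. For [c > 0] it is evaluated at its minimum [- b / c]. *)
have [c00|cn0] := eqVneq c 0.
  have [b00|bn0] := eqVneq b 0; first by rewrite b00 c00 expr0n/= mulr0.
  have := q (- (a + 1) / (2 * b)); rewrite c00 mulr0 addr0.
  by rewrite (_ : _ + _ = -1) ?ler0N1//; field.
have cp : 0 < c by rewrite lt_def cn0.
have /(ler_wpM2r c0) := q (- b / c); rewrite mul0r.
rewrite (_ : (_ + _) * _ = a * c - b ^+ 2); last by field.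
by rewrite subr_ge0.
Qed.

Lemma n2D D f g : measurable D -> L2 D f -> L2 D g ->
  n2 D (fun x => f x + g x) <= n2 D f + n2 D g.
Proof.
move=> mD Lf Lg; rewrite -(@ler_pXn2r _ 2)// ?nnegrE ?addr_ge0 ?n2_ge0//.
have If := Lf.2; have Ig := Lg.2; have Ifg := L2_mul mD Lf Lg.
have -> : n2 D (fun x => f x + g x) ^+ 2 =
    n2 D f ^+ 2 + 2 * \int[mu]_(x in D) (f x * g x) + n2 D g ^+ 2.
  rewrite !n2_sqr -RintegralZl// -RintegralD//; last exact: L1Z.
  rewrite -RintegralD//; last by apply: L1D => //; exact: L1Z.
  by apply: int_eq => x _; ring.
have := cauchy_schwarz mD Lf Lg; have := ler_norm (\int[mu]_(x in D) (f x * g x)).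
nra.
Qed.

Lemma n2_le D f g : measurable D -> L2 D f -> L2 D g ->
  (\forall x \ae mu, D x -> `|f x| <= `|g x|) -> n2 D f <= n2 D g.
Proof.
move=> mD Lf Lg fg; rewrite ler_wsqrtr// int_le_ae//; [exact: Lf.2|exact: Lg.2|].
apply: filterS fg => x /[apply] h.
by rewrite -[f x ^+ 2]sqr_normr -[g x ^+ 2]sqr_normr lerXn2r.
Qed.

Lemma n2N D f : n2 D (fun x => - f x) = n2 D f.
Proof. by congr Num.sqrt; apply: int_eq => x _; rewrite sqrrN. Qed.

Lemma n2Z D k f : measurable D -> L2 D f -> n2 D (fun x => k * f x) = `|k| * n2 D f.
Proof.
move=> mD Lf; rewrite /n2 -[`|k|]sqrtr_sqr -sqrtrM ?sqr_ge0//.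
rewrite -RintegralZl//; last exact: Lf.2.
by congr Num.sqrt; apply: int_eq => x _; rewrite exprMn.
Qed.

Lemma n2BC D f g : n2 D (fun x => f x - g x) = n2 D (fun x => g x - f x).
Proof. by rewrite -n2N; congr Num.sqrt; apply: int_eq => x _; rewrite opprB. Qed.

Lemma n2_eq D f g : (forall x, D x -> f x = g x) -> n2 D f = n2 D g.
Proof. by move=> fg; congr Num.sqrt; apply: int_eq => x /fg ->. Qed.

Lemma n2_eq_ae D f g : measurable D -> measurable_fun D f -> measurable_fun D g ->
  (\forall x \ae mu, D x -> f x = g x) -> n2 D f = n2 D g.
Proof.
move=> mD mf mg fg; congr Num.sqrt; apply: int_eq_ae => //; try exact: measurable_funX.
by apply: filterS fg => x /[apply] ->.
Qed.

Lemma n2_0 D : n2 D (fun=> 0) = 0.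
Proof. by rewrite /n2; under eq_Rintegral do rewrite expr0n; rewrite /Rintegral integral0 sqrtr0. Qed.

Lemma n1_mul D f g : measurable D -> L2 D f -> L2 D g ->
  n1 D (fun x => f x * g x) <= n2 D f * n2 D g.
Proof.
move=> mD Lf Lg.
have La h : L2 D h -> L2 D (fun x => `|h x|).
  move=> [mh Ih]; split; first exact: measurableT_comp.
  by apply: L1_eq Ih => // x _; rewrite sqr_normr.
have na h : n2 D (fun x => `|h x|) = n2 D h.
  by congr Num.sqrt; apply: int_eq => x _; rewrite sqr_normr.
have := cauchy_schwarz mD (La _ Lf) (La _ Lg); rewrite !na; apply: le_trans.
apply: le_trans (ler_norm _); rewrite le_eqVlt; apply/orP; left; apply/eqP.
by apply: int_eq => x _; rewrite normrM.
Qed.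

Lemma L1_bounded D f M : measurable D -> (mu D < +oo)%E -> measurable_fun D f ->
  (\forall x \ae mu, D x -> `|f x| <= M) -> L1 D f.
Proof.
move=> mD Doo mf fM; apply: (@L1_dom _ _ (fun=> M)) => //.
apply/L1P; split => //; rewrite integral_cst//.
by rewrite lte_mul_pinfty// lee_fin.
Qed.

Lemma L2_bounded D f M : measurable D -> (mu D < +oo)%E -> measurable_fun D f ->
  (\forall x \ae mu, D x -> `|f x| <= M) -> L2 D f.
Proof.
move=> mD Doo mf fM; split => //; apply: (@L1_bounded _ _ (M ^+ 2)) => //.
  exact: measurable_funX.
apply: filterS fM => x /[apply] h; rewrite ger0_norm ?sqr_ge0// -sqr_normr.
by rewrite lerXn2r// nnegrE (le_trans _ h).
Qed.

Lemma L2_L1 D f : measurable D -> (mu D < +oo)%E -> L2 D f -> L1 D f.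
Proof.
move=> mD Doo Lf; have L2c : L2 D (fun=> 1).
  by apply: (@L2_bounded _ _ 1) => //; apply/nearW => x _; rewrite normr1.
by apply: (L1_eq mD _ (L2_mul mD Lf L2c)) => x _; rewrite mulr1.
Qed.

Lemma dominated_cvg_int D (F : nat -> T -> R) f g : measurable D ->
  (forall n, measurable_fun D (F n)) -> measurable_fun D f -> L1 D g ->
  (\forall x \ae mu, D x -> F n x @[n --> \oo] --> f x) ->
  (forall n, \forall x \ae mu, D x -> `|F n x| <= g x) ->
  L1 D f /\ \int[mu]_(x in D) F n x @[n --> \oo] --> \int[mu]_(x in D) f x.
Proof.
move=> mD mF mf Ig Ff Fg.
have mF' n : measurable_fun D (EFin \o F n) by exact/measurable_EFinP.
have mf' : measurable_fun D (EFin \o f) by exact/measurable_EFinP.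
have c' : \forall x \ae mu, D x -> (EFin \o F n) x @[n --> \oo] --> (EFin \o f) x.
  by apply: filterS Ff => x /[apply] h; exact: cvg_EFinW.
have d' : \forall x \ae mu, forall n, D x -> (`|(EFin \o F n) x| <= (EFin \o g) x)%E.
  by apply: filterS (ae_foralln Fg) => x h n /h; rewrite /= lee_fin.
have [If _ cv] := dominated_convergence mD mF' mf' c' Ig d'.
split => //; apply: fine_cvg; rewrite fineK//; exact: integrable_fin_num.
Qed.

(** Dominated convergence: [w] is finite, so the indicator of [K < |w|] tends to 0 pointwise as [K]
    grows. With [f] equal to [w] or to its square this is the uniform integrability that stands in
    for almost everywhere convergent subsequences. *)
Lemma L1_tail D f w (e : R) : measurable D -> L1 D f -> measurable_fun D w -> 0 < e ->
  exists K : R, 0 < K /\ \int[mu]_(x in D) (`|f x| * (K < `|w x|)%R%:R) <= e.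
Proof.
move=> mD If mw e0.
have mc n : measurable_fun D (fun x => ((n.+1%:R < `|w x|)%R%:R : R)).
  rewrite (_ : (fun _ => _) = (fun x => if n.+1%:R < `|w x| then 1 else 0)).
    apply: (measurable_fun_if mD); [|exact: measurable_cst|exact: measurable_cst].
    by apply: measurable_fun_ltr => //; exact: measurableT_comp.
  by apply/funext => x; case: ifP.
have [|||||_] := @dominated_cvg_int D (fun n x => `|f x| * (n.+1%:R < `|w x|)%R%:R)
  (fun=> 0) (fun x => `|f x|) mD.
- move=> n; apply: measurable_funM => //; exact/L1_meas/L1_abs.
- exact: measurable_cst.
- exact: L1_abs.
- apply/nearW => x _; apply: cvg_near_cst.
  near=> n; rewrite ltNge (_ : (_ <= _) = true) ?mulr0//.
  apply: (@le_trans _ _ n%:R); last by rewrite ler_nat.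
  by near: n; exact: nbhs_infty_ger.
- move=> n; apply/nearW => x _; rewrite normrM normr_id.
  by case: (_ < _); rewrite ?normr1 ?normr0 ?mulr1 ?mulr0.
rewrite [X in _ --> X](_ : _ = 0); last by rewrite /Rintegral integral0.
move=> /cvgr0Pnorm_le /(_ e e0)[N _ /(_ N (leqnn N)) hN].
by exists N.+1%:R; split => //; exact: le_trans (ler_norm _) hN.
Unshelve. all: by end_near. Qed.

End real_integrals.

(** * The norms of the definitions as real integrals *)

Section Lp_bridge.
Context {R : realType} {d : nat}.
Local Notation E := 'rV[R]_d.
Variable mu : {measure set E -> \bar R}.
Implicit Types (V : set E) (f g : E -> R).

Lemma Lp1P V f : measurable V -> Lp mu 1 V f <-> L1 mu V f.
Proof.
move=> mV; rewrite /Lp; split.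
  move=> /Lfun1_integrable /= h; apply/integrable_mkcond => //.
  by rewrite restrict_EFin.
move=> h; apply/Lfun1_integrable; move/integrable_mkcond : h.
by rewrite restrict_EFin; exact.
Qed.

Lemma Lpnorm1E V f : measurable V -> L1 mu V f -> Lpnorm mu 1 V f = (n1 mu V f)%:E.
Proof.
move=> mV If; rewrite /Lpnorm Lnorm1 /n1 /Rintegral fineK; last first.
  by have := integrable_fin_num mV (L1_abs mV If).
rewrite [RHS]integral_mkcond; apply: eq_integral => x _ /=.
by rewrite /patch; case: ifP => // _; rewrite normr0.
Qed.

Lemma Lp2P V f : measurable V -> Lp mu 2%:E V f <-> L2 mu V f.
Proof.
move=> mV; rewrite /Lp.
have sqE : (fun x => (f \_ V) x ^+ 2) = (fun x => f x ^+ 2) \_ V.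
  by apply/funext => x; rewrite /patch; case: ifP => // _; rewrite expr0n.
split.
  move=> fL; split.
    move: (fL); rewrite inE /= => /andP[]; rewrite inE /= => mf _.
    exact/(measurable_restrictT f mV).
  move/Lfun2_integrable_sqr : fL; rewrite sqE => h.
  by apply/integrable_mkcond => //; rewrite restrict_EFin.
move=> [mf If]; rewrite inE; apply/andP; split.
  by rewrite inE/=; exact/(measurable_restrictT f mV).
rewrite inE /= /finite_norm unlock /=; apply: poweR_lty.
move: If => /L1P[_]; apply: le_lt_trans.
rewrite integral_mkcond; rewrite le_eqVlt; apply/orP; left; apply/eqP.
apply: eq_integral => x _ /=; rewrite powR_mulrn// sqr_normr.
rewrite -[LHS]/(((fun x => (f \_ V) x ^+ 2) x)%:E) sqE /patch; case: ifP => // _.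
by rewrite ger0_norm ?sqr_ge0.
Qed.

Lemma Lpnorm2E V f : measurable V -> L2 mu V f -> Lpnorm mu 2%:E V f = (n2 mu V f)%:E.
Proof.
move=> mV [mf If]; rewrite /Lpnorm unlock /n2.
rewrite (_ : (\int[mu]_x _)%E = (\int[mu]_(x in V) (f x ^+ 2))%:E).
  rewrite poweR_EFin; congr EFin.
  by rewrite -powR12_sqrt//; apply: Rintegral_ge0 => x _; exact: sqr_ge0.
rewrite /Rintegral fineK; last by have := integrable_fin_num mV If.
rewrite [RHS]integral_mkcond; apply: eq_integral => x _ /=.
rewrite powR_mulrn// sqr_normr /patch; case: ifP => // _.
by rewrite expr0n.
Qed.

Lemma LpooP V f : measurable V -> Lp mu +oo%E V f <->
  measurable_fun V f /\ exists M, 0 <= M /\ \forall x \ae mu, V x -> `|f x| <= M.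
Proof.
move=> mV; rewrite /Lp; split.
  rewrite inE => /andP[]; rewrite inE /= => mf; rewrite inE /= /finite_norm unlock /= => fn.
  split; first exact/(measurable_restrictT f mV).
  move: fn; case: ifPn => mu0.
    move=> fin; pose M := fine (ess_sup mu (abse \o (EFin \o f \_ V))).
    exists `|M|; split => //.
    have := @ess_sup_ge _ _ _ mu (abse \o (EFin \o f \_ V)).
    apply: filterS => x /= h Vx; apply: le_trans (ler_norm _).
    rewrite -lee_fin /M fineK.
      by apply: le_trans h; rewrite /patch mem_set.
    rewrite fin_real// fin andbT.
    apply: (@lt_le_trans _ _ 0%E) => //.
    by apply: le_trans h; rewrite lee_fin.
  (* For the zero measure every bound holds almost everywhere, whatever the norm is. *)
  move=> _; exists 0; split => //.
  have z : mu setT = 0%E by apply/eqP; rewrite -measure_le0 leNgt.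
  exists setT; split => //.
move=> [mf [M [M0 fM]]]; rewrite inE; apply/andP; split.
  by rewrite inE/=; exact/(measurable_restrictT f mV).
rewrite inE /= /finite_norm unlock; case: ifPn => // mu0.
apply: (@le_lt_trans _ _ M%:E); last by rewrite ltry.
apply/ess_supP; apply: filterS fM => x h /=; rewrite lee_fin /patch.
by case: ifP => [/set_mem/h//|_]; rewrite normr0.
Qed.

Lemma cvg_Lpnorm1 V (F : nat -> E -> R) : measurable V -> (forall n, L1 mu V (F n)) ->
  Lpnorm mu 1 V (F n) @[n --> \oo] --> 0%E <-> n1 mu V (F n) @[n --> \oo] --> 0.
Proof.
move=> mV IF; under eq_fun do rewrite Lpnorm1E//.
by split=> [/fine_cvgP[]//|h]; exact: cvg_EFinW.
Qed.

Lemma cvg_Lpnorm2 V (F : nat -> E -> R) : measurable V -> (forall n, L2 mu V (F n)) ->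
  Lpnorm mu 2%:E V (F n) @[n --> \oo] --> 0%E <-> n2 mu V (F n) @[n --> \oo] --> 0.
Proof.
move=> mV IF; under eq_fun do rewrite Lpnorm2E//.
by split=> [/fine_cvgP[]//|h]; exact: cvg_EFinW.
Qed.

End Lp_bridge.

(** * Topology and calculus on row vectors *)

Lemma nat_gt {R : realType} (x : R) : exists n : nat, x < n.+1%:R.
Proof. by eexists; exact: truncnS_gt. Qed.

Section rV_topology.
Context {R : realType} {d : nat}.
Local Notation E := 'rV[R]_d.
Implicit Types (x y : E) (A K V : set E) (f : E -> R) (i : 'I_d).

Lemma coord_le_norm x i : `|x ord0 i| <= `|x|.
Proof.
rewrite [leRHS]/Num.norm /= mx_normrE; apply/bigmax_geP; right => /=.
by exists (ord0, i).
Qed.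

Lemma rV_normP x (M : R) : 0 <= M -> (forall i, `|x ord0 i| <= M) -> `|x| <= M.
Proof.
move=> M0 h; rewrite [leLHS]/Num.norm /= mx_normrE; apply/bigmax_leP; split => //.
by case=> a i _ /=; rewrite (ord1 a).
Qed.

Lemma rV_norm_lt x (M : R) : 0 < M -> (forall i, `|x ord0 i| < M) -> `|x| < M.
Proof.
move=> M0 h; rewrite [ltLHS]/Num.norm /= mx_normrE; apply/bigmax_ltP; split => //.
by case=> a i _ /=; rewrite (ord1 a).
Qed.

Lemma in_ball x (e : R) y : ball x e y <-> `|x - y| < e.
Proof. by rewrite -ball_normE. Qed.

Lemma open_ballP A : open A <-> (forall x, A x -> exists2 e : R, 0 < e & forall y, `|x - y| < e -> A y).
Proof.
split=> [oA x Ax|h].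
  have /nbhs_ballP[e e0 eA] : nbhs x A by apply: open_nbhs_nbhs; split.
  by exists e => // y /in_ball /eA.
rewrite openE => x /h[e e0 eA]; apply/nbhs_ballP; exists e => // y /in_ball.
exact: eA.
Qed.

(** The sigma-algebra is the one generated by the coordinates. [A] is the union of the countably
    many boxes with rational centre and radius [1/(k+1)] that it contains. *)
Lemma open_measurable_rV A : open A -> measurable A.
Proof.
move=> oA.
pose box (p : {ffun 'I_d -> rat} * nat) : set E :=
  [set x | forall i, `|x ord0 i - ratr (p.1 i)| < p.2.+1%:R^-1].
have mbox p : measurable (box p).
  rewrite (_ : box p = \bigcap_(i in [set: 'I_d]) [set x : E | `|x ord0 i - ratr (p.1 i)| < p.2.+1%:R^-1]); last first.
    by apply/seteqP; split=> x /= h i => [_|]; [exact: h|exact: (h i I)].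
  apply: fin_bigcap_measurable => // i _.
  have mfi : measurable_fun [set: E] (fun x => `|x ord0 i - ratr (p.1 i)|).
    by apply: measurableT_comp => //; apply: measurable_funB => //; exact: measurable_coord.
  have := mfi measurableT _ (measurable_itv `]-oo, (p.2.+1%:R^-1 : R)[); rewrite setTI.
  by congr measurable; apply/seteqP; split=> x /=; rewrite in_itv.
rewrite (_ : A = \bigcup_p (if pselect (box p `<=` A) then box p else set0)).
  apply: countable_bigcupT_measurable; first exact: countableP.
  by move=> p; case: (pselect (box p `<=` A)) => ?; [exact: mbox|exact: measurable0].
apply/seteqP; split => [x Ax|x [p _]]; last by case: (pselect (box p `<=` A)) => // h /h.
have [e e0 eA] := (open_ballP A).1 oA x Ax.
have e20 : 0 < 2 / e by rewrite divr_gt0.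
(* All points of a box whose rational centre is within [1/(k+1) < e/2] of [x] are within [e] of
   [x]. *)
have [k ek] := nat_gt (2 / e).
have ke : k.+1%:R^-1 < e / 2.
  by rewrite -[e / 2]invf_div ltf_pV2 ?posrE.
have ex i : exists q : rat, `|x ord0 i - ratr q| < k.+1%:R^-1.
  have /rat_in_itvoo[q] : x ord0 i - k.+1%:R^-1 < x ord0 i + k.+1%:R^-1.
    by rewrite ltrD2l -subr_gt0 opprK -mulr2n pmulrn_lgt0// invr_gt0.
  by rewrite in_itv /= => /andP[h1 h2]; exists q; rewrite ltr_distlC h1 h2.
pose q i := projT1 (cid (ex i)).
have hq i : `|x ord0 i - ratr (q i)| < k.+1%:R^-1 := projT2 (cid (ex i)).
exists ([ffun i => q i], k) => //; case: (pselect (box _ `<=` A)) => [_ i|[]]; first by rewrite ffunE.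
move=> y /= hy; apply: eA; apply: rV_norm_lt => // i; rewrite !mxE.
have := hy i; have := hq i; rewrite ffunE => h1 h2.
have -> : x ord0 i - y ord0 i = (x ord0 i - ratr (q i)) - (y ord0 i - ratr (q i)) by lra.
apply: le_lt_trans (ler_normB _ _) _.
by rewrite (splitr e) ltrD// (lt_trans _ ke).
Qed.

Lemma closed_measurable_rV A : closed A -> measurable A.
Proof.
by move=> cA; rewrite -[A]setCK; apply: measurableC; apply: open_measurable_rV; exact: closed_openC.
Qed.

Lemma continuous_measurable_rV f : continuous f -> measurable_fun setT f.
Proof.
move=> cf; apply: (measurability _ (RGenOpens.measurableE R)).
move=> _ [_ [a [b ->]] <-]; rewrite setTI; apply: open_measurable_rV.
by apply: open_comp => //; exact: interval_open.
Qed.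

Lemma compact_measurable_rV K : compact K -> measurable K.
Proof. by move=> cK; apply: closed_measurable_rV; apply: compact_closed. Qed.

(** The norm of row vectors is the maximum norm, so its closed balls are cubes; [norm_enorm]
    compares it with the Euclidean norm [enorm]. *)
Definition cube (r : R) : set E := [set x | `|x| <= r].

Lemma cube_closed r : closed (cube r).
Proof.
rewrite (_ : cube r = (fun x : E => `|x|) @^-1` [set t | t <= r])//.
by apply: closed_comp => // x _; exact: norm_continuous.
Qed.

Lemma cube_compact r : compact (cube r).
Proof.
apply: bounded_closed_compact; last exact: cube_closed.
exists r; split; first exact: num_real.
by move=> M rM x /= xr; rewrite (le_trans xr)// ltW.
Qed.

Lemma measurable_cube r : measurable (cube r).
Proof. by apply: closed_measurable_rV; exact: cube_closed. Qed.

Lemma compact_cube K : compact K -> exists2 r, 0 < r & K `<=` cube r.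
Proof.
move=> /compact_bounded[M [_ h]]; exists (`|M| + 1); first by rewrite ltr_pwDr.
by move=> x Kx; apply: h => //; rewrite (le_lt_trans (ler_norm _))// ltrDl.
Qed.

Lemma cube_le r s : r <= s -> cube r `<=` cube s.
Proof. by move=> rs x /= /le_trans; exact. Qed.

Lemma cube_cover x : exists n : nat, cube n%:R x.
Proof. by have [n hn] := nat_gt `|x|; exists n.+1; rewrite /cube /= ltW. Qed.

Lemma closed_bounded_compact K r : closed K -> K `<=` cube r -> compact K.
Proof. by move=> cK Kr; apply: subclosed_compact Kr => //; exact: cube_compact. Qed.

(** A Lebesgue number, from the near-covering form of compactness for the filter of radii tending to
    0 from the right: half of a radius that works at [x] works at all points near [x]. *)
Lemma compact_in_open K V : compact K -> open V -> K `<=` V ->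
  exists2 e : R, 0 < e & forall x y, K x -> `|x - y| < e -> V y.
Proof.
move=> cK oV KV.
have /compact_near_coveringP/(_ _ (0^'+ : set_system R) (fun e x => forall y, `|x - y| < e -> V y)) H := cK.
have : \forall e \near (0^'+ : set_system R), K `<=` (fun x => forall y, `|x - y| < e -> V y).
  apply: H => x Kx; have [e e0 eV] := (open_ballP V).1 oV x (KV x Kx).
  have e2 : 0 < e / 2 by rewrite divr_gt0.
  exists (ball x (e / 2), [set t | t < e / 2]) => /=.
    by split; [exact: nbhsx_ballx|exact: nbhs_right_lt].
  case=> z t /= [/in_ball xz te] y zy; apply: eV.
  by rewrite -(subrKA z) (le_lt_trans (ler_normD _ _))//; lra.
move=> /(filterI (nbhs_right_gt 0))/filter_ex[e [e0 he]].
by exists e => // x y /he; apply.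
Qed.

(** Only [x] is confined to [K]. With a cube exceeding the support by 1 this becomes uniform
    continuity on the whole space in [unif_cont_cs]. *)
Lemma unif_cont_compact K f (eta : R) : compact K -> continuous f -> 0 < eta ->
  exists2 e : R, 0 < e & forall x y, K x -> `|x - y| < e -> `|f x - f y| < eta.
Proof.
move=> cK cf eta0.
have /compact_near_coveringP/(_ _ (0^'+ : set_system R) (fun e x => forall y, `|x - y| < e -> `|f x - f y| < eta)) H := cK.
have : \forall e \near (0^'+ : set_system R), K `<=` (fun x => forall y, `|x - y| < e -> `|f x - f y| < eta).
  apply: H => x Kx; have eta2 : 0 < eta / 2 by rewrite divr_gt0.
  have /cvgr_dist_lt /(_ _ eta2) /nbhs_ballP[e e0 he] := cf x.
  have e2 : 0 < e / 2 by move: e0 => /= e0; rewrite divr_gt0.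
  exists (ball x (e / 2), [set t | t < e / 2]) => /=.
    by split; [exact: nbhsx_ballx|exact: nbhs_right_lt].
  case=> z t /= [/in_ball xz te] y zy.
  have h1 : `|f x - f z| < eta / 2 by apply: he; apply/in_ball; lra.
  have h2 : `|f x - f y| < eta / 2.
    apply: he; apply/in_ball.
    by rewrite -(subrKA z) (le_lt_trans (ler_normD _ _))//; lra.
  rewrite -(subrKA (f x)) (le_lt_trans (ler_normD _ _))//.
  by rewrite (distrC (f z)); lra.
move=> /(filterI (nbhs_right_gt 0))/filter_ex[e [e0 he]].
by exists e => // x y /he; apply.
Qed.

Lemma unif_cont_cs f r (eta : R) : continuous f -> (forall x, r < `|x| -> f x = 0) ->
  0 < eta -> exists2 e : R, 0 < e & forall x y, `|x - y| < e -> `|f x - f y| < eta.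
Proof.
move=> cf fr eta0; have [e e0 he] := unif_cont_compact (@cube_compact (r + 1)) cf eta0.
exists (Num.min e 1); first by rewrite lt_min e0 ltr01.
move=> x y; rewrite lt_min => /andP[xe x1].
have [xr|xr] := leP `|x| (r + 1); first exact: he.
have h : `|x| <= `|x - y| + `|y| by rewrite -{1}(subrK y x) ler_normD.
rewrite !fr ?subrr ?normr0//; lra.
Qed.

Lemma cont_bounded f r : continuous f -> (forall x, r < `|x| -> f x = 0) ->
  exists2 M : R, 0 <= M & forall x, `|f x| <= M.
Proof.
move=> cf fr.
have /compact_bounded[M [_ h]] : compact (f @` cube r).
  by apply: continuous_compact (@cube_compact r); apply: continuous_subspaceT.
exists (`|M| + 1); first by rewrite addr_ge0.
move=> x; have [xr|/fr ->] := leP `|x| r; last by rewrite normr0 addr_ge0.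
by apply: h; [rewrite (le_lt_trans (ler_norm _))// ltrDl|exists x].
Qed.

Lemma closure_supp_vanish f x : ~ closure [set y | f y != 0] x -> \forall y \near x, f y = 0.
Proof.
move=> nc; have : nbhs x (~` closure [set y | f y != 0]).
  by apply: open_nbhs_nbhs; split => //; exact/closed_openC/closed_closure.
apply: filterS => y ny; apply/eqP/negPn/negP => fy; apply: ny.
exact: subset_closure.
Qed.

Lemma closure_supp_vanish1 f x : ~ closure [set y | f y != 0] x -> f x = 0.
Proof. by move=> /closure_supp_vanish/nbhs_singleton. Qed.

End rV_topology.

(** * Derivatives of functions of one variable *)

Section one_variable.
Context {R : realType}.
Implicit Types (f g : R -> R) (t s l : R).

(** Remainders of the form [C h^2] survive integration against an integrable function and can be
    checked case by case for piecewise polynomials. Derivatives of mollifications and of splines are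
    obtained in this way. *)
Lemma quad_is_derive f t l (C : R) :
  (forall h, `|h| <= 1 -> `|f (t + h) - f t - h * l| <= C * h ^+ 2) -> is_derive t 1 f l.
Proof.
move=> fC.
have cv : h^-1 *: ((f \o shift t) (h *: 1) - f t) @[h --> 0^'] --> l.
  apply/cvgrPdist_le => e e0.
  have e1 : 0 < e / (`|C| + 1) by rewrite divr_gt0// ltr_pwDr.
  near=> h.
  have h0 : h != 0 by near: h; exact: nbhs_dnbhs_neq.
  have hs : `|h| <= e / (`|C| + 1).
    near: h; apply: (@nbhs_dnbhs _ (0:R)).
    by apply/nbhs_ballP; exists (e / (`|C| + 1)) => //= z; rewrite /ball/= sub0r normrN => /ltW.
  have h1 : `|h| <= 1.
    near: h; apply: (@nbhs_dnbhs _ (0:R)).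
    by apply/nbhs_ballP; exists 1 => //= z; rewrite /ball/= sub0r normrN => /ltW.
  rewrite /= distrC [h *: 1]mulr1 (addrC h t).
  have -> : h^-1 *: (f (t + h) - f t) - l = h^-1 * (f (t + h) - f t - h * l).
    by rewrite [_ *: _]mulrBr mulrBr mulKf// mulrBr.
  rewrite normrM normfV ler_pdivrMl ?normr_gt0//.
  apply: (le_trans (fC h h1)).
  have -> : h ^+ 2 = `|h| * `|h| by rewrite -expr2 sqr_normr.
  rewrite mulrCA ler_wpM2l//.
  apply: (@le_trans _ _ (`|C| * (e / (`|C| + 1)))).
    by apply: le_trans (ler_norm _) _; rewrite normrM normr_id ler_wpM2l.
  by rewrite mulrA ler_pdivrMr ?ltr_pwDr// mulrC ler_wpM2l ?ltW// ltrDl.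
split; first by apply/cvg_ex; exists l.
exact: cvg_lim cv.
Unshelve. all: by end_near. Qed.

Lemma is_derive_shift f s l : is_derive (0 : R) 1 (fun t => f (s + t)) l -> is_derive s 1 f l.
Proof.
move=> h; have -> : f = (fun t => f (s + t)) \o (fun t => t - s).
  by apply/funext => t /=; rewrite addrC subrK.
have h' : is_derive (s - s) 1 (fun t => f (s + t)) l by rewrite subrr.
have hs : is_derive s 1 (fun t => t - s) (1 : R).
  by have := is_deriveB (is_derive_id s 1) (is_derive_cst s s 1); rewrite subr0.
by have := @is_derive1_comp _ (fun t => f (s + t)) (fun t => t - s) s l 1 h' hs; rewrite mulr1.
Qed.

Lemma is_derive_continuous f t l : is_derive t 1 f l -> {for t, continuous f}.
Proof.
move=> [df _]; apply: differentiable_continuous; exact/derivable1_diffP.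
Qed.

Lemma derive_continuous f g : (forall t, is_derive t 1 f (g t)) -> continuous f.
Proof. by move=> fg t; apply: is_derive_continuous (fg t). Qed.

Lemma MVT_any f g a b : (forall t, is_derive t 1 f (g t)) ->
  exists c, [/\ f b - f a = g c * (b - a) & `|c - a| <= `|b - a|].
Proof.
move=> fg; have cf := derive_continuous fg.
have [ab|ba] := leP a b.
  have [c] := MVT_segment ab (fun t _ => fg t) (continuous_subspaceT cf).
  rewrite in_itv /= => /andP[ac cb] e; exists c; split => //.
  by rewrite !ger0_norm ?subr_ge0// lerD2r.
have [c] := MVT_segment (ltW ba) (fun t _ => fg t) (continuous_subspaceT cf).
rewrite in_itv /= => /andP[bc ca] e; exists c; split.
  by rewrite -opprB e -mulrN opprB.
by rewrite !ler0_norm ?subr_le0 ?(ltW ba)// !opprB lerD2l lerN2.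
Qed.

Lemma lipschitz_of_derive f g M : (forall t, is_derive t 1 f (g t)) ->
  (forall t, `|g t| <= M) -> forall a b, `|f a - f b| <= M * `|a - b|.
Proof.
move=> fg gM a b; have [c [-> _]] := MVT_any b a fg.
by rewrite normrM ler_wpM2r.
Qed.

Lemma quad_of_derive f g k M : (forall t, is_derive t 1 f (g t)) ->
  (forall t, is_derive t 1 g (k t)) -> (forall t, `|k t| <= M) ->
  forall t h, `|f (t + h) - f t - h * g t| <= M * h ^+ 2.
Proof.
move=> fg gk kM t h; have [c [e hc]] := MVT_any t (t + h) fg.
rewrite e (addrC t h) addrK mulrC -mulrBr normrM.
apply: (@le_trans _ _ (`|h| * (M * `|c - t|))).
  by rewrite ler_wpM2l//; exact: lipschitz_of_derive gk kM _ _.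
rewrite -sqr_normr expr2 mulrCA ler_wpM2l//; first exact: le_trans (kM 0).
by rewrite ler_wpM2l//; move: hc; rewrite (addrC t h) addrK.
Qed.

End one_variable.

(** * Partial derivatives and classes of differentiable functions *)

Section partials.
Context {R : realType} {d : nat}.
Local Notation E := 'rV[R]_d.
Implicit Types (x y : E) (V K : set E) (f g : E -> R) (i : 'I_d).

Definition evec i : E := delta_mx ord0 i.

Lemma evecE i j : evec i ord0 j = (j == i)%:R.
Proof. by rewrite mxE eqxx. Qed.

Lemma norm_evec i : `|evec i| <= 1.
Proof.
by apply: rV_normP => // j; rewrite evecE; case: eqP => _; rewrite ?normr1 ?normr0.
Qed.

(** Restriction to a line turns partial derivatives into derivatives of one variable, to which the
    chain rule and the mean value theorem apply. *)
Lemma line_is_derive i f x l : is_derive (0 : R) 1 (fun t => f (x + t *: evec i)) l <->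
  is_derive x (evec i) f l.
Proof.
have E1 : (fun h : R => h^-1 *: (((fun t => f (x + t *: evec i)) \o shift 0) (h *: 1) - f (x + 0 *: evec i)))
   = (fun h => h^-1 *: ((f \o shift x) (h *: evec i) - f x)).
  by apply/funext => h /=; rewrite addr0 scale0r addr0 [h *: 1]mulr1 (addrC x).
split=> -[D1 D2].
  split; first by move: D1; rewrite /derivable E1.
  by move: D2; rewrite /derive E1.
split; first by rewrite /derivable E1.
by rewrite /derive E1.
Qed.

Lemma line_is_derive_at i f (g : E -> R) x (s : R) :
  (forall y, is_derive y (evec i) f (g y)) ->
  is_derive s 1 (fun t => f (x + t *: evec i)) (g (x + s *: evec i)).
Proof.
move=> fg; apply: is_derive_shift.
under eq_fun do rewrite scalerDl addrA.
by apply/line_is_derive; exact: fg.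
Qed.

Lemma quad_partial i f x l (C : R) :
  (forall h : R, `|h| <= 1 -> `|f (x + h *: evec i) - f x - h * l| <= C * h ^+ 2) ->
  is_derive x (evec i) f l.
Proof.
move=> H; apply/line_is_derive; apply: (@quad_is_derive _ _ _ _ C) => h h1.
by rewrite add0r scale0r addr0; exact: H.
Qed.

Lemma partial_is_derive i f x : derivable f x (delta_mx ord0 i : E) ->
  is_derive x (evec i) f (partial i f x).
Proof. by move=> df; exact: DeriveDef. Qed.

Lemma is_derive_partial i f x l : is_derive x (evec i) f l -> partial i f x = l.
Proof. by case. Qed.

Lemma partial_comp i f x (F : R -> R) a l : is_derive (f x) 1 F a ->
  is_derive x (evec i) f l -> is_derive x (evec i) (F \o f) (a * l).
Proof.
move=> Fa /line_is_derive fl; apply/line_is_derive.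
apply: (@is_derive1_comp _ F (fun t => f (x + t *: evec i))) => //.
by rewrite scale0r addr0.
Qed.

Lemma contD f g : continuous f -> continuous g -> continuous (fun x => f x + g x).
Proof. by move=> cf cg x; exact: (continuousD (cf x) (cg x)). Qed.

Lemma contM f g : continuous f -> continuous g -> continuous (fun x => f x * g x).
Proof. by move=> cf cg x; exact: (continuousM (cf x) (cg x)). Qed.

Lemma Ck_cont k f : Ck k f -> continuous f. Proof. by case: k => [|k] []. Qed.

Lemma Ck_derivable k i f x : Ck k.+1 f -> is_derive x (evec i) f (partial i f x).
Proof. by move=> [_ /(_ i)[h _]]; exact: partial_is_derive. Qed.

Lemma Ck_partial k i f : Ck k.+1 f -> Ck k (partial i f).
Proof. by move=> [_ /(_ i)[]]. Qed.

Lemma Ck1I f (g : 'I_d -> E -> R) : continuous f -> (forall i, continuous (g i)) ->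
  (forall i x, is_derive x (evec i) f (g i x)) ->
  Ck 1 f /\ (forall i x, partial i f x = g i x).
Proof.
move=> cf cg fg; have e i : partial i f = g i.
  by apply/funext => x; exact: is_derive_partial.
split; last by move=> i x; rewrite e.
split => // i; split; first by move=> x; case: (fg i x).
by split => //; rewrite e.
Qed.

(** Membership in [Ck] is proved by exhibiting candidates for the partial derivatives; [partial]
    itself need not be computed first. *)
Lemma CkI k f (g : 'I_d -> E -> R) : continuous f -> (forall i, Ck k (g i)) ->
  (forall i x, is_derive x (evec i) f (g i x)) -> Ck k.+1 f.
Proof.
move=> cf cg fg; have e i : partial i f = g i.
  by apply/funext => x; exact: is_derive_partial.
split => // i; split; first by move=> x; case: (fg i x).
by rewrite e.
Qed.

Lemma CkS k f : Ck k.+1 f -> Ck k f.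
Proof.
elim: k f => [|k IH] f; first by case.
move=> hf; apply: (CkI (Ck_cont hf) (g := fun i => partial i f)).
  by move=> i; apply: IH; exact: Ck_partial.
by move=> i x; exact: Ck_derivable hf.
Qed.

Lemma Ck_cst k (c : R) : Ck k (fun _ : E => c).
Proof.
elim: k c => [|k IH] c; first by split => //; exact: cst_continuous.
by apply: (CkI (g := fun _ _ => 0)) => //; first exact: cst_continuous.
Qed.

Lemma CkD k f g : Ck k f -> Ck k g -> Ck k (fun x => f x + g x).
Proof.
elim: k f g => [|k IH] f g hf hg.
  by split => //; apply: contD; [exact: (Ck_cont hf)|exact: (Ck_cont hg)].
apply: (CkI (g := fun i x => partial i f x + partial i g x)).
- by apply: contD; [exact: (Ck_cont hf)|exact: (Ck_cont hg)].
- by move=> i; apply: IH; exact: Ck_partial.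
- by move=> i x; apply: is_deriveD; [exact: Ck_derivable hf|exact: Ck_derivable hg].
Qed.

Lemma CkM k f g : Ck k f -> Ck k g -> Ck k (fun x => f x * g x).
Proof.
elim: k f g => [|k IH] f g hf hg.
  by split => //; apply: contM; [exact: (Ck_cont hf)|exact: (Ck_cont hg)].
apply: (CkI (g := fun i x => f x * partial i g x + g x * partial i f x)).
- by apply: contM; [exact: (Ck_cont hf)|exact: (Ck_cont hg)].
- move=> i; apply: CkD; apply: IH; try exact: Ck_partial; exact: CkS.
- by move=> i x; apply: is_deriveM; [exact: Ck_derivable hf|exact: Ck_derivable hg].
Qed.

Lemma CkZ k (c : R) f : Ck k f -> Ck k (fun x => c * f x).
Proof. by move=> hf; apply: CkM => //; exact: Ck_cst. Qed.

Lemma CkB k f g : Ck k f -> Ck k g -> Ck k (fun x => f x - g x).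
Proof.
move=> hf hg; have -> : (fun x => f x - g x) = (fun x => f x + (-1) * g x).
  by apply/funext => x; rewrite mulN1r.
by apply: CkD => //; exact: CkZ.
Qed.

Lemma Ck_sum k (I : Type) (s : seq I) (F : I -> E -> R) :
  (forall j, Ck k (F j)) -> Ck k (fun x => \sum_(j <- s) F j x).
Proof.
move=> hF; elim: s => [|i s IH].
  by under eq_fun do rewrite big_nil; exact: Ck_cst.
by under eq_fun do rewrite big_cons; exact: CkD.
Qed.

Lemma Ck_coord k i : Ck k (fun x : E => x ord0 i).
Proof.
have dc j x : is_derive x (evec j) (fun x : E => x ord0 i) (i == j)%:R.
  apply: (@quad_partial _ _ _ _ 0) => h _; rewrite !mxE eqxx/=.
  by rewrite (addrC (x ord0 i)) addrK subrr normr0 mul0r.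
case: k => [|k]; first by split => //; exact: coord_continuous.
apply: (CkI (g := fun j _ => (i == j)%:R)) => //; first exact: coord_continuous.
by move=> j; exact: Ck_cst.
Qed.

Lemma partialD k i f g x : Ck k.+1 f -> Ck k.+1 g ->
  partial i (fun x => f x + g x) x = partial i f x + partial i g x.
Proof. by move=> hf hg; apply: is_derive_partial; apply: is_deriveD; [exact: Ck_derivable hf|exact: Ck_derivable hg]. Qed.

Lemma partialM k i f g x : Ck k.+1 f -> Ck k.+1 g ->
  partial i (fun x => f x * g x) x = f x * partial i g x + g x * partial i f x.
Proof. by move=> hf hg; apply: is_derive_partial; apply: is_deriveM; [exact: Ck_derivable hf|exact: Ck_derivable hg]. Qed.

Lemma partial_cst i (c : R) x : partial i (fun _ : E => c) x = 0.
Proof. by apply: is_derive_partial; exact: is_derive_cst. Qed.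

Lemma partialZ k i (c : R) f x : Ck k.+1 f ->
  partial i (fun x => c * f x) x = c * partial i f x.
Proof. by move=> hf; rewrite (partialM _ _ (Ck_cst k.+1 c) hf) partial_cst mulr0 addr0. Qed.

Lemma Ck1_comp f (F F' : R -> R) : Ck 1 f ->
  (forall x, is_derive (f x) 1 F (F' (f x))) -> continuous (F' \o f) ->
  Ck 1 (F \o f) /\ (forall i x, partial i (F \o f) x = F' (f x) * partial i f x).
Proof.
move=> hf FF' cF'.
apply: (@Ck1I _ (fun i x => F' (f x) * partial i f x)).
- move=> x; apply: (@continuous_comp _ _ _ f F x); first exact: (Ck_cont hf).
  exact: is_derive_continuous (FF' x).
- by move=> i; apply: contM; [exact: cF'|exact: (Ck_cont (Ck_partial i hf))].
- by move=> i x; apply: partial_comp (FF' x) _; exact: Ck_derivable hf.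
Qed.

Lemma Ck2_comp f (F F' F'' : R -> R) : Ck 2 f ->
  (forall x, is_derive (f x) 1 F (F' (f x))) ->
  (forall x, is_derive (f x) 1 F' (F'' (f x))) -> continuous (F'' \o f) ->
  [/\ Ck 2 (F \o f),
     (forall i x, partial i (F \o f) x = F' (f x) * partial i f x) &
     (forall i j x, partial i (partial j (F \o f)) x =
        F'' (f x) * (partial i f x * partial j f x) + F' (f x) * partial i (partial j f) x)].
Proof.
move=> hf FF' FF'' cF''; have hf1 := CkS hf.
have [C1 e1] := Ck1_comp hf1 FF'' cF''.
have [C0 e0] := Ck1_comp hf1 FF' (Ck_cont C1).
have e0' j : partial j (F \o f) = (fun x => (F' \o f) x * partial j f x).
  by apply/funext => x; rewrite e0.
split; [|exact: e0|].
  apply: (CkI (Ck_cont C0) (g := fun i => partial i (F \o f))).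
    by move=> i; rewrite e0'; exact: CkM C1 (Ck_partial i hf).
  by move=> i x; exact: Ck_derivable C0.
move=> i j x; rewrite e0' (partialM _ _ C1 (Ck_partial j hf)) e1 /=.
ring.
Qed.

(** Composition with a spline leaves the smooth functions but not this class, and by [H0g_Cc1] its
    members still belong to H^{1,2}_0. *)
Definition Cc1 V f := [/\ Ck 1 f, compact (closure [set x | f x != 0]) &
  closure [set x | f x != 0] `<=` V].

Lemma Cc_smooth1 V f : Cc_smooth V f -> Cc1 V f.
Proof. by case=> h ? ?; split => //; exact: (h 1%N). Qed.

Lemma supp_sub f g : (forall x, g x = 0 -> f x = 0) ->
  closure [set x | f x != 0] `<=` closure [set x | g x != 0].
Proof. by move=> gf; apply: closure_subset => x /=; apply: contra => /eqP/gf ->. Qed.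

Lemma supp_compact_sub f g : (forall x, g x = 0 -> f x = 0) ->
  compact (closure [set x | g x != 0]) -> compact (closure [set x | f x != 0]).
Proof.
by move=> gf; move=> h; apply: subclosed_compact h _; [exact: closed_closure|exact: supp_sub].
Qed.

Lemma Cc1_sub V f g : Cc1 V g -> Ck 1 f -> (forall x, g x = 0 -> f x = 0) -> Cc1 V f.
Proof.
move=> [_ cg gV] hf gf; split => //; first exact: supp_compact_sub cg.
by apply: subset_trans gV; exact: supp_sub.
Qed.

Lemma Cc1_subset V W f : V `<=` W -> Cc1 V f -> Cc1 W f.
Proof. by move=> VW [? ? fV]; split => //; exact: subset_trans VW. Qed.

Lemma Cc_smooth_subset V W f : V `<=` W -> Cc_smooth V f -> Cc_smooth W f.
Proof. by move=> VW [? ? fV]; split => //; exact: subset_trans VW. Qed.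

Lemma partial_vanish i f x : ~ closure [set y | f y != 0] x -> partial i f x = 0.
Proof.
move=> /closure_supp_vanish h; apply: is_derive_partial.
have h' : \near x, (fun=> 0) x = f x by apply: filterS h => y ->.
by apply: near_eq_is_derive h' _; exact: is_derive_cst.
Qed.

Lemma Cc1_out V f : Cc1 V f -> exists2 r : R, 0 < r &
  forall x, r < `|x| -> ~ closure [set y | f y != 0] x.
Proof.
move=> [_ /compact_cube[r r0 h] _]; exists r => // x rx /h.
by rewrite /cube /= leNgt rx.
Qed.

Lemma Cc1_bounded V f : Cc1 V f -> exists2 M : R, 0 <= M &
  forall x, `|f x| <= M /\ forall i, `|partial i f x| <= M.
Proof.
move=> hf; have [r r0 out] := Cc1_out hf; have [C1 _ _] := hf.
have [M M0 fM] := @cont_bounded _ _ f r (Ck_cont C1) (fun x rx => closure_supp_vanish1 (out x rx)).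
have H i : exists2 N : R, 0 <= N & forall x, `|partial i f x| <= N.
  exact: (@cont_bounded _ _ _ r (Ck_cont (Ck_partial i C1)) (fun x rx => partial_vanish i (out x rx))).
pose N i := sval (cid2 (H i)).
have N0 i : 0 <= N i by rewrite /N; case: cid2.
have hN i x : `|partial i f x| <= N i by rewrite /N; case: cid2.
exists (M + \sum_i N i); first by rewrite addr_ge0// sumr_ge0.
move=> x; split; first by rewrite (le_trans (fM x))// lerDl sumr_ge0.
move=> i; rewrite (le_trans (hN i x))// (bigD1 i)//= addrCA lerDl.
by rewrite addr_ge0// sumr_ge0.
Qed.

Lemma Ck_measurable k f : Ck k f -> measurable_fun setT f.
Proof. by move=> /Ck_cont; exact: continuous_measurable_rV. Qed.

Lemma Cc1M V f g : Ck 1 f -> Cc1 V g -> Cc1 V (fun x => f x * g x).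
Proof.
move=> hf hg; have [C1 _ _] := hg; apply: (Cc1_sub hg); first exact: CkM.
by move=> x ->; rewrite mulr0.
Qed.

Lemma Cc_smoothM V f g : (forall k, Ck k f) -> Cc_smooth V g -> Cc_smooth V (fun x => f x * g x).
Proof.
move=> hf [C1 cg gV]; split; first by move=> k; exact: CkM.
  by apply: supp_compact_sub cg => x ->; rewrite mulr0.
by apply: subset_trans gV; apply: supp_sub => x ->; rewrite mulr0.
Qed.

Lemma closureU_supp f g : closure [set x | f x + g x != 0] `<=`
  closure [set x | f x != 0] `|` closure [set x | g x != 0].
Proof.
rewrite -closureU; apply: closure_subset => x /= h.
by case: (eqVneq (f x) 0) => [fx|]; [right; move: h; rewrite fx add0r|left].
Qed.

Lemma Cc_smoothD V f g : Cc_smooth V f -> Cc_smooth V g -> Cc_smooth V (fun x => f x + g x).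
Proof.
move=> [C1 cf fV] [C2 cg gV]; split; first by move=> k; exact: CkD.
  apply: (subclosed_compact _ (compactU cf cg)); first exact: closed_closure.
  exact: closureU_supp.
by move=> x /closureU_supp[/fV|/gV].
Qed.

Lemma Cc_smoothZ V (c : R) f : Cc_smooth V f -> Cc_smooth V (fun x => c * f x).
Proof. by move=> hf; apply: Cc_smoothM => // k; exact: Ck_cst. Qed.

End partials.

(** * Lebesgue measure and mollification *)

Section lebesgue_integration_by_parts.
Context {R : realType}.

Lemma lipschitz_continuous {U V : normedModType R} (f : U -> V) (M : R) : 0 <= M ->
  (forall x y, `|f x - f y| <= M * `|x - y|) -> continuous f.
Proof.
move=> M0 h x; apply/cvgrPdist_lt => e e0.
have e1 : 0 < e / (M + 1) by rewrite divr_gt0// ltr_wpDl.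
near=> y; apply: le_lt_trans (h _ _) _.
have hy : `|x - y| < e / (M + 1) by near: y; apply: cvgr_dist_lt.
apply: (@le_lt_trans _ _ ((M + 1) * `|x - y|)); first by rewrite ler_wpM2r// lerDl.
by rewrite mulrC -ltr_pdivlMr// ltr_wpDl.
Unshelve. all: by end_near. Qed.

Lemma nonexpansive_continuous {U V : normedModType R} (h : U -> V) :
  (forall x y, `|h x - h y| <= `|x - y|) -> continuous h.
Proof.
by move=> hle; apply: (lipschitz_continuous ler01) => x y; rewrite mul1r.
Qed.

Lemma measurable_closed_box n (a b : 'rV[R]_n) :
  measurable [set x : 'rV[R]_n | forall i, x ord0 i \in `[a ord0 i, b ord0 i]].
Proof.
set B := [set x | _].
have -> : B = \bigcap_(i in [set: 'I_n])
    (fun x : 'rV[R]_n => x ord0 i) @^-1` `[a ord0 i, b ord0 i].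
  by apply/seteqP; split=> x /= h i => [_|]; [exact: h|exact: (h i I)].
apply: fin_bigcap_measurable => // i _.
by rewrite -[X in measurable X]setTI; exact: measurable_coord.
Qed.

Lemma lebesgue_cube n (r : R) : 0 <= r -> (lebesgue_rV n (cube r) < +oo)%E.
Proof.
move=> r0.
have H : forall i, (\row_(_ < n) (- r)) ord0 i <= (\row_(_ < n) r : 'rV[R]_n) ord0 i.
  by move=> i; rewrite !mxE; lra.
apply: (@le_lt_trans _ _ (lebesgue_rV n [set x | forall i, x ord0 i \in
    `[(\row_(_ < n) (- r)) ord0 i, (\row_(_ < n) r : 'rV[R]_n) ord0 i]])).
  apply: le_measure; rewrite ?inE.
  - exact: measurable_cube.
  - exact: measurable_closed_box.
  - move=> x /= xr i; rewrite in_itv /= !mxE -ler_norml.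
    exact: le_trans (coord_le_norm _ _) xr.
by rewrite lebesgue_rV_box// ltry.
Qed.

Lemma cs_integrable n (f : 'rV[R]_n -> R) (r : R) : 0 <= r -> continuous f ->
  (forall x, r < `|x| -> f x = 0) -> L1 (lebesgue_rV n) setT f.
Proof.
move=> r0 cf fr; have [M M0 fM] := cont_bounded cf fr.
have mf := continuous_measurable_rV cf.
have h : L1 (lebesgue_rV n) (cube r) f.
  apply: (@L1_bounded _ _ _ _ _ _ M).
  - exact: measurable_cube.
  - exact: lebesgue_cube.
  - exact: measurable_funS mf.
  - by apply/nearW => x _.
have /integrable_mkcond := h => /(_ (measurable_cube _)).
apply: eq_integrable => // x _ /=; rewrite /patch; case: ifPn => // /negP xr.
rewrite fr// ltNge; apply/negP => xr'; apply: xr.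
by rewrite inE.
Qed.

Lemma integral_lebesgue_S n (f : 'rV[R]_n.+1 -> R) : L1 (lebesgue_rV n.+1) setT f ->
  measurable_fun setT f ->
  (lebesgue_measure \x (lebesgue_rV n))%E.-integrable setT (EFin \o f \o @consrV R n) /\
  (\int[lebesgue_rV n.+1]_x (f x)%:E =
   \int[(lebesgue_measure \x (lebesgue_rV n))%E]_p (f (consrV p))%:E)%E.
Proof.
move=> If mf.
have I' : (lebesgue_measure \x (lebesgue_rV n))%E.-integrable setT (EFin \o f \o @consrV R n).
  apply/integrableP; split.
    by apply/measurable_EFinP; apply: measurableT_comp => //; exact: measurable_consrV.
  have /integrableP[_] := If; rewrite /= /lebesgue_step ge0_integral_pushforward//.
  - exact: measurable_consrV.
  - by apply/measurable_EFinP; apply: measurableT_comp.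
split => //; rewrite /= /lebesgue_step integral_pushforward//.
- exact: measurable_consrV.
- exact/measurable_EFinP.
Qed.

Lemma integral_line_derive (f g : R -> R) (r : R) : 0 < r -> continuous g ->
  (forall t : R, is_derive t 1 f (g t)) -> (forall t, r < `|t| -> f t = 0 /\ g t = 0) ->
  (\int[lebesgue_measure]_t (g t)%:E = 0)%E.
Proof.
move=> r0 cg fg fr; have cf := derive_continuous fg.
(* The interval exceeds the support by 1, so [f] vanishes at both endpoints. *)
have -> : (\int[lebesgue_measure]_t (g t)%:E = \int[lebesgue_measure]_(t in `[(- (r + 1))%R, (r + 1)%R]) (g t)%:E)%E.
  rewrite [RHS]integral_mkcond; apply: eq_integral => t _; rewrite /patch.
  case: ifPn => // /negP; rewrite inE /= in_itv /= -ler_norml => h.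
  have /fr[_ ->//] : r < `|t|.
  by move/negP : h; rewrite -ltNge; lra.
rewrite (@continuous_FTC2 _ g f).
- have [|-> _] := fr (r + 1); first by rewrite ger0_norm; lra.
  have [|-> _] := fr (- (r + 1)); first by rewrite normrN ger0_norm; lra.
  by rewrite subee.
- by lra.
- exact: continuous_subspaceT.
- split; first by move=> t _; case: (fg t).
    exact/cvg_at_right_filter/cf.
  exact/cvg_at_left_filter/cf.
- by move=> t _; rewrite derive1E; case: (fg t).
Qed.

Lemma consrV_sub n (s : R) (y y' : 'rV[R]_n) : `|consrV (s, y) - consrV (s, y')| <= `|y - y'|.
Proof.
apply: rV_normP => // i; rewrite !mxE; case: unliftP => [j _|_] /=; last first.
  by rewrite subrr normr0.
by apply: le_trans (coord_le_norm _ j); rewrite !mxE.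
Qed.

Lemma consrV_sub0 n (s s' : R) (y : 'rV[R]_n) : `|consrV (s, y) - consrV (s', y)| <= `|s - s'|.
Proof.
apply: rV_normP => // i; rewrite !mxE; case: unliftP => [j _|_] //=.
by rewrite subrr normr0.
Qed.

Lemma consrV_norm n (s : R) (y : 'rV[R]_n) : `|y| <= `|consrV (s, y)|.
Proof.
apply: rV_normP => // i; apply: le_trans (coord_le_norm _ (lift ord0 i)).
by rewrite consrVS.
Qed.

Lemma consrV_norm0 n (s : R) (y : 'rV[R]_n) : `|s| <= `|consrV (s, y)|.
Proof. by apply: le_trans (coord_le_norm _ ord0); rewrite consrV0. Qed.

Lemma consrV_evec n (s h : R) (y : 'rV[R]_n) j :
  consrV (s, y + h *: evec j) = consrV (s, y) + h *: evec (lift ord0 j).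
Proof.
apply/rowP => i; rewrite !mxE eqxx; case: (unliftP ord0 i) => [k ->|->] /=.
  by rewrite !mxE (inj_eq lift_inj).
by rewrite mulr0 addr0.
Qed.

Lemma consrV_evec0 n (s h : R) (y : 'rV[R]_n) :
  consrV (s + h, y) = consrV (s, y) + h *: evec ord0.
Proof.
apply/rowP => i; rewrite !mxE eqxx; case: (unliftP ord0 i) => [k ->|->] /=.
  by rewrite mulr0 addr0.
by rewrite mulr1.
Qed.

(** Induction on the dimension through Fubini. If [i] is a later coordinate, each slice with fixed
    first coordinate vanishes by induction; if [i] is the first one, the other order of integration
    leads to the fundamental theorem of calculus on lines. *)
Lemma integral_partial n (f g : 'rV[R]_n -> R) (i : 'I_n) (r : R) : 0 < r -> continuous g ->
  (forall x, is_derive x (evec i) f (g x)) ->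
  (forall x, r < `|x| -> f x = 0 /\ g x = 0) ->
  (\int[lebesgue_rV n]_x (g x)%:E = 0)%E.
Proof.
elim: n f g i => [|n IH] f g i r0 cg fg fr; first by have := ltn_ord i.
have Ig : L1 (lebesgue_rV n.+1) setT g.
  by apply: (cs_integrable (ltW r0) cg) => x /fr[].
have mg := continuous_measurable_rV cg.
have [Ig' ->] := integral_lebesgue_S Ig mg.
have cs s : continuous (fun y : 'rV[R]_n => g (consrV (s, y))).
  move=> y; apply: (@continuous_comp _ _ _ (fun y => consrV (s, y)) g); last exact: cg.
  by apply: nonexpansive_continuous => ? ?; exact: consrV_sub.
have cs0 y : continuous (fun s : R => g (consrV (s, y : 'rV[R]_n))).
  move=> s; apply: (@continuous_comp _ _ _ (fun s => consrV (s, y)) g); last exact: cg.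
  by apply: nonexpansive_continuous => ? ?; exact: consrV_sub0.
case: (unliftP ord0 i) => [j ij|i0].
  rewrite -[LHS](fubini1 Ig') /fubini_F /=.
  rewrite integral0_eq// => s _.
  apply: (IH (fun y => f (consrV (s, y))) _ j) => //.
    move=> y; apply/line_is_derive.
    under eq_fun do rewrite consrV_evec -ij.
    by apply/line_is_derive; exact: fg.
  by move=> y ry; apply: fr; apply: lt_le_trans ry (consrV_norm _ _).
rewrite -[LHS](fubini2 Ig') /fubini_G /=.
rewrite integral0_eq// => y _.
apply: (@integral_line_derive (fun s => f (consrV (s, y))) _ r) => //.
  move=> s; apply: is_derive_shift.
  under eq_fun do rewrite consrV_evec0 -i0.
  by apply/line_is_derive; exact: fg.
by move=> s rs; apply: fr; apply: lt_le_trans rs (consrV_norm0 _ _).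
Qed.

Lemma int_partial_Cc1 n (f : 'rV[R]_n -> R) (i : 'I_n) : Cc1 setT f ->
  \int[lebesgue_rV n]_x (partial i f x) = 0.
Proof.
move=> hf; have [r r0 out] := Cc1_out hf; have [C1 _ _] := hf.
have H : (\int[lebesgue_rV n]_x (partial i f x)%:E = 0)%E.
  apply: (@integral_partial n f (partial i f) i r) => //.
  - exact: Ck_cont (Ck_partial i C1).
  - by move=> x; exact: Ck_derivable C1.
  - by move=> x /out o; rewrite (closure_supp_vanish1 o) (partial_vanish i o).
by rewrite /Rintegral H.
Qed.

End lebesgue_integration_by_parts.

(** * Smooth functions of one variable built from exp(-1/t) *)

Section smooth_one_variable.
Context {R : realType}.
Implicit Types (f g : R -> R) (t s : R) (n : nat).

(** The extra power of [1/t] makes the family stable under differentiation up to linear combinations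
    ([flat_derive]). *)
Definition flat n t : R := if 0 < t then t^-1 ^+ n * expR (- t^-1) else 0.

Lemma flat_ge0 n t : 0 <= flat n t.
Proof.
rewrite /flat; case: ifPn => // t0; rewrite mulr_ge0 ?expR_ge0// exprn_ge0//.
by rewrite invr_ge0 ltW.
Qed.

(** With [y = 1/t] one has [y <= (n+1) exp(y/(n+1))], and the n-th power leaves
    [exp(n y/(n+1)) <= exp y]. Dividing by [n+1] instead of [n] covers [n = 0]. *)
Lemma flat_le n t : flat n t <= n.+1%:R ^+ n.
Proof.
rewrite /flat; case: ifPn => [t0|_]; last by rewrite exprn_ge0.
set y := t^-1; have y0 : 0 < y by rewrite invr_gt0.
rewrite expRN ler_pdivrMr ?expR_gt0//.
have h1 : y <= n.+1%:R * expR (y / n.+1%:R).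
  rewrite -ler_pdivrMl ?ltr0n// mulrC; apply: le_trans (expR_ge1Dx _).
  by rewrite lerDr.
have h2 : y ^+ n <= n.+1%:R ^+ n * expR (y / n.+1%:R) ^+ n.
  by rewrite -exprMn lerXn2r ?nnegrE// ?ltW// mulr_gt0// expR_gt0.
apply: (le_trans h2); rewrite ler_wpM2l ?exprn_ge0//.
rewrite -expRM_natl ler_expR mulrCA ler_piMr ?(ltW y0)//.
by rewrite ler_pdivrMr ?ltr0n// mul1r ler_nat.
Qed.

Lemma flat_bound n t : `|flat n t| <= n.+1%:R ^+ n.
Proof. by rewrite ger0_norm ?flat_ge0// flat_le. Qed.

Lemma flat_derive n t : is_derive t 1 (flat n) (flat n.+2 t - n%:R * flat n.+1 t).
Proof.
have [t0|t0|->] := ltgtP t 0.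
- have -> : flat n.+2 t - n%:R * flat n.+1 t = 0.
    by rewrite /flat ltNge (ltW t0)/= mulr0 subr0.
  apply: near_eq_is_derive (is_derive_cst (0:R) t 1).
  near=> z; rewrite /flat ifF//; apply/negbTE; rewrite -leNgt ltW//.
  by near: z; exact: lt_nbhsl.
- have -> : flat n.+2 t - n%:R * flat n.+1 t =
     t^-1 ^+ n * (expR (- t^-1) * (- (- (t ^- 2)))) + expR (- t^-1) * (n%:R * t^-1 ^+ n.-1 * (- (t ^- 2))).
    by rewrite /flat t0 -!exprVn; case: n => [|n] /=; rewrite ?exprS; ring.
  apply: (@near_eq_is_derive _ _ _ (fun t => t^-1 ^+ n * expR (- t^-1))).
    near=> z; rewrite /flat ifT//.
    by near: z; exact: lt_nbhsr.
  have dV : is_derive t 1 (fun t : R => t^-1) (- (t ^- 2)).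
    have := is_deriveV (lt0r_neq0 t0) (is_derive_id t 1).
    by rewrite [_ *: _]mulr1.
  have dE : is_derive t 1 (fun t : R => expR (- t^-1)) (expR (- t^-1) * (- (- (t ^- 2)))).
    exact: is_derive1_comp (is_derive_expR _) (is_deriveN dV).
  have dX : is_derive t 1 (fun t : R => t^-1 ^+ n) (n%:R * t^-1 ^+ n.-1 * (- (t ^- 2))).
    have -> : (fun t : R => t^-1 ^+ n) = (fun t => t^-1) ^+ n by apply/funext => z; rewrite exprfctE.
    exact: is_deriveX.
  exact: is_deriveM dX dE.
- have -> : flat n.+2 0 - n%:R * flat n.+1 0 = 0 by rewrite /flat ltxx mulr0 subr0.
  apply: (@quad_is_derive _ _ _ _ (n.+3%:R ^+ n.+2)) => h _.
  rewrite add0r {2}/flat ltxx subr0 mulr0 subr0.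
  (* At 0 the derivative vanishes because [flat n h] is [h^2] times the bounded value
     [flat n.+2 h]. *)
  have -> : flat n h = flat n.+2 h * h ^+ 2.
    rewrite /flat; case: ifPn => h0; last by rewrite mul0r.
    rewrite 2!exprS expr2.
    by field; exact: lt0r_neq0.
  by rewrite normrM (ger0_norm (sqr_ge0 h)) ler_wpM2r ?sqr_ge0// flat_bound.
Unshelve. all: by end_near. Qed.

(* Stability under differentiation makes every derivative of a mollification bounded,
   so that quadratic Taylor bounds replace dominated convergence. *)
Inductive sm : (R -> R) -> Prop :=
| sm_flat n a b : sm (fun t => flat n (a * t + b))
| sm_cst c : sm (fun=> c)
| sm_add f g : sm f -> sm g -> sm (fun t => f t + g t)
| sm_mul f g : sm f -> sm g -> sm (fun t => f t * g t).

Lemma sm_affine f a b : sm f -> sm (fun t => f (a * t + b)).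
Proof.
elim=> [n a' b'|c|{}f g _ IHf _ IHg|{}f g _ IHf _ IHg].
- have -> : (fun t => flat n (a' * (a * t + b) + b')) = (fun t => flat n ((a' * a) * t + (a' * b + b'))).
    by apply/funext => t; congr flat; ring.
  exact: sm_flat.
- exact: sm_cst.
- exact: sm_add.
- exact: sm_mul.
Qed.

(** The normalization [1 <= M] makes bounds multiply and lets [prod_diff] replace factors by powers
    of [M]. *)
Lemma sm_bounded f : sm f -> exists2 M : R, 1 <= M & forall t, `|f t| <= M.
Proof.
have le1 (M : R) : 1 <= `|M| + 1 by rewrite lerDr.
have leM (M x : R) : x <= M -> x <= `|M| + 1.
  by move=> h; rewrite (le_trans h)// (le_trans (ler_norm M))// lerDl.
elim=> [n a b|c|{}f g _ [M M1 fM] _ [N N1 gN]|{}f g _ [M M1 fM] _ [N N1 gN]].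
- by exists (`|n.+1%:R ^+ n| + 1) => // t; apply: leM; exact: flat_bound.
- by exists (`|c| + 1) => // t; rewrite lerDl.
- exists (M + N); first by rewrite (le_trans M1)// lerDl (le_trans _ N1).
  by move=> t; rewrite (le_trans (ler_normD _ _))// lerD.
- exists (M * N); first by rewrite -[leLHS]mulr1 ler_pM.
  by move=> t; rewrite normrM ler_pM.
Qed.

Lemma sm_derivable f : sm f -> exists2 g, sm g & forall t, is_derive t 1 f (g t).
Proof.
elim=> [n a b|c|{}f g sf [f' sf' ff'] sg [g' sg' gg']|{}f g sf [f' sf' ff'] sg [g' sg' gg']].
- exists (fun t => (flat n.+2 (a * t + b) + (- n%:R) * flat n.+1 (a * t + b)) * a).
    apply: sm_mul; last exact: sm_cst.
    by apply: sm_add; [exact: sm_flat|apply: sm_mul; [exact: sm_cst|exact: sm_flat]].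
  move=> t; have dl : is_derive t 1 (fun t => a * t + b) a.
    have := is_deriveD (is_deriveZ a (is_derive_id t 1)) (is_derive_cst b t 1).
    by rewrite addr0 [_ *: _]mulr1.
  have := @is_derive1_comp _ (flat n) (fun t => a * t + b) t _ _ (flat_derive n (a * t + b)) dl.
  by rewrite mulNr.
- by exists (fun=> 0); [exact: sm_cst|move=> t; exact: is_derive_cst].
- by exists (fun t => f' t + g' t); [exact: sm_add|move=> t; exact: is_deriveD].
- exists (fun t => f t * g' t + g t * f' t); first by apply: sm_add; exact: sm_mul.
  by move=> t; exact: is_deriveM.
Qed.

Lemma sm_derive f : sm f -> sm (derive1 f) /\ forall t, is_derive t 1 f (derive1 f t).
Proof.
move=> /sm_derivable[g sg fg].
have -> : derive1 f = g by apply/funext => t; rewrite derive1E; case: (fg t).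
by [].
Qed.

Lemma sm_lipschitz f : sm f -> exists2 M : R, 1 <= M & forall a b, `|f a - f b| <= M * `|a - b|.
Proof.
move=> /sm_derivable[g /sm_bounded[M M1 gM] fg]; exists M => //.
exact: lipschitz_of_derive fg gM.
Qed.

Lemma sm_quad f : sm f -> exists2 M : R, 1 <= M & forall t h, `|f (t + h) - f t - h * derive1 f t| <= M * h ^+ 2.
Proof.
move=> sf; have [sf' ff'] := sm_derive sf.
have [sf'' ff''] := sm_derive sf'.
have [M M1 fM] := sm_bounded sf''; exists M => // t h.
exact: quad_of_derive ff' ff'' fM t h.
Qed.

End smooth_one_variable.

(** * Tensor product kernels and convolution *)

Section tensor_products.
Context {R : realType} {d : nat}.
Local Notation E := 'rV[R]_d.
Local Notation leb := (lebesgue_rV d : {measure set E -> \bar R}).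
Implicit Types (x y z : E) (j : 'I_d) (k : 'I_d -> R -> R).

Definition tens k x : R := \prod_i k i (x ord0 i).
(** The factors of the j-th partial derivative of [tens k], which is again a tensor product of
    functions in [sm]. *)
Definition upd k j : 'I_d -> R -> R := fun i => if i == j then derive1 (k j) else k i.

(** Telescoping: exchanging one factor at a time costs [|a i - b i|] times a product of bounded
    factors. *)
Lemma prod_diff (I : Type) (s : seq I) (a b : I -> R) (M : R) : 1 <= M ->
  (forall i, `|a i| <= M) -> (forall i, `|b i| <= M) ->
  `|\prod_(i <- s) a i| <= M ^+ size s /\
  `|\prod_(i <- s) a i - \prod_(i <- s) b i| <= M ^+ size s * \sum_(i <- s) `|a i - b i|.
Proof.
move=> M1 aM bM; have M0 : 0 <= M by exact: le_trans M1.
elim: s => [|i s [IH1 IH2]]; first by rewrite !big_nil subrr normr0 normr1 mulr0.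
rewrite !big_cons /= exprS normrM; split; first by rewrite ler_pM.
set A := \prod_(j <- s) a j; set B := \prod_(j <- s) b j.
have -> : a i * A - b i * B = (a i - b i) * A + b i * (A - B) by ring.
rewrite (le_trans (ler_normD _ _))// !normrM mulrDr lerD//.
  rewrite mulrC ler_wpM2r//; apply: (le_trans IH1).
  by rewrite ler_peMl// exprn_ge0.
by rewrite -mulrA ler_pM.
Qed.

Lemma sm_upd k j : (forall i, sm (k i)) -> forall i, sm (upd k j i).
Proof. by move=> sk i; rewrite /upd; case: eqP => // _; have [] := sm_derive (sk j). Qed.

Lemma tens_uniform k : (forall i, sm (k i)) -> exists2 M : R, 1 <= M &
  forall i, [/\ forall t, `|k i t| <= M, forall s t, `|k i s - k i t| <= M * `|s - t| &
   forall t h, `|k i (t + h) - k i t - h * derive1 (k i) t| <= M * h ^+ 2].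
Proof.
move=> sk.
have H i : exists2 M : R, 1 <= M & [/\ forall t, `|k i t| <= M, forall s t, `|k i s - k i t| <= M * `|s - t| &
   forall t h, `|k i (t + h) - k i t - h * derive1 (k i) t| <= M * h ^+ 2].
  have [A A1 hA] := sm_bounded (sk i); have [B B1 hB] := sm_lipschitz (sk i).
  have [C C1 hC] := sm_quad (sk i); exists (A + B + C); first by lra.
  split=> [t|s t|t h]; [apply: le_trans (hA t) _|apply: le_trans (hB s t) _|apply: le_trans (hC t h) _].
  - by lra.
  - by rewrite ler_wpM2r//; lra.
  - by rewrite ler_wpM2r ?sqr_ge0//; lra.
pose N i := sval (cid2 (H i)).
have N1 i : 1 <= N i by rewrite /N; case: cid2.
have hN i := svalP (cid2 (H i)).
have N0 i : 0 <= N i by exact: le_trans (N1 i).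
exists (1 + \sum_i N i); first by rewrite lerDl sumr_ge0.
have le i : N i <= 1 + \sum_i N i.
  by rewrite (bigD1 i)//= addrCA lerDl addr_ge0// sumr_ge0.
move=> i; have : N i <= 1 + \sum_i N i by exact: le.
rewrite /N; case: cid2 => /= M M1 [hA hB hC] hM; split=> [t|s t|t h].
- exact: le_trans (hA t) hM.
- by apply: le_trans (hB s t) _; rewrite ler_wpM2r.
- by apply: le_trans (hC t h) _; rewrite ler_wpM2r ?sqr_ge0.
Qed.

Lemma tens_bounded k : (forall i, sm (k i)) -> exists2 M : R, 0 <= M & forall x, `|tens k x| <= M.
Proof.
move=> /tens_uniform[M M1 hM]; exists (M ^+ size (index_enum 'I_d)).
  by rewrite exprn_ge0// (le_trans _ M1).
move=> x; have [h _ _] := all_and3 hM.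
by have [] := prod_diff (index_enum 'I_d) M1 (fun i => h i (x ord0 i)) (fun i => h i (x ord0 i)).
Qed.

Lemma tens_lipschitz k : (forall i, sm (k i)) ->
  exists2 M : R, 0 <= M & forall x y, `|tens k x - tens k y| <= M * `|x - y|.
Proof.
move=> /tens_uniform[M M1 hM]; have M0 : 0 <= M by exact: le_trans M1.
exists (M ^+ size (index_enum 'I_d) * (\sum_(i : 'I_d) M)).
  by rewrite mulr_ge0 ?exprn_ge0// sumr_ge0.
move=> x y; have [h h2 _] := all_and3 hM.
have [_] := prod_diff (index_enum 'I_d) M1 (fun i => h i (x ord0 i)) (fun i => h i (y ord0 i)).
move=> /le_trans; apply; rewrite -mulrA ler_wpM2l ?exprn_ge0// mulr_suml ler_sum// => i _.
apply: le_trans (h2 i _ _) _; rewrite ler_wpM2l//.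
by apply: le_trans (coord_le_norm _ i); rewrite !mxE.
Qed.

Lemma tens_split k j x :
  tens k x = k j (x ord0 j) * \prod_(i | i != j) k i (x ord0 i).
Proof. by rewrite /tens (bigD1 j). Qed.

(** Only the j-th factor moves, so its one-variable Taylor bound is multiplied by the bounded
    product of the others. *)
Lemma tens_quad k j : (forall i, sm (k i)) -> exists2 M : R, 0 <= M & forall x (h : R),
  `|tens k (x + h *: evec j) - tens k x - h * tens (upd k j) x| <= M * h ^+ 2.
Proof.
move=> /tens_uniform[M M1 hM]; have M0 : 0 <= M by exact: le_trans M1.
exists (M * M ^+ size [seq i <- index_enum 'I_d | i != j]); first by rewrite mulr_ge0 ?exprn_ge0.
move=> x h; rewrite !(tens_split _ j).
have -> : \prod_(i | i != j) k i ((x + h *: evec j) ord0 i) = \prod_(i | i != j) k i (x ord0 i).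
  by apply: eq_bigr => i /negbTE ij; rewrite !mxE ij andbF mulr0 addr0.
have -> : \prod_(i | i != j) upd k j i (x ord0 i) = \prod_(i | i != j) k i (x ord0 i).
  by apply: eq_bigr => i /negbTE ij; rewrite /upd ij.
rewrite {1}/upd eqxx; set P := \prod_(i | i != j) _.
have -> : (x + h *: evec j) ord0 j = x ord0 j + h by rewrite !mxE !eqxx mulr1.
rewrite -mulrBl mulrA -mulrBl normrM mulrAC.
have [hb _ hq] := all_and3 hM.
rewrite ler_pM//; rewrite /P -big_filter.
by have [] := prod_diff [seq i <- index_enum 'I_d | i != j] M1 (fun i => hb i (x ord0 i)) (fun i => hb i (x ord0 i)).
Qed.

Lemma tens_derive k j x : (forall i, sm (k i)) -> is_derive x (evec j) (tens k) (tens (upd k j) x).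
Proof.
by move=> /(tens_quad j)[M M0 h]; apply: (@quad_partial _ _ _ _ _ _ M) => t _; exact: h.
Qed.

Lemma tens_continuous k : (forall i, sm (k i)) -> continuous (tens k).
Proof. by move=> /tens_lipschitz[M M0 h]; exact: lipschitz_continuous h. Qed.

Lemma tens_Ck n k : (forall i, sm (k i)) -> Ck n (tens k).
Proof.
elim: n k => [|n IH] k sk; first by split => //; exact: tens_continuous.
apply: (CkI (tens_continuous sk) (g := fun j => tens (upd k j))).
  by move=> j; apply: IH; exact: sm_upd.
by move=> j x; exact: tens_derive.
Qed.

(** As a function of [y], the kernel at [x - y] is again a tensor product, with reflected and
    translated factors. *)
Definition refl k x : 'I_d -> R -> R := fun i t => k i ((-1) * t + x ord0 i).

Lemma tens_refl k x y : tens k (x - y) = tens (refl k x) y.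
Proof. by apply: eq_bigr => i _; rewrite /refl !mxE mulN1r addrC. Qed.

Lemma sm_refl k x : (forall i, sm (k i)) -> forall i, sm (refl k x i).
Proof. by move=> sk i; exact: (sm_affine (-1) (x ord0 i) (sk i)). Qed.

Lemma tens_sub_continuous k x : (forall i, sm (k i)) -> continuous (fun y => tens k (x - y)).
Proof.
move=> sk; under eq_fun do rewrite tens_refl.
by apply: tens_continuous; exact: sm_refl.
Qed.

Lemma tens_sub_Ck n k x : (forall i, sm (k i)) -> Ck n (fun y => tens k (x - y)).
Proof.
move=> sk; under eq_fun do rewrite tens_refl.
by apply: tens_Ck; exact: sm_refl.
Qed.

Lemma tens_sub_derive k j x y : (forall i, sm (k i)) ->
  is_derive y (evec j) (fun y => tens k (x - y)) (- tens (upd k j) (x - y)).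
Proof.
move=> sk; have [M M0 h] := tens_quad j sk.
apply: (@quad_partial _ _ _ _ _ _ M) => t _.
have := h (x - y) (- t); rewrite sqrrN scaleNr opprD addrA.
by rewrite mulNr mulrN.
Qed.

Section mollification.
Variables (f : E -> R) (If : L1 leb setT f).

Definition moll k x : R := \int[leb]_y (tens k (x - y) * f y).

Lemma moll_integrable k x : (forall i, sm (k i)) -> L1 leb setT (fun y => tens k (x - y) * f y).
Proof.
move=> sk; have [M M0 hM] := tens_bounded sk.
apply: (@L1_bM _ _ _ _ _ _ _ M) => //.
  by apply: continuous_measurable_rV; exact: tens_sub_continuous.
by apply/nearW => y _.
Qed.

Lemma moll_lipschitz k : (forall i, sm (k i)) ->
  exists2 M : R, 0 <= M & forall x y, `|moll k x - moll k y| <= M * `|x - y|.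
Proof.
move=> sk; have [M M0 h] := tens_lipschitz sk.
exists (M * n1 leb setT f); first by rewrite mulr_ge0// n1_ge0.
move=> x x'; rewrite /moll -RintegralB//; try exact: moll_integrable.
have I1 := L1B measurableT (moll_integrable x sk) (moll_integrable x' sk).
apply: (le_trans (int_le_n1 measurableT I1)).
rewrite mulrAC -RintegralZl//; last exact: L1_abs.
apply: int_le_ae => //; first exact: L1_abs.
  by apply: L1Z => //; exact: L1_abs.
apply/nearW => y _; rewrite -mulrBl normrM ler_wpM2r//.
by apply: (le_trans (h _ _)); rewrite opprB addrA subrK.
Qed.

(** The Taylor bound of the kernel is uniform in the base point, hence integrates against [|f|] to a
    bound of the same form; no limit is interchanged with the integral. *)
Lemma moll_derive k j x : (forall i, sm (k i)) ->
  is_derive x (evec j) (moll k) (moll (upd k j) x).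
Proof.
move=> sk; have [M M0 h] := tens_quad j sk; have su := sm_upd j sk.
apply: (@quad_partial _ _ _ _ _ _ (M * n1 leb setT f)) => t _.
rewrite /moll -RintegralB//; try exact: moll_integrable.
rewrite -RintegralZl//; last exact: moll_integrable.
have I1 := L1B measurableT (moll_integrable (x + t *: evec j) sk) (moll_integrable x sk).
have I2 := L1Z t measurableT (moll_integrable x su).
rewrite -RintegralB//.
have I3 := L1B measurableT I1 I2.
apply: (le_trans (int_le_n1 measurableT I3)).
rewrite mulrAC -RintegralZl//; last exact: L1_abs.
apply: int_le_ae => //; first exact: L1_abs.
  by apply: L1Z => //; exact: L1_abs.
apply/nearW => y _; rewrite -mulrBl mulrA -mulrBl normrM ler_wpM2r//.
by have := h (x - y) t; rewrite (addrAC x).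
Qed.

Lemma moll_Ck n k : (forall i, sm (k i)) -> Ck n (moll k).
Proof.
elim: n k => [|n IH] k sk; have [M M0 h] := moll_lipschitz sk.
  by split => //; exact: lipschitz_continuous h.
apply: (CkI (lipschitz_continuous M0 h) (g := fun j => moll (upd k j))).
  by move=> j; apply: IH; exact: sm_upd.
by move=> j x; exact: moll_derive.
Qed.

Lemma moll_partial k j x : (forall i, sm (k i)) -> partial j (moll k) x = moll (upd k j) x.
Proof. by move=> sk; apply: is_derive_partial; exact: moll_derive. Qed.

End mollification.

Lemma Cc1_L1 V (f : E -> R) : Cc1 V f -> L1 leb setT f.
Proof.
move=> hf; have [r r0 out] := Cc1_out hf; have [C1 _ _] := hf.
apply: (cs_integrable (ltW r0) (Ck_cont C1)) => x /out.
exact: closure_supp_vanish1.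
Qed.

Lemma Cc1_partial_L1 V (f : E -> R) j : Cc1 V f -> L1 leb setT (partial j f).
Proof.
move=> hf; have [r r0 out] := Cc1_out hf; have [C1 _ _] := hf.
apply: (cs_integrable (ltW r0) (Ck_cont (Ck_partial j C1))) => x /out.
exact: partial_vanish.
Qed.

(** The two sides differ by the integral of the j-th partial derivative of the compactly supported
    function [tens k (x - y) * f y] of [y], which vanishes. *)
Lemma moll_partial_Cc1 (f : E -> R) k j x : (forall i, sm (k i)) -> Cc1 setT f ->
  partial j (moll f k) x = moll (partial j f) k x.
Proof.
move=> sk hf; have If := Cc1_L1 hf; have Idf := Cc1_partial_L1 j hf.
have [C1 _ _] := hf; have su := sm_upd j sk.
rewrite moll_partial//; apply/eqP; rewrite -subr_eq0 -oppr_eq0 opprB; apply/eqP.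
have hF : Cc1 setT (fun y => tens k (x - y) * f y) by apply: Cc1M => //; exact: tens_sub_Ck.
rewrite -(int_partial_Cc1 j hF) /moll -RintegralB//; try exact: moll_integrable.
apply: int_eq => y _; rewrite (partialM _ _ (tens_sub_Ck 1 x sk) C1).
by rewrite (is_derive_partial (tens_sub_derive j x y sk)) mulrN [f y * _]mulrC.
Qed.

End tensor_products.

(** * Mollifiers, smooth approximation and cutoff functions *)

Section mollifiers.
Context {R : realType} {d : nat}.
Local Notation E := 'rV[R]_d.
Local Notation leb := (lebesgue_rV d : {measure set E -> \bar R}).
Implicit Types (x y z : E) (j : 'I_d) (V : set E).

Definition kap (e t : R) : R := flat 0 ((- e^-1) * t + 1) * flat 0 (e^-1 * t + 1).

Lemma sm_kap e (i : 'I_d) : sm ((fun=> kap e : R -> R) i).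
Proof. by apply: sm_mul; exact: sm_flat. Qed.

Lemma kap_ge0 e t : 0 <= kap e t.
Proof. by rewrite mulr_ge0// flat_ge0. Qed.

Lemma kap_out e t : 0 < e -> e <= `|t| -> kap e t = 0.
Proof.
move=> e0 et; rewrite /kap /flat; have [t0|t0] := leP 0 t.
  rewrite ifF ?mul0r//; apply/negbTE; rewrite -leNgt mulNr addrC subr_le0.
  by move: et; rewrite ger0_norm// ler_pdivlMl// mulr1.
rewrite [X in _ * X]ifF ?mulr0//; apply/negbTE; rewrite -leNgt -lerBrDr sub0r.
by move: et; rewrite ltr0_norm// ler_pdivrMl// mulrN1 lerNr.
Qed.

Lemma kap0 e : 0 < kap e 0.
Proof. by rewrite /kap !mulr0 !add0r /flat ltr01 !expr0 !mul1r mulr_gt0// expR_gt0. Qed.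

Definition ker e : E -> R := tens (fun=> kap e).

Lemma ker_ge0 e z : 0 <= ker e z.
Proof. by apply: prodr_ge0 => i _; exact: kap_ge0. Qed.

Lemma ker_out e z : 0 < e -> e <= `|z| -> ker e z = 0.
Proof.
move=> e0; apply: contraPeq => kz; apply/negP; rewrite -ltNge; apply: rV_norm_lt => // i.
rewrite ltNge; apply/negP => /(kap_out e0) h.
by move: kz; rewrite /ker (tens_split _ i) h mul0r eqxx.
Qed.

Lemma ker_supp e z : 0 < e -> e < `|z| -> ~ closure [set y | ker e y != 0] z.
Proof.
move=> e0 ez hc.
have : closure (cube e) z.
  apply: closure_subset hc => y /= ky; rewrite /cube /= leNgt; apply/negP => /ltW /(ker_out e0) h.
  by rewrite h eqxx in ky.
rewrite -(closure_id _).1; last exact: cube_closed.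
by rewrite /cube /= leNgt ez.
Qed.

Lemma ker_gt0 e : 0 < ker e 0.
Proof. by apply: prodr_gt0 => i _; rewrite mxE kap0. Qed.

Lemma ker_sub_L1 e x : 0 < e -> L1 leb setT (fun y => ker e (x - y)).
Proof.
move=> e0; apply: (@cs_integrable _ _ _ (`|x| + e)); first by rewrite addr_ge0// ltW.
  by apply: tens_sub_continuous; exact: sm_kap.
move=> y xy; apply: ker_out => //.
have := lerB_dist y x; rewrite distrC; lra.
Qed.

Lemma cube_indic_L1 (N : R) : 0 <= N -> L1 leb setT (\1_(cube N) : E -> R).
Proof.
move=> N0; have h : L1 leb (cube N) (fun=> 1).
  apply: (@L1_bounded _ _ _ _ _ _ 1); [exact: measurable_cube|exact: lebesgue_cube|by []|].
  by apply/nearW => x _; rewrite normr1.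
have /integrable_mkcond := h => /(_ (measurable_cube _)).
apply: eq_integrable => // x _ /=; rewrite /patch indicE.
by case: (x \in _).
Qed.

Definition kmass e : R := \int[leb]_y ker e (0 - y).

(** Translation invariance from integration by parts: the derivative of the mass along a line is the
    integral of a partial derivative in [y]. Derivatives are available for mollifications of
    integrable functions, so the mass is written as the mollification of the indicator of a cube of
    radius [N], large enough to contain the support of the kernel at every [x + s e_j] with
    [|s| <= |t|]. *)
Lemma ker_int_step e x j (t : R) : 0 < e ->
  \int[leb]_y ker e (x + t *: evec j - y) = \int[leb]_y ker e (x - y).
Proof.
move=> e0; pose N := `|x| + `|t| + e + 1.
have N0 : 0 <= N by rewrite /N; have := normr_ge0 x; have := normr_ge0 t; lra.
have If := cube_indic_L1 N0.
have nte s : `|s| <= `|t| -> `|x + s *: evec j| <= `|x| + `|t|.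
  move=> st; rewrite (le_trans (ler_normD _ _))// lerD2l normrZ (le_trans _ st)//.
  by rewrite ler_piMr// norm_evec.
have out s y : `|s| <= `|t| -> ~ cube N y -> e < `|x + s *: evec j - y|.
  move=> /nte h /negP; rewrite /cube /= -ltNge /N => Ny.
  have := lerB_dist y (x + s *: evec j); rewrite distrC.
  by set a := `|x + _| in h *; lra.
have E1 s : `|s| <= `|t| -> \int[leb]_y ker e (x + s *: evec j - y) =
    moll \1_(cube N) (fun=> kap e) (x + s *: evec j).
  move=> st; apply: int_eq => y _; rewrite indicE; case: (boolP (y \in _)) => [_|/negP yN].
    by rewrite mulr1.
  by rewrite mulr0 ker_out// ltW//; apply: out => // yN'; apply: yN; rewrite inE.
have E0 : \int[leb]_y ker e (x - y) = moll \1_(cube N) (fun=> kap e) (x + 0 *: evec j).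
  by have := E1 0; rewrite normr0 normr_ge0 scale0r addr0 => /(_ isT).
rewrite (E1 t (lexx _)) E0.
have Dg (s : R) : is_derive s 1 (fun s => moll \1_(cube N) (fun=> kap e) (x + s *: evec j))
   (moll \1_(cube N) (upd (fun=> kap e) j) (x + s *: evec j)).
  apply: line_is_derive_at => y.
  by apply: (moll_derive If); exact: sm_kap.
have [c [hc1 hc2]] := MVT_any 0 t Dg.
apply/eqP; rewrite -subr_eq0 hc1; apply/eqP.
rewrite [X in X * _](_ : _ = 0) ?mul0r//.
have ct : `|c| <= `|t| by move: hc2; rewrite !subr0.
have hF : Cc1 setT (fun y => ker e (x + c *: evec j - y)).
  have C1 : Ck 1 (fun y => ker e (x + c *: evec j - y)) by apply: tens_sub_Ck; exact: sm_kap.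
  split => //.
  apply: (@closed_bounded_compact _ _ _ N); first exact: closed_closure.
  apply: (subset_trans (B := closure (cube N))).
    apply: closure_subset => y /= ky; apply/negPn/negP => /negP /(out _ _ ct) /ltW /(ker_out e0) h.
    by rewrite h eqxx in ky.
  by rewrite -(closure_id _).1//; exact: cube_closed.
apply/eqP; rewrite -oppr_eq0; apply/eqP.
rewrite -(int_partial_Cc1 j hF) -mulN1r -RintegralZl//; last first.
  by apply: moll_integrable => //; apply: sm_upd; exact: sm_kap.
apply: int_eq => y _.
rewrite (is_derive_partial (tens_sub_derive j (x + c *: evec j) y (sm_kap e))) mulN1r.
congr (- _); rewrite indicE; case: (boolP (y \in _)) => [_|/negP yN]; first by rewrite mulr1.
rewrite mulr0.
have /(ker_supp e0) /(partial_vanish j) : e < `|x + c *: evec j - y|.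
  by apply: out => // yN'; apply: yN; rewrite inE.
by rewrite (is_derive_partial (tens_derive j _ (sm_kap e))).
Qed.

Lemma ker_int e x : 0 < e -> \int[leb]_y ker e (x - y) = kmass e.
Proof.
(* [z n] agrees with [x] in the first [n] coordinates and is 0 in the others: [x] is reached from 0
   by moving one coordinate at a time. *)
move=> e0; pose z n : E := \row_i (if (i < n)%N then x ord0 i else 0).
have -> : x = z d by apply/rowP => i; rewrite mxE ltn_ord.
suff H n : (n <= d)%N -> \int[leb]_y ker e (z n - y) = kmass e by exact: H.
elim: n => [|n IH] nd.
  by congr Rintegral; apply/funext => y; congr (ker e (_ - y)); apply/rowP => i; rewrite !mxE.
rewrite -(IH (ltnW nd)).
have -> : z n.+1 = z n + x ord0 (Ordinal nd) *: evec (Ordinal nd).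
  apply/rowP => i; rewrite !mxE eqxx /= ltnS leq_eqVlt -val_eqE /=.
  case: (eqVneq (i : nat) n) => [ein|nin] /=; last by rewrite mulr0 addr0.
  by rewrite ein ltnn add0r mulr1; congr (x _ _); exact: val_inj.
exact: ker_int_step.
Qed.

Definition rbox (r : R) : set E := [set x : E | forall i, x ord0 i \in
   `[(\row_(_ < d) (- r)) ord0 i, (\row_(_ < d) r : 'rV[R]_d) ord0 i]].

Lemma lebesgue_box_gt0 (r : R) : 0 < r -> (0 < lebesgue_rV d (rbox r))%E.
Proof.
move=> r0; rewrite lebesgue_rV_box; last by move=> i; rewrite !mxE; lra.
by rewrite lte_fin; apply: prodr_gt0 => i _; rewrite !mxE; lra.
Qed.

(** By continuity [f] is at least [f 0 / 2] on a small box, which has positive measure. *)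
Lemma int_pos (f : E -> R) : continuous f -> L1 leb setT f -> (forall x, 0 <= f x) ->
  0 < f 0 -> 0 < \int[leb]_x f x.
Proof.
move=> cf If f0 fp; have f2 : 0 < f 0 / 2 by rewrite divr_gt0.
have /cvgr_dist_lt /(_ _ f2) /nbhs_ballP[e /= e0 he] := cf 0.
have e2 : 0 < e / 2 by rewrite divr_gt0.
pose B := rbox (e / 2).
have mB : measurable B by exact: measurable_closed_box.
have Bc : B `<=` cube (e / 2).
  move=> x Bx; apply: rV_normP => [|i]; first exact: ltW.
  by have := Bx i; rewrite !mxE in_itv /= -ler_norml.
have fB x : B x -> f 0 / 2 <= f x.
  move=> /Bc xe; have : `|f 0 - f x| < f 0 / 2.
    apply: he; apply/in_ball; rewrite sub0r normrN.
    by move: xe; rewrite /cube /=; lra.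
  by rewrite ltr_norml => /andP[_]; lra.
have Boo : (leb B < +oo)%E.
  apply: le_lt_trans (lebesgue_cube d (ltW e2)); apply: le_measure; rewrite ?inE//.
  exact: measurable_cube.
have B0 : (0 < leb B)%E by exact: lebesgue_box_gt0.
have IB : L1 leb B f by apply: L1S If.
have Ic : L1 leb B (fun=> f 0 / 2).
  by apply: (@L1_bounded _ _ _ _ _ _ `|f 0 / 2|) => //; apply/nearW.
apply: (@lt_le_trans _ _ (\int[leb]_(x in B) (f 0 / 2))).
  by rewrite Rintegral_cst// mulr_gt0// fine_gt0// B0.
apply: (@le_trans _ _ (\int[leb]_(x in B) f x)).
  by apply: int_le_ae => //; apply/nearW.
rewrite Rintegral_mkcond; apply: int_le_ae => //.
  by have /integrable_mkcond := IB => /(_ mB); rewrite restrict_EFin.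
by apply/nearW => x _; rewrite /patch; case: ifP.
Qed.

Lemma kmass_gt0 e : 0 < e -> 0 < kmass e.
Proof.
move=> e0; apply: int_pos.
- by apply: tens_sub_continuous; exact: sm_kap.
- exact: ker_sub_L1.
- by move=> x; exact: ker_ge0.
- by rewrite subr0 ker_gt0.
Qed.

Definition smoothing e (f : E -> R) x : R := (kmass e)^-1 * moll f (fun=> kap e) x.

Lemma smoothing_Ck n e f : L1 leb setT f -> Ck n (smoothing e f).
Proof. by move=> If; apply: CkZ; apply: moll_Ck => //; exact: sm_kap. Qed.

Lemma smoothing_partial e f j x : 0 < e -> Cc1 setT f ->
  partial j (smoothing e f) x = smoothing e (partial j f) x.
Proof.
move=> e0 hf; have If := Cc1_L1 hf.
have C1 : Ck 1 (moll f (fun=> kap e)) by apply: moll_Ck => //; exact: sm_kap.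
rewrite (partialZ _ _ _ C1); congr (_ * _).
by apply: moll_partial_Cc1 => //; exact: sm_kap.
Qed.

(** [smoothing e f x] is an average of [f] with nonnegative weights carried by the points within [e]
    of [x]. *)
Lemma smoothing_approx e f x (eta : R) : 0 < e -> L1 leb setT f ->
  (forall y, `|x - y| < e -> `|f y - f x| <= eta) -> `|smoothing e f x - f x| <= eta.
Proof.
move=> e0 If H; have c0 := kmass_gt0 e0.
have IK := ker_sub_L1 x e0.
have IM := moll_integrable If x (sm_kap e).
have -> : smoothing e f x - f x = (kmass e)^-1 * \int[leb]_y (ker e (x - y) * f y - f x * ker e (x - y)).
  rewrite RintegralB//; last exact: L1Z.
  by rewrite RintegralZl// ker_int// mulrBr mulrCA mulVf ?mulr1// gt_eqF.
rewrite normrM normfV (gtr0_norm c0) ler_pdivrMl//.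
have I1 := L1B measurableT IM (L1Z (f x) measurableT IK).
apply: (le_trans (int_le_n1 measurableT I1)).
rewrite -(ker_int x e0) mulrC -RintegralZl//.
apply: int_le_ae => //; [exact: L1_abs|exact: L1Z|].
apply/nearW => y _; rewrite mulrC -mulrBl normrM (ger0_norm (ker_ge0 _ _)).
have [xy|xy] := ltP `|x - y| e; first by rewrite ler_wpM2r ?ker_ge0// H.
by rewrite ker_out// !mulr0.
Qed.

Lemma smoothing_out e f x : 0 < e ->
  (forall y, `|x - y| < e -> f y = 0) -> smoothing e f x = 0.
Proof.
move=> e0 H; rewrite /smoothing /moll [X in _ * X](_ : _ = 0) ?mulr0//.
rewrite (@int_eq _ _ _ _ _ _ (fun=> 0)); first by rewrite /Rintegral integral0.
move=> y _; have [xy|xy] := ltP `|x - y| e; first by rewrite H// mulr0.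
by rewrite [tens _ _]ker_out// mul0r.
Qed.

Lemma smoothing_id e f x (c : R) : 0 < e -> L1 leb setT f ->
  (forall y, `|x - y| < e -> f y = c) -> smoothing e f x = c.
Proof.
move=> e0 If H; have fx : f x = c by rewrite H// subrr normr0.
have : `|smoothing e f x - f x| <= 0.
  by apply: smoothing_approx => // y /H ->; rewrite fx subrr normr0.
by rewrite normr_le0 subr_eq0 fx => /eqP.
Qed.

Lemma smoothing_le e f (M : R) x : 0 < e -> L1 leb setT f -> (forall y, 0 <= f y <= M) ->
  0 <= smoothing e f x <= M.
Proof.
move=> e0 If H; have c0 := kmass_gt0 e0.
have IK := ker_sub_L1 x e0.
rewrite mulr_ge0 ?invr_ge0 ?(ltW c0)//=; last first.
  apply: Rintegral_ge0 => y _; rewrite mulr_ge0// ?ker_ge0//.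
  by have /andP[] := H y.
rewrite ler_pdivrMl// -(ker_int x e0) mulrC -RintegralZl//.
apply: int_le_ae => //; [by apply: moll_integrable => //; exact: sm_kap|exact: L1Z|].
apply/nearW => y _; rewrite mulrC ler_wpM2r ?ker_ge0//.
by have /andP[] := H y.
Qed.

(** [r] is fixed before [eta], so that all approximants live in one cube. Uniform closeness then
    gives closeness in L^2(mu), mu being finite on cubes. *)
Lemma Cc1_approx V (f : E -> R) : open V -> Cc1 V f ->
  exists2 r : R, 0 < r & forall eta : R, 0 < eta -> exists g,
  [/\ Cc_smooth V g, forall x, `|g x - f x| <= eta,
      forall j x, `|partial j g x - partial j f x| <= eta &
      forall x, r < `|x| -> [/\ f x = 0, g x = 0,
        forall j, partial j f x = 0 & forall j, partial j g x = 0]].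
Proof.
move=> oV hf; have hfT : Cc1 setT f by exact: Cc1_subset hf.
have If := Cc1_L1 hf; have [C1 cf fV] := hf.
have [r r0 out] := Cc1_out hf.
have [e0 e00 he0] := compact_in_open cf oV fV.
exists (r + 1); first by rewrite addr_gt0.
move=> eta eta0.
have fr x : r < `|x| -> f x = 0 by move=> /out; exact: closure_supp_vanish1.
have dfr j x : r < `|x| -> partial j f x = 0 by move=> /out; exact: partial_vanish.
have [e1 e10 he1] := unif_cont_cs (Ck_cont C1) fr eta0.
have H j : exists2 e : R, 0 < e & forall x y, `|x - y| < e -> `|partial j f x - partial j f y| < eta.
  exact: (unif_cont_cs (Ck_cont (Ck_partial j C1)) (dfr j) eta0).
pose ej j := sval (cid2 (H j)).
have ej0 j : 0 < ej j by rewrite /ej; case: cid2.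
have hej j x y : `|x - y| < ej j -> `|partial j f x - partial j f y| < eta.
  by rewrite /ej; case: cid2 => /= e _; exact.
(* [e] is at most half the distance [e0] that keeps supports inside [V], at most 1 (hence the radius
   [r + 1]), and at most the moduli of continuity of [f] and of its partial derivatives for
   [eta]. *)
pose e := \big[Num.min/Num.min (Num.min (e0 / 2) 1) e1]_j ej j.
have ebase : e <= Num.min (Num.min (e0 / 2) 1) e1 by exact: bigmin_le_id.
have eej j : e <= ej j by exact: bigmin_le.
have ep : 0 < e.
  apply/bigmin_gtP; split; last by move=> j _; exact: ej0.
  by rewrite !lt_min divr_gt0// ltr01 e10.
move: ebase; rewrite !le_min => /andP[/andP[ee0 e_1] ee1].
have g0 x : ~ closure [set y | f y != 0] x -> True by [].
have sup x : smoothing e f x != 0 -> exists2 y, closure [set y | f y != 0] y & `|x - y| < e.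
  move=> h; apply: contrapT => hn; move/eqP: h; apply.
  apply: smoothing_out => // y xy; apply: closure_supp_vanish1 => cy.
  by apply: hn; exists y.
have cl x : closure [set x | smoothing e f x != 0] x ->
    exists2 y, closure [set y | f y != 0] y & `|x - y| < Num.min e0 (e + e / 2).
  move=> /(_ (ball x (e / 2)))[|z [/= /sup[y cy zy] /in_ball xz]].
    by apply: nbhsx_ballx; rewrite divr_gt0.
  exists y => //; have := ler_normD (x - z) (z - y); rewrite addrA subrK => h.
  have e2 : e / 2 < e0 / 2 by lra.
  by rewrite lt_min; apply/andP; split; lra.
have sup_r x : r + 1 < `|x| -> smoothing e f x = 0.
  move=> rx; apply/eqP/negPn/negP => /sup[y cy xy].
  have : `|y| <= r by rewrite leNgt; apply/negP => /out.
  by have := lerB_dist x y; lra.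
have cr x : closure [set x | smoothing e f x != 0] x -> cube (r + 1) x.
  move=> h; have : closure (cube (r + 1)) x.
    apply: closure_subset h => y /= hy; rewrite /cube /= leNgt; apply/negP => /sup_r hy0.
    by rewrite hy0 eqxx in hy.
  by rewrite -(closure_id _).1//; exact: cube_closed.
exists (smoothing e f); split.
- split; first by move=> k; exact: smoothing_Ck.
    exact: closed_bounded_compact (@closed_closure _ _) cr.
  by move=> x /cl[y cy]; rewrite lt_min => /andP[xy _]; apply: (he0 y) => //; rewrite distrC.
- move=> x; apply: smoothing_approx => // y xy; rewrite distrC ltW//.
  by apply: he1; exact: lt_le_trans ee1.
- move=> j x; rewrite smoothing_partial//; apply: smoothing_approx => //.
    exact: Cc1_partial_L1 hf.
  move=> y xy; rewrite distrC ltW//.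
  by apply: hej; exact: lt_le_trans (eej j).
- move=> x rx; have rx' : r < `|x| by lra.
  split; [exact: fr|exact: sup_r|by move=> j; exact: dfr|].
  move=> j; apply: partial_vanish => /cr.
  by rewrite /cube /= leNgt rx.
Qed.

(** Mollification at scale 1 of the function that is 1 for [|x| <= r + 1], 0 for [|x| >= r + 2] and
    affine in [|x|] in between. The scale costs 1 on either side, hence the radii [r] and
    [r + 3]. *)
Lemma cutoff (r : R) : 0 < r -> exists chi : E -> R,
  [/\ Cc_smooth setT chi, forall x, 0 <= chi x <= 1,
     forall x, `|x| <= r -> chi x = 1 & forall x, r + 3 <= `|x| -> chi x = 0].
Proof.
move=> r0; pose p x : R := Num.max 0 (Num.min 1 (r + 2 - `|x|)).
have pc : continuous p.
  move=> x; pose q := fun z : E => r + 2 - `|z|.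
  have qc : {for x, continuous q}.
    by apply: continuousB; [exact: cst_continuous|exact: norm_continuous].
  have mc : {for x, continuous ((fun _ : E => (1 : R)) \min q)}.
    exact: (@continuous_min _ _ (fun _ : E => (1 : R)) q x (@cst_continuous _ _ _ _) qc).
  exact: (@continuous_max _ _ (fun _ : E => (0 : R)) _ x (@cst_continuous _ _ _ _) mc).
have p1 x : `|x| <= r + 1 -> p x = 1.
  by move=> h; rewrite /p min_l ?max_r//; lra.
have p0 x : r + 2 <= `|x| -> p x = 0.
  by move=> h; rewrite /p max_l// ge_min; apply/orP; right; lra.
have p01 x : 0 <= p x <= 1.
  by rewrite /p le_max lexx /= ge_max ler01 ge_min lexx.
have Ip : L1 leb setT p.
  apply: (@cs_integrable _ _ _ (r + 2)) => //; first lra.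
  by move=> x /ltW /p0.
exists (smoothing 1 p); split.
- split; first by move=> k; exact: smoothing_Ck.
    apply: (@closed_bounded_compact _ _ _ (r + 3)); first exact: closed_closure.
    move=> x h; have : closure (cube (r + 3)) x.
      apply: closure_subset h => y /= hy; rewrite /cube /= leNgt; apply/negP => ry.
      move/eqP: hy; apply; apply: smoothing_out => // z yz; apply: p0.
      by have := lerB_dist y z; lra.
    by rewrite -(closure_id _).1//; exact: cube_closed.
  by [].
- by move=> x; exact: smoothing_le.
- move=> x xr; apply: smoothing_id => // y xy; apply: p1.
  by have := lerB_dist y x; rewrite distrC; lra.
- move=> x rx; apply: smoothing_out => // y xy; apply: p0.
  by have := lerB_dist x y; lra.
Qed.

End mollifiers.

(** * The fundamental lemma of the calculus of variations *)

Section du_bois_reymond.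
Context {R : realType} {d : nat}.
Local Notation E := 'rV[R]_d.
Local Notation leb := (lebesgue_rV d : {measure set E -> \bar R}).
Implicit Types (x a b : E) (h : E -> R).

Definition obox a b : set E := [set x : E | forall i, x ord0 i \in `]a ord0 i, b ord0 i[].

Lemma obox_measurable a b : measurable (obox a b).
Proof.
have -> : obox a b = \bigcap_(i in [set: 'I_d])
    (fun x : E => x ord0 i) @^-1` `]a ord0 i, b ord0 i[.
  by apply/seteqP; split=> x /= h i => [_|]; [exact: h|exact: (h i I)].
apply: fin_bigcap_measurable => // i _.
by rewrite -[X in measurable X]setTI; exact: measurable_coord.
Qed.

Lemma oboxI a b a' b' : obox a b `&` obox a' b' =
  obox (\row_i Num.max (a ord0 i) (a' ord0 i)) (\row_i Num.min (b ord0 i) (b' ord0 i)).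
Proof.
apply/seteqP; split => [x /= [h h'] i|x h].
  have := h i; have := h' i; rewrite !mxE !in_itv /= gt_max lt_min.
  by move=> /andP[-> ->] /andP[-> ->].
split=> i; have := h i; rewrite !mxE !in_itv /= gt_max lt_min => /andP[/andP[h1 h2] /andP[h3 h4]].
  by rewrite h1 h3.
by rewrite h2 h4.
Qed.

(** A pi-system, empty intersections included because the corners [a] and [b] are not ordered. *)
Definition obox_system : set (set E) := [set B | exists a b, B = obox a b].

Lemma measurable_obox_system : @measurable _ E = <<s obox_system >>.
Proof.
apply/seteqP; split; last first.
  apply: smallest_sub; first exact: sigma_algebra_measurable.
  by move=> B [a [b ->]]; exact: obox_measurable.
move=> Y mY.
pose idf (x : g_sigma_algebraType obox_system) : E := x.
suff : measurable_fun setT idf by move=> /(_ measurableT Y mY); rewrite setTI.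
apply: measurable_fun_rVP => i.
apply: (measurability _ (RGenOpens.measurableE R)).
move=> _ [_ [s [t ->]] <-]; rewrite setTI.
pose an n : E := \row_j (if j == i then s else - n%:R).
pose bn n : E := \row_j (if j == i then t else n%:R).
rewrite (_ : _ @^-1` _ = \bigcup_n obox (an n) (bn n)).
  apply: bigcupT_measurable => n; apply: sub_sigma_algebra.
  by exists (an n), (bn n).
apply/seteqP; split => [x /= xst|x [n _ /(_ i)]]; last by rewrite /= !mxE eqxx.
have [n hn] := nat_gt `|x : E|; exists n.+1 => // j; rewrite !mxE.
case: eqP => [->//|_]; rewrite in_itv /= -ltr_norml.
exact: le_lt_trans (coord_le_norm (x : E) j) hn.
Qed.

(** Smooth approximation of the indicator of the open box: for each coordinate, [flat 0] of
    [(n+1)(t - a)] vanishes for [t <= a] and tends to 1 for [t > a], and likewise at [b]. *)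
Definition bump (n : nat) a b : E -> R :=
  tens (fun i t => flat 0 (n.+1%:R * t + (- (n.+1%:R * a ord0 i))) *
                   flat 0 ((- n.+1%:R) * t + n.+1%:R * b ord0 i)).

Lemma sm_bump n a b i : sm ((fun i t => flat 0 (n.+1%:R * t + (- (n.+1%:R * a ord0 i))) *
                   flat 0 ((- n.+1%:R) * t + n.+1%:R * b ord0 i)) i).
Proof. by apply: sm_mul; exact: sm_flat. Qed.

Lemma flat01 (t : R) : 0 <= flat 0 t <= 1.
Proof. by rewrite flat_ge0; have := flat_le 0 t; rewrite expr0. Qed.

Lemma bump01 n a b x : 0 <= bump n a b x <= 1.
Proof.
have H i : 0 <= flat 0 (n.+1%:R * x ord0 i + (- (n.+1%:R * a ord0 i))) *
    flat 0 ((- n.+1%:R) * x ord0 i + n.+1%:R * b ord0 i) <= 1.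
  have /andP[h1 h2] := flat01 (n.+1%:R * x ord0 i + (- (n.+1%:R * a ord0 i))).
  have /andP[h3 h4] := flat01 ((- n.+1%:R) * x ord0 i + n.+1%:R * b ord0 i).
  by rewrite mulr_ge0//= mulr_ile1.
apply/andP; split; first by apply: prodr_ge0 => i _; have /andP[] := H i.
by apply: prodr_ile1 => i _; exact: H.
Qed.

Lemma bump_out n a b x : ~ obox a b x -> bump n a b x = 0.
Proof.
move=> xab; apply/eqP; apply/negPn/negP => bx; apply: xab => i.
move: bx; rewrite /bump (tens_split _ i) mulf_eq0 negb_or => /andP[+ _].
rewrite mulf_eq0 negb_or /flat => /andP[].
case: ifP => [h1 _|_]; last by rewrite eqxx.
case: ifP => [h2 _|_]; last by rewrite eqxx.
rewrite in_itv /=; move: h1; rewrite -mulrBr pmulr_rgt0 ?ltr0n// subr_gt0 => ->.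
by move: h2; rewrite mulNr addrC -mulrBr pmulr_rgt0 ?ltr0n// subr_gt0 => ->.
Qed.

Lemma flat_cvg1 (c : R) : 0 < c -> flat 0 (n.+1%:R * c) @[n --> \oo] --> (1 : R).
Proof.
move=> c0; rewrite /flat.
have -> : (fun n : nat => if 0 < n.+1%:R * c then (n.+1%:R * c)^-1 ^+ 0 * expR (- (n.+1%:R * c)^-1) else 0)
   = (fun n => expR (- (c^-1 * n.+1%:R^-1))).
  by apply/funext => n; rewrite mulr_gt0 ?ltr0n// expr0 mul1r invfM mulrC.
rewrite -[X in _ --> X](@expR0 R).
have h : (- (c^-1 * n.+1%:R^-1)) @[n --> \oo] --> (0 : R).
  rewrite -[X in _ --> X]oppr0; apply: cvgN.
  by rewrite -[X in _ --> X](mulr0 c^-1); apply: cvgM; [exact: cvg_cst|exact: cvg_harmonic].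
exact: (continuous_cvg _ (@continuous_expR R 0) h).
Qed.

Lemma bump_cvg1 a b x : obox a b x -> bump n a b x @[n --> \oo] --> (1 : R).
Proof.
move=> xab; rewrite /bump /tens.
have : (\prod_i (flat 0 (n.+1%:R * x ord0 i + (- (n.+1%:R * a ord0 i))) *
   flat 0 ((- n.+1%:R) * x ord0 i + n.+1%:R * b ord0 i))) @[n --> \oo] --> \prod_(i : 'I_d) (1 * 1 : R).
  apply: cvg_big => // [|i _]; first exact: mul_continuous.
  have := xab i; rewrite in_itv /= => /andP[ax xb].
  apply: cvgM.
    under eq_fun do rewrite -mulrBr.
    by apply: flat_cvg1; rewrite subr_gt0.
  under eq_fun do rewrite mulNr addrC -mulrBr.
  by apply: flat_cvg1; rewrite subr_gt0.
by rewrite mulr1 big1_eq.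
Qed.

Lemma bump_Cc_smooth n a b : Cc_smooth setT (bump n a b).
Proof.
pose r := `|a| + `|b|.
have hr x : obox a b x -> cube r x.
  move=> h; apply: rV_normP => [|i]; first by rewrite addr_ge0.
  have := h i; rewrite in_itv /= => /andP[h1 h2].
  have := coord_le_norm a i; have := coord_le_norm b i.
  rewrite !ler_norml /r => /andP[h3 h4] /andP[h5 h6]; apply/andP.
  by have := normr_ge0 a; have := normr_ge0 b; split; lra.
split => //; first by move=> k; apply: tens_Ck; exact: sm_bump.
apply: (@closed_bounded_compact _ _ _ r); first exact: closed_closure.
move=> x h; have : closure (cube r) x.
  apply: closure_subset h => y /= hy; apply: hr; apply: contrapT => /(bump_out n) hy0.
  by rewrite hy0 eqxx in hy.
by rewrite -(closure_id _).1//; exact: cube_closed.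
Qed.

Lemma locally_integrable_measurable h : (forall n : nat, measurable_fun (cube n%:R) h) ->
  measurable_fun setT h.
Proof.
move=> H; have -> : [set: E] = \bigcup_n cube n%:R.
  by apply/esym; rewrite -subTset => x _; have [n hn] := cube_cover x; exists n.
by apply/measurable_fun_bigcup => // n; exact: measurable_cube.
Qed.

(** By dominated convergence along the bumps [h] has zero integral over open boxes, by a Dynkin
    argument over all measurable sets, so it is zero almost everywhere. As [h] is only locally
    integrable, this is done inside each bounded box [Q N]. *)
Lemma du_bois_reymond h : (forall n : nat, L1 leb (cube n%:R) h) ->
  (forall psi, Cc_smooth setT psi -> \int[leb]_x (h x * psi x) = 0) ->
  \forall x \ae leb, h x = 0.
Proof.
move=> Ih H.
have mh : measurable_fun setT h.
  by apply: locally_integrable_measurable => n; exact: L1_meas (Ih n).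
pose Q (N : nat) : set E := obox (\row__ (- N%:R)) (\row__ N%:R).
have QE N : Q N `<=` cube N%:R.
  move=> x h'; apply: rV_normP => // i; have := h' i.
  by rewrite !mxE in_itv /= ler_norml => /andP[/ltW -> /ltW ->].
have mQ N : measurable (Q N) by exact: obox_measurable.
have IQ N : L1 leb (Q N) h by exact: L1S (measurable_cube _) (mQ N) (@QE N) (Ih N).
have ind1 N (Y : set E) : measurable Y -> L1 leb (Q N) (fun x => \1_Y x * h x).
  move=> mY; apply: (@L1_bM _ _ _ _ _ _ _ 1 (mQ N) _ (IQ N)).
    exact: measurable_indic.
  by apply/nearW => x _; rewrite indicE; case: (_ \in _); rewrite ?normr1 ?normr0.
(* The box is intersected with [Q N] first, so that the bumps vanish outside [Q N] and the
   hypothesis, which concerns integrals over the whole space, applies. *)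
have box0 N a b : \int[leb]_(x in Q N) (\1_(obox a b) x * h x) = 0.
  have -> : \int[leb]_(x in Q N) (\1_(obox a b) x * h x) =
     \int[leb]_(x in Q N) (\1_(obox a b `&` Q N) x * h x).
    by apply: int_eq => x Qx; rewrite indicI /= [\1_(Q N) x]indicE mem_set// mulr1.
  rewrite /Q oboxI -/(Q N); set a' := \row_i _; set b' := \row_i _.
  have sub : obox a' b' `<=` Q N by rewrite /a' /b' -oboxI; exact: subIsetr.
  have mb n : measurable_fun (Q N) (fun x => bump n a' b' x * h x).
    apply: measurable_funM; last exact: measurable_funS mh.
    apply: (@measurable_funS _ _ _ _ setT) => //; apply: continuous_measurable_rV.
    by apply: tens_continuous; exact: sm_bump.
  have c1 : \forall x \ae leb, Q N x -> bump n a' b' x * h x @[n --> \oo] --> \1_(obox a' b') x * h x.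
    apply/nearW => x _; apply: cvgM; last exact: cvg_cst.
    rewrite indicE; case: (boolP (x \in _)) => [|/negP] xo.
      by apply: bump_cvg1; exact: set_mem.
    by apply: cvg_near_cst; apply: nearW => n; rewrite bump_out// => xo'; apply: xo; rewrite inE.
  have c2 n : \forall x \ae leb, Q N x -> `|bump n a' b' x * h x| <= `|h x|.
    apply/nearW => x _; have /andP[p0 p1] := bump01 n a' b' x.
    by rewrite normrM ger0_norm// ler_piMl.
  have [_ cv] := dominated_cvg_int (mQ N) mb
    (L1_meas (ind1 N _ (obox_measurable a' b'))) (L1_abs (mQ N) (IQ N)) c1 c2.
  have z n : \int[leb]_(x in Q N) (bump n a' b' x * h x) = 0.
    rewrite -[RHS](H _ (bump_Cc_smooth n a' b')) Rintegral_mkcond.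
    apply: int_eq => x _; rewrite /patch mulrC; case: ifPn => // /negP xQ.
    rewrite bump_out ?mulr0// => xo; apply: xQ; rewrite inE; exact: sub.
  by move: cv; under eq_fun do rewrite z; move=> /(cvg_unique _ (cvg_cst _)) <-.
have step N Y : <<s obox_system >> Y -> \int[leb]_(x in Q N) (\1_Y x * h x) = 0.
  apply: (dynkin_induction measurable_obox_system
    (P := [set Y | \int[leb]_(x in Q N) (\1_Y x * h x) = 0])).
  - by move=> _ _ [a [b ->]] [a' [b' ->]]; rewrite oboxI; eexists; eexists.
  - rewrite /= -(box0 N (\row__ (- N%:R)) (\row__ N%:R)); apply: int_eq => x Qx.
    by rewrite !indicE in_setT mem_set.
  - by move=> _ [a [b ->]] /=; exact: box0.
  - move=> Y' mY' /= h0.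
    have -> : \int[leb]_(x in Q N) (\1_(~` Y') x * h x) =
       \int[leb]_(x in Q N) (\1_[set: E] x * h x - \1_Y' x * h x).
      apply: int_eq => x _; rewrite !indicE in_setT in_setC.
      by case: (x \in Y') => /=; ring.
    rewrite RintegralB//; [|exact: ind1|exact: ind1].
    rewrite h0 subr0 -(box0 N (\row__ (- N%:R)) (\row__ N%:R)); apply: int_eq => x Qx.
    by rewrite !indicE in_setT mem_set.
  (* Disjoint countable unions are reached from the finite ones by dominated convergence. *)
  - move=> F mF tF /= F0.
    pose U n := \big[setU/set0]_(k < n) F k.
    have mU n : measurable (U n) by apply: bigsetU_measurable => k _; exact: mF.
    have U0 n : \int[leb]_(x in Q N) (\1_(U n) x * h x) = 0.
      elim: n => [|n IHn].
        rewrite /U big_ord0 (@int_eq _ _ _ _ _ _ (fun=> 0)).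
          by rewrite /Rintegral integral0.
        by move=> x _; rewrite indicE in_set0 mul0r.
      have -> : \int[leb]_(x in Q N) (\1_(U n.+1) x * h x) =
         \int[leb]_(x in Q N) (\1_(U n) x * h x + \1_(F n) x * h x).
        apply: int_eq => x _; rewrite -mulrDl /U big_ord_recr /= !indicE in_setU.
        case: (boolP (x \in F n)) => xF; rewrite ?orbT ?orbF ?addr0// (_ : (x \in _) = false) ?add0r//.
        apply/negbTE/negP; rewrite inE -bigcup_mkord => -[k /= kn Fk].
        have := tF k n I I (ex_intro _ x (conj Fk (set_mem xF))).
        by move=> kn'; rewrite kn' ltnn in kn.
      by rewrite RintegralD ?IHn ?F0 ?addr0//; exact: ind1.
    have mUF : measurable (\bigcup_k F k) by exact: bigcupT_measurable.
    have c1 : \forall x \ae leb, Q N x -> \1_(U n) x * h x @[n --> \oo] --> \1_(\bigcup_k F k) x * h x.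
      apply/nearW => x _; apply: cvgM; last exact: cvg_cst.
      apply: cvg_near_cst; rewrite indicE; case: (boolP (x \in \bigcup_k F k)).
        move=> /set_mem[k _ Fk]; near=> n.
        rewrite indicE mem_set// /U -bigcup_mkord; exists k => //=.
        by near: n; exact: nbhs_infty_gt.
      move=> /negP xn; apply: nearW => n; rewrite indicE (_ : (x \in _) = false)//.
      apply/negbTE/negP; rewrite inE /U -bigcup_mkord => -[k _ Fk].
      by apply: xn; rewrite inE; exists k.
    have c2 n : \forall x \ae leb, Q N x -> `|\1_(U n) x * h x| <= `|h x|.
      apply/nearW => x _; rewrite normrM indicE.
      by case: (_ \in _); rewrite ?normr1 ?normr0 ?mul1r ?mul0r.
    have [_ cv] := dominated_cvg_int (mQ N) (fun n => L1_meas (ind1 N _ (mU n)))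
      (L1_meas (ind1 N _ mUF)) (L1_abs (mQ N) (IQ N)) c1 c2.
    by move: cv; under eq_fun do rewrite U0; move=> /(cvg_unique _ (cvg_cst _)) <-.
have ae N : \forall x \ae leb, Q N x -> h x = 0.
  have : ae_eq leb (Q N) (EFin \o h) (cst 0%E).
    apply: (integral_ae_eq (mQ N) (IQ N)) => // Y YQ mY.
    have IY : L1 leb Y h by exact: L1S (IQ N).
    rewrite [RHS]integral0.
    have : \int[leb]_(x in Y) h x = 0.
      rewrite -[RHS](step N Y); last by rewrite -measurable_obox_system.
      rewrite Rintegral_mkcond [RHS]Rintegral_mkcond; apply: int_eq => x _.
      rewrite /patch indicE; case: (boolP (x \in Y)) => [xY|_]; last by rewrite mul0r; case: ifP.
      by rewrite mem_set ?mul1r//; apply: YQ; exact: set_mem.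
    rewrite /Rintegral => e; rewrite -[LHS]fineK ?e//.
    by have := integrable_fin_num mY IY.
  by apply: filterS => x /= /[apply] -[].
apply: filterS (ae_foralln ae) => x hx.
have [n hn] := nat_gt `|x|; apply: (hx n.+1) => i.
rewrite !mxE in_itv /= -ltr_norml.
exact: le_lt_trans (coord_le_norm x i) hn.
Unshelve. all: by end_near. Qed.

End du_bois_reymond.

(** * The Sobolev spaces with zero trace and their localization *)

Section zero_trace_space.
Context {R : realType} {d : nat}.
Local Notation E := 'rV[R]_d.
Variable mu : {measure set E -> \bar R}.
Hypothesis mufin : forall r : R, (mu (cube r) < +oo)%E.
Implicit Types (x : E) (V : set E) (u v f : E -> R) (w z : E -> E) (i : 'I_d).

Lemma cont_comp (f : E -> R) (F : R -> R) : continuous f -> continuous F -> continuous (F \o f).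
Proof. by move=> cf cF x; apply: continuous_comp; [exact: cf|exact: cF]. Qed.

(* H0_grad with the approximating sequence replaced by approximation up to every e > 0
   (see H0gP). *)
Definition H0g V u w := [/\ L2 mu V u, forall i, L2 mu V (fun x => w x ord0 i) &
  forall e : R, 0 < e -> exists v, [/\ Cc_smooth V v,
    n2 mu V (fun x => v x - u x) <= e &
    forall i, n2 mu V (fun x => partial i v x - w x ord0 i) <= e]].

Lemma Cc_L2T f r (M : R) : measurable_fun setT f -> (forall x, `|f x| <= M) ->
  (forall x, r < `|x| -> f x = 0) -> L2 mu setT f.
Proof.
move=> mf fM fr; have h : L2 mu (cube r) f.
  apply: (@L2_bounded _ _ _ _ _ _ M); [exact: measurable_cube|exact: mufin| |].
    exact: measurable_funS mf.
  by apply/nearW => x _; exact: fM.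
split => //; have /integrable_mkcond := h.2 => /(_ (measurable_cube _)).
apply: eq_integrable => // x _ /=; rewrite /patch; case: ifPn => // /negP xr.
rewrite fr ?expr0n// ltNge; apply/negP => xr'; apply: xr.
by rewrite inE.
Qed.

Lemma Cc1_L2 W V f : measurable V -> Cc1 W f -> L2 mu V f.
Proof.
move=> mV hf; have [r r0 out] := Cc1_out hf; have [M M0 hM] := Cc1_bounded hf.
have [C1 _ _] := hf.
apply: (L2S measurableT) => //; apply: (@Cc_L2T f r M).
- exact: Ck_measurable C1.
- by move=> x; have [] := hM x.
- by move=> x /out; exact: closure_supp_vanish1.
Qed.

Lemma Cc1_partial_L2 W V f i : measurable V -> Cc1 W f -> L2 mu V (partial i f).
Proof.
move=> mV hf; have [r r0 out] := Cc1_out hf; have [M M0 hM] := Cc1_bounded hf.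
have [C1 _ _] := hf.
apply: (L2S measurableT) => //; apply: (@Cc_L2T _ r M).
- exact: Ck_measurable (Ck_partial i C1).
- by move=> x; have [_] := hM x; exact.
- by move=> x /out; exact: partial_vanish.
Qed.

Lemma H0gP V u w : measurable V -> H0_grad mu V u w <-> H0g V u w.
Proof.
move=> mV; split.
  move=> [/(Lp2P _ _ mV) Lu Lw [un [un1 un2 un3]]].
  have {}Lw i : L2 mu V (fun x => w x ord0 i) by apply/(Lp2P _ _ mV); exact: Lw.
  split => // e e0.
  have L1n n : L2 mu V (fun x => un n x - u x).
    by apply: L2B => //; exact: Cc1_L2 (Cc_smooth1 (un1 n)).
  have L2n i n : L2 mu V (fun x => partial i (un n) x - w x ord0 i).
    by apply: L2B => //; exact: Cc1_partial_L2 (Cc_smooth1 (un1 n)).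
  have /(cvg_Lpnorm2 mV L1n) /cvgr0Pnorm_le /(_ e e0) A := un2.
  have B : \forall n \near \oo, forall i, n2 mu V (fun x => partial i (un n) x - w x ord0 i) <= e.
    apply: filter_forall => i.
    have /(cvg_Lpnorm2 mV (L2n i)) /cvgr0Pnorm_le /(_ e e0) := un3 i.
    by apply: filterS => n; rewrite ger0_norm ?n2_ge0.
  have AB : \forall n \near \oo, `|n2 mu V (fun x => un n x - u x)| <= e /\
      forall i, n2 mu V (fun x => partial i (un n) x - w x ord0 i) <= e.
    by apply: filterI; [exact: A|exact: B].
  have [n [hA hB]] := filter_ex AB.
  by exists (un n); split => //; move: hA; rewrite ger0_norm ?n2_ge0.
move=> [Lu Lw H]; split; first exact/(Lp2P _ _ mV).
  by move=> i; apply/(Lp2P _ _ mV).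
have ip n : 0 < (n.+1%:R : R)^-1 by rewrite invr_gt0.
pose un n := projT1 (cid (H _ (ip n))).
have hun n := projT2 (cid (H _ (ip n))).
exists un; split=> [n||i]; first by have [] := hun n.
- apply/cvg_Lpnorm2 => //.
    by move=> n; apply: L2B => //; have [h _ _] := hun n; exact: Cc1_L2 (Cc_smooth1 h).
  apply: (squeeze_cvgr (f := fun=> 0) (h := harmonic)); [|exact: cvg_cst|exact: cvg_harmonic].
  by apply: nearW => n; rewrite n2_ge0 /=; have [] := hun n.
- apply/cvg_Lpnorm2 => //.
    by move=> n; apply: L2B => //; have [h _ _] := hun n; exact: Cc1_partial_L2 (Cc_smooth1 h).
  apply: (squeeze_cvgr (f := fun=> 0) (h := harmonic)); [|exact: cvg_cst|exact: cvg_harmonic].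
  by apply: nearW => n; rewrite n2_ge0 /=; have [] := hun n.
Qed.

Lemma H0g_lim V u w : measurable V -> L2 mu V u -> (forall i, L2 mu V (fun x => w x ord0 i)) ->
  (forall e : R, 0 < e -> exists u' w', [/\ H0g V u' w',
     n2 mu V (fun x => u' x - u x) <= e &
     forall i, n2 mu V (fun x => w' x ord0 i - w x ord0 i) <= e]) -> H0g V u w.
Proof.
move=> mV Lu Lw H; split => // e e0; have e2 : 0 < e / 2 by rewrite divr_gt0.
have [u' [w' [[Lu' Lw' /(_ _ e2)[v [hv v1 v2]]] h1 h2]]] := H _ e2.
have Lv := Cc1_L2 mV (Cc_smooth1 hv).
have Ldv i := Cc1_partial_L2 i mV (Cc_smooth1 hv).
exists v; split => // [|i].
  rewrite (@n2_eq _ _ _ _ _ _ (fun x => (v x - u' x) + (u' x - u x))); last by move=> x _; lra.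
  by apply: (le_trans (n2D mV (L2B mV Lv Lu') (L2B mV Lu' Lu))); lra.
rewrite (@n2_eq _ _ _ _ _ _ (fun x => (partial i v x - w' x ord0 i) + (w' x ord0 i - w x ord0 i))); last by move=> x _; lra.
apply: (le_trans (n2D mV (L2B mV (Ldv i) (Lw' i)) (L2B mV (Lw' i) (Lw i)))).
by have := v2 i; have := h2 i; lra.
Qed.

(** This turns the uniform approximation of [Cc1_approx] into approximation in the Sobolev norm. *)
Lemma n2_unif V f r (eta : R) : measurable V -> 0 <= eta -> measurable_fun setT f ->
  (forall x, `|f x| <= eta) -> (forall x, r < `|x| -> f x = 0) ->
  n2 mu V f <= eta * Num.sqrt (fine (mu (cube r))).
Proof.
move=> mV eta0 mf feta fr; rewrite -{1}(ger0_norm eta0) -sqrtr_sqr -sqrtrM ?sqr_ge0// ler_wsqrtr//.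
have mc : measurable (cube r : set E) by exact: measurable_cube.
have Lf := Cc_L2T mf feta fr.
have -> : \int[mu]_(x in V) f x ^+ 2 = \int[mu]_(x in cube r `&` V) f x ^+ 2.
  rewrite Rintegral_mkcondl; apply: int_eq => x _; rewrite /patch.
  case: ifPn => // /negP xr; rewrite fr ?expr0n// ltNge; apply/negP => xr'; apply: xr.
  by rewrite inE.
have mcV : measurable (cube r `&` V) by exact: measurableI.
have Vfin : (mu (cube r `&` V) < +oo)%E.
  by apply: le_lt_trans (mufin r); apply: le_measure; rewrite ?inE//; exact: subIsetl.
apply: (@le_trans _ _ (\int[mu]_(x in cube r `&` V) (eta ^+ 2))).
  apply: int_le_ae => //.
  - exact: L1S measurableT mcV (@subsetT _ _) Lf.2.
  - apply: (@L1_bounded _ _ _ _ _ _ (eta ^+ 2)) => //.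
    by apply/nearW => x _; rewrite ger0_norm ?sqr_ge0.
  - apply/nearW => x _; rewrite -[f x ^+ 2]sqr_normr lerXn2r// nnegrE//.
rewrite Rintegral_cst// ler_wpM2l ?sqr_ge0// fine_le//.
- by rewrite ge0_fin_numE.
- by rewrite ge0_fin_numE.
- by apply: le_measure; rewrite ?inE//; exact: subIsetl.
Qed.

Lemma H0g_Cc1 V f : open V -> Cc1 V f -> H0g V f (gradient f).
Proof.
move=> oV hf; have mV := open_measurable_rV oV.
have [r r0 H] := Cc1_approx oV hf; have [C1 _ _] := hf.
split; first exact: Cc1_L2 hf.
  move=> i; apply: L2_eq (Cc1_partial_L2 i mV hf) => // x _.
  by rewrite mxE.
move=> e e0; set c := Num.sqrt (fine (mu (cube r))).
have c0 : 0 <= c by exact: sqrtr_ge0.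
have eta0 : 0 < e / (c + 1) by rewrite divr_gt0// ltr_wpDl.
have [g [gs g1 g2 g3]] := H _ eta0; have g1s := Cc_smooth1 gs; have [Cg _ _] := g1s.
have le : e / (c + 1) * c <= e.
  by rewrite mulrAC ler_pdivrMr ?ltr_wpDl// ler_wpM2l ?(ltW e0)// lerDl.
exists g; split => // [|i].
  apply: le_trans le; apply: (@n2_unif _ _ r) => //; first exact: ltW.
    by apply: (@Ck_measurable _ _ 1); exact: CkB.
  by move=> x /g3[-> -> _ _]; rewrite subrr.
rewrite (@n2_eq _ _ _ _ _ _ (fun x => partial i g x - partial i f x)); last by move=> x _; rewrite mxE.
apply: le_trans le; apply: (@n2_unif _ _ r) => //; first exact: ltW.
  by apply: (@Ck_measurable _ _ 0); apply: CkB; exact: Ck_partial.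
by move=> x /g3[_ _ -> ->]; rewrite subrr.
Qed.

Lemma H0g_eq_ae V u u' w w' : measurable V -> H0g V u w ->
  measurable_fun V u' -> (forall i, measurable_fun V (fun x => w' x ord0 i)) ->
  (\forall x \ae mu, V x -> u x = u' x) ->
  (forall i, \forall x \ae mu, V x -> w x ord0 i = w' x ord0 i) -> H0g V u' w'.
Proof.
move=> mV [Lu Lw H] mu' mw' uu' ww'.
have Lu' : L2 mu V u'.
  apply: (@L2_dom _ _ _ _ _ _ u 1) => //.
  by apply: filterS uu' => x /[apply] ->; rewrite mul1r.
have Lw' i : L2 mu V (fun x => w' x ord0 i).
  apply: (@L2_dom _ _ _ _ _ _ (fun x => w x ord0 i) 1) => //.
  by apply: filterS (ww' i) => x /[apply] ->; rewrite mul1r.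
split => // e e0; have [v [hv v1 v2]] := H e e0; exists v; split => // [|i].
  apply: le_trans v1; rewrite le_eqVlt; apply/orP; left; apply/eqP.
  have Lv := Cc1_L2 mV (Cc_smooth1 hv).
  apply: n2_eq_ae => //; [exact: L2_meas (L2B mV Lv Lu')|exact: L2_meas (L2B mV Lv Lu)|].
  by apply: filterS uu' => x /[apply] ->.
apply: le_trans (v2 i); rewrite le_eqVlt; apply/orP; left; apply/eqP.
have Lv := Cc1_partial_L2 i mV (Cc_smooth1 hv).
apply: n2_eq_ae => //; [exact: L2_meas (L2B mV Lv (Lw' i))|exact: L2_meas (L2B mV Lv (Lw i))|].
by apply: filterS (ww' i) => x /[apply] ->.
Qed.

Lemma H0g_eq V u u' w w' : measurable V -> H0g V u w -> (forall x, V x -> u x = u' x) ->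
  (forall x i, V x -> w x ord0 i = w' x ord0 i) -> H0g V u' w'.
Proof.
move=> mV H uu' ww'; have [Lu Lw _] := H; apply: (H0g_eq_ae mV H).
- by apply: eq_measurable_fun (L2_meas Lu) => x /set_mem /uu'.
- by move=> i; apply: eq_measurable_fun (L2_meas (Lw i)) => x /set_mem /ww'.
- exact/nearW.
- by move=> i; apply/nearW => x /ww'.
Qed.

Lemma n2_lin V (c : R) u v : measurable V -> L2 mu V u -> L2 mu V v ->
  n2 mu V (fun x => c * u x + v x) <= `|c| * n2 mu V u + n2 mu V v.
Proof. by move=> mV Lu Lv; rewrite -n2Z//; apply: n2D => //; exact: L2Z. Qed.

Lemma H0gZD V (c : R) u v w z : measurable V -> H0g V u w -> H0g V v z ->
  H0g V (fun x => c * u x + v x) (fun x => c *: w x + z x).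
Proof.
move=> mV [Lu Lw Hu] [Lv Lz Hv].
split; first by apply: L2D => //; exact: L2Z.
  move=> i; apply: (L2_eq mV _ (L2D mV (L2Z c mV (Lw i)) (Lz i))) => x _.
  by rewrite !mxE.
move=> e e0; have e1 : 0 < e / (`|c| + 1) by rewrite divr_gt0// ltr_wpDl.
have e2 : 0 < e / 2 by rewrite divr_gt0.
have e3 : 0 < e / 2 / (`|c| + 1) by rewrite divr_gt0// ltr_wpDl.
have [f [hf f1 f2]] := Hu _ e3; have [g [hg g1 g2]] := Hv _ e2.
have ce a : 0 <= a -> a <= e / 2 / (`|c| + 1) -> `|c| * a <= e / 2.
  move=> a0 h; apply: (@le_trans _ _ ((`|c| + 1) * (e / 2 / (`|c| + 1)))).
    by apply: ler_pM => //; rewrite ?lerDl.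
  by rewrite mulrCA divff ?mulr1// gt_eqF// ltr_wpDl.
have hf1 := Cc_smooth1 hf; have hg1 := Cc_smooth1 hg; have [Cf _ _] := hf1; have [Cg _ _] := hg1.
exists (fun x => c * f x + g x); split.
- by apply: Cc_smoothD => //; exact: Cc_smoothZ.
- rewrite (@n2_eq _ _ _ _ _ _ (fun x => c * (f x - u x) + (g x - v x))); last by move=> x _; lra.
  apply: (le_trans (n2_lin c mV (L2B mV (Cc1_L2 mV hf1) Lu) (L2B mV (Cc1_L2 mV hg1) Lv))).
  by have := ce _ (n2_ge0 _ _ _) f1; lra.
- move=> i; rewrite (@n2_eq _ _ _ _ _ _ (fun x => c * (partial i f x - w x ord0 i) + (partial i g x - z x ord0 i))); last first.
    by move=> x _; rewrite (partialD _ _ (CkZ c Cf) Cg) (partialZ _ _ _ Cf) !mxE; lra.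
  apply: (le_trans (n2_lin c mV (L2B mV (Cc1_partial_L2 i mV hf1) (Lw i)) (L2B mV (Cc1_partial_L2 i mV hg1) (Lz i)))).
  by have := ce _ (n2_ge0 _ _ _) (f2 i); have := g2 i; lra.
Qed.

Lemma H0g_0 V : measurable V -> H0g V (fun=> 0) (fun=> 0).
Proof.
move=> mV; split; first exact: L2_0.
  by move=> i; apply: (L2_eq mV _ (L2_0 mu V)) => x _; rewrite mxE.
have C0 : Cc_smooth V (fun _ : E => (0 : R)).
  have e0 : closure [set x : E | (0 : R) != 0] = set0.
    rewrite (_ : [set x : E | _] = set0) ?closure0//.
    by apply/seteqP; split => // x /=; rewrite eqxx.
  by split; [move=> k; exact: Ck_cst|rewrite e0; exact: compact0|rewrite e0].
move=> e e0; exists (fun=> 0); split => // [|i].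
  by rewrite (@n2_eq _ _ _ _ _ _ (fun=> 0)) ?n2_0 ?ltW// => x _; rewrite subrr.
rewrite (@n2_eq _ _ _ _ _ _ (fun=> 0)) ?n2_0 ?ltW// => x _.
by rewrite partial_cst mxE subrr.
Qed.

Lemma H0gZ V (c : R) u w : measurable V -> H0g V u w ->
  H0g V (fun x => c * u x) (fun x => c *: w x).
Proof.
move=> mV Hu; apply: (H0g_eq mV (H0gZD c mV Hu (H0g_0 mV))) => [x _|x i _].
  by rewrite addr0.
by rewrite addr0.
Qed.

Lemma H0gD V u v w z : measurable V -> H0g V u w -> H0g V v z ->
  H0g V (fun x => u x + v x) (fun x => w x + z x).
Proof.
move=> mV Hu Hv; apply: (H0g_eq mV (H0gZD 1 mV Hu Hv)) => [x _|x i _].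
  by rewrite mul1r.
by rewrite scale1r.
Qed.

Lemma H0gB V u v w z : measurable V -> H0g V u w -> H0g V v z ->
  H0g V (fun x => u x - v x) (fun x => w x - z x).
Proof.
move=> mV Hu Hv; apply: (H0g_eq mV (H0gZD (-1) mV Hv Hu)) => [x _|x i _].
  by rewrite mulN1r addrC.
by rewrite scaleN1r addrC.
Qed.

Lemma H0g_sum V (s : seq nat) (u : nat -> E -> R) (w : nat -> E -> E) : measurable V ->
  (forall n, H0g V (u n) (w n)) ->
  H0g V (fun x => \sum_(n <- s) u n x) (fun x => \sum_(n <- s) w n x).
Proof.
move=> mV H; elim: s => [|n s IH].
  by apply: (H0g_eq mV (H0g_0 mV)) => [x _|x i _]; rewrite big_nil.
by apply: (H0g_eq mV (H0gD mV (H n) IH)) => [x _|x i _]; rewrite big_cons.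
Qed.

(* The Lipschitz bound on F' replaces an almost everywhere convergent subsequence: the
   region where |w| is large is controlled by the integrability of |w|^2. *)
Lemma H0g_chain V u w (F F' : R -> R) (C L : R) : open V -> H0g V u w -> F 0 = 0 ->
  (forall t : R, is_derive t 1 F (F' t)) -> (forall t, `|F' t| <= C) ->
  (forall s t, `|F' s - F' t| <= L * `|s - t|) ->
  H0g V (F \o u) (fun x => F' (u x) *: w x).
Proof.
move=> oV Hu F0 FF' F'C F'L; have mV := open_measurable_rV oV; have [Lu Lw H] := Hu.
have C0 : 0 <= C by exact: le_trans (F'C 0).
have L0 : 0 <= L by have := F'L 1 0; rewrite subr0 normr1 mulr1; exact: le_trans.
have cF : continuous F := derive_continuous FF'.
have cF' : continuous F' by exact: lipschitz_continuous F'L.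
have FC := lipschitz_of_derive FF' F'C.
have mFu : measurable_fun V (F \o u).
  by apply: measurableT_comp (L2_meas Lu); exact: continuous_measurable_fun.
have mF'u : measurable_fun V (F' \o u).
  by apply: measurableT_comp (L2_meas Lu); exact: continuous_measurable_fun.
have LFu : L2 mu V (F \o u).
  apply: (L2_dom mV mFu Lu (c := C)); apply/nearW => x _ /=.
  by have := FC (u x) 0; rewrite F0 !subr0.
have LFw i : L2 mu V (fun x => F' (u x) * w x ord0 i).
  by apply: (L2_bM (M := C) mV mF'u (Lw i)); apply/nearW => x _ /=.
apply: H0g_lim => //.
  by move=> i; apply: (L2_eq mV _ (LFw i)) => x _; rewrite mxE.
move=> e e0.
(* The part of [w_i] above height [K i] gets L^2 norm at most [e/(4(C+1))]; multiplied by the bound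
   [2C] of [F'(v) - F'(u)] it stays below [e/2]. *)
have tail i : exists K : R, 0 < K /\ \int[mu]_(x in V) (`|w x ord0 i ^+ 2| * (K < `|w x ord0 i|)%R%:R) <= (e / (4 * (C + 1))) ^+ 2.
  apply: L1_tail => //; first exact: (Lw i).2.
    exact: L2_meas (Lw i).
  by rewrite exprn_gt0// divr_gt0// mulr_gt0// ltr_wpDl.
pose K i := sval (cid (tail i)).
have K0 i : 0 < K i by rewrite /K; case: cid => ? [].
have hK i : \int[mu]_(x in V) (`|w x ord0 i ^+ 2| * (K i < `|w x ord0 i|)%R%:R) <= (e / (4 * (C + 1))) ^+ 2.
  by rewrite /K; case: cid => ? [].
pose KK := \sum_i K i.
have KK0 : 0 <= KK by apply: sumr_ge0 => i _; exact: ltW.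
have KKi i : K i <= KK.
  by rewrite /KK (bigD1 i)//= lerDl; apply: sumr_ge0 => j _; exact: ltW.
(* With this closeness of [v] to [u] the errors [C del] and [L KK del] are each at most [e/4]; the
   added ones keep the denominator positive. *)
pose del := e / (4 * (C + 1 + L * (KK + 1))).
have D0 : 0 < C + 1 + L * (KK + 1) by rewrite ltr_wpDr ?mulr_ge0 ?addr_ge0// ltr_wpDl.
have del0 : 0 < del by rewrite divr_gt0// mulr_gt0.
have delE : (C + 1 + L * (KK + 1)) * del = e / 4.
  by rewrite /del; move: (C + 1 + L * (KK + 1)) (lt0r_neq0 D0) => D Dn; field.
have [v [hv v1 v2]] := H _ del0; have hv1 := Cc_smooth1 hv; have [Cv cv vV] := hv1.
have [CFv eFv] := @Ck1_comp _ _ v F F' Cv (fun x => FF' (v x)) (cont_comp (Ck_cont Cv) cF').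
have hFv : Cc1 V (F \o v) by apply: (Cc1_sub hv1) => // x /= ->.
have Lv := Cc1_L2 mV hv1; have Ldv i := Cc1_partial_L2 i mV hv1.
have del4 : C * del <= e / 4 /\ L * (KK + 1) * del <= e / 4.
  by rewrite -delE; split; rewrite ler_wpM2r ?(ltW del0)// ?lerDr; nra.
exists (F \o v), (gradient (F \o v)); split; first exact: H0g_Cc1.
  apply: (@le_trans _ _ (n2 mu V (fun x => C * (v x - u x)))).
    apply: n2_le => //; [by apply: L2B => //; exact: Cc1_L2 hFv|by apply: L2Z => //; exact: L2B|].
    by apply/nearW => x _ /=; rewrite normrM (ger0_norm C0) FC.
  rewrite n2Z ?(ger0_norm C0)//; last exact: L2B.
  have := ler_wpM2l C0 v1; case: del4; have := ltW e0; lra.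
move=> i.
have mF'v : measurable_fun V (F' \o v).
  by apply: measurableT_comp (L2_meas Lv); exact: continuous_measurable_fun.
have LA : L2 mu V (fun x => F' (v x) * (partial i v x - w x ord0 i)).
  by apply: (L2_bM (M := C) mV mF'v (L2B mV (Ldv i) (Lw i))); apply/nearW => x _ /=.
have mdF : measurable_fun V (fun x => F' (v x) - F' (u x)) by exact: measurable_funB.
have LB : L2 mu V (fun x => (F' (v x) - F' (u x)) * w x ord0 i).
  apply: (L2_bM (M := C + C) mV mdF (Lw i)); apply/nearW => x _ /=.
  by rewrite (le_trans (ler_normB _ _))// lerD.
rewrite (@n2_eq _ _ _ _ _ _ (fun x => F' (v x) * (partial i v x - w x ord0 i) + (F' (v x) - F' (u x)) * w x ord0 i)); last first.
  by move=> x _; rewrite !mxE eFv; lra.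
apply: (le_trans (n2D mV LA LB)).
have hA : n2 mu V (fun x => F' (v x) * (partial i v x - w x ord0 i)) <= e / 4.
  apply: (@le_trans _ _ (n2 mu V (fun x => C * (partial i v x - w x ord0 i)))).
    apply: n2_le => //; [by apply: L2Z => //; exact: L2B|].
    by apply/nearW => x _ /=; rewrite !normrM (ger0_norm C0) ler_wpM2r.
  rewrite n2Z ?(ger0_norm C0)//; last exact: L2B.
  by have := ler_wpM2l C0 (v2 i); case: del4; lra.
pose s x : R := (K i < `|w x ord0 i|)%R%:R.
have ms : measurable_fun V s.
  rewrite (_ : s = (fun x => if K i < `|w x ord0 i| then 1 else 0)); last first.
    by apply/funext => x; rewrite /s; case: ifP.
  apply: (measurable_fun_if mV); [|exact: measurable_cst|exact: measurable_cst].
  by apply: measurable_fun_ltr => //; apply: measurableT_comp => //; exact: L2_meas (Lw i).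
have s01 x : s x = 0 \/ s x = 1 by rewrite /s; case: (_ < _); [right|left].
have Ls : L2 mu V (fun x => s x * w x ord0 i).
  apply: (L2_bM (M := 1) mV ms (Lw i)); apply/nearW => x _.
  by case: (s01 x) => ->; rewrite ?normr0 ?normr1.
have ns : n2 mu V (fun x => s x * w x ord0 i) <= e / (4 * (C + 1)).
  have q0 : 0 <= e / (4 * (C + 1)) by rewrite ltW// divr_gt0// mulr_gt0// ltr_wpDl.
  rewrite -(@ler_pXn2r _ 2)// ?nnegrE ?n2_ge0// n2_sqr.
  apply: le_trans (hK i); rewrite le_eqVlt; apply/orP; left; apply/eqP; apply: int_eq => x _.
  rewrite -/(s x) exprMn (ger0_norm (sqr_ge0 _)) mulrC.
  by case: (s01 x) => ->; rewrite ?expr0n ?expr1n.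
(* Above height [K i] the difference of the derivatives is at most [2C]; below it, that difference
   is at most [L |v - u|] and [|w_i|] is at most [KK]. *)
have hB : n2 mu V (fun x => (F' (v x) - F' (u x)) * w x ord0 i) <=
   (C + C) * n2 mu V (fun x => s x * w x ord0 i) + (L * KK) * n2 mu V (fun x => v x - u x).
  have Lt1 := L2Z (C + C) mV Ls; have Lt2 := L2Z (L * KK) mV (L2B mV Lv Lu).
  have Labs f : L2 mu V f -> L2 mu V (fun x => `|f x|) /\ n2 mu V (fun x => `|f x|) = n2 mu V f.
    move=> Lf; split; last by congr Num.sqrt; apply: int_eq => x _; rewrite sqr_normr.
    apply: (L2_dom mV _ Lf (c := 1)); first by apply: measurableT_comp => //; exact: L2_meas Lf.
    by apply/nearW => x _; rewrite normr_id mul1r.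
  have [La1 na1] := Labs _ Lt1; have [La2 na2] := Labs _ Lt2.
  have -> : (C + C) * n2 mu V (fun x => s x * w x ord0 i) + (L * KK) * n2 mu V (fun x => v x - u x) =
     n2 mu V (fun x => `|(C + C) * (s x * w x ord0 i)|) + n2 mu V (fun x => `|L * KK * (v x - u x)|).
    rewrite na1 na2 !n2Z//; last exact: L2B.
    by rewrite (ger0_norm (addr_ge0 C0 C0)) (ger0_norm (mulr_ge0 L0 KK0)).
  apply: le_trans (n2D mV La1 La2).
  apply: n2_le => //; first exact: L2D.
  apply/nearW => x _; rewrite [leRHS]ger0_norm ?addr_ge0// !normrM (ger0_norm (addr_ge0 C0 C0)).
  rewrite (ger0_norm L0) (ger0_norm KK0).
  have wn := normr_ge0 (w x ord0 i); have un := normr_ge0 (v x - u x).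
  case: (leP `|w x ord0 i| (K i)) => [wK|Kw].
    apply: (@le_trans _ _ (L * `|v x - u x| * KK)).
      by rewrite ler_pM// (le_trans wK).
    by rewrite mulrAC lerDr !mulr_ge0// addr_ge0.
  rewrite (_ : s x = 1); last by rewrite /s Kw.
  rewrite normr1 mul1r; apply: (@le_trans _ _ ((C + C) * `|w x ord0 i|)).
    by rewrite ler_wpM2r// (le_trans (ler_normB _ _))// lerD.
  by rewrite lerDl !mulr_ge0.
have h1 : (C + C) * n2 mu V (fun x => s x * w x ord0 i) <= e / 2.
  apply: (@le_trans _ _ ((C + C) * (e / (4 * (C + 1))))); first by rewrite ler_wpM2l// addr_ge0.
  rewrite -(@ler_pM2r _ (4 * (C + 1))) ?mulr_gt0// ?ltr_wpDl// -mulrA divfK; last first.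
    by rewrite gt_eqF// mulr_gt0// ltr_wpDl.
  by have := ltW e0; nra.
have h2 : L * KK * n2 mu V (fun x => v x - u x) <= e / 4.
  case: del4 => _; apply: le_trans.
  by rewrite ler_pM ?mulr_ge0 ?n2_ge0// ler_wpM2l// lerDl.
lra.
Qed.

End zero_trace_space.

(** * Truncated squares *)

Section truncations.
Context {R : realType}.
Implicit Types t s h K : R.

Definition pp t : R := (Num.max 0 t) ^+ 2.
Definition dpp t : R := 2 * Num.max 0 t.

Lemma max0_lip s t : `|Num.max 0 s - Num.max 0 t| <= `|s - t|.
Proof.
case: (leP 0 s) => hs; case: (leP 0 t) => ht; rewrite ?(subrr, subr0, sub0r) ?normr0// ?normrN.
- by rewrite ger0_norm// (le_trans _ (ler_norm _))//; lra.
- by rewrite ger0_norm// -normrN (le_trans _ (ler_norm _))//; lra.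
Qed.

Lemma pp_derive t : is_derive t 1 pp (dpp t).
Proof.
apply: (@quad_is_derive _ _ _ _ 1) => h _; rewrite mul1r /pp /dpp ler_norml.
by case: (leP 0 t) => ht; case: (leP 0 (t + h)) => hth; apply/andP; split; nra.
Qed.

(** The square on [[-K, K]], continued by its tangents at the endpoints. Unlike the square it has a
    bounded derivative, which [H0g_chain] demands, and that derivative is Lipschitz. *)
Definition huber K t : R := t ^+ 2 - pp (t - K) - pp (- t - K).
Definition dhuber K t : R := 2 * t - dpp (t - K) + dpp (- t - K).

Lemma huber_id K t : `|t| <= K -> huber K t = t ^+ 2 /\ dhuber K t = 2 * t.
Proof.
rewrite ler_norml => /andP[h1 h2].
rewrite /huber /dhuber /pp /dpp !max_l; [by split; ring|lra|lra].
Qed.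

Lemma huber_derive K t : is_derive t 1 (huber K) (dhuber K t).
Proof.
apply: (@quad_is_derive _ _ _ _ 3) => h _; rewrite /huber /dhuber.
have H y k : `|pp (y + k) - pp y - k * dpp y| <= k ^+ 2.
  rewrite /pp /dpp ler_norml.
  by case: (leP 0 y) => ht; case: (leP 0 (y + k)) => hth; apply/andP; split; nra.
have h1 := H (t - K) h; have h2 := H (- t - K) (- h).
move: h1 h2; rewrite (_ : t - K + h = t + h - K); last by ring.
rewrite (_ : - t - K - h = - (t + h) - K); last by ring.
rewrite sqrrN mulNr !ler_norml => /andP[a1 a2] /andP[a3 a4]; apply/andP; split; nra.
Qed.

Lemma dhuber_bound K t : 0 <= K -> `|dhuber K t| <= 2 * K.
Proof.
move=> K0; rewrite /dhuber /dpp ler_norml.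
by case: (leP 0 (t - K)) => h1; case: (leP 0 (- t - K)) => h2; apply/andP; split; lra.
Qed.

Lemma dhuber_lip K s t : `|dhuber K s - dhuber K t| <= 6 * `|s - t|.
Proof.
rewrite /dhuber /dpp.
have h1 := max0_lip (s - K) (t - K); have h2 := max0_lip (- s - K) (- t - K).
have e1 : `|s - K - (t - K)| = `|s - t| by congr (`|_|); ring.
have e2 : `|- s - K - (- t - K)| = `|s - t|.
  by rewrite -normrN; congr (`|_|); ring.
rewrite e1 in h1; rewrite e2 in h2.
have h0 := lexx `|s - t|; move: h0 h1 h2; rewrite {1}ler_norml !ler_norml.
by move=> /andP[a1 a2] /andP[a3 a4] /andP[a5 a6]; apply/andP; split; lra.
Qed.

End truncations.

Section local_spaces.
Context {R : realType} {d : nat}.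
Local Notation E := 'rV[R]_d.
Variable mu : {measure set E -> \bar R}.
Hypothesis mufin : forall r : R, (mu (cube r) < +oo)%E.
Implicit Types (x : E) (V : set E) (u v f chi : E -> R) (w z : E -> E) (i : 'I_d).

Lemma H0g_M1 V u w chi (M : R) : open V -> H0g mu V u w -> Ck 1 chi ->
  (forall x, `|chi x| <= M) -> (forall i x, `|partial i chi x| <= M) ->
  H0g mu V (fun x => u x * chi x) (fun x => chi x *: w x + u x *: gradient chi x).
Proof.
move=> oV [Lu Lw H] Cchi cM dcM; have mV := open_measurable_rV oV; have M0 : 0 <= M by exact: le_trans (cM 0).
have mc : measurable_fun V chi by apply: measurable_funS (Ck_measurable Cchi).
have mdc i : measurable_fun V (partial i chi).
  by apply: measurable_funS (Ck_measurable (Ck_partial i Cchi)).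
have LM f : L2 mu V f -> L2 mu V (fun x => chi x * f x) /\ n2 mu V (fun x => chi x * f x) <= M * n2 mu V f.
  move=> Lf; have L : L2 mu V (fun x => chi x * f x).
    by apply: (L2_bM (M := M) mV mc Lf); apply/nearW.
  split => //; rewrite -[X in X * _](ger0_norm M0) -n2Z//; apply: n2_le => //; first exact: L2Z.
  by apply/nearW => x _; rewrite !normrM (ger0_norm M0) ler_wpM2r.
have LdM i f : L2 mu V f -> L2 mu V (fun x => partial i chi x * f x) /\ n2 mu V (fun x => partial i chi x * f x) <= M * n2 mu V f.
  move=> Lf; have L : L2 mu V (fun x => partial i chi x * f x).
    by apply: (L2_bM (M := M) mV (mdc i) Lf); apply/nearW.
  split => //; rewrite -[X in X * _](ger0_norm M0) -n2Z//; apply: n2_le => //; first exact: L2Z.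
  by apply/nearW => x _; rewrite !normrM (ger0_norm M0) ler_wpM2r.
have LG i : L2 mu V (fun x => chi x * w x ord0 i + partial i chi x * u x).
  by apply: L2D => //; [exact: (LM _ (Lw i)).1|exact: (LdM i _ Lu).1].
apply: H0g_lim => //.
- by apply: (L2_eq mV _ (LM _ Lu).1) => x _; rewrite mulrC.
- by move=> i; apply: (L2_eq mV _ (LG i)) => x _; rewrite !mxE [u x * _]mulrC.
- move=> e e0.
  have del0 : 0 < e / (2 * (M + 1)) by rewrite divr_gt0// mulr_gt0// ltr_wpDl.
  have dM : M * (e / (2 * (M + 1))) <= e / 2.
    rewrite -(@ler_pM2r _ (2 * (M + 1))) ?mulr_gt0// ?ltr_wpDl// -mulrA divfK; last first.
      by rewrite gt_eqF// mulr_gt0// ltr_wpDl.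
    by have := ltW e0; nra.
  have [v [hv v1 v2]] := H _ del0; have hv1 := Cc_smooth1 hv; have [Cv _ _] := hv1.
  have hvc : Cc1 V (fun x => chi x * v x) by exact: Cc1M.
  have Lv := Cc1_L2 mufin mV hv1; have Ldv i := Cc1_partial_L2 mufin i mV hv1.
  exists (fun x => chi x * v x), (gradient (fun x => chi x * v x)); split.
  + exact: H0g_Cc1.
  + rewrite (@n2_eq _ _ _ _ _ _ (fun x => chi x * (v x - u x))); last by move=> x _; ring.
    apply: (le_trans (LM _ (L2B mV Lv Lu)).2).
    by have := ler_wpM2l M0 v1; have := ltW e0; lra.
  + move=> i; rewrite (@n2_eq _ _ _ _ _ _ (fun x => chi x * (partial i v x - w x ord0 i) +
       partial i chi x * (v x - u x))); last first.
      by move=> x _; rewrite !mxE (partialM _ _ Cchi Cv); ring.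
    have [La na] := LM _ (L2B mV (Ldv i) (Lw i)); have [Lb nb] := LdM i _ (L2B mV Lv Lu).
    apply: (le_trans (n2D mV La Lb)).
    by have := ler_wpM2l M0 v1; have := ler_wpM2l M0 (v2 i); lra.
Qed.

Lemma H0g_M1c V W u w chi : open V -> H0g mu V u w -> Cc1 W chi ->
  H0g mu V (fun x => u x * chi x) (fun x => chi x *: w x + u x *: gradient chi x).
Proof.
move=> oV Hu hc; have [M M0 hM] := Cc1_bounded hc; have [C1 _ _] := hc.
apply: (@H0g_M1 _ _ _ _ M) => //; first by move=> x; have [] := hM x.
by move=> i x; have [_] := hM x.
Qed.

Lemma H0g_huber V u w K : 0 <= K -> open V -> H0g mu V u w ->
  H0g mu V (huber K \o u) (fun x => dhuber K (u x) *: w x).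
Proof.
move=> K0 oV Hu; apply: (H0g_chain mufin oV Hu (C := 2 * K) (L := 6)).
- by have [] := @huber_id _ K 0; rewrite ?normr0// expr0n.
- exact: huber_derive.
- by move=> t; exact: dhuber_bound.
- exact: dhuber_lip.
Qed.

(* Polarization reduces products to the square, which the Huber function replaces on [-K, K]. *)
Lemma H0g_prod V u v w z K : open V -> H0g mu V u w -> H0g mu V v z ->
  (\forall x \ae mu, V x -> `|u x| <= K) -> (\forall x \ae mu, V x -> `|v x| <= K) ->
  H0g mu V (fun x => u x * v x) (fun x => v x *: w x + u x *: z x).
Proof.
move=> oV Hu Hv uK vK; have mV := open_measurable_rV oV.
(* A negative bound is possible only if [V] is a null set, and then all identities hold almost
   everywhere on [V]. *)
have [K0|K0] := ltP K 0.
  have u0 : \forall x \ae mu, ~ V x by apply: filterS uK => x h /h; rewrite leNgt (lt_le_trans K0).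
  have [[mu_ _] Lw _] := Hu; have [[mv_ _] Lz _] := Hv.
  apply: (H0g_eq_ae mufin mV Hu).
  - exact: measurable_funM.
  - move=> i; apply: (@eq_measurable_fun _ _ _ _ _ (fun x => v x * w x ord0 i + u x * z x ord0 i)).
      by move=> x _; rewrite !mxE.
    by apply: measurable_funD; apply: measurable_funM => //; [exact: L2_meas (Lw i)|exact: L2_meas (Lz i)].
  - by apply: filterS u0.
  - by move=> i; apply: filterS u0.
have Huv := H0gD mufin mV Hu Hv.
(* The level [2K] also covers [u + v], for which polarization needs the Huber function to be the
   square. *)
have KK0 : 0 <= 2 * K by rewrite mulr_ge0.
have H1 := H0g_huber KK0 oV Huv.
have H2 := H0g_huber KK0 oV Hu.
have H3 := H0g_huber KK0 oV Hv.
have H4 := H0gZ mufin 2^-1 mV (H0gB mufin mV (H0gB mufin mV H1 H2) H3).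
have [[mu_ _] Lw _] := Hu; have [[mv_ _] Lz _] := Hv.
have uvK : \forall x \ae mu, V x -> [/\ `|u x| <= 2 * K, `|v x| <= 2 * K & `|u x + v x| <= 2 * K].
  apply: filterS2 uK vK => x h1 h2 Vx; have a := h1 Vx; have b := h2 Vx.
  by split; [lra|lra|rewrite (le_trans (ler_normD _ _))//; lra].
apply: (H0g_eq_ae mufin mV H4).
- exact: measurable_funM.
- move=> i; apply: (@eq_measurable_fun _ _ _ _ _ (fun x => v x * w x ord0 i + u x * z x ord0 i)).
    by move=> x _; rewrite !mxE.
  by apply: measurable_funD; apply: measurable_funM => //; [exact: L2_meas (Lw i)|exact: L2_meas (Lz i)].
- apply: filterS uvK => x /[apply] -[h1 h2 h3] /=.
  by rewrite (huber_id h1).1 (huber_id h2).1 (huber_id h3).1; field.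
- move=> i; apply: filterS uvK => x /[apply] -[h1 h2 h3] /=.
  by rewrite (huber_id h1).2 (huber_id h2).2 (huber_id h3).2 !mxE; field.
Qed.

Lemma near_cutoff_partial chi (r : R) i x : (forall x, `|x| <= r -> chi x = 1) -> `|x| < r ->
  partial i chi x = 0.
Proof.
move=> h xr; apply: is_derive_partial.
have r0 : 0 < r - `|x| by rewrite subr_gt0.
have h' : \near x, (fun=> 1) x = chi x.
  apply/nbhs_ballP; exists (r - `|x|) => // y /in_ball xy; rewrite h//.
  by have := lerB_dist y x; rewrite distrC; lra.
by apply: near_eq_is_derive h' _; exact: is_derive_cst.
Qed.

(** With radius [4n + 1] the cutoff vanishes beyond [4(n+1)], so each cutoff is 1 on the support of
    its predecessor. The two zero functions at the start allow differences with indices up to three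
    steps apart to begin at 0. *)
Definition cut n : E -> R :=
  if n is n'.+2 then sval (cid (@cutoff R d (4 * n'%:R + 1) (ltr_wpDl (mulr_ge0 (ler0n _ 4) (ler0n _ n')) ltr01)))
  else fun=> 0.

Lemma cutP n : [/\ Cc_smooth setT (cut n.+2), forall x, 0 <= cut n.+2 x <= 1,
  forall x, `|x| <= 4 * n%:R + 1 -> cut n.+2 x = 1 &
  forall x, 4 * n.+1%:R <= `|x| -> cut n.+2 x = 0].
Proof.
rewrite /cut; case: cid => /= chi [h1 h2 h3 h4]; split => // x xn; apply: h4.
by move: xn; rewrite -[n.+1]addn1 natrD; lra.
Qed.

Lemma cut_succ n x : cut n.+1 x * cut n x = cut n x.
Proof.
case: n => [|[|n]]; rewrite ?mulr0//.
have [_ _ _ h0] := cutP n; have [_ _ h1 _] := cutP n.+1.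
have [xn|xn] := leP (4 * n.+1%:R) `|x|; first by rewrite h0// mulr0.
by rewrite h1 ?mul1r//; lra.
Qed.

Lemma cut_Cc n : Cc_smooth setT (cut n).
Proof.
have [h _ _ _] := cutP n.
have z : Cc_smooth setT (fun _ : E => (0 : R)).
  have := Cc_smoothZ 0 h; rewrite (_ : (fun x => 0 * _) = (fun=> 0))//.
  by apply/funext => x; rewrite mul0r.
by case: n h => [|[|n]] h //; have [] := cutP n.
Qed.

Lemma cut1 n x : `|x| <= n%:R -> cut n.+2 x = 1.
Proof.
move=> xn; have [_ _ h _] := cutP n; apply: h; apply: (le_trans xn).
have : 0 <= n%:R :> R by exact: ler0n.
lra.
Qed.

End local_spaces.

(** * Gradients of locally Sobolev functions *)

Section gluing.
Context {R : realType} {d : nat}.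
Local Notation E := 'rV[R]_d.
Variable mu : {measure set E -> \bar R}.
Hypothesis mufin : forall r : R, (mu (cube r) < +oo)%E.
Implicit Types (x : E) (V : set E) (u v f chi : E -> R) (w z : E -> E) (i : 'I_d).

Local Notation cut := (@cut R d).

Lemma H0gPT u w : H0_grad mu setT u w <-> H0g mu setT u w.
Proof. exact: H0gP. Qed.

Lemma Cc_smoothB V f g : Cc_smooth V f -> Cc_smooth V g -> Cc_smooth V (fun x => f x - g x).
Proof.
move=> hf hg; have -> : (fun x => f x - g x) = (fun x => f x + (-1) * g x).
  by apply/funext => x; rewrite mulN1r.
by apply: Cc_smoothD => //; exact: Cc_smoothZ.
Qed.

Lemma cut_cover x (K n : nat) : `|x| <= K%:R -> (K.+2 <= n)%N -> cut n x = 1.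
Proof.
case: n => [|[|n]]// xK Kn; apply: cut1; apply: (le_trans xK).
by rewrite ler_nat; move: Kn; rewrite !ltnS.
Qed.

(* The gradient is glued from the gradients of u eta_n, for the partition of unity
   eta_n = cut (n+2) - cut (n+1); each is first multiplied by a cutoff theta_n equal to 1 on
   the support of eta_n, so that the sum is locally finite everywhere. *)
Lemma Hloc_grad_exists u : Hloc mu u -> exists w, Hloc_grad mu u w.
Proof.
move=> Hu; have oT : open [set: E] by exact: openT.
pose eta n x := cut n.+2 x - cut n.+1 x.
pose theta n x := cut n.+3 x - cut n x.
have eta_s n : Cc_smooth setT (eta n).
  exact: Cc_smoothB (cut_Cc _) (cut_Cc _).
have theta_s n : Cc_smooth setT (theta n).
  exact: Cc_smoothB (cut_Cc _) (cut_Cc _).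
have te n x : theta n x * eta n x = eta n x.
  rewrite /theta /eta.
  have h1 := cut_succ n.+2 x; have h2 := cut_succ n.+1 x; have h3 := cut_succ n x.
  have h4 : cut n.+3 x * cut n.+1 x = cut n.+1 x by rewrite -h2 mulrA h1.
  have h5 : cut n.+2 x * cut n x = cut n x by rewrite -h3 mulrA h2.
  rewrite mulrBl !mulrBr h1 h4 (mulrC (cut n x)) h5 (mulrC (cut n x)) h3; ring.
(* Where [eta n] is nonzero it is so in a neighbourhood, on which [theta n] is identically 1. *)
have edt n i x : eta n x * partial i (theta n) x = 0.
  have [->|ex] := eqVneq (eta n x) 0; first by rewrite mul0r.
  rewrite (_ : partial i (theta n) x = 0) ?mulr0//; apply: is_derive_partial.
  have ce : continuous (eta n) by have [h _ _] := eta_s n; exact: Ck_cont (h 0%N).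
  have h' : \near x, (fun=> 1) x = theta n x.
    have : \near x, eta n x != 0.
      have := ce x; move=> /(_ [set t | t != 0]); apply.
      by apply: open_nbhs_nbhs; split => //; exact: open_neq.
    apply: filterS => y ey; apply: (mulIf ey); rewrite mul1r te//.
  by apply: near_eq_is_derive h' _; exact: is_derive_cst.
have H n : exists g, H0g mu setT (fun x => u x * eta n x) g.
  by have [g /H0gPT] := Hu _ (eta_s n); exists g.
pose g n := projT1 (cid (H n)); have hg n := projT2 (cid (H n)).
pose G n x : E := theta n x *: g n x.
have HG n : H0g mu setT (fun x => u x * eta n x) (G n).
  have := H0g_M1c mufin oT (hg n) (Cc_smooth1 (theta_s n)).
  move=> /(H0g_eq mufin measurableT); apply => [x _|x i _].
    by rewrite -mulrA [eta n x * _]mulrC te.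
  by rewrite /G !mxE -mulrA edt mulr0 addr0.
have G0 (K n : nat) x : `|x| <= K%:R -> (K.+2 <= n)%N -> G n x = 0.
  move=> xK Kn; rewrite /G /theta !(cut_cover xK)// ?subrr ?scale0r//.
  by rewrite (leq_trans Kn)// ltnW// ltnW.
have Gsum (K N : nat) x : `|x| <= K%:R -> (K.+2 <= N)%N ->
    \sum_(0 <= n < N) G n x = \sum_(0 <= n < K.+2) G n x.
  move=> xK KN; rewrite (big_cat_nat (leq0n K.+2) KN)/= [X in _ + X]big1_seq ?addr0//.
  by move=> n /andP[_]; rewrite mem_index_iota => /andP[Kn _]; exact: G0 Kn.
pose k x : nat := sval (cid (cube_cover x)).
have hk x : `|x| <= (k x)%:R by rewrite /k; case: cid.
(* The terms with index at least [K + 2] vanish on the cube of radius [K], so every longer range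
   gives the same value and near any point [w] is one fixed finite sum ([wE]). *)
pose w x := \sum_(0 <= n < (k x).+2) G n x.
have wE (K : nat) x : `|x| <= K%:R -> w x = \sum_(0 <= n < K.+2) G n x.
  move=> xK; rewrite /w -(Gsum (k x) (maxn (k x).+2 K.+2))// ?leq_maxl//.
  by apply: Gsum => //; exact: leq_maxr.
exists w => chi hchi; apply/H0gPT; have hc1 := Cc_smooth1 hchi.
have [r r0 out] := Cc1_out hc1; have [K rK] := nat_gt r.
have outK x : ~ `|x| <= K.+1%:R -> chi x = 0 /\ forall i, partial i chi x = 0.
  move=> /negP; rewrite -ltNge => Kx; have /out o : r < `|x| by exact: lt_trans Kx.
  by split; [exact: closure_supp_vanish1|move=> i; exact: partial_vanish].
have HM n := H0g_M1c mufin oT (HG n) hc1.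
have := H0g_sum mufin (index_iota 0 K.+3) measurableT HM.
move=> /(H0g_eq mufin measurableT).
have etasum x : `|x| <= K.+1%:R -> \sum_(0 <= n < K.+3) eta n x = 1.
  move=> xK; rewrite /eta (telescope_sumr (fun n => cut n.+1 x))//.
  by rewrite (cut_cover xK)// [cut 1 x](_ : _ = 0)// subr0.
apply => [x _|x i _].
  have [xK|xK] := pselect (`|x| <= K.+1%:R); last first.
    have [-> _] := outK x xK; rewrite mulr0 big1// => n _; exact: mulr0.
  rewrite -mulr_suml -mulr_sumr etasum// mulr1.
  by [].
rewrite summxE !mxE.
have [xK|xK] := pselect (`|x| <= K.+1%:R); last first.
  have [c0 dc0] := outK x xK; rewrite c0 mul0r add0r dc0 mulr0 big1// => n _.
  by rewrite !mxE ?c0 dc0 mul0r mulr0 addr0.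
rewrite (wE _ _ xK) summxE mulr_sumr.
transitivity (\sum_(0 <= n < K.+3) (chi x * G n x ord0 i + (u x * partial i chi x) * eta n x)).
  by apply: eq_bigr => n _; rewrite !mxE; ring.
by rewrite big_split /= -[X in _ + X = _]mulr_sumr etasum// mulr1.
Qed.

Lemma wgradP u : Hloc mu u -> Hloc_grad mu u (wgrad mu u).
Proof. by move=> /Hloc_grad_exists[w hw]; exact: (xgetPex _ (ex_intro _ w hw)). Qed.

(** A cutoff that is 1 on the cube of radius [r + 1] has zero gradient on [cube r]; multiplying by
    it changes neither [u] nor [w] there. *)
Lemma Hloc_grad_approx u w (r : R) : 0 < r -> Hloc_grad mu u w ->
  [/\ L2 mu (cube r) u, forall i, L2 mu (cube r) (fun x => w x ord0 i) &
   forall e : R, 0 < e -> exists g, [/\ Cc_smooth setT g,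
     n2 mu (cube r) (fun x => g x - u x) <= e &
     forall i, n2 mu (cube r) (fun x => partial i g x - w x ord0 i) <= e]].
Proof.
move=> r0 Hw; have r1 : 0 < r + 1 by lra.
have [chi [hc c01 c1 c0]] := cutoff (d := d) r1.
have /H0gPT[L1u L1w H] := Hw _ hc.
have mc : measurable (cube r : set E) by exact: measurable_cube.
have cu x : cube r x -> u x * chi x = u x.
  by rewrite /cube /= => xr; rewrite c1 ?mulr1//; lra.
have cw i x : cube r x -> (chi x *: w x + u x *: gradient chi x) ord0 i = w x ord0 i.
  rewrite /cube /= => xr; rewrite !mxE (near_cutoff_partial i c1) ?mulr0 ?addr0; last by lra.
  by rewrite c1 ?mul1r//; lra.
have Lu : L2 mu (cube r) u.
  by apply: (L2_eq mc cu); exact: L2S measurableT mc (@subsetT _ _) L1u.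
have Lw i : L2 mu (cube r) (fun x => w x ord0 i).
  by apply: (L2_eq mc (cw i)); exact: L2S measurableT mc (@subsetT _ _) (L1w i).
split => // e e0; have [g [hg g1 g2]] := H e e0; exists g.
have n2S (f : E -> R) : L2 mu setT f -> n2 mu (cube r) f <= n2 mu setT f.
  move=> Lf; rewrite ler_wsqrtr// Rintegral_mkcond; apply: int_le_ae => //.
  - have := L1S measurableT mc (@subsetT _ _) Lf.2.
    by move=> /(integrable_mkcond _ mc).1; rewrite restrict_EFin.
  - exact: Lf.2.
  - by apply/nearW => x _; rewrite /patch; case: ifP => // _; exact: sqr_ge0.
split => //.
  rewrite (@n2_eq _ _ _ _ _ _ (fun x => g x - u x * chi x)); last by move=> x /cu ->.
  apply: le_trans (n2S _ _) g1; apply: L2B => //.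
  exact: Cc1_L2 (Cc_smooth1 hg).
move=> i; rewrite (@n2_eq _ _ _ _ _ _ (fun x => partial i g x - (chi x *: w x + u x *: gradient chi x) ord0 i)); last first.
  by move=> x /(cw i) ->.
apply: le_trans (n2S _ _) (g2 i); apply: L2B => //.
exact: Cc1_partial_L2 (Cc_smooth1 hg).
Qed.

End gluing.

(** * Integration by parts for the weighted measure *)

Section density.
Context {disp : measure_display} {T : measurableType disp} {R : realType}.
Variables (nu mu : {measure set T -> \bar R}) (rho : T -> R).
Hypothesis mrho : measurable_fun setT rho.
Hypothesis rho0 : forall x, 0 <= rho x.
Hypothesis muE : forall Y : set T, measurable Y -> mu Y = (\int[nu]_(x in Y) (rho x)%:E)%E.

Import HBNNSimple.

(** The formula for sets gives it for simple functions, and monotone convergence on both sides does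
    the rest. *)
Lemma ge0_integral_density (f : T -> R) : measurable_fun setT f -> (forall x, 0 <= f x) ->
  (\int[mu]_x (f x)%:E = \int[nu]_x (f x * rho x)%:E)%E.
Proof.
move=> mf f0; have mf' : measurable_fun setT (EFin \o f) by exact/measurable_EFinP.
pose f_ := nnsfun_approx measurableT mf'.
have cvf x : (f_ n x)%:E @[n --> \oo] --> (f x)%:E.
  by apply: cvg_nnsfun_approx => // y _; rewrite lee_fin.
transitivity (limn (fun n => \int[mu]_x (f_ n x)%:E)%E).
  rewrite -monotone_convergence//.
  - by apply: eq_integral => x _; apply/esym/cvg_lim.
  - by move=> n; exact/measurable_EFinP/measurable_funP.
  - by move=> n y _; rewrite lee_fin.
  - by move=> y _ m n mn; rewrite lee_fin; exact/lefP/nd_nnsfun_approx.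
transitivity (limn (fun n => \int[nu]_x (f_ n x * rho x)%:E)%E); last first.
  rewrite -monotone_convergence//.
  - apply: eq_integral => x _; apply/cvg_lim => //.
    have h : (f_ n x) @[n --> \oo] --> f x by have /fine_cvg := cvf x.
    by apply: cvg_EFinW; apply: cvgM; [exact: h|exact: cvg_cst].
  - by move=> n; apply/measurable_EFinP; apply: measurable_funM => //; exact/measurable_funP.
  - by move=> n y _; rewrite lee_fin mulr_ge0.
  - by move=> y _ m n mn; rewrite lee_fin ler_wpM2r//; exact/lefP/nd_nnsfun_approx.
congr (limn _); apply/funext => n.
have mfn r : measurable (f_ n @^-1` [set r]) by [].
transitivity (\sum_(k \in range (f_ n)) (k%:E * mu (f_ n @^-1` [set k])))%E.
  rewrite -sintegralE integral_nnsfun//; congr sintegral.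
  by apply/funext => x; rewrite /patch in_setT.
transitivity (\sum_(k \in range (f_ n)) \int[nu]_x (k * \1_(f_ n @^-1` [set k]) x * rho x)%:E)%E.
  apply: eq_fsbigr => r _; rewrite muE// integral_mkcond.
  have [r0|r0] := ltP r 0.
    have -> : f_ n @^-1` [set r] = set0.
      apply/seteqP; split => // x /= fx; have : 0 <= f_ n x by [].
      by rewrite fx leNgt r0.
    rewrite [X in (_ * X)%E](_ : _ = 0%E) ?mule0; last first.
      by rewrite integral0_eq// => x _; rewrite /patch in_set0.
    by rewrite integral0_eq// => x _; rewrite indic0 mulr0 mul0r.
  rewrite -ge0_integralZl//; last 2 first.
  - have : measurable_fun (f_ n @^-1` [set r]) (EFin \o rho).
      by apply/measurable_EFinP; exact: measurable_funS mrho.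
    by move=> /(measurable_restrictT _ (mfn r)).
  - by move=> x _; rewrite /patch; case: ifP => // _; rewrite lee_fin.
  apply: eq_integral => x _; rewrite /patch indicE.
  by case: ifP => _; [rewrite mulr1 EFinM|rewrite mulr0 mul0r mule0].
rewrite -ge0_integral_fsum//; last 2 first.
- move=> r; apply/measurable_EFinP; apply: measurable_funM => //.
  by apply: measurable_funM => //; exact: measurable_indic.
- move=> r x _; rewrite lee_fin mulr_ge0//.
  by have := nnfun_muleindic_ge0 (f_ n) r x; rewrite lee_fin.
apply: eq_integral => x _; rewrite fsumEFin//; congr EFin.
by rewrite [in RHS]fimfunE mulr_fsuml.
Qed.

Lemma L1_density_T (f : T -> R) : measurable_fun setT f ->
  L1 mu setT f <-> L1 nu setT (fun x => f x * rho x).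
Proof.
move=> mf; have mfr : measurable_fun setT (fun x => f x * rho x) by exact: measurable_funM.
have e : (\int[mu]_x `|f x|%:E = \int[nu]_x `|f x * rho x|%:E)%E.
  rewrite ge0_integral_density//; last exact: measurableT_comp.
  by apply: eq_integral => x _; rewrite normrM (ger0_norm (rho0 x)).
by rewrite !L1P e; split=> -[].
Qed.

Lemma int_density_T (f : T -> R) : L1 mu setT f ->
  \int[mu]_x f x = \int[nu]_x (f x * rho x).
Proof.
move=> If; have mf := L1_meas If; have If' := (L1_density_T mf).1 If.
have mp : measurable_fun setT (fun x => Num.max 0 (f x)) by exact: measurable_maxr.
have mn : measurable_fun setT (fun x => Num.max 0 (- f x)).
  by apply: measurable_maxr => //; exact: measurableT_comp.
have p0 x : 0 <= Num.max 0 (f x) by rewrite le_max lexx.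
have n0 x : 0 <= Num.max 0 (- f x) by rewrite le_max lexx.
have le1 x : `|Num.max 0 (f x)| <= `|f x|.
  by rewrite ger0_norm// ge_max normr_ge0 ler_norm.
have le2 x : `|Num.max 0 (- f x)| <= `|f x|.
  by rewrite ger0_norm// ge_max normr_ge0 -normrN ler_norm.
have Ip : L1 mu setT (fun x => Num.max 0 (f x)).
  by apply: (L1_dom measurableT mp (L1_abs measurableT If)); apply/nearW => x _.
have In : L1 mu setT (fun x => Num.max 0 (- f x)).
  by apply: (L1_dom measurableT mn (L1_abs measurableT If)); apply/nearW => x _.
have Ip' := (L1_density_T mp).1 Ip; have In' := (L1_density_T mn).1 In.
have fE x : f x = Num.max 0 (f x) - Num.max 0 (- f x).
  by case: (leP 0 (f x)) => h; case: (leP 0 (- f x)) => h'; lra.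
transitivity (\int[mu]_x (Num.max 0 (f x) - Num.max 0 (- f x))).
  by apply: int_eq => x _.
rewrite RintegralB// {1}/Rintegral {1}/Rintegral !ge0_integral_density//.
rewrite -!/(Rintegral _ _ _) -RintegralB//.
by apply: int_eq => x _; rewrite -mulrBl -fE.
Qed.

Lemma L1_density (D : set T) (f : T -> R) : measurable D -> measurable_fun D f ->
  L1 mu D f <-> L1 nu D (fun x => f x * rho x).
Proof.
move=> mD mf; have mf' : measurable_fun setT (f \_ D) by exact/(measurable_restrictT f mD).
have H (m : {measure set T -> \bar R}) g : L1 m D g <-> L1 m setT (g \_ D).
  by rewrite /L1 (integrable_mkcond (EFin \o g) mD) restrict_EFin.
rewrite !H (L1_density_T mf'); split; apply: L1_eq => // x _; rewrite /patch;
  by case: ifP => // _; rewrite mul0r.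
Qed.

Lemma int_density (D : set T) (f : T -> R) : measurable D -> L1 mu D f ->
  \int[mu]_(x in D) f x = \int[nu]_(x in D) (f x * rho x).
Proof.
move=> mD If; rewrite Rintegral_mkcond int_density_T; last first.
  by have := (integrable_mkcond (EFin \o f) mD).1 If; rewrite restrict_EFin.
rewrite [RHS]Rintegral_mkcond; apply: int_eq => x _; rewrite /patch.
by case: ifP => // _; rewrite mul0r.
Qed.

Lemma ae_density (P : T -> Prop) : (\forall x \ae nu, P x) -> \forall x \ae mu, P x.
Proof.
move=> [N [mN N0 PN]]; exists N; split => //.
rewrite muE//; apply: null_set_integral => //; first by apply/measurable_EFinP; exact: measurable_funS mrho.
Qed.

End density.

Section limit_tools.
Context {disp : measure_display} {T : measurableType disp} {R : realType}.
Variable mu : {measure set T -> \bar R}.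
Implicit Types (D : set T) (f g h : T -> R).

(** The form in which most limits are taken below. The restriction [e <= 1] lets terms of order
    [e^2] be absorbed in [C e]. *)
Lemma eps_zero (a : R) : (exists C : R, forall e : R, 0 < e -> e <= 1 -> `|a| <= C * e) -> a = 0.
Proof.
move=> [C H]; apply/eqP; rewrite -normr_le0; apply/ler_addgt0Pr => e e0; rewrite add0r.
have C1 : 0 < `|C| + 1 by rewrite ltr_pwDr.
pose e' := Num.min 1 (e / (`|C| + 1)).
have e'0 : 0 < e' by rewrite lt_min ltr01 divr_gt0.
apply: (le_trans (H e' e'0 _)); first by rewrite ge_min lexx.
apply: (@le_trans _ _ ((`|C| + 1) * e')).
  by rewrite ler_wpM2r ?(ltW e'0)// (le_trans (ler_norm _))// lerDl.
by rewrite -ler_pdivlMl// mulrC ge_min lexx orbT.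
Qed.

Lemma int_prod_close D f g f' g' h (M : R) : measurable D -> L2 mu D f -> L2 mu D g ->
  L2 mu D f' -> L2 mu D g' -> measurable_fun D h -> (forall x, `|h x| <= M) ->
  `|\int[mu]_(x in D) (f x * g x * h x) - \int[mu]_(x in D) (f' x * g' x * h x)| <=
  M * (n2 mu D (fun x => f x - f' x) * n2 mu D g + n2 mu D f' * n2 mu D (fun x => g x - g' x)).
Proof.
move=> mD Lf Lg Lf' Lg' mh hM; have M0 : 0 <= M by exact: le_trans (hM (point : T)).
have I k l : L2 mu D k -> L2 mu D l -> L1 mu D (fun x => k x * l x * h x).
  move=> Lk Ll; apply: (L1_eq mD _ (L1_bM (M := M) mD mh (L2_mul mD Lk Ll) _)).
    by move=> x _; rewrite mulrC.
  by apply/nearW => x _.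
have La := L2B mD Lf Lf'; have Lb := L2B mD Lg Lg'.
rewrite -RintegralB//; [|exact: I|exact: I].
apply: (@le_trans _ _ (\int[mu]_(x in D) (M * (`|(f x - f' x) * g x| + `|f' x * (g x - g' x)|)))); last first.
  have I1 := L1_abs mD (L2_mul mD La Lg); have I2 := L1_abs mD (L2_mul mD Lf' Lb).
  rewrite RintegralZl//; last exact: L1D.
  rewrite ler_wpM2l// RintegralD// lerD//; [exact: n1_mul La Lg|exact: n1_mul Lf' Lb].
have IB := L1B mD (I _ _ Lf Lg) (I _ _ Lf' Lg').
apply: (le_trans (int_le_n1 mD IB)); apply: int_le_ae => //.
- exact: L1_abs.
- by apply: L1Z => //; apply: L1D => //; apply: L1_abs => //; exact: L2_mul.
- apply/nearW => x _.
  have -> : f x * g x * h x - f' x * g' x * h x = h x * ((f x - f' x) * g x + f' x * (g x - g' x)) by ring.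
  by rewrite normrM ler_pM// ler_normD.
Qed.

Lemma L1_ext D f : measurable D -> (forall x, ~ D x -> f x = 0) -> L1 mu D f -> L1 mu setT f.
Proof.
move=> mD f0 /(integrable_mkcond _ mD).1; rewrite restrict_EFin; apply: L1_eq => // x _.
by rewrite /patch; case: ifPn => // /negP xD; rewrite f0// => Dx; apply: xD; rewrite inE.
Qed.

Lemma int_ext D f : (forall x, ~ D x -> f x = 0) ->
  \int[mu]_x f x = \int[mu]_(x in D) f x.
Proof.
move=> f0; rewrite [RHS]Rintegral_mkcond; apply: int_eq => x _.
by rewrite /patch; case: ifPn => // /negP xD; rewrite f0// => Dx; apply: xD; rewrite inE.
Qed.

Lemma int0 D : \int[mu]_(x in D) (0 : R) = 0.
Proof. by rewrite /Rintegral integral0. Qed.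

End limit_tools.

(** * The distributional gradient of the density *)

Section weighted.
Context {R : realType} {d : nat}.
Local Notation E := 'rV[R]_d.
Local Notation leb := (lebesgue_rV d : {measure set E -> \bar R}).
Variables (mu : {measure set E -> \bar R}) (phi : E -> R).
Let rho := fun x => phi x ^+ 2.
Hypothesis Hphi : Hloc leb phi.
Hypothesis Hmu : forall Y : set E, measurable Y -> mu Y = (\int[leb]_(x in Y) (rho x)%:E)%E.
Implicit Types (x : E) (V : set E) (u v f F : E -> R) (j : 'I_d).

Lemma lebfin (r : R) : (leb (cube r) < +oo)%E.
Proof.
have [r0|r0] := leP 0 r; first exact: lebesgue_cube.
apply: le_lt_trans (lebesgue_cube d (lexx 0)); apply: le_measure; rewrite ?inE; try exact: measurable_cube.
exact/cube_le/ltW.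
Qed.

Let wp := wgrad leb phi.

Lemma wpP : Hloc_grad leb phi wp.
Proof. exact: wgradP lebfin _ Hphi. Qed.

Lemma phi_L2 (r : R) : 0 < r -> L2 leb (cube r) phi.
Proof. by move=> r0; have [] := Hloc_grad_approx lebfin r0 wpP. Qed.

Lemma wp_L2 (r : R) j : 0 < r -> L2 leb (cube r) (fun x => wp x ord0 j).
Proof. by move=> r0; have [_ h _] := Hloc_grad_approx lebfin r0 wpP; exact: h. Qed.

Lemma meas_cubes f : (forall r : R, 0 < r -> measurable_fun (cube r) f) -> measurable_fun setT f.
Proof.
move=> H; apply: locally_integrable_measurable => n.
by apply: (measurable_funS (measurable_cube n.+1%:R)); [apply: cube_le; rewrite ler_nat|exact: H].
Qed.

Lemma mphi : measurable_fun setT phi.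
Proof. by apply: meas_cubes => r /phi_L2 /L2_meas. Qed.

Lemma mwp j : measurable_fun setT (fun x => wp x ord0 j).
Proof. by apply: meas_cubes => r r0; exact: L2_meas (wp_L2 j r0). Qed.

Lemma mrho : measurable_fun setT rho.
Proof. by apply: measurable_funX; exact: mphi. Qed.

Lemma mufin (r : R) : (mu (cube r) < +oo)%E.
Proof.
have h s : 0 < s -> (mu (cube s) < +oo)%E.
  move=> s0; have ms : measurable (cube s : set E) by exact: measurable_cube.
  have /L1P[_] := (phi_L2 s0).2; rewrite Hmu//.
  apply: le_lt_trans; rewrite le_eqVlt; apply/orP; left; apply/eqP.
  by apply: eq_integral => x _; rewrite ger0_norm// sqr_ge0.
apply: le_lt_trans (h (`|r| + 1) _); last by rewrite ltr_wpDl.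
apply: le_measure; rewrite ?inE; try exact: measurable_cube.
by apply: cube_le; rewrite (le_trans (ler_norm _))// lerDl.
Qed.

Lemma Cc1_cube F : Cc1 setT F -> exists r : R, [/\ 0 < r,
   forall x, ~ cube r x -> F x = 0 & forall j x, ~ cube r x -> partial j F x = 0].
Proof.
move=> hF; have [r r0 out] := Cc1_out hF; exists r; split => // [x|j x] /negP;
  rewrite -ltNge => /out.
  exact: closure_supp_vanish1.
exact: partial_vanish.
Qed.

(** For a smooth [g] close to [phi] on the support of [F], the integral of the j-th derivative of
    [g^2 F] vanishes. Its two terms depend continuously on [g] in the H^{1,2} norm by
    [int_prod_close]. *)
Lemma ibp_phi F j : Cc1 setT F ->
  \int[leb]_x (rho x * partial j F x) = - \int[leb]_x (2 * phi x * wp x ord0 j * F x).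
Proof.
move=> hF; have [r [r0 F0 dF0]] := Cc1_cube hF; have [C1 _ _] := hF.
have [M M0 hM] := Cc1_bounded hF.
have mc : measurable (cube r : set E) by exact: measurable_cube.
have [Lp Lw H] := Hloc_grad_approx lebfin r0 wpP.
rewrite (@int_ext _ _ _ _ (cube r)); last by move=> x /(dF0 j) ->; rewrite mulr0.
rewrite [in RHS](@int_ext _ _ _ _ (cube r)); last by move=> x /F0 ->; rewrite mulr0.
apply/eqP; rewrite -subr_eq0 opprK; apply/eqP; apply: eps_zero.
pose N := n2 leb (cube r) phi; pose W := n2 leb (cube r) (fun x => wp x ord0 j).
have N0 : 0 <= N by exact: n2_ge0.
have W0 : 0 <= W by exact: n2_ge0.
(* For [e <= 1] the norms of [g] and of its derivative are at most [1 + N] and [1 + W]. The first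
   summand bounds the error in [g^2] times the derivative of [F], the second the error in [2 g]
   times its derivative times [F]. *)
exists (M * (1 + N + N) + 2 * M * (W + 1 + N)) => e e0 e1.
have [g [hg g1 g2]] := H e e0; have hg1 := Cc_smooth1 hg; have [Cg _ _] := hg1.
have Lg := Cc1_L2 lebfin mc hg1; have Ldg := Cc1_partial_L2 lebfin j mc hg1.
have mF : measurable_fun (cube r) F by apply: measurable_funS (Ck_measurable C1).
have mdF : measurable_fun (cube r) (partial j F) by apply: measurable_funS (Ck_measurable (Ck_partial j C1)).
have c1 := int_prod_close mc Lg Lg Lp Lp mdF (fun x => (hM x).2 j).
have c2 := int_prod_close mc Lg Ldg Lp (Lw j) mF (fun x => (hM x).1).
have hgF : Cc1 setT (fun x => g x * (g x * F x)) by apply: Cc1M => //; exact: Cc1M.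
have z := int_partial_Cc1 j hgF.
have CgF : Ck 1 (fun x => g x * F x) by exact: CkM.
have IA : L1 leb (cube r) (fun x => g x * g x * partial j F x).
  apply: (L1_eq mc _ (L1_bM (M := M) mc mdF (L2_mul mc Lg Lg) _)); first by move=> x _; rewrite mulrC.
  by apply/nearW => x _; have [_] := hM x; exact.
have IB : L1 leb (cube r) (fun x => g x * partial j g x * F x).
  apply: (L1_eq mc _ (L1_bM (M := M) mc mF (L2_mul mc Lg Ldg) _)); first by move=> x _; rewrite mulrC.
  by apply/nearW => x _; have [] := hM x.
have {}z : \int[leb]_(x in cube r) (g x * g x * partial j F x) + 2 * \int[leb]_(x in cube r) (g x * partial j g x * F x) = 0.
  rewrite -RintegralZl// -RintegralD//; last exact: L1Z.
  rewrite -[RHS]z [in RHS](@int_ext _ _ _ _ (cube r)).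
    by apply: int_eq => x _; rewrite (partialM _ _ Cg CgF) (partialM _ _ Cg C1); ring.
  by move=> x xr; rewrite (partialM _ _ Cg CgF) (partialM _ _ Cg C1) F0// (dF0 j)//; ring.
have e2 : \int[leb]_(x in cube r) (2 * phi x * wp x ord0 j * F x) =
    2 * \int[leb]_(x in cube r) (phi x * wp x ord0 j * F x).
  rewrite -RintegralZl//; first by apply: int_eq => x _; ring.
  apply: (L1_eq mc _ (L1_bM (M := M) mc mF (L2_mul mc Lp (Lw j)) _)); first by move=> x _; rewrite mulrC.
  by apply/nearW => x _; have [] := hM x.
rewrite e2 (@int_eq _ _ _ _ _ (fun x => rho x * partial j F x) (fun x => phi x * phi x * partial j F x)); last by [].
set a := \int[leb]_(x in _) _; set b := \int[leb]_(x in _) _.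
set a' := (X in X + _ = 0) in z; set b' := (X in _ + 2 * X = 0) in z.
have -> : a + 2 * b = - ((a' - a) + 2 * (b' - b)) by lra.
rewrite normrN (le_trans (ler_normD _ _))// normrM (ger0_norm (ler0n _ 2)) [leRHS]mulrDl.
have gN : n2 leb (cube r) g <= 1 + N.
  rewrite (@n2_eq _ _ _ _ _ _ (fun x => (g x - phi x) + phi x)); last by move=> x _; lra.
  by apply: (le_trans (n2D mc (L2B mc Lg Lp) Lp)); rewrite lerD2r (le_trans g1).
have dgW : n2 leb (cube r) (partial j g) <= 1 + W.
  rewrite (@n2_eq _ _ _ _ _ _ (fun x => (partial j g x - wp x ord0 j) + wp x ord0 j)); last by move=> x _; lra.
  by apply: (le_trans (n2D mc (L2B mc Ldg (Lw j)) (Lw j))); rewrite lerD2r (le_trans (g2 j)).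
apply: lerD.
  apply: (le_trans c1); rewrite -mulrA ler_wpM2l// [leRHS]mulrDl -/N lerD//.
    by rewrite mulrC ler_pM ?n2_ge0.
  by rewrite ler_wpM2l.
rewrite -mulrA -mulrA ler_wpM2l//; apply: (le_trans c2); rewrite ler_wpM2l// [leRHS]mulrDl -/N lerD//.
  by rewrite mulrC ler_pM ?n2_ge0// addrC.
by rewrite ler_wpM2l.
Qed.

End weighted.

(** * The logarithmic derivative of the density and closability of the gradient *)

Section weighted_calculus.
Context {R : realType} {d : nat}.
Local Notation E := 'rV[R]_d.
Local Notation leb := (lebesgue_rV d : {measure set E -> \bar R}).
Variables (mu : {measure set E -> \bar R}) (phi : E -> R).
Let rho := fun x => phi x ^+ 2.
Hypothesis Hphi : Hloc leb phi.
Hypothesis Hmu : forall Y : set E, measurable Y -> mu Y = (\int[leb]_(x in Y) (rho x)%:E)%E.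
Implicit Types (x : E) (V : set E) (u v f F psi : E -> R) (w z : E -> E) (i j : 'I_d).

Let wp := wgrad leb phi.
Let mphi := mphi Hphi.
Let mrho := mrho Hphi.
Let mufin := mufin Hphi Hmu.
Let rho0 x : 0 <= rho x. Proof. exact: sqr_ge0. Qed.

Lemma dgrad_rhoP : distr_grad rho (dgrad rho).
Proof.
apply: (xgetPex _ (ex_intro _ (fun x => \row_j (2 * phi x * wp x ord0 j)) _)).
move=> j; split.
  have mj : measurable_fun setT (fun x => 2 * phi x * wp x ord0 j).
    by apply: measurable_funM; [exact: measurable_funM|exact: mwp].
  split.
    by apply: eq_measurable_fun mj => x _; rewrite mxE.
  move=> K cK; have [r r0 Kr] := compact_cube cK; have mK := compact_measurable_rV cK.
  apply/(Lp1P _ _ mK).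
  have mc : measurable (cube r : set E) by exact: measurable_cube.
  have I : L1 leb (cube r) (fun x => (2 * phi x) * wp x ord0 j).
    by apply: L2_mul => //; [apply: L2Z => //; exact: phi_L2|exact: wp_L2].
  by apply: (L1_eq mK _ (L1S mc mK Kr I)) => x _; rewrite mxE.
move=> psi hpsi; rewrite (ibp_phi Hphi j (Cc_smooth1 hpsi)); congr (- _).
by apply: int_eq => x _; rewrite mxE.
Qed.

(** [dgrad] is picked by choice, so only its integrals against test functions are known; du
    Bois-Reymond identifies it almost everywhere. *)
Lemma dgrad_rhoE j : \forall x \ae leb, dgrad rho x ord0 j = 2 * phi x * wp x ord0 j.
Proof.
have [/= [mD DK] Dpsi] := dgrad_rhoP j.
pose h x := dgrad rho x ord0 j - 2 * phi x * wp x ord0 j.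
have mc (r : R) : measurable (cube r : set E) by exact: measurable_cube.
have I1 (r : R) : L1 leb (cube r) (fun x => dgrad rho x ord0 j).
  by apply/(Lp1P _ _ (mc r)); apply: DK; exact: cube_compact.
have I2 (r : R) : 0 < r -> L1 leb (cube r) (fun x => (2 * phi x) * wp x ord0 j).
  by move=> r0; apply: L2_mul => //; [apply: L2Z => //; exact: phi_L2|exact: wp_L2].
have : \forall x \ae leb, h x = 0.
  apply: du_bois_reymond => [n|psi hpsi].
    have n1 : 0 < n.+1%:R :> R by [].
    apply: (L1S (mc n.+1%:R)) => //; first by apply: cube_le; rewrite ler_nat.
    exact: L1B (mc _) (I1 _) (I2 _ n1).
  have hp1 := Cc_smooth1 hpsi; have [r [r0 F0 _]] := Cc1_cube hp1.
  have [M M0 hM] := Cc1_bounded hp1; have [C1 _ _] := hp1.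
  have mpsi : measurable_fun (cube r) psi by apply: measurable_funS (Ck_measurable C1).
  have bM (f : E -> R) : L1 leb (cube r) f -> L1 leb setT (fun x => f x * psi x).
    move=> If; apply: (@L1_ext _ _ _ _ (cube r)) => //; first by move=> x /F0 ->; rewrite mulr0.
    apply: (L1_eq (mc r) _ (L1_bM (M := M) (mc r) mpsi If _)); first by move=> x _; rewrite mulrC.
    by apply/nearW => x _; have [] := hM x.
  have -> : \int[leb]_x (h x * psi x) =
    \int[leb]_x (dgrad rho x ord0 j * psi x - 2 * phi x * wp x ord0 j * psi x).
    by apply: int_eq => x _; rewrite -mulrBl.
  rewrite RintegralB//; [|exact: bM|apply: bM; exact: I2].
  have e1 := Dpsi psi hpsi; have e2 := ibp_phi Hphi j hp1.
  by apply/eqP; rewrite subr_eq0; apply/eqP/oppr_inj; rewrite -e1; exact: e2.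
by apply: filterS => x /eqP; rewrite subr_eq0 => /eqP.
Qed.

(** The logarithmic derivative of [rho]. At zeros of [rho] the quotient is 0 by convention; these
    points form a mu-null set. *)
Definition gam j x : R := dgrad rho x ord0 j / rho x.

Lemma gam_rho j : \forall x \ae leb, gam j x * rho x = 2 * phi x * wp x ord0 j.
Proof.
apply: filterS (dgrad_rhoE j) => x e; rewrite /gam e /rho.
have [->|p0] := eqVneq (phi x) 0; first by rewrite !(mulr0, mul0r, expr0n).
by rewrite divfK// sqrf_eq0.
Qed.

Lemma measurable_inv_real (f : E -> R) : measurable_fun setT f -> measurable_fun setT (fun x => (f x)^-1).
Proof.
move=> mf; apply: (measurableT_comp (f := @GRing.inv R)) => //.
have -> : [set: R] = [set 0] `|` ~` [set 0] by rewrite setUv.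
have m0 : measurable ([set 0] : set R) by exact: measurable_set1.
apply/measurable_funU => //; first exact: measurableC.
split; first exact: measurable_fun_set1.
apply: open_continuous_measurable_fun; first by apply: closed_openC; exact: closed_eq.
by move=> x /set_mem /eqP x0; exact: inv_continuous.
Qed.

Lemma mgam j : measurable_fun setT (gam j).
Proof.
have [/= [mD _] _] := dgrad_rhoP j.
by apply: measurable_funM => //; exact: measurable_inv_real.
Qed.

(** The weight cancels the denominator: [gam j ^2 rho] is four times the square of the j-th
    derivative of [phi], which is locally integrable for Lebesgue measure. *)
Lemma gam_L2 j (r : R) : 0 < r -> L2 mu (cube r) (gam j).
Proof.
move=> r0; have mc : measurable (cube r : set E) by exact: measurable_cube.
have mg : measurable_fun (cube r) (gam j) by apply: measurable_funS (mgam j).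
split => //; apply/(L1_density mrho rho0 Hmu mc); first exact: measurable_funX.
have Iw := L1Z 4 mc (wp_L2 Hphi j r0).2.
apply: (L1_dom mc _ Iw).
  by apply: measurable_funM; [exact: measurable_funX|apply: measurable_funS mrho].
apply: filterS (gam_rho j) => x e _; rewrite ger0_norm; last by apply: mulr_ge0 => //; exact: sqr_ge0.
have [p0|p0] := eqVneq (phi x) 0.
  by rewrite /rho p0 expr0n mulr0; apply: mulr_ge0 => //; exact: sqr_ge0.
have -> : gam j x = 2 * wp x ord0 j / phi x.
  apply: (mulIf (x := rho x)); first by rewrite /rho sqrf_eq0.
  by rewrite e /rho; field.
by rewrite le_eqVlt; apply/orP; left; apply/eqP; rewrite /rho; field.
Qed.

Lemma Cc1_gam_L1 F j : Cc1 setT F -> L1 mu setT (fun x => F x * gam j x).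
Proof.
move=> hF; have [r [r0 F0 _]] := Cc1_cube hF; have mc : measurable (cube r : set E) by exact: measurable_cube.
apply: (@L1_ext _ _ _ _ (cube r)) => //; first by move=> x /F0 ->; rewrite mul0r.
by apply: L2_mul => //; [exact: Cc1_L2 hF|exact: gam_L2].
Qed.

Lemma Cc1_partial_L1mu F j : Cc1 setT F -> L1 mu setT (partial j F).
Proof.
move=> hF; have [r [r0 _ F0]] := Cc1_cube hF; have mc : measurable (cube r : set E) by exact: measurable_cube.
apply: (@L1_ext _ _ _ _ (cube r)) => //; first exact: F0.
by apply: L2_L1 => //; exact: Cc1_partial_L2 hF.
Qed.

Lemma ibp_mu F j : Cc1 setT F -> \int[mu]_x partial j F x = - \int[mu]_x (F x * gam j x).
Proof.
move=> hF; have I1 := Cc1_partial_L1mu j hF; have I2 := Cc1_gam_L1 j hF.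
have [C1 _ _] := hF.
rewrite !(int_density mrho rho0 Hmu)//.
transitivity (\int[leb]_x (rho x * partial j F x)); first by apply: int_eq => x _; rewrite mulrC.
rewrite (ibp_phi Hphi j hF); congr (- _); apply: int_eq_ae => //.
- apply: measurable_funM; last exact: Ck_measurable C1.
  by apply: measurable_funM; [exact: measurable_funM|exact: mwp].
- by apply: measurable_funM => //; exact: L1_meas I2.
- apply: filterS (gam_rho j) => x e _. transitivity (F x * (gam j x * rho x)); [by rewrite e mulrC|exact: mulrA].
Qed.

Lemma rho_pos_ae : \forall x \ae mu, rho x != 0.
Proof.
exists [set x | rho x = 0].
have mz : measurable [set x | rho x = 0].
  rewrite (_ : [set x | rho x = 0] = setT `&` rho @^-1` [set 0]); last by rewrite setTI.
  exact: mrho.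
split => //; last by move=> x /= /negP; rewrite negbK => /eqP.
by rewrite Hmu// integral0_eq// => x /= ->.
Qed.

(** Closability of the gradient. For smooth [v] in [V] small in L^2 with gradient close to
    [om = w - w'], integration by parts moves the derivative from [v] to the test function and to
    the density, so that the integral of [om_j psi] is 0 for every test function [psi]. *)
Lemma H0g_unique V u w w' : open V -> H0g mu V u w -> H0g mu V u w' ->
  forall j, \forall x \ae mu, V x -> w x ord0 j = w' x ord0 j.
Proof.
move=> oV Hw Hw' j; have mV := open_measurable_rV oV.
have := H0gB mufin mV Hw Hw'; set om := (fun x => w x - w' x).
move=> /(H0g_eq mufin mV (w' := om) (u' := fun=> 0)) => Hom.
have {Hom}[_ Lom H] : H0g mu V (fun=> 0) om by apply: Hom => // x _; rewrite subrr.
have Z psi : Cc1 setT psi -> \int[mu]_(x in V) (om x ord0 j * psi x) = 0.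
  move=> hpsi; have [C1 _ _] := hpsi; have [r [r0 F0 dF0]] := Cc1_cube hpsi.
  have [M M0 hM] := Cc1_bounded hpsi.
  have mc : measurable (cube r : set E) by exact: measurable_cube.
  have mcV : measurable (cube r `&` V) by exact: measurableI.
  have Lpsi : L2 mu V psi by exact: Cc1_L2 hpsi.
  have Ldpsi : L2 mu V (partial j psi) by exact: Cc1_partial_L2 hpsi.
  have Lpg : L2 mu V (fun x => psi x * gam j x).
    have LT : L2 mu setT (fun x => psi x * gam j x).
      have mpg : measurable_fun setT (fun x => psi x * gam j x).
        by apply: measurable_funM; [exact: Ck_measurable C1|exact: mgam].
      split => //; apply: (@L1_ext _ _ _ _ (cube r)) => //.
        by move=> x /F0 ->; rewrite mul0r expr0n.
      apply: (L2_bM (M := M) mc _ (gam_L2 j r0) _).2; first exact: measurable_funS (Ck_measurable C1).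
      by apply/nearW => x _; have [] := hM x.
    exact: L2S LT.
  have Lq : L2 mu V (fun x => partial j psi x + psi x * gam j x) by exact: L2D.
  apply: eps_zero.
  exists (n2 mu V psi + n2 mu V (fun x => partial j psi x + psi x * gam j x)) => e e0 _.
  have [v [hv v1 v2]] := H e e0; have hv1 := Cc_smooth1 hv.
  have hvT : Cc1 setT v by exact: Cc1_subset hv1.
  have [Cv _ vV] := hv1.
  have Lv : L2 mu V v by exact: Cc1_L2 hv1.
  have Ldv : L2 mu V (partial j v) by exact: Cc1_partial_L2 hv1.
  have hvp : Cc1 setT (fun x => v x * psi x) by exact: Cc1M.
  have I1 := L2_mul mV Ldv Lpsi; have I2 := L2_mul mV Lv Lq.
  have vout x : ~ V x -> v x = 0 /\ partial j v x = 0.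
    move=> Vx; have o : ~ closure [set y | v y != 0] x by move=> /vV.
    by split; [exact: closure_supp_vanish1|exact: partial_vanish].
  have z : \int[mu]_(x in V) (partial j v x * psi x) = - \int[mu]_(x in V) (v x * (partial j psi x + psi x * gam j x)).
    apply/eqP; rewrite -subr_eq0 opprK -RintegralD//; apply/eqP.
    have := ibp_mu j hvp.
    rewrite (@int_ext _ _ _ _ V); last first.
      by move=> x /vout[v0 dv0]; rewrite (partialM _ _ Cv C1) v0 dv0 mul0r mulr0 addr0.
    rewrite [in RHS](@int_ext _ _ _ _ V); last by move=> x /vout[v0 _]; rewrite v0 !mul0r.
    move=> /eqP; rewrite -subr_eq0 opprK -RintegralD//.
    - move=> /eqP <-; apply: int_eq => x _; rewrite (partialM _ _ Cv C1); ring.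
    - exact: L1S measurableT mV (@subsetT _ _) (Cc1_partial_L1mu j hvp).
    - exact: L1S measurableT mV (@subsetT _ _) (Cc1_gam_L1 j hvp).
  have LD := L2B mV Ldv (Lom j).
  have -> : \int[mu]_(x in V) (om x ord0 j * psi x) =
     - (\int[mu]_(x in V) ((partial j v x - om x ord0 j) * psi x)) - \int[mu]_(x in V) (v x * (partial j psi x + psi x * gam j x)).
    have -> : \int[mu]_(x in V) ((partial j v x - om x ord0 j) * psi x) =
       \int[mu]_(x in V) (partial j v x * psi x) - \int[mu]_(x in V) (om x ord0 j * psi x).
      rewrite -RintegralB//; last exact: L2_mul.
      by apply: int_eq => x _; ring.
    by rewrite z opprB opprK addrK.
  rewrite (le_trans (ler_normD _ _))// !normrN mulrDl lerD//.
    apply: (le_trans (cauchy_schwarz mV LD Lpsi)).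
    by rewrite mulrC ler_wpM2l ?n2_ge0.
  apply: (le_trans (cauchy_schwarz mV Lv Lq)).
  rewrite mulrC ler_wpM2l ?n2_ge0//.
  by apply: le_trans v1; rewrite le_eqVlt (@n2_eq _ _ _ _ _ v (fun x => v x - 0)) ?eqxx// => x _; rewrite subr0.
(* Written with Lebesgue measure, the vanishing integrals are those of [om_j rho] extended by 0
   outside [V]; du Bois-Reymond applies, and [rho] is nonzero mu-almost everywhere. *)
pose h := (fun x => om x ord0 j * rho x) \_ V.
have mom : measurable_fun V (fun x => om x ord0 j) by exact: L2_meas (Lom j).
have Ih (r : R) : L1 leb (cube r) h.
  have mc : measurable (cube r : set E) by exact: measurable_cube.
  have mcV : measurable (cube r `&` V) by exact: measurableI.
  have I : L1 mu (cube r `&` V) (fun x => om x ord0 j).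
    apply: L2_L1 => //.
      apply: le_lt_trans (mufin r); apply: le_measure; rewrite ?inE//.
    by apply: (L2S mV mcV) (Lom j); exact: subIsetr.
  have := (L1_density mrho rho0 Hmu mcV (L1_meas I)).1 I.
  move=> /(integrable_mkcond _ mcV).1; rewrite restrict_EFin => I'.
  apply: (L1_eq mc _ (L1S measurableT mc (@subsetT _ _) I')) => x xr.
  rewrite /h /patch; case: ifPn => xV; case: ifPn => // xV'; exfalso.
    by move/negP: xV'; apply; move: xV; rewrite !inE => -[].
  by move/negP: xV; apply; move: xV'; rewrite !inE.
have h0 : \forall x \ae leb, h x = 0.
  apply: du_bois_reymond => // psi hpsi; have hp1 := Cc_smooth1 hpsi.
  rewrite -[RHS](Z _ hp1) (int_density mrho rho0 Hmu)//; last first.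
    by apply: L2_mul => //; exact: Cc1_L2 hp1.
  rewrite [RHS]Rintegral_mkcond; apply: int_eq => x _; rewrite /h /patch.
  by case: ifP => _; rewrite ?mul0r// mulrAC.
apply: filterS2 (ae_density mrho Hmu h0) rho_pos_ae => x.
rewrite /h /patch => + rx Vx; rewrite mem_set// => /eqP; rewrite mulf_eq0 (negbTE rx) orbF.
by rewrite !mxE subr_eq0 => /eqP.
Qed.

End weighted_calculus.

(** * Divergence form of the operator and the divergence-free drift *)

Section elliptic_coefficients.
Context {R : realType} {d : nat}.
Local Notation E := 'rV[R]_d.
Local Notation leb := (lebesgue_rV d : {measure set E -> \bar R}).
Variables (mu : {measure set E -> \bar R}) (phi : E -> R) (A : E -> 'M[R]_d) (G : E -> E).
Let rho := fun x => phi x ^+ 2.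
Let b := beta mu rho A.
Let B := fun x => G x - b x.
Hypothesis Hphi : Hloc leb phi.
Hypothesis Hmu : forall Y : set E, measurable Y -> mu Y = (\int[leb]_(x in Y) (rho x)%:E)%E.
Hypothesis Asym : forall x, (A x)^T = A x.
Hypothesis HA : forall i j, Hloc mu (fun x => A x i j).
Hypothesis Aell : locally_elliptic A.
Hypothesis HG : forall i, Lploc mu 2%:E (fun x => G x ord0 i).
Hypothesis divG : forall u, Cc_smooth setT u -> (\int[mu]_x (diffop A G u x)%:E = 0)%E.
Implicit Types (x : E) (V : set E) (u v f F psi : E -> R) (w z : E -> E) (i j : 'I_d).

Let mufin := mufin Hphi Hmu.
Let gam := gam phi.
Let mgam j : measurable_fun setT (gam j). Proof. exact: mgam. Qed.
Let gam_L2 j (r : R) : 0 < r -> L2 mu (cube r) (gam j). Proof. exact: gam_L2. Qed.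

(** On a cube containing the support of [psi], [a] and [w] are replaced by a smooth [g] and its
    gradient; for these it is [ibp_mu] applied to [g psi]. *)
Lemma ibp_weak a w j psi : Hloc_grad mu a w -> Cc1 setT psi ->
  L1 mu setT (fun x => w x ord0 j * psi x + a x * (partial j psi x + psi x * gam j x)) /\
  \int[mu]_x (w x ord0 j * psi x + a x * (partial j psi x + psi x * gam j x)) = 0.
Proof.
move=> Ha hpsi; have [C1 _ _] := hpsi; have [r [r0 F0 dF0]] := Cc1_cube hpsi.
have [M M0 hM] := Cc1_bounded hpsi.
have [La Lw H] := Hloc_grad_approx mufin r0 Ha.
have mc : measurable (cube r : set E) by exact: measurable_cube.
pose q x := partial j psi x + psi x * gam j x.
have Lpsi : L2 mu (cube r) psi by exact: Cc1_L2 hpsi.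
have Lq : L2 mu (cube r) q.
  apply: L2D => //; first exact: Cc1_partial_L2 hpsi.
  apply: (L2_bM (M := M)) => //; first exact: measurable_funS (Ck_measurable C1).
    exact: gam_L2.
  by apply/nearW => x _; have [] := hM x.
have out0 (f : E -> R) g x : ~ cube r x -> f x * psi x + g x * q x = 0.
  by move=> xr; rewrite /q F0// dF0// !(mulr0, mul0r, addr0).
have I (f : E -> R) g : L2 mu (cube r) f -> L2 mu (cube r) g -> L1 mu (cube r) (fun x => f x * psi x + g x * q x).
  by move=> Lf Lg; apply: L1D => //; exact: L2_mul.
split; first by apply: (@L1_ext _ _ _ _ (cube r)) => //; [exact: out0|exact: I].
rewrite (@int_ext _ _ _ _ (cube r)); last exact: out0.
apply: eps_zero; exists (n2 mu (cube r) psi + n2 mu (cube r) q) => e e0 _.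
have [g [hg g1 g2]] := H e e0; have hg1 := Cc_smooth1 hg; have [Cg _ _] := hg1.
have Lg : L2 mu (cube r) g by exact: Cc1_L2 hg1.
have Ldg : L2 mu (cube r) (partial j g) by exact: Cc1_partial_L2 hg1.
have hgp : Cc1 setT (fun x => g x * psi x) by exact: Cc1M.
have z : \int[mu]_(x in cube r) (partial j g x * psi x + g x * q x) = 0.
  rewrite -(@int_ext _ _ _ _ (cube r)); last exact: out0.
  have /eqP := ibp_mu Hphi Hmu j hgp; rewrite -subr_eq0 opprK => /eqP <-.
  rewrite -RintegralD//; [|exact: (Cc1_partial_L1mu Hphi Hmu j hgp)|exact: (Cc1_gam_L1 Hphi Hmu j hgp)].
  by apply: int_eq => x _; rewrite (partialM _ _ Cg C1) /q /gam; ring.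
have LD1 := L2B mc (Lw j) Ldg; have LD2 := L2B mc La Lg.
have -> : \int[mu]_(x in cube r) (w x ord0 j * psi x + a x * q x) =
  \int[mu]_(x in cube r) ((w x ord0 j - partial j g x) * psi x) +
  \int[mu]_(x in cube r) ((a x - g x) * q x).
  rewrite -RintegralD//; [|exact: L2_mul|exact: L2_mul].
  rewrite -[LHS]subr0 -[X in _ - X]z -RintegralB//; [|exact: I|exact: I].
  by apply: int_eq => x _; ring.
rewrite (le_trans (ler_normD _ _))// mulrDl lerD//.
  apply: (le_trans (cauchy_schwarz mc LD1 Lpsi)).
  by rewrite mulrC ler_wpM2l ?n2_ge0// n2BC.
apply: (le_trans (cauchy_schwarz mc LD2 Lq)).
by rewrite mulrC ler_wpM2l ?n2_ge0// n2BC.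
Qed.

Lemma mxdotE (M : 'M[R]_d) (x y : E) : mxdot M x y = \sum_i \sum_j M j i * (x ord0 i * y ord0 j).
Proof.
rewrite /mxdot /dot exchange_big; apply: eq_bigr => j _ /=.
rewrite mxE mulr_suml; apply: eq_bigr => i _; rewrite mxE; ring.
Qed.

Lemma Asw x i j : A x i j = A x j i. Proof. by rewrite -[in RHS]Asym mxE. Qed.

Lemma mxdotA x (y z : E) : mxdot (A x) y z = \sum_i \sum_j A x i j * (y ord0 i * z ord0 j).
Proof. by rewrite mxdotE; apply: eq_bigr => i _; apply: eq_bigr => j _; rewrite Asw. Qed.

Lemma mxdotDl (M : 'M[R]_d) (x y z : E) : mxdot M (x + y) z = mxdot M x z + mxdot M y z.
Proof.
by rewrite !mxdotE -big_split; apply: eq_bigr => i _; rewrite -big_split; apply: eq_bigr => j _ /=; rewrite mxE; ring.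
Qed.
Lemma mxdotDr (M : 'M[R]_d) (x y z : E) : mxdot M z (x + y) = mxdot M z x + mxdot M z y.
Proof.
by rewrite !mxdotE -big_split; apply: eq_bigr => i _; rewrite -big_split; apply: eq_bigr => j _ /=; rewrite mxE; ring.
Qed.
Lemma mxdotZl (M : 'M[R]_d) c (x z : E) : mxdot M (c *: x) z = c * mxdot M x z.
Proof.
by rewrite !mxdotE big_distrr; apply: eq_bigr => i _; rewrite big_distrr; apply: eq_bigr => j _ /=; rewrite mxE; ring.
Qed.
Lemma mxdotZr (M : 'M[R]_d) c (x z : E) : mxdot M z (c *: x) = c * mxdot M z x.
Proof.
by rewrite !mxdotE big_distrr; apply: eq_bigr => i _; rewrite big_distrr; apply: eq_bigr => j _ /=; rewrite mxE; ring.
Qed.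

Lemma sum_evec i (F : 'I_d -> R) : \sum_k (evec i : E) ord0 k * F k = F i.
Proof.
rewrite (bigD1 i)//= evecE eqxx mul1r big1 ?addr0// => k ki.
by rewrite evecE (negbTE ki) mul0r.
Qed.

Lemma mxdot_evec (M : 'M[R]_d) i j : mxdot M (evec i) (evec j) = M j i.
Proof.
rewrite mxdotE (eq_bigr (fun k => (evec i : E) ord0 k * \sum_l (evec j : E) ord0 l * M l k)).
  by rewrite sum_evec sum_evec.
by move=> k _; rewrite mulr_sumr; apply: eq_bigr => l _; ring.
Qed.

Lemma dot_evec i j : dot (evec i : E) (evec j) = (i == j)%:R.
Proof. by rewrite /dot sum_evec evecE. Qed.

Lemma dotDl (x y z : E) : dot (x + y) z = dot x z + dot y z.
Proof. by rewrite -big_split; apply: eq_bigr => i _; rewrite mxE mulrDl. Qed.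
Lemma dotC (x y : E) : dot x y = dot y x.
Proof. by apply: eq_bigr => i _; rewrite mulrC. Qed.
Lemma dotDr (x y z : E) : dot z (x + y) = dot z x + dot z y.
Proof. by rewrite dotC dotDl !(dotC z). Qed.
Lemma dotZl c (x y : E) : dot (c *: x) y = c * dot x y.
Proof. by rewrite /dot mulr_sumr; apply: eq_bigr => i _; rewrite mxE mulrA. Qed.
Lemma dotZr c (x y : E) : dot x (c *: y) = c * dot x y.
Proof. by rewrite dotC dotZl dotC. Qed.
Lemma dot_ge0 (x : E) : 0 <= dot x x.
Proof. by apply: sumr_ge0 => i _; exact: sqr_ge0. Qed.

(** Diagonal entries lie between 0 and [nu]; nonnegativity of the form at [e_i + e_j] and
    [e_i - e_j] gives [2 |a_ij| <= a_ii + a_jj]. *)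
Lemma entry_bound V : relcompact_open V -> exists2 nu : R, 0 < nu & forall x i j, V x -> `|A x i j| <= nu.
Proof.
move=> rV; have [nu nu0 H] := Aell rV; exists nu => // x i j Vx.
have pos y : 0 <= mxdot (A x) y y.
  have /andP[h _] := H y x Vx; apply: le_trans h; apply: mulr_ge0; last exact: dot_ge0.
  by rewrite invr_ge0 ltW.
have up k : 0 <= A x k k <= nu.
  have := pos (evec k); rewrite mxdot_evec => ->.
  by have /andP[_] := H (evec k) x Vx; rewrite mxdot_evec dot_evec eqxx mulr1.
have /andP[i0 i1] := up i; have /andP[j0 j1] := up j.
have := pos (evec i + evec j); have := pos (evec i + (-1) *: evec j).
rewrite !(mxdotDl, mxdotDr, mxdotZl, mxdotZr) !mxdot_evec (Asw x j i) => h1 h2.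
rewrite ler_norml; lra.
Qed.

Lemma relcompact_ball (r : R) : relcompact_open [set x : E | `|x| < r].
Proof.
have sub : closure [set x : E | `|x| < r] `<=` cube r.
  have /closure_id -> := cube_closed (R := R) (d := d) (r := r).
  by apply: closure_subset => x /= /ltW.
split; last by apply: closed_bounded_compact sub; exact: closed_closure.
apply/open_ballP => x /= xr; exists (r - `|x|); first by rewrite subr_gt0.
by move=> y xy; have := lerB_dist y x; rewrite distrC; lra.
Qed.

Lemma entry_bound_cube (r : R) : exists2 nu : R, 0 < nu & forall x i j, cube r x -> `|A x i j| <= nu.
Proof.
have [nu nu0 H] := entry_bound (relcompact_ball (r + 1)).
by exists nu => // x i j xr; apply: H; move: xr; rewrite /cube /=; lra.
Qed.

Lemma measurable_entry i j : measurable_fun setT (fun x => A x i j).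
Proof.
apply: meas_cubes => r r0.
by have [L _ _] := Hloc_grad_approx mufin r0 (wgradP mufin (HA i j)); exact: L2_meas L.
Qed.

Lemma beta_L2 i (r : R) : 0 < r -> L2 mu (cube r) (fun x => b x ord0 i).
Proof.
move=> r0; have mc : measurable (cube r : set E) by exact: measurable_cube.
have [nu nu0 H] := entry_bound_cube r.
apply: (@L2_eq _ _ _ _ _ (fun x => 2^-1 * \sum_j (wgrad mu (fun y => A y i j) x ord0 j +
                         A x i j * gam j x))) => //; first by move=> x _; rewrite mxE.
apply: L2Z => //; apply: L2_sum => // j; apply: L2D => //.
  by have [_ L _] := Hloc_grad_approx mufin r0 (wgradP mufin (HA i j)); exact: L.
apply: (L2_bM (M := nu)) => //; first exact: measurable_funS (measurable_entry i j).
  exact: gam_L2.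
by apply/nearW => x /H; exact.
Qed.

(** [ibp_weak] for each entry [a_ij] with test function [v] times the i-th derivative of [u], summed
    over [i] and [j]: the derivatives of [a_ij] and the logarithmic derivative of [rho] assemble to
    the drift [b]. *)
Lemma beta_ibp u v : Ck 2 u -> Cc1 setT v ->
  L1 mu setT (fun x => 2^-1 * mxdot (A x) (gradient u x) (gradient v x) + diffop A b u x * v x) /\
  \int[mu]_x (2^-1 * mxdot (A x) (gradient u x) (gradient v x) + diffop A b u x * v x) = 0.
Proof.
move=> Cu hv; have [Cv _ _] := hv.
pose psi i x := partial i u x * v x.
have hpsi i : Cc1 setT (psi i) by apply: Cc1M => //; exact: Ck_partial.
pose f i j x := wgrad mu (fun y => A y i j) x ord0 j * psi i x +
   A x i j * (partial j (psi i) x + psi i x * gam j x).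
have Hf i j : L1 mu setT (f i j) /\ \int[mu]_x f i j x = 0.
  exact: (ibp_weak j (wgradP mufin (HA i j)) (hpsi i)).
have e x : 2^-1 * mxdot (A x) (gradient u x) (gradient v x) + diffop A b u x * v x =
   2^-1 * \sum_i \sum_j f i j x.
  rewrite /diffop mxdotA [X in dot X _](_ : _ = 2^-1 *: (\row_i (\sum_j (wgrad mu (fun y => A y i j) x ord0 j + A x i j * gam j x)) : E)); last first.
    by apply/rowP => i; rewrite !mxE.
  rewrite dotZl -mulrDr -mulrA -mulrDr; congr (_ * _).
  rewrite [X in _ + (X + _) * _]exchange_big /dot -big_split mulr_suml -big_split.
  apply: eq_bigr => i _ /=; rewrite !mxE mulr_suml -big_split mulr_suml -big_split.
  apply: eq_bigr => j _ /=; rewrite /f /psi !mxE (partialM _ _ (Ck_partial i Cu) Cv) (Asw x j i).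
  ring.
have I : L1 mu setT (fun x => 2^-1 * \sum_i \sum_j f i j x).
  by apply: L1Z => //; apply: L1_sum => // i; apply: L1_sum => // j; have [] := Hf i j.
split; first by apply: (L1_eq measurableT _ I) => x _.
rewrite (@int_eq _ _ _ mu _ _ (fun x => 2^-1 * \sum_i \sum_j f i j x)); last by move=> x _.
have S (s : seq 'I_d) (F : 'I_d -> E -> R) : (forall i, L1 mu setT (F i) /\ \int[mu]_x F i x = 0) ->
   \int[mu]_x (\sum_(i <- s) F i x) = 0.
  move=> HF; elim: s => [|i s IH].
    by rewrite -[RHS](int0 mu setT); apply: int_eq => x _; rewrite big_nil.
  rewrite (@int_eq _ _ _ mu _ _ (fun x => F i x + \sum_(i <- s) F i x)); last by move=> x _; rewrite big_cons.
  have [L1i e1] := HF i.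
  rewrite (RintegralD _ L1i) ?IH ?addr0//.
  by apply: L1_sum => // k; have [] := HF k.
rewrite RintegralZl//; last by apply: L1_sum => // i; apply: L1_sum => // j; have [] := Hf i j.
rewrite S ?mulr0// => i; split; first by apply: L1_sum => // j; have [] := Hf i j.
by apply: S => j.
Qed.

Lemma drift_L2 i (r : R) : 0 < r -> L2 mu (cube r) (fun x => B x ord0 i).
Proof.
move=> r0; have mc : measurable (cube r : set E) by exact: measurable_cube.
have [_ LG] := HG i.
apply: (@L2_eq _ _ _ _ _ (fun x => G x ord0 i - b x ord0 i)) => //.
  by move=> x _; rewrite !mxE.
apply: L2B => //; last exact: beta_L2.
by apply/(Lp2P _ _ mc); apply: LG; exact: cube_compact.
Qed.

(** A cutoff equal to 1 near the support of [u], used as [v] in [beta_ibp], shows that the integral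
    of [diffop A b u] is 0. Subtracting this from assumption (4) leaves the drift [B = G - b]. *)
Lemma drift_div_smooth u : Cc_smooth setT u -> \int[mu]_x dot (B x) (gradient u x) = 0.
Proof.
move=> hu; have hu1 := Cc_smooth1 hu; have [Cu _ _] := hu.
have [r [r0 F0 dF0]] := Cc1_cube hu1.
have mc : measurable (cube r : set E) by exact: measurable_cube.
have r1 : 0 < r + 1 by lra.
have [chi [hc _ c1 _]] := cutoff (d := d) r1.
have [] := beta_ibp (Cu 2%N) (Cc_smooth1 hc).
have d2F0 i j x : ~ cube r x -> partial i (partial j u) x = 0.
  move=> xr; apply: partial_vanish; move: x xr.
  have cl : closure [set y | partial j u y != 0] `<=` cube r.
    have /closure_id -> := cube_closed (R := R) (d := d) (r := r).
    by apply: closure_subset => y /= /eqP uy; apply: contrapT => /(dF0 j).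
  by move=> x xr /cl.
have e x : 2^-1 * mxdot (A x) (gradient u x) (gradient chi x) + diffop A b u x * chi x = diffop A b u x.
  have [xr|xr] := pselect (cube r x).
    rewrite c1; last by move: xr; rewrite /cube /=; lra.
    rewrite mulr1 (_ : gradient chi x = 0 *: gradient chi x) ?mxdotZr ?(mul0r, mulr0, add0r)//.
    apply/rowP => i; rewrite !mxE mul0r; apply: near_cutoff_partial c1 _.
    by move: xr; rewrite /cube /=; lra.
  have g0 : gradient u x = 0 *: gradient u x by apply/rowP => i; rewrite !mxE dF0// mulr0.
  rewrite /diffop g0 mxdotZl dotZr !mul0r mulr0 !(addr0, add0r) big1 ?mulr0 ?mul0r//.
  by move=> i _; rewrite big1// => j _; rewrite d2F0// mulr0.
move=> Ib; rewrite (@int_eq _ _ _ mu _ _ (diffop A b u)) => [zb|x _]; last exact: e.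
have {}Ib : L1 mu setT (diffop A b u) by apply: (L1_eq measurableT _ Ib) => x _.
have ID : L1 mu setT (fun x => dot (B x) (gradient u x)).
  apply: (@L1_ext _ _ _ _ (cube r)) => //.
    move=> x xr; rewrite /dot big1// => i _; rewrite [gradient _ _ _ _]mxE dF0// mulr0.
    by [].
  apply: L1_sum => // i; apply: (L1_eq mc _ (L2_mul mc (drift_L2 i r0) (Cc1_partial_L2 mufin i mc hu1))).
  by move=> x _; rewrite !mxE.
have eG x : diffop A G u x = diffop A b u x + dot (B x) (gradient u x).
  by rewrite /diffop -addrA -dotDl /B addrC [b x + _]addrC subrK addrC.
have /(congr1 fine) : (\int[mu]_x (diffop A G u x)%:E = 0)%E by exact: divG.
rewrite -/(Rintegral _ _ _) (@int_eq _ _ _ mu _ _ (fun x => diffop A b u x + dot (B x) (gradient u x))); last by move=> x _; exact: eG.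
by rewrite RintegralD// zb add0r.
Qed.

(** By density: [B] is in L^2 on the bounded set [V], so the integral is continuous in the
    gradient. *)
Lemma drift_div V u w : relcompact_open V -> H0g mu V u w -> \int[mu]_(x in V) dot (B x) (w x) = 0.
Proof.
move=> [oV cV] [Lu Lw H]; have mV := open_measurable_rV oV.
have [r r0 Vr] := compact_cube cV.
have mc : measurable (cube r : set E) by exact: measurable_cube.
have LB i : L2 mu V (fun x => B x ord0 i).
  apply: (L2S mc mV _ (drift_L2 i r0)); apply: subset_trans Vr; exact: subset_closure.
have ID z : (forall i, L2 mu V (fun x => z x ord0 i)) -> L1 mu V (fun x => dot (B x) (z x)).
  by move=> Lz; apply: L1_sum => // i; exact: L2_mul.
apply: eps_zero; exists (\sum_i n2 mu V (fun x => B x ord0 i)) => e e0 _.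
have [v [hv _ v2]] := H e e0; have hv1 := Cc_smooth1 hv.
have Ldv i : L2 mu V (fun x => gradient v x ord0 i).
  by apply: L2_eq mV _ (Cc1_partial_L2 mufin i mV hv1) => x _; rewrite mxE.
have vout x : ~ V x -> dot (B x) (gradient v x) = 0.
  move=> Vx; rewrite /dot big1// => i _; rewrite [gradient _ _ _ _]mxE.
  by rewrite partial_vanish ?mulr0// => h; apply: Vx; have [_ _] := hv1; apply.
have z0 : \int[mu]_(x in V) dot (B x) (gradient v x) = 0.
  rewrite -(@int_ext _ _ _ _ V)//; apply: drift_div_smooth.
  exact: Cc_smooth_subset hv.
have LD i : L2 mu V (fun x => (w x - gradient v x) ord0 i).
  by apply: L2_eq mV _ (L2B mV (Lw i) (Ldv i)) => x _; rewrite !mxE.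
have -> : \int[mu]_(x in V) dot (B x) (w x) = \int[mu]_(x in V) dot (B x) (w x - gradient v x).
  rewrite -[LHS]subr0 -[X in _ - X]z0 -RintegralB//; [|exact: ID|exact: ID].
  apply: int_eq => x _; rewrite (dotDr (w x)) -[- gradient v x]scaleN1r dotZr; ring.
apply: (le_trans (int_le_n1 mV (ID _ LD))).
have -> : n1 mu V (fun x => dot (B x) (w x - gradient v x)) = n1 mu V (fun x => \sum_i B x ord0 i * (w x - gradient v x) ord0 i) by [].
rewrite mulr_suml.
have S (s : seq 'I_d) : n1 mu V (fun x => \sum_(i <- s) B x ord0 i * (w x - gradient v x) ord0 i) <=
   \sum_(i <- s) n2 mu V (fun x => B x ord0 i) * e.
  elim: s => [|i s IH].
    rewrite big_nil le_eqVlt; apply/orP; left; apply/eqP.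
    by rewrite -[RHS](int0 mu V); apply: int_eq => x _; rewrite big_nil normr0.
  rewrite big_cons; set F := (X in n1 _ _ X).
  have -> : F = fun x => B x ord0 i * (w x - gradient v x) ord0 i +
      \sum_(i <- s) B x ord0 i * (w x - gradient v x) ord0 i.
    by apply/funext => x; rewrite /F big_cons.
  have Ii k := L2_mul mV (LB k) (LD k).
  apply: (le_trans (n1D mV (Ii i) (L1_sum _ mV Ii))); apply: lerD IH.
  apply: (le_trans (n1_mul mV (LB i) (LD i))); rewrite ler_wpM2l ?n2_ge0//.
  apply: le_trans (v2 i); rewrite [leRHS]n2BC.
  by rewrite le_eqVlt; apply/orP; left; apply/eqP; apply: n2_eq => x _; rewrite !mxE.
exact: S.
Qed.

End elliptic_coefficients.

(** * Truncated weak solutions *)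

Section smooth_truncation.
Context {R : realType}.
Implicit Types x s t h K c : R.

Lemma shift_derive (f g : R -> R) K t : (forall s, is_derive s 1 f (g s)) ->
  is_derive t 1 (fun t => f (t - K)) (g (t - K)).
Proof.
move=> fg; have hs : is_derive t 1 (fun t => t - K) (1 : R).
  by have := is_deriveB (is_derive_id t 1) (is_derive_cst K t 1); rewrite subr0.
by have := @is_derive1_comp _ f (fun t => t - K) t _ 1 (fg _) hs; rewrite mulr1.
Qed.

Lemma reflect_derive (f g : R -> R) K t : (forall s, is_derive s 1 f (g s)) ->
  is_derive t 1 (fun t => f (- t - K)) (- g (- t - K)).
Proof.
move=> fg; have hs : is_derive t 1 (fun t => - t - K) (- 1 : R).
  by have := is_deriveB (is_deriveN (is_derive_id t 1)) (is_derive_cst K t 1); rewrite subr0.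
by have := @is_derive1_comp _ f (fun t => - t - K) t _ (-1) (fg _) hs; rewrite mulrN1.
Qed.

Lemma dpp_lip s t : `|dpp s - dpp t| <= 2 * `|s - t|.
Proof. by rewrite /dpp -mulrBr normrM ger0_norm// ler_wpM2l// max0_lip. Qed.

Lemma cube_pp_derive t : is_derive t 1 (fun t => t * pp t) (3 * pp t).
Proof.
have := is_deriveM (is_derive_id t 1) (pp_derive t) => h; apply: (is_derive_eq h).
rewrite /GRing.scale /= /pp /dpp; case: (leP 0 t) => _; ring.
Qed.

(* bump0 is a cubic spline, 0 on the negative half-line and of slope 1 after 1;
   bump1 and bump2 are its derivatives. *)
Definition bump2 t : R := 2 * (dpp t - 2 * dpp (t - 2^-1) + dpp (t - 1)).
Definition bump1 t : R := 2 * (pp t - 2 * pp (t - 2^-1) + pp (t - 1)).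
Definition bump0 t : R := 2 / 3 * (t * pp t - 2 * ((t - 2^-1) * pp (t - 2^-1)) + (t - 1) * pp (t - 1)).

Lemma bump1_derive t : is_derive t 1 bump1 (bump2 t).
Proof.
have h K := shift_derive K t pp_derive.
have := is_deriveM (is_derive_cst (2 : R) t 1) (is_deriveD (is_deriveB (pp_derive t)
  (is_deriveM (is_derive_cst (2 : R) t 1) (h 2^-1))) (h 1)) => h'; apply: (is_derive_eq h'); rewrite /GRing.scale /= /bump2; ring.
Qed.

Lemma bump0_derive t : is_derive t 1 bump0 (bump1 t).
Proof.
have h K := shift_derive K t cube_pp_derive.
have := is_deriveM (is_derive_cst (2 / 3 : R) t 1) (is_deriveD (is_deriveB (cube_pp_derive t)
  (is_deriveM (is_derive_cst (2 : R) t 1) (h 2^-1))) (h 1)) => h'; apply: (is_derive_eq h'); rewrite /GRing.scale /= /bump1; lra.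
Qed.

Lemma bump_neg t : t <= 0 -> [/\ bump0 t = 0, bump1 t = 0 & bump2 t = 0].
Proof.
move=> t0; rewrite /bump0 /bump1 /bump2 /pp /dpp !max_l; [by split; ring|lra|lra|lra].
Qed.

Lemma bump_pos t : 0 <= t -> [/\ 0 <= bump2 t <= 2, 0 <= bump1 t <= 1,
  0 <= bump0 t <= t & t - 1 <= bump0 t].
Proof.
move=> t0; rewrite /bump0 /bump1 /bump2 /pp /dpp.
case: (leP 0 t) => h1; last by lra.
(* Three pieces: [bump0] is [t - 1/2] for [t >= 1], a cubic in [y = t - 1/2] on [[1/2, 1]], and
   [2/3 t^3] on [[0, 1/2]]. *)
case: (leP 0 (t - 2^-1)) => h2; case: (leP 0 (t - 1)) => h3; try lra.
- have -> : 2 / 3 * (t * t ^+ 2 - 2 * ((t - 2^-1) * (t - 2^-1) ^+ 2) + (t - 1) * (t - 1) ^+ 2) = t - 2^-1 by field.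
  have -> : 2 * (t ^+ 2 - 2 * (t - 2^-1) ^+ 2 + (t - 1) ^+ 2) = 1 by field.
  by split; lra.
- have [y ye] : exists y, y = t - 2^-1 by exists (t - 2^-1).
  have te : t = y + 2^-1 by lra.
  rewrite -ye te; rewrite te in h3; split; try lra.
  + rewrite expr0n/=; nra.
  + have -> : 2 / 3 * ((y + 2^-1) * (y + 2^-1) ^+ 2 - 2 * (y * y ^+ 2) + (y + 2^-1 - 1) * 0 ^+ 2) =
      2 / 3 * (8^-1 + 3/4 * y + 3/2 * y ^+ 2 - y ^+ 3) by field.
    have y0 : 0 <= y by lra.
    have y1 : y ^+ 2 <= y by rewrite expr2; nra.
    have y2 : 0 <= y ^+ 2 by exact: sqr_ge0.
    have y4 : y ^+ 2 <= 2^-1 * y by rewrite expr2; nra.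
    have y3 : 0 <= y ^+ 3 <= y ^+ 2 by rewrite exprS expr2; apply/andP; split; nra.
    by lra.
  + have -> : 2 / 3 * ((y + 2^-1) * (y + 2^-1) ^+ 2 - 2 * (y * y ^+ 2) + (y + 2^-1 - 1) * 0 ^+ 2) =
      2 / 3 * (8^-1 + 3/4 * y + 3/2 * y ^+ 2 - y ^+ 3) by field.
    have y0 : 0 <= y by lra.
    have y2 : 0 <= y ^+ 2 by exact: sqr_ge0.
    have y3 : 0 <= y ^+ 3 <= y ^+ 2 by rewrite exprS expr2; apply/andP; split; nra.
    by lra.
- have e0 a : a * 0 ^+ 2 = 0 :> R by rewrite expr0n mulr0.
  have e1 : 0 ^+ 2 = 0 :> R by rewrite expr0n.
  rewrite !e0 e1; have -> : t * t ^+ 2 = t ^+ 3 by ring.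
  have t2 : 0 <= t ^+ 2 by exact: sqr_ge0.
  have t4 : t ^+ 2 <= 2^-1 * t by rewrite expr2; nra.
  have t3 : 0 <= t ^+ 3 <= t ^+ 2 by rewrite exprS expr2; apply/andP; split; nra.
  by split; lra.
Qed.

Lemma bump_bounds t : 0 <= bump2 t <= 2 /\ 0 <= bump1 t <= 1.
Proof.
have [t0|t0] := leP t 0; last by have [] := bump_pos (ltW t0).
by have [_ -> ->] := bump_neg t0; split; lra.
Qed.

Lemma bump2_lip s t : `|bump2 s - bump2 t| <= 16 * `|s - t|.
Proof.
rewrite /bump2; have h1 := dpp_lip s t.
have := dpp_lip (s - 2^-1) (t - 2^-1); rewrite (_ : s - 2^-1 - (t - 2^-1) = s - t); last by ring.
have := dpp_lip (s - 1) (t - 1); rewrite (_ : s - 1 - (t - 1) = s - t); last by ring.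
move: h1; rewrite !ler_norml => /andP[a1 a2] /andP[a3 a4] /andP[a5 a6]; apply/andP; split; lra.
Qed.

Lemma bump1_lip s t : `|bump1 s - bump1 t| <= 2 * `|s - t|.
Proof.
apply: (lipschitz_of_derive bump1_derive) => x.
by have [/andP[h1 h2] _] := bump_bounds x; rewrite ger0_norm.
Qed.

(** The identity on [[-K, K]] and constant beyond [K + 1] in absolute value. For [K >= 0],
    [bulk K t] is [|t - tr K t|], and it is built so that [|ddtr K| <= ddbulk K]: the energy lost by
    truncating is controlled by testing with [dbulk K]. Both [dtr K - 1] and [dbulk K] are put into
    the chain rule, whence the Lipschitz second derivatives. *)
Definition tr K t := t - bump0 (t - K) + bump0 (- t - K).
Definition dtr K t := 1 - bump1 (t - K) - bump1 (- t - K).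
Definition ddtr K t := bump2 (- t - K) - bump2 (t - K).
Definition bulk K t := bump0 (t - K) + bump0 (- t - K).
Definition dbulk K t := bump1 (t - K) - bump1 (- t - K).
Definition ddbulk K t := bump2 (t - K) + bump2 (- t - K).

Lemma tr_derive K t : is_derive t 1 (tr K) (dtr K t).
Proof.
have := is_deriveD (is_deriveB (is_derive_id t 1) (shift_derive K t bump0_derive)) (reflect_derive K t bump0_derive) => h; exact: (is_derive_eq h).
Qed.

Lemma dtr_derive K t : is_derive t 1 (dtr K) (ddtr K t).
Proof.
have := is_deriveB (is_deriveB (is_derive_cst (1 : R) t 1) (shift_derive K t bump1_derive)) (reflect_derive K t bump1_derive) => h; apply: (is_derive_eq h); rewrite /ddtr; ring.
Qed.

Lemma bulk_derive K t : is_derive t 1 (bulk K) (dbulk K t).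
Proof. exact: is_deriveD (shift_derive K t bump0_derive) (reflect_derive K t bump0_derive). Qed.

Lemma dbulk_derive K t : is_derive t 1 (dbulk K) (ddbulk K t).
Proof.
have := is_deriveB (shift_derive K t bump1_derive) (reflect_derive K t bump1_derive) => h; by apply: (is_derive_eq h); rewrite opprK.
Qed.

Lemma shift_lip (f : R -> R) c K s t : (forall s t, `|f s - f t| <= c * `|s - t|) ->
  `|f (s - K) - f (t - K)| <= c * `|s - t| /\ `|f (- s - K) - f (- t - K)| <= c * `|s - t|.
Proof.
move=> fl; split; apply: le_trans (fl _ _) _.
  by rewrite le_eqVlt; apply/orP; left; apply/eqP; congr (_ * `|_|); ring.
by rewrite -normrN le_eqVlt; apply/orP; left; apply/eqP; congr (_ * `|_|); ring.
Qed.

Lemma ddtr_lip K s t : `|ddtr K s - ddtr K t| <= 32 * `|s - t|.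
Proof.
have [] := shift_lip K s t bump2_lip; rewrite /ddtr !ler_norml => /andP[a1 a2] /andP[a3 a4].
by apply/andP; split; lra.
Qed.

Lemma ddbulk_lip K s t : `|ddbulk K s - ddbulk K t| <= 32 * `|s - t|.
Proof.
have [] := shift_lip K s t bump2_lip; rewrite /ddbulk !ler_norml => /andP[a1 a2] /andP[a3 a4].
by apply/andP; split; lra.
Qed.

Lemma dtr_lip K s t : `|dtr K s - dtr K t| <= 4 * `|s - t|.
Proof.
have [] := shift_lip K s t bump1_lip; rewrite /dtr !ler_norml => /andP[a1 a2] /andP[a3 a4].
by apply/andP; split; lra.
Qed.

Lemma dbulk_lip K s t : `|dbulk K s - dbulk K t| <= 4 * `|s - t|.
Proof.
have [] := shift_lip K s t bump1_lip; rewrite /dbulk !ler_norml => /andP[a1 a2] /andP[a3 a4].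
by apply/andP; split; lra.
Qed.

Lemma bump_cases K t : 0 <= K -> (t - K <= 0) \/ (- t - K <= 0).
Proof. by move=> K0; case: (leP (t - K) 0) => h; [left|right; lra]. Qed.

Lemma tr_id K t : `|t| <= K -> [/\ tr K t = t, dtr K t = 1 & dbulk K t = 0].
Proof.
rewrite ler_norml => /andP[h1 h2]; rewrite /tr /dtr /dbulk.
have [-> -> _] : [/\ bump0 (t - K) = 0, bump1 (t - K) = 0 & bump2 (t - K) = 0].
  by apply: bump_neg; lra.
have [-> -> _] : [/\ bump0 (- t - K) = 0, bump1 (- t - K) = 0 & bump2 (- t - K) = 0].
  by apply: bump_neg; lra.
by rewrite !subr0 addr0.
Qed.

Lemma tr_bounds K t : 0 <= K -> [/\ `|tr K t| <= K + 1, 0 <= dtr K t <= 1,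
  `|dbulk K t| = 1 - dtr K t, `|ddtr K t| <= ddbulk K t & `|ddbulk K t| <= 4].
Proof.
move=> K0; rewrite /tr /dtr /dbulk /ddtr /ddbulk.
have [/andP[a1 a2] /andP[a3 a4]] := bump_bounds (t - K).
have [/andP[b1 b2] /andP[b3 b4]] := bump_bounds (- t - K).
have h4 : `|bump2 (- t - K) - bump2 (t - K)| <= bump2 (t - K) + bump2 (- t - K).
  by rewrite ler_norml; apply/andP; split; lra.
have h5 : `|bump2 (t - K) + bump2 (- t - K)| <= 4 by rewrite ger0_norm; lra.
have [t1|t1] := bump_cases t K0.
  have [-> -> _] := bump_neg t1; 
  split; [|lra|by rewrite sub0r normrN ger0_norm//; lra|by []|by []].
  have [t2|t2] := leP (- t - K) 0.
    by have [-> _ _] := bump_neg t2; rewrite ler_norml; lra.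
  have [_ _ /andP[c1 c2] c3] := bump_pos (ltW t2).
  by rewrite ler_norml; lra.
have [-> -> _] := bump_neg t1; 
split; [|lra|by rewrite subr0 ger0_norm//; lra|by []|by []].
have [t2|t2] := leP (t - K) 0.
  by have [-> _ _] := bump_neg t2; rewrite ler_norml; lra.
have [_ _ /andP[c1 c2] c3] := bump_pos (ltW t2).
by rewrite ler_norml; lra.
Qed.

Lemma tr_lip K s t : 0 <= K -> `|tr K s - tr K t| <= `|s - t|.
Proof.
move=> K0; rewrite -[leRHS]mul1r; apply: (lipschitz_of_derive (tr_derive K)) => x.
by have [_ /andP[h1 h2] _ _ _] := tr_bounds x K0; rewrite ger0_norm.
Qed.

End smooth_truncation.

(** The properties of the coefficients on which the rest of the proof relies. They are stable under
    changing the sign of [B] ([elliptic_opp]), so each result on [T] also serves for [T']. *)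
Record elliptic {R : realType} {d : nat} (mu : {measure set 'rV[R]_d -> \bar R})
    (A : 'rV[R]_d -> 'M[R]_d) (b B : 'rV[R]_d -> 'rV[R]_d) : Prop := {
  ell_fin : forall r : R, (mu (cube r) < +oo)%E;
  ell_sym : forall x, (A x)^T = A x;
  ell_meas : forall i j, measurable_fun setT (fun x => A x i j);
  ell_bd : forall r : R, exists2 nu : R, 0 < nu & forall x i j, cube r x -> `|A x i j| <= nu;
  ell_pos : forall x y, 0 <= mxdot (A x) y y;
  ell_b : forall i (r : R), 0 < r -> L2 mu (cube r) (fun x => b x ord0 i);
  ell_B : forall i (r : R), 0 < r -> L2 mu (cube r) (fun x => B x ord0 i);
  ell_div : forall V u w, relcompact_open V -> H0g mu V u w -> \int[mu]_(x in V) dot (B x) (w x) = 0;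
  ell_uniq : forall V u w w', open V -> H0g mu V u w -> H0g mu V u w' ->
    forall j, \forall x \ae mu, V x -> w x ord0 j = w' x ord0 j;
  ell_ibp : forall u v, Ck 2 u -> Cc1 setT v ->
    L1 mu setT (fun x => 2^-1 * mxdot (A x) (gradient u x) (gradient v x) + diffop A b u x * v x) /\
    \int[mu]_x (2^-1 * mxdot (A x) (gradient u x) (gradient v x) + diffop A b u x * v x) = 0 }.

(** * Weak equations and their truncation *)

Section weak_solutions.
Context {R : realType} {d : nat}.
Local Notation E := 'rV[R]_d.
Variables (mu : {measure set E -> \bar R}) (A : E -> 'M[R]_d) (b B : E -> E).
Hypothesis HE : elliptic mu A b B.
Implicit Types (x : E) (V : set E) (u v f psi : E -> R) (w z : E -> E) (i j : 'I_d) (K N M : R).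

Let mufin := ell_fin HE.
Let mA := ell_meas HE.

Lemma elliptic_opp : elliptic mu A b (fun x => - B x).
Proof.
have [h1 h2 h3 h4 h5 h6 h7 h8 h9 h10] := HE; split => //.
- move=> i r r0; apply: (L2_eq (measurable_cube r) _ (L2N (measurable_cube r) (h7 i r r0))).
  by move=> x _; rewrite !mxE.
- move=> V u w rV Hu.
  transitivity (\int[mu]_(x in V) - dot (B x) (w x)).
    by apply: int_eq => x _; rewrite -scaleN1r dotZl mulN1r.
  have mV := open_measurable_rV rV.1; have [_ Lw _] := Hu.
  have I : L1 mu V (fun x => dot (B x) (w x)).
    apply: L1_sum => // i; apply: L2_mul => //.
    have [r r0 Vr] := compact_cube rV.2.
    apply: (L2S (measurable_cube r) mV _ (h7 i r r0)); apply: subset_trans Vr; exact: subset_closure.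
  transitivity (\int[mu]_(x in V) (-1 * dot (B x) (w x))).
    by apply: int_eq => x _; rewrite mulN1r.
  by rewrite RintegralZl// (h8 _ _ _ rV Hu) mulr0.
Qed.

Section domain.
Variable V : set E.
Hypothesis rV : relcompact_open V.

Let oV := rV.1.
Let mV := open_measurable_rV oV.

Lemma relcompact_cube : exists2 r : R, 0 < r & V `<=` cube r.
Proof.
have [r r0 Vr] := compact_cube rV.2; exists r => //; apply: subset_trans Vr; exact: subset_closure.
Qed.

Lemma relcompact_fin : (mu V < +oo)%E.
Proof.
have [r _ Vr] := relcompact_cube; apply: le_lt_trans (mufin r).
by apply: le_measure; rewrite ?inE//; exact: measurable_cube.
Qed.

Lemma relcompact_L2 f : (forall r : R, 0 < r -> L2 mu (cube r) f) -> L2 mu V f.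
Proof.
by have [r r0 Vr] := relcompact_cube; move=> /(_ r r0); apply: L2S => //; exact: measurable_cube.
Qed.

Lemma drift_L1 w : (forall i, L2 mu V (fun x => w x ord0 i)) -> L1 mu V (fun x => dot (B x) (w x)).
Proof.
move=> Lw; apply: L1_sum => // i; apply: L2_mul => //.
by apply: relcompact_L2 => r; exact: (ell_B HE).
Qed.

Lemma form_L1 w z : (forall i, L2 mu V (fun x => w x ord0 i)) -> (forall i, L2 mu V (fun x => z x ord0 i)) ->
  L1 mu V (fun x => mxdot (A x) (w x) (z x)).
Proof.
move=> Lw Lz; have [r _ Vr] := relcompact_cube; have [nu _ Anu] := ell_bd HE r.
apply: (L1_eq mV (f := fun x => \sum_i \sum_j A x j i * (w x ord0 i * z x ord0 j))).
  by move=> x _; rewrite mxdotE.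
apply: L1_sum => // i; apply: L1_sum => // j.
apply: (L1_bM (M := nu) mV); [exact: measurable_funS (mA j i)|exact: L2_mul|].
by apply/nearW => x /Vr; exact: Anu.
Qed.

(** The gradients occurring in the definitions of the local operator and of the Dirichlet generator
    are a priori different; [ell_uniq] identifies them. Test functions are bounded to make
    [<B, w> v] integrable. *)
Lemma local_operator_weak u f : local_operator mu A B V u f ->
  exists w, [/\ H0g mu V u w, L1 mu V f & forall v z N, H0g mu V v z ->
    (\forall x \ae mu, V x -> `|v x| <= N) ->
    2^-1 * \int[mu]_(x in V) mxdot (A x) (w x) (z x) - \int[mu]_(x in V) (dot (B x) (w x) * v x) =
    - \int[mu]_(x in V) (f x * v x)].
Proof.
move=> [w [h [/(H0gP mufin _ _ mV) Hw [w' [/(H0gP mufin _ _ mV) Hw' /(Lp2P _ _ mV) Lh weak]] _ /(Lp1P _ _ mV) Lf ef]]].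
exists w; split => // v z N Hv vN; have [Lv Lz _] := Hv; have [_ Lw _] := Hw; have [_ Lw' _] := Hw'.
have ew : \int[mu]_(x in V) mxdot (A x) (w x) (z x) = \int[mu]_(x in V) mxdot (A x) (w' x) (z x).
  apply: int_eq_ae => //; [exact: L1_meas (form_L1 Lw Lz)|exact: L1_meas (form_L1 Lw' Lz)|].
  apply: filterS (filter_forall _ (ell_uniq HE oV Hw Hw')) => x hx Vx.
  by congr mxdot; apply/rowP => j; exact: hx.
rewrite ew (weak _ _ ((H0gP mufin v z mV).2 Hv)).
have Lbv : L1 mu V (fun x => dot (B x) (w x) * v x).
  apply: (L1_eq mV _ (L1_bM mV (L2_meas Lv) (drift_L1 Lw) vN)) => x _; exact: mulrC.
have Lhv := L2_mul mV Lh Lv.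
have -> : \int[mu]_(x in V) (f x * v x) = \int[mu]_(x in V) (h x * v x + dot (B x) (w x) * v x).
  apply: int_eq_ae => //.
  - by apply: measurable_funM; [exact: L1_meas Lf|exact: L2_meas Lv].
  - exact: L1_meas (L1D mV Lhv Lbv).
  - by apply: filterS ef => x e Vx; rewrite e// mulrDl.
by rewrite RintegralD// opprD.
Qed.

(** The drift is divergence free on the product [u v], which is in H^{1,2}_0 with the expected
    gradient because both factors are bounded. *)
Lemma drift_antisym u v w z N : H0g mu V u w -> H0g mu V v z ->
  (\forall x \ae mu, V x -> `|u x| <= N) -> (\forall x \ae mu, V x -> `|v x| <= N) ->
  \int[mu]_(x in V) (dot (B x) (w x) * v x) = - \int[mu]_(x in V) (dot (B x) (z x) * u x).
Proof.
move=> Hu Hv uN vN; have [Lu Lw _] := Hu; have [Lv Lz _] := Hv.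
have := ell_div HE rV (H0g_prod mufin oV Hu Hv uN vN).
have I1 : L1 mu V (fun x => dot (B x) (w x) * v x).
  apply: (L1_eq mV _ (L1_bM mV (L2_meas Lv) (drift_L1 Lw) vN)) => x _; exact: mulrC.
have I2 : L1 mu V (fun x => dot (B x) (z x) * u x).
  apply: (L1_eq mV _ (L1_bM mV (L2_meas Lu) (drift_L1 Lz) uN)) => x _; exact: mulrC.
move=> h; apply/eqP; rewrite -subr_eq0 opprK -RintegralD//; apply/eqP; rewrite -[RHS]h.
by apply: int_eq => x _; rewrite dotDr !dotZr; ring.
Qed.

Lemma measurable_lip_comp (F : R -> R) c u : 0 <= c -> (forall s t, `|F s - F t| <= c * `|s - t|) ->
  measurable_fun V u -> measurable_fun V (F \o u).
Proof.
move=> c0 Fl mu'; apply: measurableT_comp mu'; apply: continuous_measurable_fun.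
exact: lipschitz_continuous Fl.
Qed.

(** The equation is tested with [dtr K (u) psi]. When the gradient falls on [dtr K (u)] it leaves
    [psi ddtr K (u) <A w, w>], at most [N] times the energy with weight [ddbulk K (u)]. *)
Lemma truncated_weak u f w K psi z N : 0 <= K -> 0 <= N -> H0g mu V u w -> L1 mu V f ->
  (forall v z N, H0g mu V v z -> (\forall x \ae mu, V x -> `|v x| <= N) ->
    2^-1 * \int[mu]_(x in V) mxdot (A x) (w x) (z x) - \int[mu]_(x in V) (dot (B x) (w x) * v x) =
    - \int[mu]_(x in V) (f x * v x)) ->
  H0g mu V psi z -> (\forall x \ae mu, V x -> `|psi x| <= N) ->
  `|2^-1 * \int[mu]_(x in V) mxdot (A x) (dtr K (u x) *: w x) (z x) -
    \int[mu]_(x in V) (dot (B x) (dtr K (u x) *: w x) * psi x) +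
    \int[mu]_(x in V) (f x * (dtr K (u x) * psi x))| <=
  N * n1 mu V (fun x => f x * dbulk K (u x)).
Proof.
move=> K0 N0 Hu Lf weak Hpsi psiN; have [Lu Lw _] := Hu; have [Lpsi Lz _] := Hpsi.
have z0 : `|0 : R| <= K by rewrite normr0.
have [t0 dt0 db0] := tr_id z0.
have tb t := tr_bounds t K0.
have mu' := L2_meas Lu.
have ddb4 t : `|ddbulk K t| <= 4 by have [] := tb t.
have Htau := H0g_chain mufin oV Hu db0 (dbulk_derive K) ddb4 (ddbulk_lip K).
have dbK t : `|dbulk K t| <= 1 by have [_ /andP[h1 h2] -> _ _] := tb t; lra.
have bu0 : bulk K 0 = 0.
  have K1 : - K <= 0 by lra.
  by rewrite /bulk oppr0 !sub0r; have [-> _ _] := bump_neg K1; rewrite addr0.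
have HTh := H0g_chain mufin oV Hu bu0 (bulk_derive K) dbK (dbulk_lip K).
have dtr1 (t : R) : is_derive t 1 (fun t => dtr K t - 1) (ddtr K t).
  by have := is_deriveB (dtr_derive K t) (is_derive_cst (1 : R) t 1); rewrite subr0.
have dt00 : dtr K 0 - 1 = 0 by rewrite dt0 subrr.
have ddt4 t : `|ddtr K t| <= 4.
  by have [_ _ _ h1 h2] := tb t; rewrite (le_trans h1)// (le_trans _ h2)// ler_norm.
have Hs := H0g_chain mufin oV Hu dt00 dtr1 ddt4 (ddtr_lip K).
have Ldd : L1 mu V (fun x => ddbulk K (u x) * mxdot (A x) (w x) (w x)).
  apply: (L1_bM (M := 4) mV _ (form_L1 Lw Lw)).
    by apply: measurable_lip_comp mu'; [|exact: ddbulk_lip].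
  by apply/nearW => x _; have [] := tb (u x).
(* Testing with dbulk K (u) controls the energy of u where u is truncated; the drift does
   not contribute because <B, w> dbulk K (u) is the divergence-free drift applied to bulk K (u). *)
have energy : 2^-1 * \int[mu]_(x in V) (ddbulk K (u x) * mxdot (A x) (w x) (w x)) <= n1 mu V (fun x => f x * dbulk K (u x)).
  have := weak _ _ 1 Htau; set I1 := \int[mu]_(x in V) _; set I2 := \int[mu]_(x in V) _.
  have -> : I1 = \int[mu]_(x in V) (ddbulk K (u x) * mxdot (A x) (w x) (w x)).
    by apply: int_eq => x _; rewrite mxdotZr.
  have -> : I2 = 0.
    rewrite -[RHS](ell_div HE rV HTh); apply: int_eq => x _.
    by rewrite dotZr mulrC.
  rewrite subr0 => ->; last by apply/nearW => x _; exact: dbK.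
  rewrite (le_trans (ler_norm _))// normrN; apply: int_le_n1 => //.
  have [Ltau _ _] := Htau; have tau1 : \forall x \ae mu, V x -> `|(dbulk K \o u) x| <= 1.
    by apply/nearW => x _; exact: dbK.
  by apply: (L1_eq mV _ (L1_bM mV (L2_meas Ltau) Lf tau1)) => x _; rewrite mulrC.
pose N' := Num.max 1 N.
have s1N : \forall x \ae mu, V x -> `|((fun t => dtr K t - 1) \o u) x| <= N'.
  apply/nearW => x _ /=; have [_ /andP[h1 h2] _ _ _] := tb (u x).
  by rewrite /N' le_max ler_norml; apply/orP; left; lra.
have psiN' : \forall x \ae mu, V x -> `|psi x| <= N'.
  by apply: filterS psiN => x h /h; rewrite /N' le_max => ->; rewrite orbT.
(* [dtr K] is 1 at 0, so [dtr K (u)] does not vanish at the boundary; the test function is therefore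
   split as [(dtr K (u) - 1) psi + psi]. *)
have Hv := H0gD mufin mV (H0g_prod mufin oV Hs Hpsi s1N psiN') Hpsi.
have {}Hv : H0g mu V (fun x => dtr K (u x) * psi x) (fun x => (psi x * ddtr K (u x)) *: w x + dtr K (u x) *: z x).
  apply: (H0g_eq mufin mV Hv) => x /=; first by move=> _; ring.
  by move=> i _; rewrite !mxE /=; ring.
have vN : \forall x \ae mu, V x -> `|dtr K (u x) * psi x| <= N.
  apply: filterS psiN => x h /h; have [_ /andP[h1 h2] _ _ _] := tb (u x).
  by rewrite normrM ger0_norm//; apply: le_trans; rewrite ler_piMl.
have Lc : L1 mu V (fun x => psi x * ddtr K (u x) * mxdot (A x) (w x) (w x)).
  have m1 : measurable_fun V (fun x => psi x * ddtr K (u x)).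
    apply: measurable_funM; first exact: L2_meas Lpsi.
    by apply: measurable_lip_comp mu'; [|exact: ddtr_lip].
  apply: (L1_bM (M := N * 4) mV m1 (form_L1 Lw Lw)).
  apply: filterS psiN => x h /h hN; rewrite normrM.
  exact: ler_pM (normr_ge0 _) (normr_ge0 _) hN (ddt4 _).
have Ls i : L2 mu V (fun x => (dtr K (u x) *: w x) ord0 i).
  apply: (L2_eq mV (f := fun x => dtr K (u x) * w x ord0 i)); first by move=> x _; rewrite mxE.
  apply: (L2_bM (M := 1) mV _ (Lw i)); first by apply: measurable_lip_comp mu'; [|exact: dtr_lip].
  by apply/nearW => x _; have [_ /andP[h1 h2] _ _ _] := tb (u x); rewrite ger0_norm.
have := weak _ _ N Hv vN; set I1 := \int[mu]_(x in V) _; set I2 := \int[mu]_(x in V) _ => e.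
have e1 : I1 = \int[mu]_(x in V) (psi x * ddtr K (u x) * mxdot (A x) (w x) (w x)) +
    \int[mu]_(x in V) mxdot (A x) (dtr K (u x) *: w x) (z x).
  rewrite -RintegralD//; last exact: form_L1.
  by apply: int_eq => x _; rewrite mxdotDr !mxdotZr mxdotZl.
have e2 : I2 = \int[mu]_(x in V) (dot (B x) (dtr K (u x) *: w x) * psi x).
  by apply: int_eq => x _; rewrite dotZr; ring.
rewrite -e2; rewrite e1 in e.
set J := \int[mu]_(x in V) (psi x * _ * _) in e.
set I0 := \int[mu]_(x in V) mxdot _ _ _ in e *.
set I3 := \int[mu]_(x in V) (f x * _) in e *.
have -> : 2^-1 * I0 - I2 + I3 = - (2^-1 * J) by lra.
rewrite normrN normrM ger0_norm ?invr_ge0//.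
have JN : `|J| <= N * \int[mu]_(x in V) (ddbulk K (u x) * mxdot (A x) (w x) (w x)).
  apply: (le_trans (int_le_n1 mV Lc)); rewrite -RintegralZl//; apply: int_le_ae => //.
  - exact: L1_abs.
  - exact: L1Z.
  - apply: filterS psiN => x h /h hN; rewrite !normrM mulrA [X in _ * X]ger0_norm; last exact: ell_pos HE _ _.
    apply: ler_wpM2r; first exact: ell_pos HE _ _.
    by apply: ler_pM => //; have [] := tb (u x).
apply: (@le_trans _ _ (N * (2^-1 * \int[mu]_(x in V) (ddbulk K (u x) * mxdot (A x) (w x) (w x))))).
  by rewrite mulrCA ler_wpM2l// invr_ge0.
by rewrite ler_wpM2l.
Qed.

End domain.
End weak_solutions.

(** * Sub-Markovian semigroups and resolvents *)

Section submarkov.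
Context {R : realType} {d : nat}.
Local Notation E := 'rV[R]_d.
Variables (mu : {measure set E -> \bar R}) (V : set E) (S : R -> (E -> R) -> E -> R).
Hypothesis mV : measurable V.
Hypothesis HS : submarkov_semigroup mu V S.
Implicit Types (x : E) (f g h u v : E -> R) (s t a c e : R).

Lemma near_right0 (P : R -> Prop) : (\forall t \near 0^'+, P t) ->
  exists2 t0 : R, 0 < t0 & forall t, 0 < t -> t <= t0 -> P t.
Proof.
move=> /nbhs_ballP[e /= e0 H]; exists (e / 2); first exact: divr_gt0.
move=> t t0 te; apply: H => //=; rewrite /ball /= sub0r normrN gtr0_norm//; lra.
Qed.

Lemma cvg_right_n1 (F : R -> E -> R) : (forall t, 0 < t -> L1 mu V (F t)) ->
  Lpnorm mu 1 V (F t) @[t --> 0^'+] --> 0%E ->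
  forall e, 0 < e -> exists2 t0 : R, 0 < t0 & forall t, 0 < t -> t <= t0 -> n1 mu V (F t) <= e.
Proof.
move=> IF /fine_cvgP[_ /cvgr0_norm_le H] e e0; have [t0 t00 h] := near_right0 (H e e0).
exists t0 => // t tp tt; have := h t tp tt; rewrite /= Lpnorm1E//; last exact: IF.
by rewrite /= ger0_norm ?n1_ge0.
Qed.

Lemma sg_L1 t f : 0 < t -> L1 mu V f -> L1 mu V (S t f).
Proof. by move=> t0 /(Lp1P _ _ mV) h; apply/(Lp1P _ _ mV); exact: semigroup_L1 HS t f t0 h. Qed.

Lemma sg_contr t f : 0 < t -> L1 mu V f -> n1 mu V (S t f) <= n1 mu V f.
Proof.
move=> t0 Lf; have := semigroup_contraction HS t0 ((Lp1P _ _ mV).2 Lf).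
by rewrite !Lpnorm1E// ?lee_fin//; exact: sg_L1.
Qed.

Lemma sg_lin t a f g : 0 < t -> L1 mu V f -> L1 mu V g ->
  \forall x \ae mu, V x -> S t (fun x => a * f x + g x) x = a * S t f x + S t g x.
Proof. by move=> t0 /(Lp1P _ _ mV) h /(Lp1P _ _ mV) h'; exact: semigroup_linear HS t a f g t0 h h'. Qed.

Lemma sg_ae t f g : 0 < t -> L1 mu V f -> L1 mu V g -> (\forall x \ae mu, V x -> f x = g x) ->
  \forall x \ae mu, V x -> S t f x = S t g x.
Proof. by move=> t0 /(Lp1P _ _ mV) h /(Lp1P _ _ mV) h'; exact: semigroup_ae HS t f g t0 h h'. Qed.

Lemma sgD s t f : 0 < s -> 0 < t -> L1 mu V f -> \forall x \ae mu, V x -> S (s + t) f x = S s (S t f) x.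
Proof. by move=> s0 t0 /(Lp1P _ _ mV) h; exact: semigroupD HS s t f s0 t0 h. Qed.

Lemma sgB t f g : 0 < t -> L1 mu V f -> L1 mu V g ->
  \forall x \ae mu, V x -> S t (fun x => f x - g x) x = S t f x - S t g x.
Proof.
move=> t0 Lf Lg; have Lfg := L1B mV Lf Lg.
have Lfg' : L1 mu V (fun x => -1 * g x + f x).
  by apply: (L1_eq mV _ Lfg) => x _; rewrite mulN1r addrC.
apply: filterS2 (sg_lin (-1) t0 Lg Lf) (sg_ae t0 Lfg Lfg' _) => [x e1 e2 Vx|].
  by rewrite e2// e1// mulN1r addrC.
by apply/nearW => x _; rewrite mulN1r addrC.
Qed.

Lemma sgZ t a f : 0 < t -> L1 mu V f -> \forall x \ae mu, V x -> S t (fun x => a * f x) x = a * S t f x.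
Proof.
move=> t0 Lf; have L0 := L1_0 mu V.
have Lz := L1Z a mV Lf.
have Lz' : L1 mu V (fun x => a * f x + 0) by exact: L1D.
have Lz0 : L1 mu V (fun x => 0 * f x) by apply: (L1_eq mV _ L0) => x _; rewrite mul0r.
have z0 : \forall x \ae mu, V x -> S t (fun=> 0) x = 0.
  have L00 : L1 mu V (fun x => -1 * (0 : R) + 0) by apply: (L1_eq mV _ L0) => x _; rewrite mulr0 addr0.
  have h := sg_lin (-1) t0 L0 L0.
  have h' : \forall x \ae mu, V x -> S t (fun x => 0) x = S t (fun x => -1 * (0 : R) + 0) x.
    by apply: sg_ae => //; apply/nearW => x _; rewrite mulr0 addr0.
  by apply: filterS2 h h' => x e1 e2 Vx; rewrite e2// e1// mulN1r addNr.
have h := sg_lin a t0 Lf L0.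
have h' : \forall x \ae mu, V x -> S t (fun x => a * f x) x = S t (fun x => a * f x + 0) x.
  by apply: sg_ae => //; apply/nearW => x _; rewrite addr0.
apply: filterS3 h h' z0 => x e1 e2 e3 Vx.
by rewrite e2// e1// e3// addr0.
Qed.

Lemma sg_diff t f g : 0 < t -> L1 mu V f -> L1 mu V g ->
  n1 mu V (fun x => S t f x - S t g x) <= n1 mu V (fun x => f x - g x).
Proof.
move=> t0 Lf Lg; have Lfg := L1B mV Lf Lg.
apply: le_trans (sg_contr t0 Lfg); rewrite le_eqVlt; apply/orP; left; apply/eqP.
apply: n1_eq_ae => //; [by apply: L1B => //; exact: sg_L1|exact: sg_L1|].
by apply: filterS (sgB t0 Lf Lg) => x e Vx; rewrite e.
Qed.

Lemma sg_C0 f e : L1 mu V f -> 0 < e ->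
  exists2 t0 : R, 0 < t0 & forall t, 0 < t -> t <= t0 -> n1 mu V (fun x => S t f x - f x) <= e.
Proof.
move=> Lf; apply: cvg_right_n1; last exact: semigroup_C0 HS f ((Lp1P _ _ mV).2 Lf).
by move=> t t0; apply: L1B => //; exact: sg_L1.
Qed.

Lemma sg_bounded t f c : 0 < t -> 0 < c -> L1 mu V f -> (\forall x \ae mu, V x -> 0 <= f x <= c) ->
  \forall x \ae mu, V x -> 0 <= S t f x <= c.
Proof.
move=> t0 c0 Lf fc; have Lcf := L1Z c^-1 mV Lf.
have h : \forall x \ae mu, V x -> 0 <= c^-1 * f x <= 1.
  apply: filterS fc => x h /h /andP[f0 f1].
  by rewrite mulr_ge0 ?invr_ge0 ?(ltW c0)//= mulrC ler_pdivrMr// mul1r.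
have := semigroup_submarkov HS t0 ((Lp1P _ _ mV).2 Lcf) h.
apply: filterS2 (sgZ c^-1 t0 Lf) => x e h' Vx; have := h' Vx; rewrite e// => /andP[a1 a2].
rewrite -(pmulr_rge0 _ (x := c^-1)) ?invr_gt0// a1 /=.
by move: a2; rewrite mulrC ler_pdivrMr// mul1r.
Qed.

Lemma n1_trunc f : L1 mu V f -> (\forall x \ae mu, V x -> 0 <= f x) -> forall e, 0 < e ->
  exists2 c : R, 0 < c & n1 mu V (fun x => f x - Num.min c (f x)) <= e.
Proof.
move=> Lf f0 e e0; have [c [c0 hc]] := L1_tail mV Lf (L1_meas Lf) e0.
exists c => //; apply: le_trans hc; have mf := L1_meas Lf.
have mmin : measurable_fun V (fun x => Num.min c (f x)) by exact: measurable_minr.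
have Lm : L1 mu V (fun x => Num.min c (f x)).
  apply: (L1_dom mV mmin Lf); apply: filterS f0 => x h /h h0.
  by rewrite ger0_norm ?ge_min ?lexx ?orbT// le_min h0 (ltW c0).
have LB := L1_abs mV (L1B mV Lf Lm).
apply: int_le_ae => //.
  apply: (L1_dom mV _ (L1_abs mV Lf)).
    apply: measurable_funM; first exact: measurableT_comp.
    rewrite (_ : (fun x => _) = (fun b : bool => b%:R : R) \o (fun x => c < `|f x|)) //.
    apply: measurableT_comp => //; apply: measurable_fun_ltr => //; exact: measurableT_comp.
  by apply/nearW => x _; case: ltP => _; rewrite ?mulr1 ?mulr0 ?normr0// normr_id.
apply: filterS f0 => x h /h h0; rewrite (ger0_norm h0) minEle.
case: (leP c (f x)) => cf; last by rewrite subrr normr0; apply: mulr_ge0.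
rewrite ger0_norm ?subr_ge0//; move: cf; rewrite le_eqVlt => /orP[/eqP <-|cf].
  by rewrite subrr ltxx mulr0.
by rewrite cf mulr1 lerBlDr lerDl ltW.
Qed.

(** The sub-Markov property concerns values in [[0, 1]], and scaling extends it to bounded
    functions. An integrable [f] is L^1-close to its truncation [min c f], and by contraction the
    negative part of [S t f] is as small as that distance. *)
Lemma sg_ge0 t f : 0 < t -> L1 mu V f -> (\forall x \ae mu, V x -> 0 <= f x) ->
  \forall x \ae mu, V x -> 0 <= S t f x.
Proof.
move=> t0 Lf f0; have LS := sg_L1 t0 Lf.
pose neg x := Num.max 0 (- S t f x).
have mneg : measurable_fun V neg.
  apply: measurable_maxr; first exact: measurable_cst.
  by apply: measurableT_comp => //; exact: L1_meas LS.
have Lneg : L1 mu V neg.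
  apply: (L1_dom mV mneg (L1_abs mV LS)); apply/nearW => x _; rewrite /neg.
  by case: (leP 0 (- S t f x)) => h; rewrite ?normrN ?normr0.
suff n0 : n1 mu V neg = 0.
  apply: filterS (n1_0_ae mV Lneg n0) => x h /h; rewrite /neg => e.
  by have : - S t f x <= 0; [rewrite -e le_max lexx orbT|rewrite oppr_le0].
apply: eps_zero; exists 1 => e e0 _; rewrite mul1r ger0_norm ?n1_ge0//.
have [c c0 hc] := n1_trunc Lf f0 e0; apply: le_trans hc.
have mmin : measurable_fun V (fun x => Num.min c (f x)) by apply: measurable_minr => //; exact: L1_meas Lf.
have Lm : L1 mu V (fun x => Num.min c (f x)).
  apply: (L1_dom mV mmin Lf); apply: filterS f0 => x h /h h0.
  by rewrite ger0_norm ?ge_min ?lexx ?orbT// le_min h0 (ltW c0).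
have LSm := sg_L1 t0 Lm.
apply: le_trans (sg_diff t0 Lf Lm); apply: n1_le => //; first exact: L1B.
have mb : \forall x \ae mu, V x -> 0 <= Num.min c (f x) <= c.
  by apply: filterS f0 => x h /h h0; rewrite le_min h0 (ltW c0) ge_min lexx.
apply: filterS (sg_bounded t0 c0 Lm mb) => x h /h /andP[h1 h2]; rewrite /neg.
case: (leP 0 (- S t f x)) => h3; last by rewrite normr0.
by rewrite normrN -normrN -[leRHS]normrN !ger0_norm; lra.
Qed.

Lemma sg_le t f g : 0 < t -> L1 mu V f -> L1 mu V g -> (\forall x \ae mu, V x -> f x <= g x) ->
  \forall x \ae mu, V x -> S t f x <= S t g x.
Proof.
move=> t0 Lf Lg fg; have h : \forall x \ae mu, V x -> 0 <= g x - f x.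
  by apply: filterS fg => x h /h; rewrite subr_ge0.
apply: filterS2 (sg_ge0 t0 (L1B mV Lg Lf) h) (sgB t0 Lg Lf) => x h1 h2 Vx.
by have := h1 Vx; rewrite h2// subr_ge0.
Qed.

Lemma generatorE u f : generator mu V S u f -> [/\ L1 mu V u, L1 mu V f &
  forall e, 0 < e -> exists2 t0 : R, 0 < t0 & forall t, 0 < t -> t <= t0 ->
    n1 mu V (fun x => (S t u x - u x) / t - f x) <= e].
Proof.
move=> [/(Lp1P _ _ mV) Lu /(Lp1P _ _ mV) Lf H]; split => //; apply: cvg_right_n1 H => t t0.
apply: L1B => //; apply: (L1_eq mV (f := fun x => t^-1 * (S t u x - u x))).
  by move=> x _; rewrite mulrC.
by apply: L1Z => //; apply: L1B => //; exact: sg_L1.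
Qed.

Lemma generator_rem u f t : 0 < t -> L1 mu V u -> L1 mu V f -> L1 mu V (fun x => (S t u x - u x) / t - f x).
Proof.
move=> t0 Lu Lf; apply: L1B => //; apply: (L1_eq mV (f := fun x => t^-1 * (S t u x - u x))).
  by move=> x _; rewrite mulrC.
by apply: L1Z => //; apply: L1B => //; exact: sg_L1.
Qed.

Lemma generatorB u f u' f' : generator mu V S u f -> generator mu V S u' f' ->
  [/\ L1 mu V (fun x => u x - u' x), L1 mu V (fun x => f x - f' x) &
  forall e, 0 < e -> exists2 t0 : R, 0 < t0 & forall t, 0 < t -> t <= t0 ->
    n1 mu V (fun x => (S t (fun x => u x - u' x) x - (u x - u' x)) / t - (f x - f' x)) <= e].
Proof.
move=> /generatorE[Lu Lf H] /generatorE[Lu' Lf' H'].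
have LU := L1B mV Lu Lu'; have LF := L1B mV Lf Lf'; split => // e e0.
have e2 : 0 < e / 2 by exact: divr_gt0.
have [t1 t10 h1] := H _ e2; have [t2 t20 h2] := H' _ e2.
exists (Num.min t1 t2); first by rewrite lt_min t10.
move=> t t0; rewrite le_min => /andP[tt1 tt2].
have I1 := generator_rem t0 Lu Lf; have I2 := generator_rem t0 Lu' Lf'.
rewrite (n1_eq_ae mV (generator_rem t0 LU LF) (L1B mV I1 I2)).
  by apply: (le_trans (n1B mV I1 I2)); have := h1 t t0 tt1; have := h2 t t0 tt2; lra.
by apply: filterS (sgB t0 Lu Lu') => x e1 Vx; rewrite e1//; ring.
Qed.

(** Up to the remainder of the difference quotient, [(a + 1/t) u] equals [(a u - f) + S_t u / t],
    and the norm of the last term is at most that of [u / t]. *)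
Lemma dissipative a u f : 0 < a -> L1 mu V u -> L1 mu V f ->
  (forall e, 0 < e -> exists2 t0 : R, 0 < t0 & forall t, 0 < t -> t <= t0 ->
    n1 mu V (fun x => (S t u x - u x) / t - f x) <= e) ->
  a * n1 mu V u <= n1 mu V (fun x => a * u x - f x).
Proof.
move=> a0 Lu Lf H; apply/ler_addgt0Pr => e e0; have [t t0 h] := H e e0.
have {}h := h t t0 (lexx t); have ti0 : 0 < t^-1 by rewrite invr_gt0.
have LS := sg_L1 t0 Lu; have Lr := generator_rem t0 Lu Lf.
have L1a := L1B mV (L1Z a mV Lu) Lf; have L2a := L1Z t^-1 mV LS.
have I3 := L1D mV L1a L2a.
have e1 : (a + t^-1) * n1 mu V u = n1 mu V (fun x => (a + t^-1) * u x).
  by rewrite n1Z// ger0_norm// addr_ge0// ltW.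
have e2 : n1 mu V (fun x => (a + t^-1) * u x) =
   n1 mu V (fun x => (a * u x - f x) + t^-1 * S t u x - ((S t u x - u x) / t - f x)).
  by apply: int_eq => x _; congr (`|_|); ring.
have := n1B mV I3 Lr; rewrite -e2 -e1 => h1.
have := n1D mV L1a L2a; rewrite n1Z// ger0_norm ?(ltW ti0)// => h2.
have h3 : t^-1 * n1 mu V (S t u) <= t^-1 * n1 mu V u by rewrite ler_wpM2l ?(ltW ti0)// sg_contr.
by move: h1; rewrite [leLHS]mulrDl; lra.
Qed.

Lemma resolvent_L1 a f g : resolvent mu V S a f g -> L1 mu V f /\ L1 mu V g.
Proof.
move=> /generatorE[Lg Lh _]; split => //.
by apply: (L1_eq mV _ (L1B mV (L1Z a mV Lg) Lh)) => x _; ring.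
Qed.

Lemma resolvent_contr a f g f' g' : 0 < a -> resolvent mu V S a f g -> resolvent mu V S a f' g' ->
  a * n1 mu V (fun x => g x - g' x) <= n1 mu V (fun x => f x - f' x).
Proof.
move=> a0 H H'; have [L L' h] := generatorB H H'.
apply: (le_trans (dissipative a0 L L' h)); rewrite le_eqVlt; apply/orP; left; apply/eqP.
by apply: int_eq => x _; congr (`|_|); ring.
Qed.

Lemma resolvent_n1 a f g : 0 < a -> resolvent mu V S a f g -> a * n1 mu V g <= n1 mu V f.
Proof.
move=> a0 H; have [L L' h] := generatorE H.
apply: (le_trans (dissipative a0 L L' h)); rewrite le_eqVlt; apply/orP; left; apply/eqP.
by apply: int_eq => x _; congr (`|_|); ring.
Qed.

Lemma resolvent_unique a f g g' : 0 < a -> resolvent mu V S a f g -> resolvent mu V S a f g' ->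
  \forall x \ae mu, V x -> g x = g' x.
Proof.
move=> a0 H H'; have [_ Lg] := resolvent_L1 H; have [_ Lg'] := resolvent_L1 H'.
have := resolvent_contr a0 H H'; rewrite (_ : n1 _ _ (fun x => f x - f x) = 0); last first.
  by rewrite -[RHS](int0 mu V); apply: int_eq => x _; rewrite subrr normr0.
rewrite pmulr_rle0// => n0; have {}n0 : n1 mu V (fun x => g x - g' x) = 0.
  by apply/eqP; rewrite eq_le n0 n1_ge0.
by apply: filterS (n1_0_ae mV (L1B mV Lg Lg') n0) => x h /h /eqP; rewrite subr_eq0 => /eqP.
Qed.

(* If (1 + a t) v <= S_t v up to an error o(t) in L^1 then v <= 0, because S_t
   is a contraction. *)
Lemma pos_part_zero a v (r : R -> E -> R) : 0 < a -> L1 mu V v -> (\forall x \ae mu, V x -> 0 <= v x) ->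
  (forall t, 0 < t -> L1 mu V (r t)) ->
  (forall e, 0 < e -> exists2 t0 : R, 0 < t0 & forall t, 0 < t -> t <= t0 -> n1 mu V (r t) <= e) ->
  (forall t, 0 < t -> \forall x \ae mu, V x -> (1 + a * t) * v x <= S t v x + t * `|r t x|) ->
  \forall x \ae mu, V x -> v x = 0.
Proof.
move=> a0 Lv v0 Lr H h; apply: (n1_0_ae mV Lv); apply/eqP; rewrite eq_le n1_ge0 andbT.
rewrite -(pmulr_rle0 _ a0); apply/ler_addgt0Pr => e e0; rewrite add0r.
have [t t0 {}H] := H e e0; have {}H := H t t0 (lexx t).
have at0 : 0 <= 1 + a * t by rewrite addr_ge0// mulr_ge0// ltW.
have L1a := L1Z (1 + a * t) mV Lv; have Lb := sg_L1 t0 Lv.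
have Lc := L1Z t mV (L1_abs mV (Lr t t0)).
have : n1 mu V (fun x => (1 + a * t) * v x) <= n1 mu V (fun x => S t v x + t * `|r t x|).
  apply: n1_le => //; first exact: L1D.
  apply: filterS2 v0 (h t t0) => x h1 h2 Vx; rewrite ger0_norm; last by rewrite mulr_ge0// h1.
  by apply: le_trans (ler_norm _); exact: h2.
rewrite n1Z// ger0_norm// => h1.
have h2 := n1D mV Lb Lc; have h3 := sg_contr t0 Lv.
have h4 : n1 mu V (fun x => t * `|r t x|) = t * n1 mu V (r t).
  rewrite n1Z//; last exact: L1_abs mV (Lr t t0).
  by rewrite gtr0_norm//; congr (_ * _); apply: int_eq => x _; rewrite normr_id.
have h5 : t * n1 mu V (r t) <= t * e by rewrite ler_wpM2l ?(ltW t0).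
rewrite -(ler_pM2l t0); move: h1; rewrite mulrDl mul1r; lra.
Qed.

(** [pos_part_zero] for the negative part [v] of [g]: positivity of the semigroup gives
    [S_t g >= - S_t v]. *)
Lemma resolvent_ge0 a f g : 0 < a -> resolvent mu V S a f g -> (\forall x \ae mu, V x -> 0 <= f x) ->
  \forall x \ae mu, V x -> 0 <= g x.
Proof.
move=> a0 Hg f0; have [Lg Lh H] := generatorE Hg.
pose v x := Num.max 0 (- g x).
have mv : measurable_fun V v.
  apply: measurable_maxr; first exact: measurable_cst.
  by apply: measurableT_comp => //; exact: L1_meas Lg.
have Lv : L1 mu V v.
  apply: (L1_dom mV mv (L1_abs mV Lg)); apply/nearW => x _; rewrite /v.
  by case: (leP 0 (- g x)) => h; rewrite ?normrN ?normr0.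
have v0 : \forall x \ae mu, V x -> 0 <= v x by apply/nearW => x _; rewrite /v le_max lexx.
suff z : \forall x \ae mu, V x -> v x = 0.
  apply: filterS z => x h /h; rewrite /v => e.
  by have : - g x <= 0; [rewrite -e le_max lexx orbT|rewrite oppr_le0].
apply: (pos_part_zero a0 Lv v0 (r := fun t x => (S t g x - g x) / t - (a * g x - f x))) => //.
  by move=> t t0; exact: generator_rem.
move=> t t0.
have Lvn := L1N mV Lv.
have h1 : \forall x \ae mu, V x -> - S t v x <= S t g x.
  have h : \forall x \ae mu, V x -> -1 * v x <= g x.
    by apply/nearW => x _; rewrite mulN1r lerNl /v le_max lexx orbT.
  apply: filterS2 (sg_le t0 (L1Z (-1) mV Lv) Lg h) (sgZ (-1) t0 Lv) => x h2 e Vx.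
  by have := h2 Vx; rewrite e// mulN1r.
apply: filterS3 h1 f0 (sg_ge0 t0 Lv v0) => x h1 h2 h3 Vx.
have {}h1 := h1 Vx; have {}h2 := h2 Vx; have {}h3 := h3 Vx.
rewrite /v; case: (leP 0 (- g x)) => gx; last by rewrite mulr0 addr_ge0// mulr_ge0// ltW.
rewrite -/(v x) in h1 h3 *.
set r := (X in `|X|); have rE : t * r = S t g x - g x - t * (a * g x - f x).
  by rewrite /r; field; exact: lt0r_neq0.
have : t * r <= t * `|r| by rewrite ler_wpM2l ?(ltW t0)// ler_norm.
have tf : 0 <= t * f x by rewrite mulr_ge0// ltW.
have : - (t * r) <= t * `|r|.
  by rewrite -mulrN ler_wpM2l ?(ltW t0)// -normrN ler_norm.
rewrite rE mulrBr; lra.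
Qed.

(** [pos_part_zero] for the excess [v] of [g] over [M / a]: [g] is at most [gp + v] with
    [0 <= gp <= M / a], and [S_t gp] keeps the bound [M / a]. *)
Lemma resolvent_le a f g M : 0 < a -> 0 < M -> resolvent mu V S a f g ->
  (\forall x \ae mu, V x -> f x <= M) -> \forall x \ae mu, V x -> a * g x <= M.
Proof.
move=> a0 M0 Hg fM; have [Lg Lh H] := generatorE Hg.
have c0 : 0 < M / a by exact: divr_gt0.
pose gp x := Num.min (M / a) (Num.max 0 (g x)).
pose v x := Num.max 0 (g x - M / a).
have mg := L1_meas Lg.
have mgp : measurable_fun V gp.
  by apply: measurable_minr; first exact: measurable_cst; apply: measurable_maxr.
have mv : measurable_fun V v.
  by apply: measurable_maxr; first exact: measurable_cst; apply: measurable_funB.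
have Lgp : L1 mu V gp.
  apply: (L1_dom mV mgp (L1_abs mV Lg)); apply/nearW => x _; rewrite /gp.
  by rewrite ler_norml; case: (leP 0 (g x)) => h1; case: (leP (M / a) _) => h2;
    rewrite ?(ger0_norm h1) ?(ltr0_norm h1); lra.
have Lv : L1 mu V v.
  apply: (L1_dom mV mv (L1_abs mV Lg)); apply/nearW => x _; rewrite /v.
  by rewrite ler_norml; case: (leP 0 (g x)) => h1; case: (leP 0 (g x - M / a)) => h2;
    rewrite ?(ger0_norm h1) ?(ltr0_norm h1); lra.
have v0 : \forall x \ae mu, V x -> 0 <= v x by apply/nearW => x _; rewrite /v le_max lexx.
suff z : \forall x \ae mu, V x -> v x = 0.
  apply: filterS z => x h /h; rewrite /v => e.
  have : g x - M / a <= 0 by rewrite -e le_max lexx orbT.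
  by rewrite subr_le0 ler_pdivlMr// mulrC.
apply: (pos_part_zero a0 Lv v0 (r := fun t x => (S t g x - g x) / t - (a * g x - f x))) => //.
  by move=> t t0; exact: generator_rem.
move=> t t0.
have h1 : \forall x \ae mu, V x -> S t g x <= S t v x + M / a.
  have h : \forall x \ae mu, V x -> g x <= 1 * gp x + v x.
    apply/nearW => x _; rewrite mul1r /gp /v; clear -c0.
    by case: (leP 0 (g x)) => h1; case: (leP (M / a) _) => h2; case: (leP 0 (g x - M / a)) => h3; lra.
  have hb : \forall x \ae mu, V x -> 0 <= gp x <= M / a.
    apply/nearW => x _; rewrite /gp; clear -c0.
    by case: (leP 0 (g x)) => h1; case: (leP (M / a) _) => h2; lra.
  have Ls : L1 mu V (fun x => 1 * gp x + v x) by apply: L1D => //; exact: L1Z.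
  apply: filterS3 (sg_le t0 Lg Ls h) (sg_lin 1 t0 Lgp Lv) (sg_bounded t0 c0 Lgp hb) => x h2 e h3 Vx.
  by have := h2 Vx; rewrite e//; have := h3 Vx; lra.
apply: filterS3 h1 fM (sg_ge0 t0 Lv v0) => x h1 h2 h3 Vx.
have {}h1 := h1 Vx; have {}h2 := h2 Vx; have {}h3 := h3 Vx.
rewrite {1}/v; case: (leP 0 (g x - M / a)) => gx; last by rewrite mulr0 addr_ge0// mulr_ge0// ltW.
set r := (X in `|X|); have rE : t * r = S t g x - g x - t * (a * g x - f x).
  by rewrite /r; field; exact: lt0r_neq0.
have tf : t * f x <= t * M by rewrite ler_wpM2l// ltW.
have : - (t * r) <= t * `|r|.
  by rewrite -mulrN ler_wpM2l ?(ltW t0)// -normrN ler_norm.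
have e1 : a * t * (M / a) = t * M by field; exact: lt0r_neq0.
move=> h5; rewrite rE mulrBr in h5; rewrite mulrDl mul1r [X in _ + X <= _]mulrBr e1; lra.
Qed.

End submarkov.

(** * Resolvents on bounded domains and their limits *)

Section local_resolvents.
Context {R : realType} {d : nat}.
Local Notation E := 'rV[R]_d.
Variables (mu : {measure set E -> \bar R}) (A : E -> 'M[R]_d) (b : E -> E).
Implicit Types (x : E) (V : set E) (u v f g psi : E -> R) (w z B : E -> E) (i j : 'I_d) (K N M : R).

Lemma closure_approx B V u g (HE : elliptic mu A b B) : relcompact_open V ->
  L1_graph_closure mu V (local_operator mu A B V) u g ->
  forall e : R, 0 < e -> exists u' g', [/\ local_operator mu A B V u' g',
    n1 mu V (fun x => u' x - u x) <= e & n1 mu V (fun x => g' x - g x) <= e].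
Proof.
move=> rV; have oV := rV.1; have mV := open_measurable_rV oV.
move=> [/(Lp1P _ _ mV) Lu /(Lp1P _ _ mV) Lg [un [gn [Hn cu cg]]]] e e0.
have Lun n : L1 mu V (un n).
  have [w [_ [/(H0gP (ell_fin HE) _ _ mV) [Lu2 _ _] _ _ _ _]]] := Hn n.
  by apply: L2_L1 => //; exact: relcompact_fin HE _ rV.
have Lgn n : L1 mu V (gn n) by have [w [_ [_ _ _ /(Lp1P _ _ mV) ? _]]] := Hn n.
have /(cvg_Lpnorm1 mV (fun n => L1B mV (Lun n) Lu)) /cvgr0_norm_le/(_ e e0) h1 := cu.
have /(cvg_Lpnorm1 mV (fun n => L1B mV (Lgn n) Lg)) /cvgr0_norm_le/(_ e e0) h2 := cg.
have [n [k1 k2]] := filter_ex (filterI h1 h2).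
exists (un n), (gn n); split => //; first by rewrite ger0_norm ?n1_ge0 in k1.
by rewrite ger0_norm ?n1_ge0 in k2.
Qed.

(* An L^1 graph limit u need not have a gradient, but u' := tr K (u_k), for u_k in the local
   operator's domain close to u, satisfies the weak equation up to an arbitrarily small
   multiple of the supremum of the test function. *)
Lemma approx_weak B V S alpha f u K M (HE : elliptic mu A b B) : relcompact_open V ->
  local_semigroup mu A B V S -> 0 < alpha -> resolvent mu V S alpha f u ->
  0 <= K -> 0 <= M ->
  (\forall x \ae mu, V x -> `|f x| <= M) -> (\forall x \ae mu, V x -> `|u x| <= K) ->
  forall e : R, 0 < e -> exists U W, [/\ H0g mu V U W, forall x, `|U x| <= K + 1,
    n1 mu V (fun x => U x - u x) <= e &
    forall psi z N, 0 <= N -> H0g mu V psi z -> (\forall x \ae mu, V x -> `|psi x| <= N) ->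
     `|2^-1 * \int[mu]_(x in V) mxdot (A x) (W x) (z x) - \int[mu]_(x in V) (dot (B x) (W x) * psi x) -
       \int[mu]_(x in V) ((f x - alpha * u x) * psi x)| <= e * N].
Proof.
move=> rV [HS gen] a0 Hu K0 M0 fM uK e e0.
have oV := rV.1; have mV := open_measurable_rV oV.
have [Lf Lu] := resolvent_L1 mV HS Hu.
pose g x := alpha * u x - f x.
have Lg : L1 mu V g by apply: L1B => //; exact: L1Z.
have cl : L1_graph_closure mu V (local_operator mu A B V) u g by apply/gen.
pose M2 := alpha * K + M.
have M20 : 0 <= M2 by rewrite addr_ge0// mulr_ge0// ltW.
have gM : \forall x \ae mu, V x -> `|g x| <= M2.
  apply: filterS2 fM uK => x h1 h2 Vx; rewrite (le_trans (ler_normB _ _))// lerD ?h1//.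
  by rewrite normrM gtr0_norm// ler_pM2l// h2.
(* Chosen such that closeness [e / c] of both [uk] and [gk] gives [e/c + 4 M2 e/c = e/2]. *)
pose c := 2 * (1 + 4 * M2) : R.
have c0 : 0 < c by rewrite /c mulr_gt0// ltr_wpDr// mulr_ge0.
have ec0 : 0 < Num.min e (e / c) by rewrite lt_min e0 divr_gt0.
have [uk [gk [Hk h1 h2]]] := closure_approx HE rV cl ec0.
move: h1 h2; rewrite !le_min => /andP[h1 h1'] /andP[_ h2].
have [w [Hw Lgk weak]] := local_operator_weak HE rV Hk.
have [Luk2 Lw _] := Hw.
have Luk : L1 mu V uk by apply: L2_L1 => //; exact: relcompact_fin HE _ rV.
have z0 : `|0 : R| <= K by rewrite normr0.
have [t0 dt0 db0] := tr_id z0.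
have tb t := tr_bounds t K0.
have dt1 (t : R) : `|dtr K t| <= 1 by have [_ /andP[k1 k2] _ _ _] := tb t; rewrite ger0_norm.
have HU := H0g_chain (ell_fin HE) oV Hw t0 (tr_derive K) dt1 (dtr_lip K).
have [LU LW _] := HU.
have muk := L2_meas Luk2.
exists (tr K \o uk), (fun x => dtr K (uk x) *: w x); split => //.
- by move=> x /=; have [] := tb (uk x).
- apply: le_trans h1; apply: n1_le => //.
  + by apply: L1B => //; apply: L2_L1 => //; exact: relcompact_fin HE _ rV.
  + exact: L1B.
  + apply: filterS uK => x /= h /h ux; have [<- _ _] := tr_id ux.
    by apply: le_trans (tr_lip (uk x) (u x) K0) _; have [-> _ _] := tr_id ux.
move=> psi z N N0 Hpsi psiN.
have [Lpsi Lz _] := Hpsi.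
have mdb : measurable_fun V (fun x => dbulk K (uk x)).
  by apply: measurable_lip_comp muk; [|exact: dbulk_lip].
have mdt : measurable_fun V (fun x => dtr K (uk x)).
  by apply: measurable_lip_comp muk; [|exact: dtr_lip].
have db1 : \forall x \ae mu, V x -> `|dbulk K (uk x)| <= 1.
  by apply/nearW => x _; have [_ /andP[k1 k2] -> _ _] := tb (uk x); lra.
have small : \forall x \ae mu, V x -> `|dbulk K (uk x)| <= 4 * `|uk x - u x|.
  apply: filterS uK => x h /h ux; have [_ _ zu] := tr_id ux.
  by have := dbulk_lip K (uk x) (u x); rewrite zu subr0.
(* Since [|u| <= K], [dbulk K] vanishes at [u] and is thus at most [4 |uk - u|] at [uk]; so the
   truncation error [gk dbulk K (uk)] is dominated by [D], although [gk] is close to the bounded [g]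
   only in L^1. *)
pose D x := `|gk x - g x| + M2 * 4 * `|uk x - u x|.
have LD1 := L1B mV Lgk Lg; have LD2 := L1B mV Luk Lu.
have LD : L1 mu V D by apply: L1D => //; [exact: L1_abs|apply: L1Z => //; exact: L1_abs].
have intD : \int[mu]_(x in V) D x <= e / 2.
  have -> : \int[mu]_(x in V) D x = n1 mu V (fun x => gk x - g x) + M2 * 4 * n1 mu V (fun x => uk x - u x).
    rewrite RintegralD//; [|exact: L1_abs|by apply: L1Z => //; exact: L1_abs].
    by rewrite RintegralZl//; exact: L1_abs.
  have -> : e / 2 = e / c + M2 * 4 * (e / c).
    by rewrite /c; field; rewrite -/c; apply/lt0r_neq0; move: c0; rewrite /c; lra.
  by rewrite lerD// ler_wpM2l// mulr_ge0.
have Lgdb : L1 mu V (fun x => gk x * dbulk K (uk x)).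
  by apply: (L1_eq mV _ (L1_bM mV mdb Lgk db1)) => x _; rewrite mulrC.
have bulkD : n1 mu V (fun x => gk x * dbulk K (uk x)) <= \int[mu]_(x in V) D x.
  apply: int_le_ae => //; first exact: L1_abs.
  apply: filterS3 gM db1 small => x k1 k2 k3 Vx; have {}k1 := k1 Vx; have {}k2 := k2 Vx; have {}k3 := k3 Vx.
  have -> : gk x * dbulk K (uk x) = (gk x - g x) * dbulk K (uk x) + g x * dbulk K (uk x) by ring.
  rewrite (le_trans (ler_normD _ _))// !normrM lerD//; first by rewrite ler_piMr.
  by rewrite -mulrA ler_pM.
have := truncated_weak HE rV K0 N0 Hw Lgk weak Hpsi psiN.
set I0 := \int[mu]_(x in V) mxdot _ _ _; set I1 := \int[mu]_(x in V) (dot _ _ * _).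
set I2 := \int[mu]_(x in V) _ => h3.
have dtpsi : \forall x \ae mu, V x -> `|dtr K (uk x) * psi x| <= N.
  apply: filterS psiN => x h /h hN; rewrite normrM; apply: le_trans hN.
  by rewrite ler_piMl.
have mdtpsi : measurable_fun V (fun x => dtr K (uk x) * psi x).
  by apply: measurable_funM => //; exact: L2_meas Lpsi.
have Lgkp : L1 mu V (fun x => gk x * (dtr K (uk x) * psi x)).
  by apply: (L1_eq mV _ (L1_bM mV mdtpsi Lgk dtpsi)) => x _; rewrite mulrC.
have Lgp : L1 mu V (fun x => g x * psi x).
  by apply: (L1_eq mV _ (L1_bM mV (L2_meas Lpsi) Lg psiN)) => x _; rewrite mulrC.
have h4 : `|I2 - \int[mu]_(x in V) (g x * psi x)| <= N * \int[mu]_(x in V) D x.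
  rewrite -RintegralB// -RintegralZl//.
  apply: (le_trans (int_le_n1 mV (L1B mV Lgkp Lgp))); apply: int_le_ae => //.
  - by apply: L1_abs => //; exact: L1B.
  - exact: L1Z.
  - apply: filterS3 gM psiN small => x k1 k2 k3 Vx; have {}k1 := k1 Vx; have {}k2 := k2 Vx; have {}k3 := k3 Vx.
    have -> : gk x * (dtr K (uk x) * psi x) - g x * psi x =
      psi x * ((gk x - g x) * dtr K (uk x) + g x * (dtr K (uk x) - 1)) by ring.
    rewrite normrM; apply: ler_pM => //.
    rewrite (le_trans (ler_normD _ _))// !normrM lerD//; first by rewrite ler_piMr.
    rewrite -mulrA; apply: ler_pM => //.
    have [_ _ e1 _ _] := tb (uk x); rewrite distrC ger0_norm -?e1//.
have -> : \int[mu]_(x in V) ((f x - alpha * u x) * psi x) = - \int[mu]_(x in V) (g x * psi x).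
  rewrite -mulN1r -RintegralZl//; apply: int_eq => x _; rewrite /g; ring.
have h5 : N * n1 mu V (fun x => gk x * dbulk K (uk x)) <= N * (e / 2).
  by rewrite ler_wpM2l// (le_trans bulkD).
have h6 : N * \int[mu]_(x in V) D x <= N * (e / 2) by rewrite ler_wpM2l.
set I3 := \int[mu]_(x in V) (g x * psi x) in h4 *.
have -> : 2^-1 * I0 - I1 - - I3 = (2^-1 * I0 - I1 + I2) - (I2 - I3) by ring.
rewrite (le_trans (ler_normB _ _))//.
have -> : e * N = N * (e / 2) + N * (e / 2) by field.
by rewrite lerD ?(le_trans h3)// (le_trans h4).
Qed.

(** [resolvent_le] for [f] and for [- f]. That [- u] is the resolvent of [- f] takes an argument
    because the semigroup is linear only almost everywhere. *)
Lemma resolvent_bounded V S alpha f u M (mV : measurable V) (HS : submarkov_semigroup mu V S) : 0 < alpha -> 0 < M ->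
  resolvent mu V S alpha f u -> (\forall x \ae mu, V x -> `|f x| <= M) ->
  \forall x \ae mu, V x -> `|u x| <= M / alpha.
Proof.
move=> a0 M0 Hu fM.
have fM1 : \forall x \ae mu, V x -> f x <= M by apply: filterS fM => x h /h; exact: le_trans (ler_norm _).
have fM2 : \forall x \ae mu, V x -> - f x <= M.
  by apply: filterS fM => x h /h; apply: le_trans; rewrite -normrN ler_norm.
have HuN : resolvent mu V S alpha (fun x => - f x) (fun x => - u x).
  have [Lu Lh H] := generatorE mV HS Hu.
  have [/(Lp1P _ _ mV) Lu' /(Lp1P _ _ mV) Lf' Hc] := Hu.
  split; [by apply/(Lp1P _ _ mV); exact: L1N| |].
    apply/(Lp1P _ _ mV); apply: (L1_eq mV _ (L1N mV Lh)) => x _; ring.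
  apply: cvg_trans Hc; apply: near_eq_cvg; near=> t.
  have t0 : 0 < t by near: t; exact: nbhs_right_gt.
  have I1 := generator_rem mV HS t0 Lu Lh.
  have I2 : L1 mu V (fun x => (S t (fun x => - u x) x - - u x) / t - (alpha * - u x - - f x)).
    apply: (generator_rem mV HS t0 (L1N mV Lu)); apply: (L1_eq mV _ (L1N mV Lh)) => x _; ring.
  rewrite !Lpnorm1E//; congr EFin; rewrite -[LHS]n1N; apply: n1_eq_ae => //; first exact: L1N.
  have Lz := L1Z (-1) mV Lu.
  have h1 : \forall x \ae mu, V x -> S t (fun x => - u x) x = S t (fun x => -1 * u x) x.
    by apply: (sg_ae mV HS t0 (L1N mV Lu) Lz); apply/nearW => x _; rewrite mulN1r.
  apply: filterS2 h1 (sgZ mV HS (-1) t0 Lu) => x e1 e2 Vx; rewrite e1// e2//; ring.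
apply: filterS2 (resolvent_le mV HS a0 M0 Hu fM1) (resolvent_le mV HS a0 M0 HuN fM2) => x h1 h2 Vx.
have {}h1 := h1 Vx; have {}h2 := h2 Vx.
by rewrite ler_pdivlMr// mulrC -[X in X * _](gtr0_norm a0) -normrM ler_norml; lra.
Unshelve. all: end_near. Qed.

(* Testing the equation of u with u' and that of u' with u: the symmetric forms agree and
   the drift terms cancel by antisymmetry. *)
Lemma local_duality B V S S' alpha f f' u u' M (HE : elliptic mu A b B) : relcompact_open V ->
  local_semigroup mu A B V S -> local_semigroup mu A (fun x => - B x) V S' -> 0 < alpha -> 0 < M ->
  resolvent mu V S alpha f u -> resolvent mu V S' alpha f' u' ->
  (\forall x \ae mu, V x -> `|f x| <= M) -> (\forall x \ae mu, V x -> `|f' x| <= M) ->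
  \int[mu]_(x in V) (f x * u' x) = \int[mu]_(x in V) (f' x * u x).
Proof.
move=> rV HS HS' a0 M0 Hu Hu' fM f'M; have oV := rV.1; have mV := open_measurable_rV oV.
have [Lf Lu] := resolvent_L1 mV HS.1 Hu; have [Lf' Lu'] := resolvent_L1 mV HS'.1 Hu'.
have uK := resolvent_bounded mV HS.1 a0 M0 Hu fM; have u'K := resolvent_bounded mV HS'.1 a0 M0 Hu' f'M.
set K := M / alpha in uK u'K; have K0 : 0 <= K by rewrite ltW// divr_gt0.
have K10 : 0 <= K + 1 by rewrite addr_ge0.
pose h x := f x - alpha * u x; pose h' x := f' x - alpha * u' x.
have hM : \forall x \ae mu, V x -> `|h x| <= 2 * M.
  apply: filterS2 fM uK => x k1 k2 Vx; rewrite (le_trans (ler_normB _ _))// mulr_natl mulr2n lerD ?k1//.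
  by rewrite normrM gtr0_norm// mulrC -ler_pdivlMr// k2.
have h'M : \forall x \ae mu, V x -> `|h' x| <= 2 * M.
  apply: filterS2 f'M u'K => x k1 k2 Vx; rewrite (le_trans (ler_normB _ _))// mulr_natl mulr2n lerD ?k1//.
  by rewrite normrM gtr0_norm// mulrC -ler_pdivlMr// k2.
have Lh : L1 mu V h by apply: L1B => //; exact: L1Z.
have Lh' : L1 mu V h' by apply: L1B => //; exact: L1Z.
have bM (k v : E -> R) c : L1 mu V k -> L1 mu V v -> (\forall x \ae mu, V x -> `|k x| <= c) -> L1 mu V (fun x => k x * v x).
  by move=> Lk Lv; apply: L1_bM => //; exact: L1_meas Lk.
have main : \int[mu]_(x in V) (h x * u' x) = \int[mu]_(x in V) (h' x * u x).
  apply/eqP; rewrite -subr_eq0; apply/eqP; apply: eps_zero; exists (2 * (K + 1) + 4 * M) => e e0 _.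
  have [U [W [HU UK Uu weak]]] := approx_weak HE rV HS a0 Hu K0 (ltW M0) fM uK e0.
  have [U' [W' [HU' U'K U'u' weak']]] := approx_weak (elliptic_opp HE) rV HS' a0 Hu' K0 (ltW M0) f'M u'K e0.
  have UKa : \forall x \ae mu, V x -> `|U x| <= K + 1 by apply/nearW => x _.
  have U'Ka : \forall x \ae mu, V x -> `|U' x| <= K + 1 by apply/nearW => x _.
  have := weak U' W' (K + 1) K10 HU' U'Ka; have := weak' U W (K + 1) K10 HU UKa.
  rewrite (drift_antisym HE rV HU HU' UKa U'Ka).
  have LU : L1 mu V U by apply: L2_L1; [|exact: relcompact_fin HE _ rV|have [] := HU].
  have LU' : L1 mu V U' by apply: L2_L1; [|exact: relcompact_fin HE _ rV|have [] := HU'].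
  have e1 : \int[mu]_(x in V) mxdot (A x) (W' x) (W x) = \int[mu]_(x in V) mxdot (A x) (W x) (W' x).
    apply: int_eq => x _; rewrite !(mxdotA (ell_sym HE)) exchange_big.
    apply: eq_bigr => i _; apply: eq_bigr => j _; rewrite (Asw (ell_sym HE)); ring.
  have e2 : \int[mu]_(x in V) (dot (- B x) (W' x) * U x) = - \int[mu]_(x in V) (dot (B x) (W' x) * U x).
    rewrite -mulN1r -RintegralZl//; first by apply: int_eq => x _; rewrite -scaleN1r dotZl; ring.
    have [_ LW' _] := HU'; have [LU2 _ _] := HU.
    by apply: (L1_eq mV _ (L1_bM mV (L2_meas LU2) (drift_L1 HE rV LW') UKa)) => x _; exact: mulrC.
  rewrite e1 e2; set I0 := \int[mu]_(x in V) mxdot _ _ _; set I1 := \int[mu]_(x in V) (dot _ _ * _).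
  rewrite -/(h _) -/(h' _); set J := \int[mu]_(x in V) _; set J' := \int[mu]_(x in V) _ => k1 k2.
  have close (k v v' : E -> R) : L1 mu V k -> L1 mu V v -> L1 mu V v' ->
      (\forall x \ae mu, V x -> `|k x| <= 2 * M) -> n1 mu V (fun x => v' x - v x) <= e ->
      `|\int[mu]_(x in V) (k x * v x) - \int[mu]_(x in V) (k x * v' x)| <= 2 * M * e.
    move=> Lk Lv Lv' kM vv'; have LB := L1B mV Lv Lv'; have LBM := bM _ _ _ Lk LB kM.
    rewrite -RintegralB//; [|exact: bM kM|exact: bM kM].
    rewrite (@int_eq _ _ _ mu _ _ (fun x => k x * (v x - v' x))); last by move=> x _; rewrite mulrBr.
    apply: (le_trans (int_le_n1 mV LBM)).
    apply: (@le_trans _ _ (2 * M * n1 mu V (fun x => v x - v' x))); last first.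
      by rewrite n1BC ler_wpM2l// mulr_ge0// ltW.
    rewrite -RintegralZl//; last exact: L1_abs.
    apply: int_le_ae => //; [exact: L1_abs|by apply: L1Z => //; exact: L1_abs|].
    by apply: filterS kM => x hk /hk {}hk; rewrite normrM ler_wpM2r.
  have := close h u' U' Lh Lu' LU' hM U'u'; have := close h' u U Lh' Lu LU h'M Uu.
  move: k1 k2; rewrite -/J -/J' !ler_norml => /andP[a1 a2] /andP[a3 a4] /andP[a5 a6] /andP[a7 a8].
  by clear -a1 a2 a3 a4 a5 a6 a7 a8; apply/andP; split; lra.
have s1 : \int[mu]_(x in V) (h x * u' x) = \int[mu]_(x in V) (f x * u' x) - alpha * \int[mu]_(x in V) (u x * u' x).
  have L := bM _ _ _ Lu Lu' uK; rewrite -RintegralZl// -RintegralB//; [|exact: bM fM|exact: L1Z].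
  by apply: int_eq => x _; rewrite /h; ring.
have s2 : \int[mu]_(x in V) (h' x * u x) = \int[mu]_(x in V) (f' x * u x) - alpha * \int[mu]_(x in V) (u x * u' x).
  have L := bM _ _ _ Lu Lu' uK; rewrite -RintegralZl// -RintegralB//; [|exact: bM f'M|exact: L1Z].
  by apply: int_eq => x _; rewrite /h'; ring.
by apply: (addIr (- (alpha * \int[mu]_(x in V) (u x * u' x)))); rewrite -s1 -s2.
Qed.

End local_resolvents.

(** * Resolvents on the whole space *)

Section global_resolvents.
Context {R : realType} {d : nat}.
Local Notation E := 'rV[R]_d.
Variables (mu : {measure set E -> \bar R}) (A : E -> 'M[R]_d) (b : E -> E).
Implicit Types (x : E) (V : set E) (u v f g psi k : E -> R) (w z B : E -> E) (i j : 'I_d) (K N M : R).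

(** Uniform integrability: where [|p| <= K] the smallness of [k] in L^1 is used, elsewhere its bound
    [M] and the tail of [p]. It serves to pair functions that are only in L^1. *)
Lemma small_pairing V p M e : measurable V -> L1 mu V p -> 0 < e -> 0 < M ->
  exists2 del : R, 0 < del & forall k, L1 mu V k -> (\forall x \ae mu, V x -> `|k x| <= M) ->
    n1 mu V k <= del -> `|\int[mu]_(x in V) (p x * k x)| <= e.
Proof.
move=> mV Lp e0 M0; have e1 : 0 < e / (2 * M) by rewrite divr_gt0// mulr_gt0.
have [K [K0 hK]] := L1_tail mV Lp (L1_meas Lp) e1.
exists (e / (2 * K)); first by rewrite divr_gt0// mulr_gt0.
move=> k Lk kM kd; have mp := L1_meas Lp; have mk := L1_meas Lk.
have Lpk : L1 mu V (fun x => p x * k x).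
  by apply: (L1_eq mV _ (L1_bM mV mk Lp kM)) => x _; exact: mulrC.
have Lt : L1 mu V (fun x => `|p x| * (K < `|p x|)%R%:R).
  apply: (L1_dom mV _ (L1_abs mV Lp)).
    apply: measurable_funM; first exact: measurableT_comp.
    rewrite (_ : (fun x => _) = (fun b : bool => b%:R : R) \o (fun x => K < `|p x|)) //.
    apply: measurableT_comp => //; apply: measurable_fun_ltr => //; exact: measurableT_comp.
  by apply/nearW => x _; case: ltP => _; rewrite ?mulr1 ?mulr0 ?normr0// normr_id.
apply: (le_trans (int_le_n1 mV Lpk)).
apply: (@le_trans _ _ (\int[mu]_(x in V) (K * `|k x| + M * (`|p x| * (K < `|p x|)%R%:R)))); last first.
  rewrite RintegralD//; [|by apply: L1Z => //; exact: L1_abs|exact: L1Z].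
  rewrite !RintegralZl//; last exact: L1_abs.
  have h1 : K * n1 mu V k <= K * (e / (2 * K)) by rewrite ler_wpM2l ?(ltW K0).
  have h2 : M * \int[mu]_(x in V) (`|p x| * (K < `|p x|)%R%:R) <= M * (e / (2 * M)).
    by rewrite ler_wpM2l ?(ltW M0).
  apply: (le_trans (lerD h1 h2)); rewrite le_eqVlt; apply/orP; left; apply/eqP.
  by field; rewrite !lt0r_neq0.
apply: int_le_ae => //.
- exact: L1_abs.
- by apply: L1D => //; apply: L1Z => //; exact: L1_abs.
apply: filterS kM => x h /h kx; rewrite normrM.
case: (ltP K `|p x|) => pK.
  rewrite mulr1 (le_trans (ler_wpM2l (normr_ge0 (p x)) kx))// mulrC lerDr mulr_ge0//.
  exact: ltW.
by rewrite mulr0 mulr0 addr0 ler_wpM2r.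
Qed.

Lemma cont_bounded_cube (f : E -> R) (r : R) : 0 < r -> continuous f ->
  exists c : R, forall x, cube r x -> `|f x| <= c.
Proof.
move=> r0 cf; have r1 : 0 < r + 1 by lra.
have [chi [hc _ c1 _]] := cutoff (d := d) r1.
have [C1 _ _] := Cc_smooth1 hc.
have [s s0 out] := Cc1_out (Cc_smooth1 hc).
have cc : continuous (fun x => f x * chi x) by apply: contM => //; exact: Ck_cont C1.
have o x : s < `|x| -> f x * chi x = 0.
  by move=> /out /closure_supp_vanish1 ->; rewrite mulr0.
have [c c0 hc'] := cont_bounded cc o; exists c => x xr.
by have := hc' x; rewrite c1 ?mulr1//; move: xr; rewrite /cube /=; lra.
Qed.

(** Density in the test function. On the bounded set [V] the derivatives of [h] are bounded, so both
    terms are continuous in the H^{1,2} norm. *)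
Lemma ibp_H0g V h u w B (HE : elliptic mu A b B) : relcompact_open V -> Ck 2 h -> H0g mu V u w ->
  L2 mu V (diffop A b h) /\
  2^-1 * \int[mu]_(x in V) mxdot (A x) (gradient h x) (w x) +
  \int[mu]_(x in V) (diffop A b h x * u x) = 0.
Proof.
move=> rV Ch [Lu Lw H]; have oV := rV.1; have mV := open_measurable_rV oV.
have [r r0 Vr] := relcompact_cube rV; have [nu nu0 Anu] := ell_bd HE r.
have bdd (f : E -> R) : continuous f -> exists c : R, forall x, V x -> `|f x| <= c.
  by move=> cf; have [c hc] := cont_bounded_cube r0 cf; exists c => x /Vr; exact: hc.
have Lcont (f : E -> R) : continuous f -> L2 mu V f.
  move=> cf; have [c hc] := bdd f cf; apply: (L2_bounded mV (relcompact_fin HE rV) (M := c)).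
    exact: measurable_funS measurableT _ (continuous_measurable_rV cf).
  by apply/nearW.
have ch i : continuous (partial i h) by exact: Ck_cont (Ck_partial i Ch).
have chh i j : continuous (partial i (partial j h)) by exact: Ck_cont (Ck_partial i (Ck_partial j Ch)).
have mAV i j : measurable_fun V (fun x => A x i j) by apply: measurable_funS (ell_meas HE i j).
have Lac (f : E -> R) i j : continuous f -> L2 mu V (fun x => A x i j * f x).
  move=> cf; apply: (L2_bM (M := nu) mV (mAV i j) (Lcont f cf)).
  by apply/nearW => x /Vr; exact: Anu.
have Lbc i : L2 mu V (fun x => b x ord0 i * partial i h x).
  have [c hc] := bdd _ (ch i); have Lb : L2 mu V (fun x => b x ord0 i).
    by apply: (relcompact_L2 rV) => s; exact: (ell_b HE).
  apply: (L2_eq mV (f := fun x => partial i h x * b x ord0 i)); first by move=> x _; exact: mulrC.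
  apply: (L2_bM (M := c) mV _ Lb); last by apply/nearW.
  exact: measurable_funS measurableT _ (continuous_measurable_rV (ch i)).
have LD : L2 mu V (diffop A b h).
  apply: L2D => //.
    by apply: L2Z => //; apply: L2_sum => // i; apply: L2_sum => // j; exact: Lac.
  apply: (L2_eq mV (f := fun x => \sum_i b x ord0 i * partial i h x)); last exact: L2_sum.
  by move=> x _; apply: eq_bigr => i _; rewrite mxE.
split => //.
pose c j x := \sum_i A x i j * partial i h x.
have Lc j : L2 mu V (c j) by apply: L2_sum => // i; exact: Lac.
have Ec (y : E -> E) x : mxdot (A x) (gradient h x) (y x) = \sum_j c j x * y x ord0 j.
  rewrite (mxdotA (ell_sym HE)) exchange_big; apply: eq_bigr => j _.
  by rewrite mulr_suml; apply: eq_bigr => i _; rewrite mxE; ring.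
have If (y : E -> E) : (forall i, L2 mu V (fun x => y x ord0 i)) -> L1 mu V (fun x => mxdot (A x) (gradient h x) (y x)).
  move=> Ly; apply: (L1_eq mV (f := fun x => \sum_j c j x * y x ord0 j)); first by move=> x _; rewrite Ec.
  by apply: L1_sum => // j; exact: L2_mul.
apply: eps_zero; exists (\sum_j n2 mu V (c j) + n2 mu V (diffop A b h)) => e e0 _.
have [v [hv v1 v2]] := H e e0; have hv1 := Cc_smooth1 hv; have [Cv _ vV] := hv1.
have Lv : L2 mu V v by exact: Cc1_L2 (ell_fin HE) _ _ _ mV hv1.
have Ldv i : L2 mu V (fun x => gradient v x ord0 i).
  by apply: L2_eq mV _ (Cc1_partial_L2 (ell_fin HE) i mV hv1) => x _; rewrite mxE.
have [Iv] := ell_ibp HE Ch (Cc1_subset (@subsetT _ V) hv1).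
have vout x : ~ V x -> 2^-1 * mxdot (A x) (gradient h x) (gradient v x) + diffop A b h x * v x = 0.
  move=> Vx; have o : ~ closure [set y | v y != 0] x by move=> /vV.
  rewrite (closure_supp_vanish1 o) mulr0 addr0 (Ec (gradient v)) big1 ?mulr0// => j _.
  by rewrite mxE partial_vanish// mulr0.
rewrite (@int_ext _ _ _ _ V)//.
rewrite RintegralD//; [|by apply: L1Z => //; exact: If|exact: L2_mul].
rewrite RintegralZl//; last exact: If.
move=> zv; rewrite -[X in `|X|]subr0 -[X in _ - X]zv.
have LDw i : L2 mu V (fun x => (w x - gradient v x) ord0 i).
  by apply: L2_eq mV _ (L2B mV (Lw i) (Ldv i)) => x _; rewrite !mxE.
have LBu := L2B mV Lu Lv.
have -> : 2^-1 * \int[mu]_(x in V) mxdot (A x) (gradient h x) (w x) + \int[mu]_(x in V) (diffop A b h x * u x) -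
  (2^-1 * \int[mu]_(x in V) mxdot (A x) (gradient h x) (gradient v x) + \int[mu]_(x in V) (diffop A b h x * v x)) =
  2^-1 * \int[mu]_(x in V) mxdot (A x) (gradient h x) (w x - gradient v x) +
  \int[mu]_(x in V) (diffop A b h x * (u x - v x)).
  have -> : \int[mu]_(x in V) mxdot (A x) (gradient h x) (w x - gradient v x) =
     \int[mu]_(x in V) mxdot (A x) (gradient h x) (w x) - \int[mu]_(x in V) mxdot (A x) (gradient h x) (gradient v x).
    rewrite -RintegralB//; [|exact: If|exact: If].
    apply: int_eq => x _; rewrite -scaleN1r mxdotDr mxdotZr; ring.
  have -> : \int[mu]_(x in V) (diffop A b h x * (u x - v x)) =
     \int[mu]_(x in V) (diffop A b h x * u x) - \int[mu]_(x in V) (diffop A b h x * v x).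
    rewrite -RintegralB//; [|exact: L2_mul|exact: L2_mul].
    by apply: int_eq => x _; rewrite mulrBr.
  by ring.
rewrite (le_trans (ler_normD _ _))// mulrDl lerD//; last first.
  apply: (le_trans (cauchy_schwarz mV LD LBu)); rewrite ler_wpM2l ?n2_ge0//.
  by rewrite n2BC.
rewrite normrM (ger0_norm (_ : 0 <= 2^-1))//.
apply: (@le_trans _ _ `|\int[mu]_(x in V) mxdot (A x) (gradient h x) (w x - gradient v x)|).
  rewrite -[leRHS]mul1r ler_wpM2r//; lra.
have -> : \int[mu]_(x in V) mxdot (A x) (gradient h x) (w x - gradient v x) =
  \int[mu]_(x in V) \sum_j c j x * (w x - gradient v x) ord0 j.
  by apply: int_eq => x _; rewrite -(Ec (fun x => w x - gradient v x)).
have S (s : seq 'I_d) : `|\int[mu]_(x in V) \sum_(j <- s) c j x * (w x - gradient v x) ord0 j| <=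
   (\sum_(j <- s) n2 mu V (c j)) * e.
  elim: s => [|j s IH].
    rewrite big_nil mul0r (_ : Rintegral _ _ _ = 0) ?normr0//.
    by rewrite -[RHS](int0 mu V); apply: int_eq => x _; rewrite big_nil.
  rewrite (@int_eq _ _ _ mu _ _ (fun x => c j x * (w x - gradient v x) ord0 j +
      \sum_(j <- s) c j x * (w x - gradient v x) ord0 j)); last by move=> x _; rewrite big_cons.
  have Lm i := L2_mul mV (Lc i) (LDw i).
  rewrite (RintegralD _ (Lm j))//; last by apply: L1_sum.
  rewrite big_cons mulrDl (le_trans (ler_normD _ _))// lerD//.
  apply: (le_trans (cauchy_schwarz mV (Lc j) (LDw j))); rewrite ler_wpM2l ?n2_ge0//.
  apply: le_trans (v2 j); rewrite [leRHS]n2BC le_eqVlt; apply/orP; left; apply/eqP.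
  by apply: n2_eq => x _; rewrite !mxE.
exact: S.
Qed.

(** The construction supplies some resolvent [g0] of [f] as the limit; uniqueness identifies it with
    the given [g]. *)
Lemma constructed_limit B T Vn alpha f g : constructed_semigroup mu A B T -> exhaustion Vn ->
  0 < alpha -> resolvent mu setT T alpha f g ->
  exists S gn, [/\ forall n, local_semigroup mu A B (Vn n) (S n),
    forall n, resolvent mu (Vn n) (S n) alpha f (gn n) &
    forall e : R, 0 < e -> exists N : nat, forall n, (N <= n)%N ->
      n1 mu setT (fun x => (gn n \_ (Vn n)) x - g x) <= e].
Proof.
move=> [HT cT] ex a0 Hg; have [Lf Lg] := resolvent_L1 measurableT HT Hg.
have [S HS /(_ alpha f a0 ((Lp1P _ _ measurableT).2 Lf))[gn Hgn [g0 Hg0 cg]]] := cT Vn ex.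
exists S, gn; split => // e e0; have [HV _ _] := ex.
have [_ Lg0] := resolvent_L1 measurableT HT Hg0.
have Lr n : L1 mu setT (fun x => (gn n \_ (Vn n)) x).
  have mVn := open_measurable_rV (HV n).1.
  have [_ Lgn] := resolvent_L1 mVn (HS n).1 (Hgn n).
  apply: (@L1_ext _ _ _ _ (Vn n)) => //; first by move=> x Vx; rewrite /patch memNset.
  by apply: (L1_eq mVn _ Lgn) => x Vx; rewrite /patch mem_set.
have Ln n := L1B measurableT (Lr n) Lg0.
have /(cvg_Lpnorm1 measurableT Ln)/cvgr0_norm_le/(_ e e0) [N _ hN] := cg.
exists N => n Nn; have := hN n Nn; rewrite /= ger0_norm ?n1_ge0//; apply: le_trans.
rewrite le_eqVlt; apply/orP; left; apply/eqP; apply: n1_eq_ae => //; first exact: L1B.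
by apply: filterS (resolvent_unique measurableT HT a0 Hg Hg0) => x e1 _; rewrite e1.
Qed.

Lemma limit_pairing Vn gn g k M : (forall n, measurable (Vn n)) -> (forall n, L1 mu (Vn n) (gn n)) ->
  L1 mu setT g -> measurable_fun setT k -> 0 <= M -> (\forall x \ae mu, `|k x| <= M) ->
  (forall e : R, 0 < e -> exists N : nat, forall n, (N <= n)%N ->
      n1 mu setT (fun x => (gn n \_ (Vn n)) x - g x) <= e) ->
  (\int[mu]_(x in Vn n) (k x * gn n x)) @[n --> \oo] --> \int[mu]_x (k x * g x).
Proof.
move=> mV Lgn Lg mk M0 kM H; apply/cvgrPdist_le => e e0.
have e1 : 0 < e / (M + 1) by rewrite divr_gt0// ltr_wpDl.
have [N hN] := H _ e1; exists N => // n /= Nn.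
have Lr : L1 mu setT (fun x => (gn n \_ (Vn n)) x).
  apply: (@L1_ext _ _ _ _ (Vn n)) => //; first by move=> x Vx; rewrite /patch memNset.
  by apply: (L1_eq (mV n) _ (Lgn n)) => x Vx; rewrite /patch mem_set.
have kMT : \forall x \ae mu, setT x -> `|k x| <= M by apply: filterS kM => x.
have -> : \int[mu]_(x in Vn n) (k x * gn n x) = \int[mu]_x (k x * (gn n \_ (Vn n)) x).
  rewrite Rintegral_mkcond; apply: int_eq => x _; rewrite /patch.
  by case: ifP => _//; rewrite mulr0.
have LB := L1B measurableT Lr Lg.
have LkB := L1_bM measurableT mk LB kMT.
rewrite distrC -RintegralB//; [|exact: L1_bM kMT|exact: L1_bM kMT].
rewrite (@int_eq _ _ _ mu _ _ (fun x => k x * ((gn n \_ (Vn n)) x - g x))); last by move=> x _; rewrite mulrBr.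
apply: (le_trans (int_le_n1 measurableT LkB)).
apply: (@le_trans _ _ (M * n1 mu setT (fun x => (gn n \_ (Vn n)) x - g x))).
  rewrite -RintegralZl//; last exact: L1_abs.
  apply: int_le_ae => //; [exact: L1_abs|by apply: L1Z => //; exact: L1_abs|].
  by apply: filterS kM => x hk _; rewrite normrM ler_wpM2r.
apply: (@le_trans _ _ (M * (e / (M + 1)))); first by rewrite ler_wpM2l// hN.
rewrite mulrA ler_pdivrMr ?ltr_wpDl// mulrC ler_wpM2l ?(ltW e0)//; lra.
Qed.

Definition balls n : set E := [set x | `|x| < n.+1%:R].

Lemma balls_exhaustion : exhaustion balls.
Proof.
split=> [n|n x|]; first exact: relcompact_ball.
  by rewrite /balls /= => h; apply: lt_le_trans h _; rewrite ler_nat.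
by rewrite -subTset => x _; have [n hn] := nat_gt `|x|; exists n.
Qed.

Lemma resolvent_exists B T alpha f : constructed_semigroup mu A B T -> 0 < alpha -> L1 mu setT f ->
  exists g, resolvent mu setT T alpha f g.
Proof.
move=> [HT cT] a0 Lf.
have [S HS /(_ alpha f a0 ((Lp1P _ _ measurableT).2 Lf))[gn Hgn [g0 Hg0 cg]]] := cT _ balls_exhaustion.
by exists g0.
Qed.

(** Local duality on the balls, with both families of local resolvents taken along the same
    exhaustion, passes to the limit. *)
Lemma resolvent_duality B T T' alpha f f' g g' M (HE : elliptic mu A b B) :
  constructed_semigroup mu A B T -> constructed_semigroup mu A (fun x => - B x) T' ->
  0 < alpha -> 0 < M -> resolvent mu setT T alpha f g -> resolvent mu setT T' alpha f' g' ->
  (\forall x \ae mu, `|f x| <= M) -> (\forall x \ae mu, `|f' x| <= M) ->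
  \int[mu]_x (f x * g' x) = \int[mu]_x (f' x * g x).
Proof.
move=> HT HT' a0 M0 Hg Hg' fM f'M.
have [S [gn [HS Hgn cg]]] := constructed_limit HT balls_exhaustion a0 Hg.
have [S' [gn' [HS' Hgn' cg']]] := constructed_limit HT' balls_exhaustion a0 Hg'.
have [rV _ _] := balls_exhaustion.
have mV n := open_measurable_rV (rV n).1.
have [Lf Lg] := resolvent_L1 measurableT HT.1 Hg; have [Lf' Lg'] := resolvent_L1 measurableT HT'.1 Hg'.
have Lgn n := (resolvent_L1 (mV n) (HS n).1 (Hgn n)).2.
have Lgn' n := (resolvent_L1 (mV n) (HS' n).1 (Hgn' n)).2.
have c1 := limit_pairing mV Lgn Lg (L1_meas Lf') (ltW M0) f'M cg.
have c2 := limit_pairing mV Lgn' Lg' (L1_meas Lf) (ltW M0) fM cg'.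
have e n : \int[mu]_(x in balls n) (f x * gn' n x) = \int[mu]_(x in balls n) (f' x * gn n x).
  by apply: (local_duality HE (rV n) (HS n) (HS' n) a0 M0 (Hgn n) (Hgn' n)); [apply: filterS fM|apply: filterS f'M].
have {}c2 : (\int[mu]_(x in balls n) (f' x * gn n x)) @[n --> \oo] --> \int[mu]_x (f x * g' x).
  by apply: cvg_trans c2; apply: near_eq_cvg; apply/nearW => n; rewrite e.
exact: cvg_unique c2 c1.
Qed.

End global_resolvents.

(** * Conservation of mass by the resolvent *)

Section mass_conservation.
Context {R : realType} {d : nat}.
Local Notation E := 'rV[R]_d.
Variables (mu : {measure set E -> \bar R}) (A : E -> 'M[R]_d) (b B : E -> E).
Hypothesis HE : elliptic mu A b B.
Implicit Types (x : E) (V : set E) (u v f g h psi k : E -> R) (w z : E -> E) (i j : 'I_d) (K N M : R).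

(** The drift of the formal adjoint: in L^2(mu), transposition reverses the divergence-free part
    [B]. *)
Let c x := b x - B x.

Lemma diffop_drift v x : diffop A c v x = diffop A b v x - dot (B x) (gradient v x).
Proof. by rewrite /diffop /c dotDl -scaleN1r dotZl; ring. Qed.

(** All derivatives are moved to [v]: the form becomes [- diffop A b v], and antisymmetry turns the
    drift around. As [u] has no gradient this is done for the approximant [U]; [diffop A c v] is
    then paired with [U - u] by [small_pairing]. *)
Lemma weak_test V S alpha f u v M : relcompact_open V -> local_semigroup mu A B V S ->
  0 < alpha -> 0 < M -> resolvent mu V S alpha f u -> (\forall x \ae mu, V x -> `|f x| <= M) ->
  Ck 2 v -> Cc1 V v ->
  L1 mu V (fun x => diffop A c v x * u x) /\
  \int[mu]_(x in V) (f x * v x) = \int[mu]_(x in V) ((alpha * v x - diffop A c v x) * u x).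
Proof.
move=> rV HS a0 M0 Hu fM Cv hv; have oV := rV.1; have mV := open_measurable_rV oV.
have [Lf Lu] := resolvent_L1 mV HS.1 Hu.
have uK := resolvent_bounded mV HS.1 a0 M0 Hu fM.
set K := M / alpha in uK; have K0 : 0 <= K by rewrite ltW// divr_gt0.
have [N N0 vN] := Cc1_bounded hv.
have vNa : \forall x \ae mu, V x -> `|v x| <= N by apply/nearW => x _; have [] := vN x.
have Hv := H0g_Cc1 (ell_fin HE) oV hv.
have [Lv Ldv _] := Hv.
have [LD _] := ibp_H0g HE rV Cv Hv.
have fin := relcompact_fin HE rV.
have LBv := drift_L1 HE rV Ldv.
have Lp : L1 mu V (diffop A c v).
  apply: (L1_eq mV (f := fun x => diffop A b v x - dot (B x) (gradient v x))).
    by move=> x _; rewrite diffop_drift.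
  by apply: L1B => //; exact: L2_L1.
have Lpu : L1 mu V (fun x => diffop A c v x * u x).
  by apply: (L1_eq mV _ (L1_bM mV (L1_meas Lu) Lp uK)) => x _; exact: mulrC.
split => //.
have Lfv : L1 mu V (fun x => f x * v x).
  by apply: (L1_eq mV _ (L1_bM mV (L2_meas Lv) Lf vNa)) => x _; exact: mulrC.
have Lvu : L1 mu V (fun x => v x * u x) by apply: L1_bM mV (L2_meas Lv) Lu vNa.
have e1 : \int[mu]_(x in V) ((f x - alpha * u x) * v x) = \int[mu]_(x in V) (f x * v x) - alpha * \int[mu]_(x in V) (v x * u x).
  have L := L1Z alpha mV Lvu; rewrite -RintegralZl// -RintegralB//; apply: int_eq => x _; ring.
have e2 : \int[mu]_(x in V) ((alpha * v x - diffop A c v x) * u x) =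
    alpha * \int[mu]_(x in V) (v x * u x) - \int[mu]_(x in V) (diffop A c v x * u x).
  have L := L1Z alpha mV Lvu; rewrite -RintegralZl// -RintegralB//; apply: int_eq => x _; ring.
suff z : \int[mu]_(x in V) (diffop A c v x * u x) + \int[mu]_(x in V) ((f x - alpha * u x) * v x) = 0.
  by rewrite e2; move: z; rewrite e1; lra.
apply: eps_zero; exists (N + 1) => e e0 _.
have M20 : 0 < 2 * K + 1 by rewrite ltr_wpDl// mulr_ge0.
have [del del0 small] := small_pairing mV Lp e0 M20.
have m0 : 0 < Num.min del e by rewrite lt_min del0.
have [U [W [HU UK Uu weak]]] := approx_weak HE rV HS a0 Hu K0 (ltW M0) fM uK m0.
have [LU LW _] := HU; have LU1 : L1 mu V U by exact: L2_L1.
move: Uu; rewrite le_min => /andP[Uu _].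
have UKa : \forall x \ae mu, V x -> `|U x| <= N + K + 1.
  by apply/nearW => x _; apply: (le_trans (UK x)); rewrite lerD2r lerDr.
have vKa : \forall x \ae mu, V x -> `|v x| <= N + K + 1.
  by apply/nearW => x _; have [h _] := vN x; apply: (le_trans h); rewrite -addrA lerDl addr_ge0.
have := weak v (gradient v) N N0 Hv vNa.
have [_ ibp] := ibp_H0g HE rV Cv HU.
have -> : 2^-1 * \int[mu]_(x in V) mxdot (A x) (W x) (gradient v x) = - \int[mu]_(x in V) (diffop A b v x * U x).
  apply/eqP; rewrite -addr_eq0 -ibp; apply/eqP; congr (_ * _ + _); apply: int_eq => x _.
  rewrite !(mxdotA (ell_sym HE)) exchange_big.
  by apply: eq_bigr => i _; apply: eq_bigr => j _; rewrite (Asw (ell_sym HE)); ring.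
rewrite (drift_antisym HE rV HU Hv UKa vKa).
have LdU : L1 mu V (fun x => dot (B x) (gradient v x) * U x).
  by apply: (L1_eq mV _ (L1_bM mV (L2_meas LU) LBv UKa)) => x _; exact: mulrC.
have LbU : L1 mu V (fun x => diffop A b v x * U x) by exact: L2_mul.
have LpU : L1 mu V (fun x => diffop A c v x * U x).
  by apply: (L1_eq mV _ (L1_bM mV (L2_meas LU) Lp UKa)) => x _; exact: mulrC.
have -> : - (\int[mu]_(x in V) (diffop A b v x * U x)) - - (\int[mu]_(x in V) (dot (B x) (gradient v x) * U x)) =
   - \int[mu]_(x in V) (diffop A c v x * U x).
  rewrite opprK addrC -opprB; congr (- _); rewrite -RintegralB//; apply: int_eq => x _.
  by rewrite diffop_drift; ring.
have LUu := L1B mV LU1 Lu.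
have UuK : \forall x \ae mu, V x -> `|U x - u x| <= 2 * K + 1.
  apply: filterS uK => x h /h ux; rewrite (le_trans (ler_normB _ _))//.
  by have Ux := UK x; clear -Ux ux; lra.
have := small _ LUu UuK Uu.
have -> : \int[mu]_(x in V) (diffop A c v x * (U x - u x)) =
   \int[mu]_(x in V) (diffop A c v x * U x) - \int[mu]_(x in V) (diffop A c v x * u x).
  by rewrite -RintegralB//; apply: int_eq => x _; rewrite mulrBr.
set I1 := \int[mu]_(x in V) (diffop A c v x * U x); set I2 := \int[mu]_(x in V) (diffop A c v x * u x).
set I3 := \int[mu]_(x in V) _.
have hN : Num.min del e * N <= e * N by rewrite ler_wpM2r// ge_min lexx orbT.
rewrite !ler_norml mulrDl mul1r => /andP[a1 a2] /andP[a3 a4].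
by clear -hN a1 a2 a3 a4; apply/andP; split; lra.
Qed.

(** The pointwise inequality for [v] is multiplied by [u], which is nonnegative because [f] is. *)
Lemma supersolution_test V S alpha f u v M : relcompact_open V -> local_semigroup mu A B V S ->
  0 < alpha -> 0 < M -> resolvent mu V S alpha f u -> (\forall x \ae mu, V x -> `|f x| <= M) ->
  (\forall x \ae mu, V x -> 0 <= f x) -> Ck 2 v -> Cc1 V v ->
  (\forall x \ae mu, V x -> alpha * v x - diffop A c v x <= alpha) ->
  \int[mu]_(x in V) (f x * v x) <= alpha * \int[mu]_(x in V) u x.
Proof.
move=> rV HS a0 M0 Hu fM f0 Cv hv sup; have oV := rV.1; have mV := open_measurable_rV oV.
have [Lpu ->] := weak_test rV HS a0 M0 Hu fM Cv hv.
have [Lf Lu] := resolvent_L1 mV HS.1 Hu.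
have u0 := resolvent_ge0 mV HS.1 a0 Hu f0.
have [N N0 vN] := Cc1_bounded hv; have [C1 _ _] := hv.
have vNa : \forall x \ae mu, V x -> `|v x| <= N by apply/nearW => x _; have [] := vN x.
have mv : measurable_fun V v by apply: measurable_funS (Ck_measurable C1).
have Lvu := L1_bM mV mv Lu vNa.
rewrite -RintegralZl//; apply: int_le_ae => //.
- apply: (L1_eq mV (f := fun x => alpha * (v x * u x) - diffop A c v x * u x)); first by move=> x _; ring.
  by apply: L1B => //; exact: L1Z.
- exact: L1Z.
by apply: filterS2 sup u0 => x h1 h2 Vx; rewrite ler_wpM2r ?h1 ?h2.
Qed.

Lemma diffop_comp h (F F' F'' : R -> R) x : Ck 2 h ->
  (forall x, is_derive (h x) 1 F (F' (h x))) -> (forall x, is_derive (h x) 1 F' (F'' (h x))) ->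
  continuous (F'' \o h) ->
  diffop A c (F \o h) x =
    2^-1 * F'' (h x) * mxdot (A x) (gradient h x) (gradient h x) + F' (h x) * diffop A c h x.
Proof.
move=> Ch d1 d2 cF; have [_ p1 p2] := Ck2_comp Ch d1 d2 cF.
rewrite /diffop (mxdotA (ell_sym HE)) mulrDr addrA; congr (_ + _); last first.
  by rewrite -dotZr; congr dot; apply/rowP => i; rewrite !mxE p1.
rewrite -mulrA (mulrCA (F' _)) -mulrDr; congr (_ * _).
rewrite !mulr_sumr -big_split; apply: eq_bigr => i _ /=.
rewrite !mulr_sumr -big_split; apply: eq_bigr => j _ /=.
by rewrite p2 !mxE; ring.
Qed.

Lemma norm_enorm x : `|x| <= enorm x.
Proof.
apply: rV_normP => [|i]; first exact: sqrtr_ge0.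
rewrite -sqrtr_sqr ler_sqrt ?dot_ge0// /dot (bigD1 i)//= -expr2 lerDl.
by apply: sumr_ge0 => j _; exact: sqr_ge0.
Qed.

Lemma sublevel_compact h (a : R) : continuous h -> (forall K, exists r : R, forall x, r <= enorm x -> K <= h x) ->
  closed [set x | h x <= a] /\ compact [set x | h x <= a].
Proof.
move=> ch hinf; have cl : closed [set x | h x <= a].
  rewrite (_ : [set x | _] = h @^-1` [set t | t <= a])//.
  by apply: preimage_closed.
split => //; have [r hr] := hinf (a + 1).
apply: (closed_bounded_compact (r := r)) => // x /= ha; rewrite /cube /=.
apply: (le_trans (norm_enorm x)); have [//|/ltW/hr] := leP (enorm x) r; lra.
Qed.

End mass_conservation.

(** * Lyapunov functions *)

Section lyapunov.
Context {R : realType} {d : nat}.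
Local Notation E := 'rV[R]_d.
Variables (mu : {measure set E -> \bar R}) (A : E -> 'M[R]_d) (b B : E -> E).
Hypothesis HE : elliptic mu A b B.
Implicit Types (x : E) (V : set E) (u v f g h psi k : E -> R) (w z : E -> E) (i j : 'I_d) (K N M : R).

Let c x := b x - B x.

(** One inequality is the contraction property of [alpha] times the resolvent. The other comes from
    supersolutions increasing to 1; cubes of positive parts are used for them because [weak_test]
    needs class C^2. *)
Lemma lyapunov_mass T h alpha f g M : Ck 2 h -> (forall x, 0 <= h x) ->
  (forall K, exists r : R, forall x, r <= enorm x -> K <= h x) -> 0 < alpha ->
  (\forall x \ae mu, diffop A c h x <= alpha * h x) ->
  constructed_semigroup mu A B T -> 0 < M -> resolvent mu setT T alpha f g ->
  (\forall x \ae mu, `|f x| <= M) -> (\forall x \ae mu, 0 <= f x) ->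
  alpha * \int[mu]_x g x = \int[mu]_x f x.
Proof.
move=> Ch h0 hinf a0 sub HT M0 Hg fM f0; have ch := Ck_cont Ch.
have [Lf Lg] := resolvent_L1 measurableT HT.1 Hg.
have f0T : \forall x \ae mu, setT x -> 0 <= f x by apply: filterS f0.
have g0 := resolvent_ge0 measurableT HT.1 a0 Hg f0T.
apply/eqP; rewrite eq_le; apply/andP; split.
  have := resolvent_n1 measurableT HT.1 a0 Hg.
  have -> : n1 mu setT g = \int[mu]_x g x.
    apply: int_eq_ae => //; [exact: L1_meas (L1_abs measurableT Lg)|exact: L1_meas Lg|].
    by apply: filterS g0 => x h' Vx; rewrite ger0_norm// h'.
  have -> // : n1 mu setT f = \int[mu]_x f x.
  apply: int_eq_ae => //; [exact: L1_meas (L1_abs measurableT Lf)|exact: L1_meas Lf|].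
  by apply: filterS f0 => x h' Vx; rewrite ger0_norm// h'.
(* The exhaustion is adapted to [h]: [v n] is supported in [h <= n+1], a compact subset of the open
   set [h < n+2]. *)
pose V n : set E := [set x | h x < n.+2%:R].
have ex : exhaustion V.
  split=> [n|n x|].
  - split.
      rewrite (_ : V n = h @^-1` [set t | t < n.+2%:R])//.
      by apply: open_comp; [move=> x _; exact: ch|exact: open_lt].
    have [cl cp] := sublevel_compact n.+2%:R ch hinf.
    apply: (subclosed_compact _ cp); first exact: closed_closure.
    rewrite [X in _ `<=` X](closure_id _).1//; apply: closure_subset => x /= /ltW; exact.
  - by rewrite /V /= => hx; apply: lt_le_trans hx _; rewrite ler_nat.
  - rewrite -subTset => x _; have [n hn] := nat_gt (h x); exists n => //.
    by rewrite /V /=; apply: lt_le_trans hn _; rewrite ler_nat.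
have [S [gn [HS Hgn cg]]] := constructed_limit HT ex a0 Hg.
have [rV _ _] := ex; have mV n := open_measurable_rV (rV n).1.
(* v n := ((1 - h/(n+1))^+)^3 satisfies alpha v - L' v <= alpha: with y := (1 - h/(n+1))^+ in
   [0, 1], the left-hand side is at most alpha y^2 (3 - 2 y). *)
pose F n (t : R) := (1 - n.+1%:R^-1 * t) * pp (1 - n.+1%:R^-1 * t).
pose v n := F n \o h.
have dlin n (t : R) : is_derive t 1 (fun t => 1 - n.+1%:R^-1 * t) (- n.+1%:R^-1).
  have := is_deriveB (is_derive_cst (1 : R) t 1) (is_deriveM (is_derive_cst (n.+1%:R^-1 : R) t 1) (is_derive_id t 1)).
  by move=> hd; apply: (is_derive_eq hd); rewrite /GRing.scale /=; ring.
pose F1 n (t : R) := - n.+1%:R^-1 * (3 * pp (1 - n.+1%:R^-1 * t)).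
pose F2 n (t : R) := n.+1%:R^-1 ^+ 2 * (3 * dpp (1 - n.+1%:R^-1 * t)).
have dF n (t : R) : is_derive t 1 (F n) (F1 n t).
  have := @is_derive1_comp _ (fun t => t * pp t) (fun t => 1 - n.+1%:R^-1 * t) t _ _ (cube_pp_derive _) (dlin n t).
  by move=> hd; apply: (is_derive_eq hd); rewrite /F1; ring.
have dF1 n (t : R) : is_derive t 1 (F1 n) (F2 n t).
  have h1 := @is_derive1_comp _ pp (fun t => 1 - n.+1%:R^-1 * t) t _ _ (pp_derive _) (dlin n t).
  have := is_deriveM (is_derive_cst (- n.+1%:R^-1 : R) t 1) (is_deriveM (is_derive_cst (3 : R) t 1) h1).
  by move=> hd; apply: (is_derive_eq hd); rewrite /F2 /GRing.scale /=; ring.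
have cF2 n : continuous (F2 n \o h).
  apply: cont_comp => //; have L : 0 <= n.+1%:R^-1 ^+ 2 * (3 * 2) :> R by rewrite mulr_ge0// sqr_ge0.
  apply: (lipschitz_continuous L) => s t; rewrite /F2 -!mulrBr mulrA normrM.
  rewrite ger0_norm; last by rewrite mulr_ge0// sqr_ge0.
  rewrite -!mulrA ler_wpM2l ?sqr_ge0// ler_wpM2l//.
  rewrite ler_wpM2l// normrM ger0_norm// ler_wpM2l//; apply: (le_trans (max0_lip _ _)).
  have -> : 1 - n.+1%:R^-1 * s - (1 - n.+1%:R^-1 * t) = n.+1%:R^-1 * (t - s) by ring.
  rewrite normrM distrC -[leRHS]mul1r ler_wpM2r//.
  by rewrite ger0_norm ?invr_ge0// invf_le1// ler1n.
have Cv n : Ck 2 (v n) by have [] := Ck2_comp Ch (fun x => dF n (h x)) (fun x => dF1 n (h x)) (@cF2 n).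
have y1 n x : 1 - n.+1%:R^-1 * h x <= 1 by rewrite lerBlDr lerDl mulr_ge0// invr_ge0.
have v01 n x : 0 <= v n x <= 1.
  rewrite /v /F /= /pp; have := y1 n x; move: (1 - _) => y.
  case: (leP 0 y) => y0 yl; last by rewrite expr0n mulr0 lexx ler01.
  by rewrite -exprS exprn_ge0//= exprn_ile1.
have hv n : Cc1 (V n) (v n).
  have [cl cp] := sublevel_compact n.+1%:R ch hinf.
  have sub' : closure [set x | v n x != 0] `<=` [set x | h x <= n.+1%:R].
    rewrite [X in _ `<=` X](closure_id _).1//; apply: closure_subset => x /=.
    apply: contraNle => hx; rewrite /v /F /= /pp max_l ?expr0n ?mulr0//.
    by rewrite subr_le0 mulrC ler_pdivlMr// mul1r ltW.
  split; [exact: CkS (Cv n)|by apply: (subclosed_compact _ cp sub'); apply: closed_closure|].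
  by move=> x /sub' /=; rewrite /V /= => hx; apply: le_lt_trans hx _; rewrite ltr_nat.
have key n : \int[mu]_(x in V n) (v n x * f x) <= alpha * \int[mu]_(x in V n) gn n x.
  rewrite (@int_eq _ _ _ mu _ _ (fun x => f x * v n x)); last by move=> x _; exact: mulrC.
  have fMn : \forall x \ae mu, V n x -> `|f x| <= M by apply: filterS fM => x hx _.
  have f0n : \forall x \ae mu, V n x -> 0 <= f x by apply: filterS f0 => x hx _.
  apply: (supersolution_test HE (rV n) (HS n) a0 M0 (Hgn n) fMn f0n (Cv n) (hv n)).
  apply: filterS sub => x hx Vx.
  rewrite (diffop_comp HE x Ch (fun x => dF n (h x)) (fun x => dF1 n (h x)) (@cF2 n)).
  have p0 : 0 <= 2^-1 * F2 n (h x) * mxdot (A x) (gradient h x) (gradient h x).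
    rewrite mulr_ge0 ?(ell_pos HE)// mulr_ge0 ?invr_ge0// /F2 mulr_ge0 ?sqr_ge0// mulr_ge0//.
    by rewrite /dpp mulr_ge0// le_max lexx.
  have p1 : F1 n (h x) * (alpha * h x) <= F1 n (h x) * diffop A c h x.
    rewrite ler_wnM2l// /F1 mulNr oppr_le0 mulr_ge0 ?invr_ge0// mulr_ge0// /pp sqr_ge0//.
  have p2 : alpha * v n x - F1 n (h x) * (alpha * h x) <= alpha.
    rewrite /v /F1 /F /=; have := y1 n x.
    have [y ye] : exists y, y = 1 - n.+1%:R^-1 * h x by exists (1 - n.+1%:R^-1 * h x).
    have he : n.+1%:R^-1 * h x = 1 - y by rewrite ye; ring.
    rewrite -ye => yl.
    have -> : alpha * (y * pp y) - - n.+1%:R^-1 * (3 * pp y) * (alpha * h x) =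
       alpha * (pp y * (y + 3 * (n.+1%:R^-1 * h x))) by ring.
    rewrite he -[leRHS]mulr1 ler_wpM2l ?(ltW a0)// /pp.
    case: (leP 0 y) => y0; last by rewrite expr0n mul0r.
    (* Expanded, this is [y^2 (3 - 2 y) <= 1]. *)
    have : 0 <= (1 - y) ^+ 2 * (1 + 2 * y) by rewrite mulr_ge0 ?sqr_ge0//; lra.
    by rewrite !expr2; lra.
  by lra.
have Lgn n := (resolvent_L1 (mV n) (HS n).1 (Hgn n)).2.
have one1 : \forall x \ae mu, `|(fun=> 1 : R) x| <= 1 by apply/nearW => x; rewrite normr1.
have c1 := @limit_pairing _ _ mu V gn g (fun=> 1) 1 mV Lgn Lg (measurable_cst _) ler01 one1 cg.
have vout n x : ~ V n x -> v n x * f x = 0.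
  move=> Vx; rewrite (_ : v n x = 0) ?mul0r//; apply: closure_supp_vanish1 => hc; apply: Vx.
  by have [_ _] := hv n; apply.
have c2 : (\int[mu]_(x in V n) (v n x * f x)) @[n --> \oo] --> \int[mu]_x f x.
  have [] := @dominated_cvg_int _ _ _ mu setT (fun n x => v n x * f x) f (fun x => `|f x|) measurableT.
  - move=> n; apply: measurable_funM; last exact: L1_meas Lf.
    exact: Ck_measurable (Cv n).
  - exact: L1_meas Lf.
  - exact: L1_abs.
  - apply/nearW => x _; rewrite -[X in _ --> X]mul1r; apply: cvgMl.
    apply/cvgrPdist_le => e e0; have [N hN] := nat_gt (3 * h x / e).
    exists N => // n /= Nn; have [v0 v1] := andP (v01 n x); rewrite ger0_norm ?subr_ge0//.
    have ne : n.+1%:R^-1 * h x <= e / 3.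
      rewrite mulrC ler_pdivrMr// -ler_pdivrMl ?divr_gt0// invf_div mulrC mulrA [h x * 3]mulrC.
      by apply: (le_trans (ltW hN)); rewrite ler_nat.
    rewrite /v /F /= /pp; have hn : 0 <= n.+1%:R^-1 * h x by rewrite mulr_ge0 ?invr_ge0.
    move: (n.+1%:R^-1 * h x) ne hn => t ne hn.
    case: (leP 0 (1 - t)) => y0; last by rewrite expr0n mulr0; lra.
    (* Expanded, this is [1 - (1 - t)^3 <= 3 t], hence the choice of [N] above [3 h(x) / e]. *)
    have : 0 <= t ^+ 2 * (3 - t) by rewrite mulr_ge0 ?sqr_ge0//; lra.
    by rewrite !expr2; lra.
  - move=> n; apply/nearW => x _; have [v0 v1] := andP (v01 n x).
    by rewrite normrM ger0_norm// ler_piMl.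
  move=> _; apply: cvg_trans; apply: near_eq_cvg; apply/nearW => n.
  by rewrite [LHS](@int_ext _ _ _ _ (V n))// => x; exact: vout.
have c3 : alpha * (\int[mu]_(x in V n) (1 * gn n x)) @[n --> \oo] --> alpha * \int[mu]_x (1 * g x).
  by apply: cvgMr; exact: c1.
have e1 : \int[mu]_x (1 * g x) = \int[mu]_x g x by apply: int_eq => x _; rewrite mul1r.
rewrite e1 in c3; apply: ler_cvg_to c2 c3 _; apply/nearW => n; apply: (le_trans (key n)).
by rewrite le_eqVlt; apply/orP; left; apply/eqP; congr (_ * _); apply: int_eq => x _; rewrite mul1r.
Qed.

End lyapunov.

(** * The logarithmic Lyapunov function and integrable coefficients *)

Section growth_conditions.
Context {R : realType} {d : nat}.
Local Notation E := 'rV[R]_d.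
Variables (mu : {measure set E -> \bar R}) (A : E -> 'M[R]_d) (b B : E -> E).
Hypothesis HE : elliptic mu A b B.
Implicit Types (x : E) (V : set E) (u v f g h psi k chi : E -> R) (w z : E -> E) (i j : 'I_d) (K N M q : R).

Let c x := b x - B x.
Let sq (x : E) : R := dot x x.

Lemma sq_derive i x : is_derive x (evec i) sq (2 * x ord0 i).
Proof.
apply: (quad_partial (C := 1)) => h _; rewrite /sq dotDl !dotDr !dotZl !dotZr dot_evec eqxx mulr1 mul1r.
have -> : dot (evec i) x = x ord0 i by rewrite /dot sum_evec.
have -> : dot x (evec i) = x ord0 i by rewrite dotC /dot sum_evec.
by rewrite (_ : _ - _ - _ = h ^+ 2) ?ger0_norm ?sqr_ge0//; ring.
Qed.

Lemma sq_partial i x : partial i sq x = 2 * x ord0 i.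
Proof. exact: is_derive_partial (sq_derive i x). Qed.

Lemma sq_partial2 i j x : partial i (partial j sq) x = 2 * (i == j)%:R.
Proof.
have -> : partial j sq = fun y => 2 * y ord0 j by apply/funext => y; exact: sq_partial.
apply: is_derive_partial; apply: (quad_partial (C := 0)) => h _.
have -> : (x + h *: evec i) ord0 j = x ord0 j + h * (i == j)%:R by rewrite mxE [X in _ + X = _]mxE evecE eq_sym.
by rewrite mul0r (_ : _ - _ = 0) ?normr0//; ring.
Qed.

Lemma Ck_sq n : Ck n sq.
Proof. by apply: Ck_sum => i; apply: CkM; exact: Ck_coord. Qed.

Lemma diffop_sq (e : E -> E) x : diffop A e sq x = \tr (A x) + 2 * dot (e x) x.
Proof.
rewrite /diffop; congr (_ + _).
  rewrite /mxtrace mulr_sumr; apply: eq_bigr => i _.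
  rewrite (bigD1 i)//= big1 ?addr0 => [|j ji]; first by rewrite sq_partial2 eqxx mulr1 mulrC mulfK.
  by rewrite sq_partial2 eq_sym (negbTE ji) mulr0 mulr0.
by rewrite -dotZr; congr dot; apply/rowP => i; rewrite !mxE sq_partial.
Qed.

Lemma enorm_sqr x : enorm x ^+ 2 = sq x.
Proof. by rewrite sqr_sqrtr// dot_ge0. Qed.

Let lg x := ln (sq x + 1) + 1.

Lemma sq_ge0 x : 0 <= sq x. Proof. exact: dot_ge0. Qed.

Lemma log_facts : [/\ Ck 2 lg, forall x, 1 <= lg x,
  (forall K, exists r : R, forall x, r <= enorm x -> K <= lg x) &
  forall x, diffop A c lg x = 2 / (sq x + 1) *
    (- (mxdot (A x) x x / (sq x + 1)) + 2^-1 * \tr (A x) + dot (c x) x)].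
Proof.
have p x : 0 < sq x + 1 by rewrite ltr_wpDl// sq_ge0.
pose F (t : R) := ln (t + 1) + 1; pose F1 (t : R) := (t + 1)^-1; pose F2 (t : R) := - (t + 1)^-2.
have dsh (t : R) : is_derive t 1 (fun t => t + 1) (1 : R).
  by have := is_deriveD (is_derive_id t 1) (is_derive_cst (1 : R) t 1); rewrite addr0.
have dF x : is_derive (sq x) 1 F (F1 (sq x)).
  have h1 := @is_derive1_comp _ (@ln R) (fun t => t + 1) (sq x) _ _ (is_derive1_ln (p x)) (dsh _).
  have := is_deriveD h1 (is_derive_cst (1 : R) (sq x) 1).
  by move=> hd; apply: (is_derive_eq hd); rewrite /F1 addr0 mulr1.
have dF1 x : is_derive (sq x) 1 F1 (F2 (sq x)).
  have hn : sq x + 1 != 0 by exact: lt0r_neq0.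
  have := @is_deriveV _ (fun t => t + 1) (sq x) 1 1 hn (dsh (sq x)).
  by move=> hd; apply: (is_derive_eq hd); rewrite /F2 /GRing.scale /= mulr1.
have cs : continuous sq by exact: Ck_cont (Ck_sq 0).
have cinv : continuous (fun x => (sq x + 1)^-1).
  move=> x; have hn : sq x + 1 != 0 by exact: lt0r_neq0.
  have c1 := Ck_cont (CkD (Ck_sq 0) (Ck_cst 0 (1 : R))).
  exact: cvgV hn (c1 x).
have cF2 : continuous (F2 \o sq).
  rewrite (_ : F2 \o sq = fun x => -1 * ((sq x + 1)^-1 * (sq x + 1)^-1)).
    by apply: (contM (Ck_cont (Ck_cst 0 (-1 : R))) (contM cinv cinv)).
  by apply/funext => x; rewrite /F2 /= mulN1r expr2 invfM.
have [C2 _ _] := Ck2_comp (Ck_sq 2) dF dF1 cF2; split => //.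
- by move=> x; rewrite /lg lerDr ln_ge0// lerDr sq_ge0.
- move=> K; exists (expR K) => x hx; rewrite /lg.
  (* As [|x| <= |x|^2 + 1], the radius [exp K] suffices. *)
  have h1 : expR K <= (sq x + 1).
    apply: (le_trans hx); rewrite -enorm_sqr.
    have : 0 <= (enorm x - 1) ^+ 2 by exact: sqr_ge0.
    have : 0 <= enorm x by exact: sqrtr_ge0.
    by rewrite !expr2; lra.
  have : K <= ln (sq x + 1) by rewrite -[K]expRK ler_ln// posrE ?expR_gt0.
  lra.
move=> x; rewrite (_ : lg = F \o sq)// (diffop_comp HE x (Ck_sq 2) dF dF1 cF2).
rewrite -/c diffop_sq (_ : gradient sq x = 2 *: x); last by apply/rowP => i; rewrite !mxE sq_partial.
by rewrite mxdotZl mxdotZr /F1 /F2; field; rewrite lt0r_neq0.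
Qed.

(** The factor [2/(|x|^2 + 1)] in the formula of [log_facts] cancels the growth, so the operator
    applied to [lg] is at most [2 M1 lg]. Adding 1 to [2 M1] keeps [alpha] positive when
    [M1 = 0]. *)
Lemma log_mass T f g M M1 : 0 <= M1 ->
  (\forall x \ae mu,
     - (mxdot (A x) x x / (enorm x ^+ 2 + 1)) + 2^-1 * \tr (A x) + dot (c x) x
           <= M1 * (enorm x ^+ 2 + 1) * (ln (enorm x ^+ 2 + 1) + 1)) ->
  constructed_semigroup mu A B T -> 0 < M -> resolvent mu setT T (2 * M1 + 1) f g ->
  (\forall x \ae mu, `|f x| <= M) -> (\forall x \ae mu, 0 <= f x) ->
  (2 * M1 + 1) * \int[mu]_x g x = \int[mu]_x f x.
Proof.
move=> M10 H HT M0 Hg fM f0; have [C2 l1 linf lE] := log_facts.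
have a0 : 0 < 2 * M1 + 1 by rewrite ltr_wpDl// mulr_ge0.
apply: (lyapunov_mass HE (h := lg) C2 _ linf a0 _ HT M0 Hg fM f0).
  by move=> x; exact: le_trans ler01 (l1 x).
apply: filterS H => x; rewrite enorm_sqr -/(lg x) -/(c x) lE => hx.
have p : 0 < sq x + 1 by rewrite ltr_wpDl// sq_ge0.
apply: (@le_trans _ _ (2 / (sq x + 1) * (M1 * (sq x + 1) * lg x))).
  by rewrite ler_wpM2l// divr_ge0// ltW.
rewrite (_ : 2 / (sq x + 1) * _ = 2 * M1 * lg x); last by field; exact: lt0r_neq0.
by rewrite [leRHS]mulrDl lerDl mul1r (le_trans ler01).
Qed.

(** [u] can be negative only on a bounded set, so adding a constant makes it nonnegative; the
    operator kills the constant, while the right-hand side grows. *)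
Lemma nonneg_lyapunov u alpha : Ck 2 u -> 0 < alpha ->
  (forall K, exists r : R, forall x, r <= enorm x -> K <= u x) ->
  (\forall x \ae mu, diffop A c u x <= alpha * u x) ->
  exists h, [/\ Ck 2 h, forall x, 0 <= h x,
    (forall K, exists r : R, forall x, r <= enorm x -> K <= h x) &
    (\forall x \ae mu, diffop A c h x <= alpha * h x)].
Proof.
move=> Cu a0 uinf sub; have [r hr] := uinf 0.
have r0 : 0 < Num.max 1 r by rewrite lt_max ltr01.
have [C hC] := cont_bounded_cube r0 (Ck_cont Cu).
have C0 : 0 <= `|C| by [].
have dsh (t : R) : is_derive t 1 (fun t => t + `|C|) (1 : R).
  by have := is_deriveD (is_derive_id t 1) (is_derive_cst (`|C| : R) t 1); rewrite addr0.
have dc (t : R) : is_derive t 1 (fun _ : R => 1 : R) 0 by exact: is_derive_cst.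
have cc : continuous ((fun _ : R => 0 : R) \o u) := Ck_cont (Ck_cst 0 (0 : R)).
have [C2 _ _] := Ck2_comp Cu (fun x => dsh (u x)) (fun x => dc (u x)) cc.
exists ((fun t => t + `|C|) \o u); split => //.
- move=> x /=; have [xr|xr] := leP (enorm x) (Num.max 1 r).
    have : `|u x| <= C by apply: hC; rewrite /cube /=; exact: le_trans (norm_enorm x) xr.
    by rewrite ler_norml => /andP[h1 _]; have := ler_norm C; lra.
  have : 0 <= u x by apply: hr; move: xr; rewrite gt_max => /andP[_ /ltW].
  lra.
- move=> K; have [s hs] := uinf K; exists s => x /hs /=; lra.
- apply: filterS sub => x hx; rewrite (diffop_comp HE x Cu (fun x => dsh (u x)) (fun x => dc (u x)) cc).
  rewrite mulr0 mul0r add0r mul1r; apply: (le_trans hx); rewrite ler_wpM2l ?(ltW a0)//=.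
  by rewrite lerDl.
Qed.

Lemma bump_one (t : R) : 1 <= t -> bump1 t = 1 /\ bump2 t = 0.
Proof.
move=> t1; rewrite /bump1 /bump2 /pp /dpp !max_r; [|lra|lra|lra].
by split; field.
Qed.

(** [1 - bump1(|x|^2/m^2 - 1)] with [m = n + 1], which is 1 for [|x| <= m] and 0 for
    [|x|^2 >= 2 m^2]. Where the gradient is nonzero, [bump2 <= 2] and [|x_i| <= 2 m] give the
    explicit bound [m^-2 * 2 * 4 m = 8 / m]. *)
Lemma cutoff_scaled n : exists chi, [/\ Cc1 setT chi, forall x, 0 <= chi x <= 1,
  forall x i, `|partial i chi x| <= 8 / n.+1%:R,
  forall x, dot x x <= n.+1%:R ^+ 2 -> chi x = 1 &
  closure [set x | chi x != 0] `<=` cube (2 * n.+1%:R)].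
Proof.
pose chim n x : R := 1 - bump1 (n.+1%:R^-2 * sq x - 1); exists (chim n).
set m : R := n.+1%:R; have m0 : 0 < m by exact: ltr0Sn.
have k0 : 0 < m ^- 2 by rewrite invr_gt0 exprn_gt0.
pose F (t : R) := 1 - bump1 (m ^- 2 * t - 1); pose F1 (t : R) := - (m ^- 2 * bump2 (m ^- 2 * t - 1)).
have dlin (t : R) : is_derive t 1 (fun t => m ^- 2 * t - 1) (m ^- 2).
  have := is_deriveB (is_deriveM (is_derive_cst (m ^- 2 : R) t 1) (is_derive_id t 1)) (is_derive_cst (1 : R) t 1).
  by move=> hd; apply: (is_derive_eq hd); rewrite /GRing.scale /=; ring.
have dF (t : R) : is_derive t 1 F (F1 t).
  have h1 := @is_derive1_comp _ bump1 (fun t => m ^- 2 * t - 1) t _ _ (bump1_derive _) (dlin t).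
  have := is_deriveB (is_derive_cst (1 : R) t 1) h1.
  by move=> hd; apply: (is_derive_eq hd); rewrite /F1; ring.
have cF1 : continuous (F1 \o sq).
  apply: cont_comp; first exact: Ck_cont (Ck_sq 0).
  have L : 0 <= m ^- 2 * (16 * m ^- 2) by rewrite mulr_ge0 ?(ltW k0)// mulr_ge0// ltW.
  apply: (lipschitz_continuous L) => s t; rewrite /F1 -opprD normrN -mulrBr normrM gtr0_norm//.
  rewrite -mulrA ler_wpM2l ?(ltW k0)//; apply: (le_trans (bump2_lip _ _)).
  rewrite (_ : _ - _ = m ^- 2 * (s - t)); last by ring.
  by rewrite normrM gtr0_norm// mulrA.
have [C1 e1] := Ck1_comp (Ck_sq 1) (fun x => dF (sq x)) cF1.
have bs x : m ^+ 2 * 2 <= sq x -> bump1 (m ^- 2 * sq x - 1) = 1 /\ bump2 (m ^- 2 * sq x - 1) = 0.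
  move=> hs; apply: bump_one; rewrite lerBrDr -[leLHS](mulKf (lt0r_neq0 (exprn_gt0 2 m0))).
  by rewrite ler_wpM2l ?(ltW k0)//; lra.
have sqn x : 2 * m < `|x| -> m ^+ 2 * 2 <= sq x.
  move=> hx; have h1 := lt_le_trans hx (norm_enorm x).
  have m20 : 0 <= 2 * m by rewrite mulr_ge0// ltW.
  have : (2 * m) ^+ 2 <= enorm x ^+ 2 by rewrite lerXn2r// ?nnegrE ?(ltW h1)//; exact: le_trans (ltW h1).
  have : 0 <= m ^+ 2 by exact: sqr_ge0.
  by rewrite enorm_sqr !expr2; lra.
have z x : 2 * m < `|x| -> chim n x = 0 by move=> /sqn /bs[e _]; rewrite /chim -/m e subrr.
have cl : closure [set x | chim n x != 0] `<=` cube (2 * m).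
  rewrite [X in _ `<=` X](closure_id _).1; last exact: cube_closed.
  by apply: closure_subset => x /=; apply: contraNle => /z ->.
split => //.
- by split => //; apply: closed_bounded_compact cl; exact: closed_closure.
- by move=> x; have [_] := bump_bounds (m ^- 2 * sq x - 1); rewrite /chim -/m; lra.
- move=> x i; rewrite (_ : chim n = F \o sq)// e1 sq_partial /F1.
  have [/bs[_ ->]|hs] := leP (m ^+ 2 * 2) (sq x); first by rewrite mulr0 oppr0 mul0r normr0 divr_ge0// ltW.
  have [/andP[b0 b2] _] := bump_bounds (m ^- 2 * sq x - 1).
  have xi : `|x ord0 i| <= 2 * m.
    have m20 : 0 <= 2 * m by rewrite mulr_ge0// ltW.
    rewrite -(@ler_pXn2r _ 2)// ?nnegrE// sqr_normr.
    have h2 : x ord0 i ^+ 2 <= sq x.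
      by rewrite /sq /dot (bigD1 i)//= -expr2 lerDl; apply: sumr_ge0 => j _; exact: sqr_ge0.
    apply: (le_trans h2); apply: (le_trans (ltW hs)).
    have : 0 <= m ^+ 2 by exact: sqr_ge0.
    by rewrite !expr2; lra.
  rewrite normrM normrN (normrM (m ^- 2)) (normrM 2 (x ord0 i)) (ger0_norm b0) (gtr0_norm k0) (ger0_norm (_ : 0 <= 2))//.
  apply: (@le_trans _ _ (m ^- 2 * 2 * (2 * (2 * m)))).
    apply: ler_pM => //; [by rewrite mulr_ge0// ltW|by rewrite ler_wpM2l// ltW|by rewrite ler_wpM2l].
  by rewrite le_eqVlt; apply/orP; left; apply/eqP; field; exact: lt0r_neq0.
- move=> x hx; rewrite /chim -/m -/(sq x); have [|_ -> _] := @bump_neg _ (m ^- 2 * sq x - 1); last by rewrite subr0.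
  by rewrite subr_le0 mulrC ler_pdivrMr ?mul1r// exprn_gt0.
Qed.

(** Nonnegativity of the form at [q y + z] and [q y - z]. *)
Lemma form_young x (y z : E) q : 0 < q ->
  `|mxdot (A x) y z| <= 2^-1 * (q * mxdot (A x) y y + q^-1 * mxdot (A x) z z).
Proof.
move=> q0; have h1 := ell_pos HE x (q *: y + z); have h2 := ell_pos HE x (q *: y + (-1) *: z).
have sw : mxdot (A x) z y = mxdot (A x) y z.
  rewrite !(mxdotA (ell_sym HE)) exchange_big; apply: eq_bigr => i _; apply: eq_bigr => j _.
  by rewrite (Asw (ell_sym HE)); ring.
move: h1 h2; rewrite !(mxdotDl, mxdotDr, mxdotZl, mxdotZr) sw.
move: (mxdot (A x) y y) (mxdot (A x) z z) (mxdot (A x) y z) => a e f h1 h2.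
rewrite -(ler_pM2l q0) -[X in X * `|_|]gtr0_norm// -normrM ler_norml.
have -> : q * (2^-1 * (q * a + q^-1 * e)) = 2^-1 * (q * (q * a) + e) by field; exact: lt0r_neq0.
apply/andP; split; lra.
Qed.

Lemma n1_sub V k : measurable V -> L1 mu setT k -> n1 mu V k <= n1 mu setT k.
Proof.
move=> mV Lk; have Lka := L1_abs measurableT Lk.
have -> : n1 mu V k = \int[mu]_x (`|k x| * \1_V x).
  rewrite /n1 Rintegral_mkcond; apply: int_eq => x _; rewrite /patch indicE.
  by case: ifP => _; rewrite ?mulr1 ?mulr0.
apply: int_le_ae => //.
  apply: (L1_dom measurableT _ Lka).
    by apply: measurable_funM; [exact: L1_meas Lka|exact: measurable_indic].
  by apply/nearW => x _; rewrite indicE; case: (_ \in _); rewrite ?mulr1 ?mulr0 ?normr0 ?normr_id.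
by apply/nearW => x _; rewrite indicE; case: (_ \in _); rewrite ?mulr1 ?mulr0.
Qed.

Lemma int_sum V (s : seq 'I_d) (F : 'I_d -> E -> R) : measurable V -> (forall i, L1 mu V (F i)) ->
  \int[mu]_(x in V) (\sum_(i <- s) F i x) = \sum_(i <- s) \int[mu]_(x in V) F i x.
Proof.
move=> mV LF; elim: s => [|i s IH].
  by rewrite big_nil -[RHS](int0 mu V); apply: int_eq => x _; rewrite big_nil.
rewrite big_cons -IH -(RintegralD _ (LF i))//; last exact: L1_sum.
by apply: int_eq => x _; rewrite big_cons.
Qed.

(** Testing with [chi], every term is of order [q]: antisymmetry puts the gradient of [chi] into the
    drift term, and the form is split by Young's inequality with weight [q] into [q] times the
    energy of [U] and [1/q] times the energy of [chi], which is of order [q^2] as the [a_ij] are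
    integrable. *)
Lemma local_cutoff_estimate V S alpha f u chi q M : relcompact_open V -> local_semigroup mu A B V S ->
  (forall i j, L1 mu setT (fun x => A x i j)) -> (forall i, L1 mu setT (fun x => B x ord0 i)) ->
  0 < alpha -> 0 < M -> L1 mu setT f -> resolvent mu V S alpha f u -> (\forall x \ae mu, V x -> `|f x| <= M) ->
  Cc1 V chi -> (forall x, 0 <= chi x <= 1) -> 0 < q -> q <= 8 -> (forall x i, `|partial i chi x| <= q) ->
  `|\int[mu]_(x in V) (f x * chi x) - alpha * \int[mu]_(x in V) (chi x * u x)| <=
   q * (1 + 4^-1 * (2 * ((M / alpha + 1) * (2 * n1 mu setT f + 8)) +
      \sum_i \sum_j n1 mu setT (fun x => A x i j)) + (M / alpha + 1) * \sum_i n1 mu setT (fun x => B x ord0 i)).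
Proof.
move=> rV HS LA LB a0 M0 LfT Hu fM hchi chi01 q0 q8 dchi.
have oV := rV.1; have mV := open_measurable_rV oV.
have [Lf Lu] := resolvent_L1 mV HS.1 Hu.
have uK := resolvent_bounded mV HS.1 a0 M0 Hu fM.
set K := M / alpha in uK *; have K0 : 0 <= K by rewrite ltW// divr_gt0.
have K10 : 0 <= K + 1 by rewrite addr_ge0.
have fin := relcompact_fin HE rV.
(* The precision of the approximant is [q] itself, so that its error is of the order of the
   claim. *)
have [U [W [HU UK Uu weak]]] := approx_weak HE rV HS a0 Hu K0 (ltW M0) fM uK q0.
have [LU LW _] := HU; have LU1 : L1 mu V U by exact: L2_L1.
have UKa : \forall x \ae mu, V x -> `|U x| <= K + 1 by apply/nearW => x _; exact: UK.
have Hchi := H0g_Cc1 (ell_fin HE) oV hchi; have [Lchi Ldchi _] := Hchi.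
have chi1 : \forall x \ae mu, V x -> `|chi x| <= 1.
  by apply/nearW => x _; have /andP[h1 h2] := chi01 x; rewrite ger0_norm.
have chiK : \forall x \ae mu, V x -> `|chi x| <= K + 1.
  by apply: filterS chi1 => x h /h hx; apply: (le_trans hx); rewrite lerDr.
have Lfu : L1 mu V (fun x => f x - alpha * u x) by apply: L1B => //; exact: L1Z.
have fu_n1 : n1 mu V (fun x => f x - alpha * u x) <= 2 * n1 mu setT f.
  have h1 := n1B mV Lf (L1Z alpha mV Lu); rewrite n1Z// gtr0_norm// in h1.
  have h2 := resolvent_n1 mV HS.1 a0 Hu.
  have h3 := n1_sub mV LfT.
  lra.
have LWW := form_L1 HE rV LW LW; have LWc := form_L1 HE rV LW Ldchi; have Lcc := form_L1 HE rV Ldchi Ldchi.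
have LBc := drift_L1 HE rV Ldchi.
have LBcU : L1 mu V (fun x => dot (B x) (gradient chi x) * U x).
  by apply: (L1_eq mV _ (L1_bM mV (L2_meas LU) LBc UKa)) => x _; exact: mulrC.
have LAV i j : L1 mu V (fun x => `|A x i j|) by apply: L1_abs => //; exact: L1S (LA i j).
have LBV i : L1 mu V (fun x => `|B x ord0 i|) by apply: L1_abs => //; exact: L1S (LB i).
have LfuU : L1 mu V (fun x => (f x - alpha * u x) * U x).
  by apply: (L1_eq mV _ (L1_bM mV (L2_meas LU) Lfu UKa)) => x _; exact: mulrC.
have energy : 2^-1 * \int[mu]_(x in V) mxdot (A x) (W x) (W x) <= (K + 1) * (2 * n1 mu setT f + 8).
  have := weak U W (K + 1) K10 HU UKa.
  (* Antisymmetry on the diagonal: the drift does not enter the energy of [U]. *)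
  have -> : \int[mu]_(x in V) (dot (B x) (W x) * U x) = 0.
    by have h0 := drift_antisym HE rV HU HU UKa UKa; lra.
  rewrite subr0 ler_norml => /andP[_ h1].
  have h2 : \int[mu]_(x in V) ((f x - alpha * u x) * U x) <= (K + 1) * (2 * n1 mu setT f).
    apply: (@le_trans _ _ ((K + 1) * n1 mu V (fun x => f x - alpha * u x))); last by rewrite ler_wpM2l.
    have La := L1_abs mV Lfu; rewrite -RintegralZl//; apply: int_le_ae => //; first exact: L1Z.
    apply/nearW => x _; apply: (le_trans (ler_norm _)); rewrite normrM mulrC.
    by rewrite ler_wpM2r.
  have h3 : q * (K + 1) <= 8 * (K + 1) by rewrite ler_wpM2r.
  lra.
have gb x i j : `|partial i chi x * partial j chi x| <= q ^+ 2.
  by rewrite normrM expr2 ler_pM.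
have cc : \int[mu]_(x in V) mxdot (A x) (gradient chi x) (gradient chi x) <= q ^+ 2 * \sum_i \sum_j n1 mu setT (fun x => A x i j).
  have Ls : L1 mu V (fun x => \sum_i \sum_j `|A x i j|) by apply: L1_sum => // i; apply: L1_sum.
  apply: (@le_trans _ _ (q ^+ 2 * \int[mu]_(x in V) (\sum_i \sum_j `|A x i j|))).
    rewrite -RintegralZl//; apply: int_le_ae => //; first exact: L1Z.
    apply/nearW => x _; rewrite (mxdotA (ell_sym HE)) mulr_sumr; apply: ler_sum => i _.
    rewrite mulr_sumr; apply: ler_sum => j _; rewrite !mxE (le_trans (ler_norm _))// normrM mulrC.
    by rewrite ler_wpM2r.
  rewrite ler_wpM2l ?sqr_ge0//.
  rewrite (int_sum _ mV) => [|i]; last exact: L1_sum.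
  apply: ler_sum => i _; rewrite (int_sum _ mV)//; apply: ler_sum => j _; exact: n1_sub.
have Bc : `|\int[mu]_(x in V) (dot (B x) (gradient chi x) * U x)| <= q * ((K + 1) * \sum_i n1 mu setT (fun x => B x ord0 i)).
  have Ls : L1 mu V (fun x => \sum_i `|B x ord0 i|) by apply: L1_sum.
  apply: (le_trans (int_le_n1 mV LBcU)).
  apply: (@le_trans _ _ (q * (K + 1) * \int[mu]_(x in V) (\sum_i `|B x ord0 i|))).
    rewrite -RintegralZl//; apply: int_le_ae => //; [exact: L1_abs|exact: L1Z|].
    apply/nearW => x _; rewrite normrM mulrC [q * _]mulrC -mulrA; apply: ler_pM => //.
    rewrite mulr_sumr; apply: le_trans (ler_norm_sum _ _ _) _; apply: ler_sum => i _.
    by rewrite normrM mulrC mxE ler_wpM2r.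
  rewrite -mulrA ler_wpM2l ?(ltW q0)// ler_wpM2l//.
  by rewrite (int_sum _ mV)//; apply: ler_sum => i _; exact: n1_sub.
have Wc : `|\int[mu]_(x in V) mxdot (A x) (W x) (gradient chi x)| <=
   2^-1 * (q * \int[mu]_(x in V) mxdot (A x) (W x) (W x) + q^-1 * \int[mu]_(x in V) mxdot (A x) (gradient chi x) (gradient chi x)).
  have I1 := L1Z q mV LWW; have I2 := L1Z q^-1 mV Lcc; have I3 := L1D mV I1 I2.
  rewrite -!RintegralZl// -RintegralD// -RintegralZl//.
  apply: (le_trans (int_le_n1 mV LWc)); apply: int_le_ae => //; [exact: L1_abs|exact: L1Z|].
  by apply/nearW => x _; exact: form_young.
have q1 : q^-1 * \int[mu]_(x in V) mxdot (A x) (gradient chi x) (gradient chi x) <= q * \sum_i \sum_j n1 mu setT (fun x => A x i j).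
  rewrite ler_pdivrMl// mulrA -expr2; exact: cc.
have := weak chi (gradient chi) 1 ler01 Hchi chi1.
rewrite (drift_antisym HE rV HU Hchi UKa chiK) opprK.
have -> : \int[mu]_(x in V) ((f x - alpha * u x) * chi x) = \int[mu]_(x in V) (f x * chi x) - alpha * \int[mu]_(x in V) (chi x * u x).
  have I1 := L1_bM mV (L2_meas Lchi) Lf chi1; have I2 := L1_bM mV (L2_meas Lchi) Lu chi1.
  have I3 : L1 mu V (fun x => f x * chi x) by apply: (L1_eq mV _ I1) => x _; exact: mulrC.
  have I4 := L1Z alpha mV I2.
  by rewrite -RintegralZl// -RintegralB//; apply: int_eq => x _; ring.
move: Wc q1 Bc energy.
set I0 := \int[mu]_(x in V) mxdot _ (W _) (W _); set I1 := \int[mu]_(x in V) mxdot _ _ _.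
set I2 := q^-1 * _; set I3 := \int[mu]_(x in V) _; set I4 := \int[mu]_(x in V) (f x * chi x) - _.
set SA := \sum_i \sum_j _; set SB := \sum_i _; set En := (K + 1) * (_ + _).
move=> Wc q1 Bc energy weakc.
have h1 : q * I0 <= q * (2 * En) by rewrite ler_wpM2l ?(ltW q0)//; lra.
have {}Wc : 2^-1 * `|I1| <= q * (4^-1 * (2 * En + SA)).
  rewrite mulrA [q * 4^-1]mulrC -mulrA mulrDr; lra.
have t4 : `|I4| <= `|2^-1 * I1 + I3 - I4| + `|2^-1 * I1| + `|I3|.
  rewrite -[X in `|X| <= _](_ : - (2^-1 * I1 + I3 - I4) + 2^-1 * I1 + I3 = _); last by ring.
  by rewrite (le_trans (ler_normD _ _))// lerD2r (le_trans (ler_normD _ _))// normrN.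
rewrite normrM (ger0_norm (_ : 0 <= 2^-1))// in t4.
rewrite mulr1 in weakc; rewrite mulrDr [q * (1 + _)]mulrDr mulr1.
move: (q * (4^-1 * _)) (q * ((K + 1) * SB)) Wc Bc => p1 p2 Wc Bc; lra.
Qed.

End growth_conditions.

(** * Mass conservation under integrability *)

Section integrable_coefficients.
Context {R : realType} {d : nat}.
Local Notation E := 'rV[R]_d.
Variables (mu : {measure set E -> \bar R}) (A : E -> 'M[R]_d) (b B : E -> E).
Hypothesis HE : elliptic mu A b B.
Implicit Types (x : E) (V : set E) (u v f g h psi k chi : E -> R) (w z : E -> E) (i j : 'I_d) (K N M q : R).

(** The scale [m] of the cutoff is fixed while the domains exhaust the space, which is possible
    because the constant [C] depends on neither; then [m] tends to infinity and [q = 8/(m+1)] to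
    0. *)
Lemma integrable_mass T alpha f g M :
  (forall i j, L1 mu setT (fun x => A x i j)) -> (forall i, L1 mu setT (fun x => B x ord0 i)) ->
  constructed_semigroup mu A B T -> 0 < alpha -> 0 < M -> resolvent mu setT T alpha f g ->
  (\forall x \ae mu, `|f x| <= M) ->
  alpha * \int[mu]_x g x = \int[mu]_x f x.
Proof.
move=> LA LB HT a0 M0 Hg fM.
have [Lf Lg] := resolvent_L1 measurableT HT.1 Hg.
pose C := 1 + 4^-1 * (2 * ((M / alpha + 1) * (2 * n1 mu setT f + 8)) +
      \sum_i \sum_j n1 mu setT (fun x => A x i j)) + (M / alpha + 1) * \sum_i n1 mu setT (fun x => B x ord0 i).
pose chi n := sval (cid (@cutoff_scaled R d n)).
have hchi n : [/\ Cc1 setT (chi n), forall x, 0 <= chi n x <= 1,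
  forall x i, `|partial i (chi n) x| <= 8 / n.+1%:R,
  forall x, dot x x <= n.+1%:R ^+ 2 -> chi n x = 1 &
  closure [set x | chi n x != 0] `<=` cube (2 * n.+1%:R)] by rewrite /chi; case: cid.
have [S [gn [HS Hgn cg]]] := constructed_limit HT balls_exhaustion a0 Hg.
have [rV _ _] := @balls_exhaustion R d; have mV n := open_measurable_rV (rV n).1.
have Lgn n := (resolvent_L1 (mV n) (HS n).1 (Hgn n)).2.
have mchi n : measurable_fun setT (chi n) by have [[C1 _ _] _ _ _ _] := hchi n; exact: Ck_measurable C1.
have chi1 n : \forall x \ae mu, `|chi n x| <= 1.
  by apply/nearW => x; have [_ /(_ x)/andP[h1 h2] _ _ _] := hchi n; rewrite ger0_norm.
have est m : `|\int[mu]_x (chi m x * f x) - alpha * \int[mu]_x (chi m x * g x)| <= 8 / m.+1%:R * C.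
  have [[C1 cs _] c01 dc _ sub] := hchi m.
  have lim := limit_pairing mV Lgn Lg (mchi m) ler01 (chi1 m) cg.
  have {}lim : `|\int[mu]_x (chi m x * f x) - alpha * \int[mu]_(x in balls n) (chi m x * gn n x)| @[n --> \oo] -->
      `|\int[mu]_x (chi m x * f x) - alpha * \int[mu]_x (chi m x * g x)|.
    by apply: cvg_norm; apply: cvgB; [exact: cvg_cst|exact: cvgMr].
  apply: (ler_cvg_to lim (cvg_cst (8 / m.+1%:R * C))); near=> n.
  have subV : closure [set x | chi m x != 0] `<=` balls n.
    move=> x /sub; rewrite /cube /balls /= => h; apply: le_lt_trans h _.
    rewrite -natrM ltr_nat ltnS; near: n; exact: nbhs_infty_ge.
  have fMn : \forall x \ae mu, balls n x -> `|f x| <= M by apply: filterS fM => x hx _.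
  have q0 : 0 < 8 / m.+1%:R :> R by rewrite divr_gt0.
  have q8 : 8 / m.+1%:R <= 8 :> R by rewrite ler_pdivrMr// ler_peMr// ler1n.
  have hc : Cc1 (balls n) (chi m) by split.
  have := local_cutoff_estimate HE (rV n) (HS n) LA LB a0 M0 Lf (Hgn n) fMn hc c01 q0 q8 dc.
  rewrite -/C => h; rewrite (@int_ext _ _ _ _ (balls n)); last first.
    move=> x Vx; rewrite (_ : chi m x = 0) ?mul0r//.
    by apply: closure_supp_vanish1 => /subV.
  rewrite (@int_eq _ _ _ mu _ _ (fun x => f x * chi m x)) => [|x _]; first exact: h.
  exact: mulrC.
have cv k : L1 mu setT k -> (\int[mu]_x (chi m x * k x)) @[m --> \oo] --> \int[mu]_x k x.
  move=> Lk; have [] := @dominated_cvg_int _ _ _ mu setT (fun n x => chi n x * k x) k (fun x => `|k x|) measurableT.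
  - by move=> n; apply: measurable_funM; [exact: mchi|exact: L1_meas Lk].
  - exact: L1_meas Lk.
  - exact: L1_abs.
  - apply/nearW => x _; have [N hN] := nat_gt (dot x x).
    apply: cvg_near_cst; exists N => // n /= Nn.
    have [_ _ _ c1 _] := hchi n; rewrite c1 ?mul1r//; apply: (le_trans (ltW hN)).
    rewrite -natrX ler_nat; apply: leq_trans (_ : n.+1 <= _)%N => //; exact: leq_pmulr.
  - move=> n; apply/nearW => x _; have [_ /(_ x)/andP[h1 h2] _ _ _] := hchi n.
    by rewrite normrM ger0_norm// ler_piMl.
  by move=> _; exact.
have l1 : `|\int[mu]_x (chi m x * f x) - alpha * \int[mu]_x (chi m x * g x)| @[m --> \oo] -->
   `|\int[mu]_x f x - alpha * \int[mu]_x g x|.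
  apply: cvg_norm; apply: cvgB; first exact: cv.
  by apply: cvgMr; exact: cv.
have C0 : 0 <= C.
  have K0 : 0 <= M / alpha + 1 by rewrite addr_ge0// ltW// divr_gt0.
  rewrite !addr_ge0// mulr_ge0//; last by apply: sumr_ge0 => i _; exact: n1_ge0.
  rewrite addr_ge0//; last by apply: sumr_ge0 => i _; apply: sumr_ge0 => j _; exact: n1_ge0.
  by rewrite !mulr_ge0// addr_ge0// mulr_ge0// n1_ge0.
apply/eqP; rewrite eq_sym -subr_eq0 -normr_le0; apply/ler_addgt0Pr => e e0; rewrite add0r.
apply: (ler_cvg_to l1 (cvg_cst e)); have [N hN] := nat_gt (8 * C / e); exists N => // n /= Nn.
apply: (le_trans (est n)); rewrite mulrAC ler_pdivrMr// -ler_pdivrMl// mulrC.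
by apply: (le_trans (ltW hN)); rewrite ler_nat.
Unshelve. all: end_near. Qed.

End integrable_coefficients.

(** * From the resolvent to the semigroup *)

Section semigroup_iteration.
Context {R : realType} {d : nat}.
Local Notation E := 'rV[R]_d.
Variables (mu : {measure set E -> \bar R}) (V : set E) (S : R -> (E -> R) -> E -> R).
Hypothesis mV : measurable V.
Hypothesis HS : submarkov_semigroup mu V S.
Implicit Types (x : E) (f g u v : E -> R) (s t a c e M : R) (k n N : nat).

Let rem h u f x : R := (S h u x - u x) / h - f x.

Lemma generatorI u f : L1 mu V u -> L1 mu V f ->
  (forall e, 0 < e -> exists2 t0 : R, 0 < t0 & forall t, 0 < t -> t <= t0 ->
    n1 mu V (fun x => (S t u x - u x) / t - f x) <= e) -> generator mu V S u f.
Proof.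
move=> Lu Lf H; split; [by apply/(Lp1P _ _ mV)|by apply/(Lp1P _ _ mV)|].
have c0 : n1 mu V (fun x => (S t u x - u x) / t - f x) @[t --> 0^'+] --> 0.
  apply/cvgrPdist_le => e e0; have [t0 t00 h] := H e e0.
  near=> t; rewrite sub0r normrN ger0_norm ?n1_ge0//; apply: h.
    by near: t; exact: nbhs_right_gt.
  by near: t; exact: nbhs_right_le.
apply: cvg_trans (cvg_EFinW c0); apply: near_eq_cvg; near=> t.
have t0 : 0 < t by near: t; exact: nbhs_right_gt.
by rewrite /= (Lpnorm1E mV (generator_rem mV HS t0 Lu Lf)).
Unshelve. all: end_near. Qed.

Lemma sg_abs_bounded t f M : 0 < t -> 0 < M -> L1 mu V f -> (\forall x \ae mu, V x -> `|f x| <= M) ->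
  \forall x \ae mu, V x -> `|S t f x| <= M.
Proof.
move=> t0 M0 Lf fM; have La := L1_abs mV Lf.
have fM' : \forall x \ae mu, V x -> 0 <= `|f x| <= M by apply: filterS fM => x h /h ->; rewrite normr_ge0.
have h1 : \forall x \ae mu, V x -> f x <= `|f x| by apply/nearW => x _; exact: ler_norm.
have h2 : \forall x \ae mu, V x -> -1 * f x <= `|f x|.
  by apply/nearW => x _; rewrite mulN1r -normrN ler_norm.
apply: filterS2 (filterI (sg_le mV HS t0 Lf La h1) (sg_bounded mV HS t0 M0 La fM'))
  (filterI (sg_le mV HS t0 (L1Z (-1) mV Lf) La h2) (sgZ mV HS (-1) t0 Lf)) => x [k1 k2] [k3 k4] Vx.
have := k1 Vx; have := k3 Vx; rewrite k4//; have := k2 Vx => /andP[_ k5] k6 k7.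
by rewrite ler_norml; lra.
Qed.

Lemma sg_comm s t f : 0 < s -> 0 < t -> L1 mu V f -> \forall x \ae mu, V x -> S s (S t f) x = S t (S s f) x.
Proof.
move=> s0 t0 Lf; apply: filterS2 (sgD mV HS s0 t0 Lf) (sgD mV HS t0 s0 Lf) => x h1 h2 Vx.
by rewrite -h1// addrC h2.
Qed.

Lemma rem_sg s h u f : 0 < s -> 0 < h -> L1 mu V u -> L1 mu V f ->
  \forall x \ae mu, V x -> rem h (S s u) (S s f) x = S s (rem h u f) x.
Proof.
move=> s0 h0 Lu Lf; have LSu := sg_L1 mV HS h0 Lu.
pose v x := (- h^-1) * u x + ((-1) * f x + 0).
have Lz : L1 mu V (fun x => -1 * f x + 0) by apply: L1D => //; [exact: L1Z|exact: L1_0].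
have Lv : L1 mu V v by apply: L1D => //; exact: L1Z.
have Lw : L1 mu V (fun x => h^-1 * S h u x + v x) by apply: L1D => //; exact: L1Z.
have e0 : \forall x \ae mu, V x -> rem h u f x = h^-1 * S h u x + v x.
  by apply/nearW => x _; rewrite /rem /v; ring.
have e1 := sg_ae mV HS s0 (generator_rem mV HS h0 Lu Lf) Lw e0.
have e2 := sg_lin mV HS h^-1 s0 LSu Lv.
have e3 := sg_lin mV HS (- h^-1) s0 Lu Lz.
have e4 : \forall x \ae mu, V x -> S s (fun x => -1 * f x + 0) x = - S s f x.
  have e5 : \forall x \ae mu, V x -> -1 * f x + 0 = -1 * f x by apply/nearW => x _; rewrite addr0.
  apply: filterS2 (sg_ae mV HS s0 Lz (L1Z (-1) mV Lf) e5) (sgZ mV HS (-1) s0 Lf) => x h1 h2 Vx.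
  by rewrite h1// h2// mulN1r.
apply: filterS2 (filterI e1 e2) (filterI (sg_comm s0 h0 Lu) (filterI e3 e4)) => x [h1 h2] [h3 [h4 h5]] Vx.
by rewrite h1// h2// h4// h5// /rem h3//; ring.
Qed.

Lemma n1_rem_sg s h u f : 0 < s -> 0 < h -> L1 mu V u -> L1 mu V f ->
  n1 mu V (rem h (S s u) (S s f)) <= n1 mu V (rem h u f).
Proof.
move=> s0 h0 Lu Lf; have Lr := generator_rem mV HS h0 Lu Lf.
apply: le_trans (sg_contr mV HS s0 Lr); rewrite le_eqVlt; apply/orP; left; apply/eqP.
apply: n1_eq_ae => //; [|exact: sg_L1|exact: rem_sg].
by apply: (generator_rem mV HS h0); exact: sg_L1.
Qed.

(** [S_s] commutes with difference quotients and is a contraction, so the remainder for [S_s g] is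
    at most that for [g]. *)
Lemma resolvent_sg s a f g : 0 < s -> resolvent mu V S a f g -> resolvent mu V S a (S s f) (S s g).
Proof.
move=> s0 Hg; have [Lf _] := resolvent_L1 mV HS Hg; have [Lg Lh H] := generatorE mV HS Hg.
have LSf := sg_L1 mV HS s0 Lf; have LSg := sg_L1 mV HS s0 Lg.
have LSh : L1 mu V (fun x => a * S s g x - S s f x) by apply: L1B => //; exact: L1Z.
apply: generatorI => // e e0; have [t0 t00 h] := H e e0; exists t0 => // t tp tt.
apply: le_trans (h t tp tt); apply: le_trans (n1_rem_sg s0 tp Lg Lh).
have Le : \forall x \ae mu, V x -> S s (fun x => a * g x - f x) x = a * S s g x - S s f x.
  have Lag := L1Z a mV Lg.
  apply: filterS2 (sgB mV HS s0 Lag Lf) (sgZ mV HS a s0 Lg) => x h1 h2 Vx.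
  by rewrite h1// h2.
rewrite le_eqVlt; apply/orP; left; apply/eqP; apply: n1_eq_ae => //.
- by have := generator_rem mV HS tp LSg LSh.
- by apply: (generator_rem mV HS tp LSg); exact: sg_L1.
- by apply: filterS Le => x e1 Vx; rewrite /rem e1.
Qed.

Section discrete.
Variable h : R.
Hypothesis h0 : 0 < h.

Let it k f := iter k (S h) f.

Lemma it_L1 k f : L1 mu V f -> L1 mu V (it k f).
Proof. by move=> Lf; elim: k => //= k IH; exact: sg_L1. Qed.

Lemma it_contr k f : L1 mu V f -> n1 mu V (it k f) <= n1 mu V f.
Proof.
by move=> Lf; elim: k => //= k IH; apply: le_trans IH; apply: sg_contr => //; exact: it_L1.
Qed.

Lemma it_bounded k f M : 0 < M -> L1 mu V f -> (\forall x \ae mu, V x -> `|f x| <= M) ->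
  \forall x \ae mu, V x -> `|it k f x| <= M.
Proof. by move=> M0 Lf fM; elim: k => //= k IH; apply: sg_abs_bounded => //; exact: it_L1. Qed.

Lemma it_ge0 k f : L1 mu V f -> (\forall x \ae mu, V x -> 0 <= f x) ->
  \forall x \ae mu, V x -> 0 <= it k f x.
Proof. by move=> Lf f0; elim: k => //= k IH; apply: sg_ge0 => //; exact: it_L1. Qed.

Lemma it_resolvent k a f g : resolvent mu V S a f g -> resolvent mu V S a (it k f) (it k g).
Proof. by move=> H; elim: k => //= k IH; exact: resolvent_sg. Qed.

Lemma it_sg k f : L1 mu V f -> \forall x \ae mu, V x -> it k.+1 f x = S (k.+1%:R * h) f x.
Proof.
move=> Lf; elim: k => [|k IH]; first by rewrite mul1r; apply/nearW.
have k0 : 0 < k.+1%:R * h by rewrite mulr_gt0.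
have e1 := sg_ae mV HS h0 (it_L1 k.+1 Lf) (sg_L1 mV HS k0 Lf) IH.
have e2 := sgD mV HS h0 k0 Lf.
have -> : k.+2%:R * h = h + k.+1%:R * h by rewrite -[k.+2]addn1 natrD; ring.
by apply: filterS2 e1 e2 => x h1 h2 Vx; rewrite /it iterS -/(it k.+1 f) h1// h2.
Qed.

(** Remainders do not grow along the grid, so one choice of the step controls all of them. *)
Lemma it_rem k a f g : resolvent mu V S a f g ->
  n1 mu V (rem h (it k g) (fun x => a * it k g x - it k f x)) <= n1 mu V (rem h g (fun x => a * g x - f x)).
Proof.
move=> Hg; elim: k => // k IH; apply: le_trans IH.
have Hk := it_resolvent k Hg; have [Lfk Lgk] := resolvent_L1 mV HS Hk.
have [_ Lhk _] := generatorE mV HS Hk.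
apply: le_trans (n1_rem_sg h0 h0 Lgk Lhk).
have LSf := sg_L1 mV HS h0 Lfk; have LSg := sg_L1 mV HS h0 Lgk.
have LSh : L1 mu V (fun x => a * S h (it k g) x - S h (it k f) x) by apply: L1B => //; exact: L1Z.
have Le : \forall x \ae mu, V x -> S h (fun x => a * it k g x - it k f x) x = a * S h (it k g) x - S h (it k f) x.
  have Lag := L1Z a mV Lgk.
  apply: filterS2 (sgB mV HS h0 Lag Lfk) (sgZ mV HS a h0 Lgk) => x h1 h2 Vx.
  by rewrite h1// h2.
rewrite le_eqVlt; apply/orP; left; apply/eqP; apply: n1_eq_ae => //.
- by have := generator_rem mV HS h0 LSg LSh.
- by apply: (generator_rem mV HS h0 LSg); exact: sg_L1.
- by apply: filterS Le => x e1 Vx; rewrite /rem e1.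
Qed.

Lemma it_step k a f g x : it k.+1 g x = it k g x + h * (a * it k g x - it k f x) +
  h * rem h (it k g) (fun x => a * it k g x - it k f x) x.
Proof. by rewrite /rem /it iterS; field; exact: lt0r_neq0. Qed.

End discrete.

Lemma small_step t (P : R -> Prop) : 0 < t -> (exists2 t0 : R, 0 < t0 & forall s, 0 < s -> s <= t0 -> P s) ->
  exists N, P (t / N.+1%:R) /\ 0 < t / N.+1%:R.
Proof.
move=> t0 [s0 s00 H]; have [N hN] := nat_gt (t / s0); exists N.
have p : 0 < t / N.+1%:R by rewrite divr_gt0.
split => //; apply: H => //; rewrite ler_pdivrMr// mulrC -ler_pdivrMr//.
exact: ltW.
Qed.

Lemma it_total t N : (N.+1%:R * (t / N.+1%:R)) = t :> R.
Proof. by rewrite mulrC mulfVK. Qed.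

(** Along the iterates of step [h] the integral of [g_k] changes by [h] times the integral of
    [a g_k - f_k], which is 0 by conservation of mass for this pair, and by a remainder; the
    remainders add up to at most [t e]. *)
Lemma mass_invariant a f g M t : 0 < M -> 0 < t -> resolvent mu V S a f g ->
  (\forall x \ae mu, V x -> `|f x| <= M) -> (\forall x \ae mu, V x -> 0 <= f x) ->
  (forall f g, resolvent mu V S a f g -> (\forall x \ae mu, V x -> `|f x| <= M) ->
     (\forall x \ae mu, V x -> 0 <= f x) -> a * \int[mu]_(x in V) g x = \int[mu]_(x in V) f x) ->
  \int[mu]_(x in V) S t f x = \int[mu]_(x in V) f x.
Proof.
move=> M0 t0 Hg fM f0 mass; have [Lf Lg] := resolvent_L1 mV HS Hg.
have [_ Lh H] := generatorE mV HS Hg.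
have Hk h (h0 : 0 < h) k := it_resolvent h0 k Hg.
have eqg : \int[mu]_(x in V) S t g x = \int[mu]_(x in V) g x.
  apply/eqP; rewrite -subr_eq0; apply/eqP; apply: eps_zero; exists t => e e0 _.
  have [N [hN p]] := small_step (P := fun s => n1 mu V (rem s g (fun x => a * g x - f x)) <= e) t0 (H e e0); set h := t / N.+1%:R in hN p.
  have key k : `|\int[mu]_(x in V) iter k (S h) g x - \int[mu]_(x in V) g x| <= k%:R * (h * e).
    elim: k => [|k IH]; first by rewrite /= subrr normr0 mul0r.
    have [Lfk Lgk] := resolvent_L1 mV HS (Hk h p k).
    have fkM := it_bounded p k M0 Lf fM.
    have mk := mass _ _ (Hk h p k) fkM (it_ge0 p k Lf f0).
    set r := rem h (iter k (S h) g) (fun x => a * iter k (S h) g x - iter k (S h) f x).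
    have Lrk : L1 mu V r.
      by apply: (generator_rem mV HS p Lgk); apply: L1B => //; exact: L1Z.
    have rk : n1 mu V r <= e by apply: le_trans (it_rem p k Hg) hN.
    have I1 := L1Z h mV Lrk; have I2 := L1Z a mV Lgk; have I3 := L1B mV I2 Lfk; have I4 := L1Z h mV I3.
    have I5 := L1D mV Lgk I4.
    have -> : \int[mu]_(x in V) iter k.+1 (S h) g x = \int[mu]_(x in V) iter k (S h) g x + h * \int[mu]_(x in V) r x.
      rewrite (@int_eq _ _ _ mu _ _ (fun x => iter k (S h) g x + h * (a * iter k (S h) g x - iter k (S h) f x) + h * r x)).
        rewrite RintegralD// RintegralD// !RintegralZl// RintegralB// RintegralZl// mk.
        by rewrite subrr mulr0 addr0.
      by move=> x _; rewrite (it_step p k a f).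
    rewrite addrAC (le_trans (ler_normD _ _))// -[k.+1]addn1 natrD mulrDl mul1r lerD//.
    rewrite normrM gtr0_norm// ler_wpM2l ?(ltW p)//; exact: le_trans (int_le_n1 mV Lrk) rk.
  have := key N.+1; rewrite mulrA it_total.
  rewrite (_ : \int[mu]_(x in V) iter N.+1 (S h) g x = \int[mu]_(x in V) S t g x)//.
  apply: int_eq_ae => //; [exact: L1_meas (it_L1 p N.+1 Lg)|exact: L1_meas (sg_L1 mV HS t0 Lg)|].
  by have := it_sg p N Lg; rewrite it_total.
(* Invariance of the integral of [g] is transferred to [f] by conservation of mass for [(f, g)] and
   for [(S_t f, S_t g)]. *)
rewrite -(mass _ _ Hg fM f0) -eqg; apply/esym; apply: mass; first exact: resolvent_sg.
  exact: sg_abs_bounded.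
exact: sg_ge0.
Qed.

Lemma bernoulli (x : R) n : 0 <= x -> 1 + n%:R * x <= (1 + x) ^+ n.
Proof.
move=> x0; elim: n => [|n IH]; first by rewrite mul0r addr0 expr0.
rewrite exprS; apply: (@le_trans _ _ ((1 + x) * (1 + n%:R * x))); last by rewrite ler_wpM2l// addr_ge0.
rewrite -[n.+1]addn1 natrD mulrDl mul1r.
have : 0 <= n%:R * x * x by rewrite !mulr_ge0.
by move: (n%:R * x) => y; nra.
Qed.

(* With g_k := S_h^k g and q := 1/(1 + a h), a g_k - u = q (a g_(k+1) - u) + (1 - q) (S_h^k u - u)
   up to the remainder, which is iterated over a time interval on which S_t u stays close to u. *)
Lemma resolvent_approx u e : L1 mu V u -> 0 < e ->
  exists2 a0 : R, 0 < a0 & forall a g, a0 <= a -> resolvent mu V S a u g ->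
    n1 mu V (fun x => a * g x - u x) <= e.
Proof.
move=> Lu e0; have e3 : 0 < e / 3 by rewrite divr_gt0.
have [del del0 hdel] := sg_C0 mV HS Lu e3.
(* By Bernoulli [q^(N+1) <= 1/(1 + a del)], so for [a >= Q] the initial error, at most twice the
   norm of [u], has shrunk below [e / 3] after [N + 1] steps, independently of [N]. *)
pose Q := 2 * n1 mu V u / (del * (e / 3)).
exists (Q + 1); first by rewrite ltr_wpDl// divr_ge0 ?mulr_ge0 ?n1_ge0// ltW.
move=> a g Qa Hg.
have Q0 : 0 <= Q by rewrite divr_ge0 ?mulr_ge0 ?n1_ge0// ltW.
have a0 : 0 < a by apply: lt_le_trans Qa; rewrite ltr_wpDl.
have [_ Lg] := resolvent_L1 mV HS Hg; have [_ _ H] := generatorE mV HS Hg.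
have [N [hN p]] := small_step (P := fun s => n1 mu V (rem s g (fun x => a * g x - u x)) <= e / 3) del0 (H _ e3); set h := del / N.+1%:R in hN p.
pose q := (1 + a * h)^-1; have ah : 0 < a * h by rewrite mulr_gt0.
have q0 : 0 < q by rewrite invr_gt0 ltr_wpDl.
have q1 : q <= 1 by rewrite invf_le1 ?lerDl ?(ltW ah)// ltr_wpDl.
pose Er k := n1 mu V (fun x => a * iter k (S h) g x - u x).
have step k : (k <= N)%N -> Er k <= q * Er k.+1 + (1 - q) * (e / 3 + e / 3).
  move=> kN; have [Luk Lgk] := resolvent_L1 mV HS (it_resolvent p k Hg).
  have [_ Lgk1] := resolvent_L1 mV HS (it_resolvent p k.+1 Hg).
  set r := rem h (iter k (S h) g) (fun x => a * iter k (S h) g x - iter k (S h) u x).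
  have Lrk : L1 mu V r by apply: (generator_rem mV HS p Lgk); apply: L1B => //; exact: L1Z.
  have rk : n1 mu V r <= e / 3 by apply: le_trans (it_rem p k Hg) hN.
  have uk : n1 mu V (fun x => iter k (S h) u x - u x) <= e / 3.
    case: k kN Luk {Lgk Lgk1 r Lrk rk} => [_ _|k kN Luk].
      rewrite (_ : n1 _ _ _ = 0) ?(ltW e3)// -[RHS](int0 mu V); apply: int_eq => x _.
      by rewrite /= subrr normr0.
    have kh : 0 < k.+1%:R * h by rewrite mulr_gt0.
    apply: le_trans (hdel _ kh _); last first.
      by rewrite -[leRHS](it_total del N) ler_wpM2r ?(ltW p)// ler_nat ltnW.
    rewrite le_eqVlt; apply/orP; left; apply/eqP; apply: n1_eq_ae => //.
    - exact: L1B.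
    - by apply: L1B => //; exact: sg_L1.
    - by apply: filterS (it_sg p k Lu) => x e1 Vx; rewrite e1.
  have L3 := L1B mV Luk Lu; have L4 := L1B mV (L1Z a mV Lgk1) Lu.
  have L5 := L1B mV L3 Lrk.
  have -> : Er k = n1 mu V (fun x => q * (a * iter k.+1 (S h) g x - u x) + (1 - q) * (iter k (S h) u x - u x - r x)).
    apply: int_eq => x _; congr (`|_|); rewrite (it_step p k a u) -/(r x) /q.
    by field; apply: lt0r_neq0; rewrite ltr_wpDl.
  have q10 : 0 <= 1 - q by rewrite subr_ge0.
  apply: (le_trans (n1D mV (L1Z q mV L4) (L1Z (1 - q) mV L5))); rewrite !n1Z// gtr0_norm// (ger0_norm q10).
  rewrite lerD2l ler_wpM2l//; apply: (le_trans (n1B mV L3 Lrk)); exact: lerD.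
have main k : (k <= N.+1)%N -> Er 0%N <= q ^+ k * Er k + (1 - q ^+ k) * (e / 3 + e / 3).
  elim: k => [_|k IH kN]; first by rewrite expr0 subrr mul0r mul1r addr0.
  apply: (le_trans (IH (ltnW kN))).
  have := step k kN; have qk : 0 <= q ^+ k by rewrite exprn_ge0// ltW.
  move=> /(ler_wpM2l qk); rewrite exprSr; move: (Er k) (Er k.+1) (q ^+ k) => e1 e2 qq.
  lra.
have EN : Er N.+1 <= 2 * n1 mu V u.
  have [Luk Lgk] := resolvent_L1 mV HS (it_resolvent p N.+1 Hg).
  apply: (le_trans (n1B mV (L1Z a mV Lgk) Lu)); rewrite n1Z// gtr0_norm//.
  have := resolvent_n1 mV HS a0 (it_resolvent p N.+1 Hg).
  have := it_contr p N.+1 Lu; lra.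
have qN : q ^+ N.+1 * (2 * n1 mu V u) <= e / 3.
  have b : 1 + a * del <= (1 + a * h) ^+ N.+1.
    have := bernoulli N.+1 (ltW ah); rewrite mulrCA it_total//.
  have ad : 0 < 1 + a * del by rewrite ltr_wpDr// mulr_ge0// ltW.
  rewrite /q exprVn ler_pdivrMl; last by rewrite exprn_gt0// ltr_wpDl.
  apply: (@le_trans _ _ ((1 + a * del) * (e / 3))); last by rewrite ler_wpM2r// ltW.
  have : Q * (del * (e / 3)) <= a * (del * (e / 3)).
    by rewrite ler_wpM2r ?mulr_ge0 ?(ltW del0) ?(ltW e3)//; lra.
  rewrite /Q divfK; last by rewrite mulf_neq0// lt0r_neq0.
  by rewrite mulrDl mul1r mulrA; lra.
have := main N.+1 (leqnn _); rewrite -/(Er 0%N).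
have qk : 0 <= q ^+ N.+1 by rewrite exprn_ge0// ltW.
have h1 := ler_wpM2l qk EN.
have h2 : (1 - q ^+ N.+1) * (e / 3 + e / 3) <= e / 3 + e / 3.
  by rewrite ler_piMl ?addr_ge0 ?(ltW e3)// lerBlDr lerDl.
move: qN h1 h2; rewrite /Er /=; lra.
Qed.

End semigroup_iteration.

(** * Duality of the semigroups *)

Section semigroup_duality.
Context {R : realType} {d : nat}.
Local Notation E := 'rV[R]_d.
Variables (mu : {measure set E -> \bar R}) (V : set E) (S S' : R -> (E -> R) -> E -> R).
Hypothesis mV : measurable V.
Hypothesis HS : submarkov_semigroup mu V S.
Hypothesis HS' : submarkov_semigroup mu V S'.
Hypothesis resolvent_dual : forall (a M : R) (f f' g g' : E -> R), 0 < a -> 0 < M ->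
  resolvent mu V S a f g -> resolvent mu V S' a f' g' ->
  (\forall x \ae mu, V x -> `|f x| <= M) -> (\forall x \ae mu, V x -> `|f' x| <= M) ->
  \int[mu]_(x in V) (f x * g' x) = \int[mu]_(x in V) (f' x * g x).
Implicit Types (x : E) (f g u v k : E -> R) (s t a c e M K : R) (n N : nat).

Lemma bM_L1 f k K : L1 mu V f -> L1 mu V k -> (\forall x \ae mu, V x -> `|k x| <= K) ->
  L1 mu V (fun x => f x * k x).
Proof.
move=> Lf Lk kK.
by apply: (L1_eq mV _ (L1_bM mV (L1_meas Lk) Lf kK)) => x _; exact: mulrC.
Qed.

Lemma int_bM f k K : L1 mu V f -> L1 mu V k -> (\forall x \ae mu, V x -> `|k x| <= K) ->
  `|\int[mu]_(x in V) (f x * k x)| <= K * n1 mu V f.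
Proof.
move=> Lf Lk kK; have Lfk := bM_L1 Lf Lk kK; apply: (le_trans (int_le_n1 mV Lfk)).
have La := L1_abs mV Lf; rewrite -RintegralZl//; apply: int_le_ae => //; [exact: L1_abs|exact: L1Z|].
by apply: filterS kK => x h /h kx; rewrite normrM mulrC ler_wpM2r.
Qed.

(* Telescoping k |-> \int (S_h^k g) (S'_h^(N-k) g'), whose increments are controlled by the
   duality of the resolvents and the remainders of the difference quotients. *)
Lemma dual_on_domain a f f' g g' M t : 0 < a -> 0 < M -> 0 < t ->
  resolvent mu V S a f g -> resolvent mu V S' a f' g' ->
  (\forall x \ae mu, V x -> `|f x| <= M) -> (\forall x \ae mu, V x -> `|f' x| <= M) ->
  \int[mu]_(x in V) (S t g x * g' x) = \int[mu]_(x in V) (g x * S' t g' x).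
Proof.
move=> a0 M0 t0 Hg Hg' fM f'M.
have [Lf Lg] := resolvent_L1 mV HS Hg; have [Lf' Lg'] := resolvent_L1 mV HS' Hg'.
have gK := resolvent_bounded mV HS a0 M0 Hg fM; have g'K := resolvent_bounded mV HS' a0 M0 Hg' f'M.
set K := M / a in gK g'K; have K0 : 0 < K by rewrite divr_gt0.
have [_ _ H] := generatorE mV HS Hg; have [_ _ H'] := generatorE mV HS' Hg'.
apply/eqP; rewrite -subr_eq0; apply/eqP; apply: eps_zero; exists (t * (2 * K)) => e e0 _.
pose rem (T : R -> (E -> R) -> E -> R) s (u v : E -> R) x := (T s u x - u x) / s - v x.
have [N [[hN hN'] p]] : exists N, (n1 mu V (rem S (t / N.+1%:R) g (fun x => a * g x - f x)) <= e /\
    n1 mu V (rem S' (t / N.+1%:R) g' (fun x => a * g' x - f' x)) <= e) /\ 0 < t / N.+1%:R.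
  apply: (small_step (P := fun s => n1 mu V (rem S s g (fun x => a * g x - f x)) <= e /\
    n1 mu V (rem S' s g' (fun x => a * g' x - f' x)) <= e) t0).
  have [t1 t10 h1] := H _ e0; have [t2 t20 h2] := H' _ e0.
  exists (Num.min t1 t2); first by rewrite lt_min t10.
  by move=> s s0; rewrite le_min => /andP[s1 s2]; split; [exact: h1|exact: h2].
set h := t / N.+1%:R in hN hN' p.
pose A n := iter n (S h) g; pose C n := iter n (S' h) g'.
pose F n := iter n (S h) f; pose F' n := iter n (S' h) f'.
have step (k j : nat) : `|\int[mu]_(x in V) (A k.+1 x * C j x) - \int[mu]_(x in V) (A k x * C j.+1 x)| <= h * (2 * K * e).
  have HA := it_resolvent mV HS p k Hg; have HC := it_resolvent mV HS' p j Hg'.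
  have [LF LA] := resolvent_L1 mV HS HA; have [LF' LC] := resolvent_L1 mV HS' HC.
  have LA1 := it_L1 mV HS p k.+1 Lg; have LC1 := it_L1 mV HS' p j.+1 Lg'.
  have FM := it_bounded mV HS p k M0 Lf fM; have F'M := it_bounded mV HS' p j M0 Lf' f'M.
  have AK := it_bounded mV HS p k K0 Lg gK; have CK := it_bounded mV HS' p j K0 Lg' g'K.
  have C1K := it_bounded mV HS' p j.+1 K0 Lg' g'K.
  set r := rem S h (A k) (fun x => a * A k x - F k x); set r' := rem S' h (C j) (fun x => a * C j x - F' j x).
  have Lr : L1 mu V r by apply: (generator_rem mV HS p LA); apply: L1B => //; exact: L1Z.
  have Lr' : L1 mu V r' by apply: (generator_rem mV HS' p LC); apply: L1B => //; exact: L1Z.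
  have rk : n1 mu V r <= e by apply: le_trans (it_rem mV HS p k Hg) hN.
  have rk' : n1 mu V r' <= e by apply: le_trans (it_rem mV HS' p j Hg') hN'.
  have I1 := bM_L1 LF LC CK; have I2 := bM_L1 LF' LA AK; have I3 := bM_L1 Lr LC CK; have I4 := bM_L1 Lr' LA AK.
  have I5 := bM_L1 LA1 LC CK; have I6 := bM_L1 LA LC1 C1K.
  have I7 := L1B mV I2 I1; have I8 := L1B mV I3 I4; have I9 := L1D mV I7 I8.
  have dual : \int[mu]_(x in V) (F k x * C j x) = \int[mu]_(x in V) (F' j x * A k x).
    exact: resolvent_dual a0 M0 HA HC FM F'M.
  have -> : \int[mu]_(x in V) (A k.+1 x * C j x) - \int[mu]_(x in V) (A k x * C j.+1 x) =
     h * (\int[mu]_(x in V) (r x * C j x) - \int[mu]_(x in V) (r' x * A k x)).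
    rewrite -RintegralB//.
    rewrite (@int_eq _ _ _ mu _ _ (fun x => h * ((F' j x * A k x - F k x * C j x) + (r x * C j x - r' x * A k x)))).
      rewrite RintegralZl// RintegralD// !RintegralB//.
      by rewrite -/(F k) -/(C j) -/(F' j) -/(A k) dual subrr add0r.
    move=> x _; rewrite (_ : A k.+1 x = A k x + h * (a * A k x - F k x) + h * r x); last exact: it_step.
    rewrite (_ : C j.+1 x = C j x + h * (a * C j x - F' j x) + h * r' x); last exact: it_step.
    by move: (A k x) (C j x) (F k x) (F' j x) (r x) (r' x) => *; ring.
  rewrite normrM gtr0_norm// ler_wpM2l ?(ltW p)//.
  apply: (le_trans (ler_normB _ _)).
  have b1 := int_bM Lr LC CK; have b2 := int_bM Lr' LA AK.
  have b3 : K * n1 mu V r <= K * e by rewrite ler_wpM2l ?(ltW K0).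
  have b4 : K * n1 mu V r' <= K * e by rewrite ler_wpM2l ?(ltW K0).
  apply: (le_trans (lerD (le_trans b1 b3) (le_trans b2 b4))).
  by rewrite -mulrA mulr_natl mulr2n.
have key (k : nat) : (k <= N.+1)%N ->
  `|\int[mu]_(x in V) (A k x * C (N.+1 - k)%N x) - \int[mu]_(x in V) (A 0%N x * C N.+1 x)| <= k%:R * (h * (2 * K * e)).
  elim: k => [_|k IH kN]; first by rewrite subn0 subrr normr0 mul0r.
  have := step k (N.+1 - k.+1)%N; rewrite subnSK// => h1.
  have := IH (ltnW kN); move: h1.
  set X := \int[mu]_(x in V) (A k.+1 x * _); set Y := \int[mu]_(x in V) (A k x * _); set Z := Rintegral _ _ _.
  move=> h1 h2; rewrite (_ : X - Z = (X - Y) + (Y - Z)); last by ring.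
  by rewrite (le_trans (ler_normD _ _))// -[k.+1]addn1 natrD mulrDl mul1r [leRHS]addrC lerD.
have := key N.+1 (leqnn _); rewrite subnn mulrA it_total -mulrA.
have -> : \int[mu]_(x in V) (A N.+1 x * C 0%N x) = \int[mu]_(x in V) (S t g x * g' x).
  apply: int_eq_ae => //.
  - by apply: measurable_funM; [exact: L1_meas (it_L1 mV HS p N.+1 Lg)|exact: L1_meas Lg'].
  - by apply: measurable_funM; [exact: L1_meas (sg_L1 mV HS t0 Lg)|exact: L1_meas Lg'].
  - by have := it_sg mV HS p N Lg; rewrite it_total; apply: filterS => x e1 Vx; rewrite /A e1.
have -> // : \int[mu]_(x in V) (A 0%N x * C N.+1 x) = \int[mu]_(x in V) (g x * S' t g' x).
  apply: int_eq_ae => //.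
  - by apply: measurable_funM; [exact: L1_meas Lg|exact: L1_meas (it_L1 mV HS' p N.+1 Lg')].
  - by apply: measurable_funM; [exact: L1_meas Lg|exact: L1_meas (sg_L1 mV HS' t0 Lg')].
  - by have := it_sg mV HS' p N Lg'; rewrite it_total; apply: filterS => x e1 Vx; rewrite /C e1.
by rewrite !mulrA.
Qed.

Hypothesis resolvent_ex : forall a f, 0 < a -> L1 mu V f -> exists g, resolvent mu V S a f g.
Hypothesis resolvent_ex' : forall a f, 0 < a -> L1 mu V f -> exists g, resolvent mu V S' a f g.

(** By [resolvent_approx] it is [a g] that approximates [f]; this exhibits [a g] as a resolvent, to
    which [dual_on_domain] applies. *)
Lemma scaled_resolvent T a f g : submarkov_semigroup mu V T -> resolvent mu V T a f g ->
  resolvent mu V T a (fun x => a * f x) (fun x => a * g x).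
Proof.
move=> HT Hg; have [Lf Lg] := resolvent_L1 mV HT Hg; have [_ Lh H] := generatorE mV HT Hg.
have Lag := L1Z a mV Lg; have Lah := L1Z a mV Lh.
have Lh' : L1 mu V (fun x => a * (a * g x) - a * f x).
  by apply: (L1_eq mV _ Lah) => x _; rewrite mulrBr.
apply: generatorI => // e e0; have a1 : 0 < `|a| + 1 by rewrite ltr_wpDl.
have e1 : 0 < e / (`|a| + 1) by rewrite divr_gt0.
have [t0 t00 h] := H _ e1; exists t0 => // t tp tt.
have Lr := generator_rem mV HT tp Lg Lh.
rewrite (n1_eq_ae mV (generator_rem mV HT tp Lag Lh') (L1Z a mV Lr)).
  rewrite n1Z//; apply: (@le_trans _ _ ((`|a| + 1) * (e / (`|a| + 1)))).
    by apply: ler_pM; rewrite ?n1_ge0//; [rewrite lerDl|exact: h].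
  by rewrite mulrC divfK// lt0r_neq0.
by apply: filterS (sgZ mV HT a tp Lg) => x e2 Vx; rewrite e2//; ring.
Qed.

(** [u] and [v] are replaced by [U = a g] and [W = a g'], close to them in L^1 for large [a]. All
    functions keep the bound [M], so each of the four replacements costs at most [M e]. *)
Lemma semigroup_duality u v M t : 0 < M -> 0 < t -> L1 mu V u -> L1 mu V v ->
  (\forall x \ae mu, V x -> `|u x| <= M) -> (\forall x \ae mu, V x -> `|v x| <= M) ->
  \int[mu]_(x in V) (S t u x * v x) = \int[mu]_(x in V) (u x * S' t v x).
Proof.
move=> M0 t0 Lu Lv uM vM.
apply/eqP; rewrite -subr_eq0; apply/eqP; apply: eps_zero; exists (4 * M) => e e0 _.
have [a1 a10 h1] := resolvent_approx mV HS Lu e0; have [a2 a20 h2] := resolvent_approx mV HS' Lv e0.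
pose a := Num.max a1 a2; have a0 : 0 < a by rewrite lt_max a10.
have [g Hg] := resolvent_ex a0 Lu; have [g' Hg'] := resolvent_ex' a0 Lv.
have {h1} h1 : n1 mu V (fun x => a * g x - u x) <= e by apply: h1 Hg; rewrite /a le_max lexx.
have {h2} h2 : n1 mu V (fun x => a * g' x - v x) <= e by apply: h2 Hg'; rewrite /a le_max lexx orbT.
have [_ Lg] := resolvent_L1 mV HS Hg; have [_ Lg'] := resolvent_L1 mV HS' Hg'.
have gK := resolvent_bounded mV HS a0 M0 Hg uM; have g'K := resolvent_bounded mV HS' a0 M0 Hg' vM.
pose U x := a * g x; pose W x := a * g' x.
have LU : L1 mu V U := L1Z a mV Lg; have LW : L1 mu V W := L1Z a mV Lg'.
have UM : \forall x \ae mu, V x -> `|U x| <= M.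
  by apply: filterS gK => x k /k; rewrite /U normrM gtr0_norm// ler_pdivlMr// mulrC.
have WM : \forall x \ae mu, V x -> `|W x| <= M.
  by apply: filterS g'K => x k /k; rewrite /W normrM gtr0_norm// ler_pdivlMr// mulrC.
have aM0 : 0 < a * M by rewrite mulr_gt0.
have auM : \forall x \ae mu, V x -> `|a * u x| <= a * M.
  by apply: filterS uM => x k /k; rewrite normrM gtr0_norm// ler_pM2l.
have avM : \forall x \ae mu, V x -> `|a * v x| <= a * M.
  by apply: filterS vM => x k /k; rewrite normrM gtr0_norm// ler_pM2l.
have main := dual_on_domain a0 aM0 t0 (scaled_resolvent HS Hg) (scaled_resolvent HS' Hg') auM avM.
rewrite -/U -/W in main.
have LSu := sg_L1 mV HS t0 Lu; have LSU := sg_L1 mV HS t0 LU.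
have LSv := sg_L1 mV HS' t0 Lv; have LSW := sg_L1 mV HS' t0 LW.
have SuM := sg_abs_bounded mV HS t0 M0 Lu uM; have SvM := sg_abs_bounded mV HS' t0 M0 Lv vM.
have d1 := le_trans (sg_diff mV HS t0 LU Lu) h1; have d2 := le_trans (sg_diff mV HS' t0 LW Lv) h2.
have LUu := L1B mV LU Lu; have LWv := L1B mV LW Lv; have LSUu := L1B mV LSU LSu; have LSWv := L1B mV LSW LSv.
have J1 := bM_L1 LSUu LW WM; have J2 := bM_L1 LWv LSu SuM; have J3 := bM_L1 LUu LSv SvM; have J4 := bM_L1 LSWv LU UM.
have b1 := le_trans (int_bM LSUu LW WM) (ler_wpM2l (ltW M0) d1).
have b2 := le_trans (int_bM LWv LSu SuM) (ler_wpM2l (ltW M0) h2).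
have b3 := le_trans (int_bM LUu LSv SvM) (ler_wpM2l (ltW M0) h1).
have b4 := le_trans (int_bM LSWv LU UM) (ler_wpM2l (ltW M0) d2).
have e1 : \int[mu]_(x in V) (S t U x * W x) - \int[mu]_(x in V) (S t u x * v x) =
  \int[mu]_(x in V) ((S t U x - S t u x) * W x) + \int[mu]_(x in V) ((W x - v x) * S t u x).
  have I1 := bM_L1 LSU LW WM; have I2 := bM_L1 LSu Lv vM.
  by rewrite -RintegralB// -RintegralD//; apply: int_eq => x _; ring.
have e2 : \int[mu]_(x in V) (U x * S' t W x) - \int[mu]_(x in V) (u x * S' t v x) =
  \int[mu]_(x in V) ((U x - u x) * S' t v x) + \int[mu]_(x in V) ((S' t W x - S' t v x) * U x).
  have SWM := sg_abs_bounded mV HS' t0 M0 LW WM.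
  have I1 := bM_L1 LU LSW SWM; have I2 := bM_L1 Lu LSv SvM.
  by rewrite -RintegralB// -RintegralD//; apply: int_eq => x _; ring.
move: e1 e2 b1 b2 b3 b4; rewrite main.
set I0 := \int[mu]_(x in V) (U x * _); set I1 := \int[mu]_(x in V) (S t u x * v x).
set I2 := \int[mu]_(x in V) (u x * _).
set K1 := \int[mu]_(x in V) (_ * W x); set K2 := \int[mu]_(x in V) ((W x - _) * _).
set K3 := \int[mu]_(x in V) ((U x - _) * _); set K4 := \int[mu]_(x in V) (_ * U x).
move=> e1 e2 b1 b2 b3 b4.
have -> : I1 - I2 = K3 + K4 - (K1 + K2) by rewrite -e1 -e2; ring.
have t1 := ler_normB (K3 + K4) (K1 + K2); have t2 := ler_normD K3 K4; have t3 := ler_normD K1 K2.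
lra.
Qed.

End semigroup_duality.

(** * Conservativeness *)

Section conservativeness.
Context {R : realType} {d : nat}.
Local Notation E := 'rV[R]_d.
Variables (mu : {measure set E -> \bar R}) (T T' : R -> (E -> R) -> E -> R).
Hypothesis mufin : forall r : R, (mu (cube r) < +oo)%E.
Hypothesis HT : submarkov_semigroup mu setT T.
Hypothesis HT' : submarkov_semigroup mu setT T'.
Hypothesis dual : forall (u v : E -> R) (M t : R), 0 < M -> 0 < t -> L1 mu setT u -> L1 mu setT v ->
  (\forall x \ae mu, setT x -> `|u x| <= M) -> (\forall x \ae mu, setT x -> `|v x| <= M) ->
  \int[mu]_x (T t u x * v x) = \int[mu]_x (u x * T' t v x).
Implicit Types (x : E) (f g u v : E -> R) (s t M : R) (n N k : nat).

Let mT := @measurableT _ E.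

Lemma invariantP : invariant_measure mu T <-> (forall t f M, 0 < t -> 0 < M -> L1 mu setT f ->
  (\forall x \ae mu, setT x -> `|f x| <= M) -> (\forall x \ae mu, setT x -> 0 <= f x) ->
  \int[mu]_x T t f x = \int[mu]_x f x).
Proof.
split=> [inv t f M t0 M0 Lf fM f0|inv t f t0 /(Lp1P _ _ mT) Lf /(LpooP _ _ mT)[_ [M [M0 fM]]] f0].
  have fo : Lp mu +oo%E setT f.
    by apply/(LpooP _ _ mT); split; [exact: L1_meas Lf|exists M; rewrite (ltW M0)].
  rewrite /Rintegral (inv t f t0 ((Lp1P _ _ mT).2 Lf) fo)//.
  by apply: filterS f0 => x; exact.
have M10 : 0 < M + 1 by rewrite ltr_wpDl.
have fM1 : \forall x \ae mu, setT x -> `|f x| <= M + 1.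
  by apply: filterS fM => x h /h hx; apply: (le_trans hx); rewrite lerDl.
have f0T : \forall x \ae mu, setT x -> 0 <= f x by apply: filterS f0.
have := inv t f (M + 1) t0 M10 Lf fM1 f0T.
have fin1 := integrable_fin_num mT Lf; have fin2 := integrable_fin_num mT (sg_L1 mT HT t0 Lf).
by rewrite /Rintegral => e; rewrite -[LHS]fineK// e fineK.
Qed.

(** By monotonicity the limit is the infimum, whose integral over a cube is below that of each [h n]
    and hence 0. The positive parts [h'] keep the sequence bounded below at every point, as the
    infimum requires. *)
Lemma decreasing_to_zero (h : nat -> E -> R) : (forall n, measurable_fun setT (h n)) ->
  (forall n, \forall x \ae mu, 0 <= h n.+1 x <= h n x) -> (forall n k, L1 mu (cube k%:R) (h n)) ->
  (forall k, \int[mu]_(x in cube k%:R) h n x @[n --> \oo] --> 0) ->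
  \forall x \ae mu, h n x @[n --> \oo] --> 0.
Proof.
move=> mh hd Lh hc.
pose h' n x := Num.max 0 (h n x); pose F x := infs (h'^~ x) 0%N.
have lb x : has_lbound (range (h'^~ x)).
  by exists 0 => _ [n _ <-]; rewrite /h' le_max lexx.
have mF : measurable_fun setT F.
  apply: measurable_fun_infs => [x _|n]; first exact: lb.
  exact: measurable_maxr.
have FE x : F x = inf (range (h'^~ x)).
  by rewrite /F /infs /sdrop; congr inf; apply/seteqP; split=> _ [n _ <-]; exists n.
have F0 x : 0 <= F x.
  rewrite FE; apply: lb_le_inf; first by exists (h' 0%N x), 0%N.
  by move=> _ [n _ <-]; rewrite /h' le_max lexx.
have Fh n x : F x <= h' n x by rewrite FE; apply: ge_inf => //; exists n.
have hn0 n : \forall x \ae mu, 0 <= h n x.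
  by apply: filterS (hd n) => x /andP[h1 h2]; exact: le_trans h2.
have FZ k : \forall x \ae mu, cube k%:R x -> F x = 0.
  have mc : measurable (cube k%:R : set E) by exact: measurable_cube.
  have LF : L1 mu (cube k%:R) F.
    apply: (L1_dom mc _ (Lh 0%N k)); first exact: measurable_funS mF.
    apply: filterS (hn0 0%N) => x hx _; rewrite ger0_norm//; apply: (le_trans (Fh 0%N x)).
    by rewrite /h' max_r.
  apply: (n1_0_ae mc LF); apply/eqP; rewrite eq_le n1_ge0 andbT.
  apply: (ler_cvg_to (cvg_cst (n1 mu (cube k%:R) F)) (hc k)); apply/nearW => n.
  apply: int_le_ae => //; first exact: L1_abs.
  apply: filterS (hn0 n) => x hx _; rewrite ger0_norm//; apply: (le_trans (Fh n x)).
  by rewrite /h' max_r.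
apply: filterS3 (ae_foralln FZ) (ae_foralln hd) (hn0 0%N) => x h1 h2 h3.
have [k xk] := cube_cover x; have Fx := h1 k xk.
have pos n : 0 <= h n x by case: n => [//|n]; have /andP[] := h2 n.
have dec : {homo (h'^~ x) : n m / (n <= m)%N >-> m <= n}.
  apply/nonincreasing_seqP => n; rewrite /h' !max_r//.
  by have /andP[] := h2 n.
have := nonincreasing_cvgn dec (lb x); rewrite -FE Fx.
by apply: cvg_trans; apply: near_eq_cvg; apply/nearW => n; rewrite /h' max_r.
Qed.

Lemma monotone_approx_facts (c : R) p (f : E -> R) : 0 <= c -> (forall x, f x = c) -> monotone_approx mu f p ->
  [/\ forall n, L1 mu setT (p n), forall n, \forall x \ae mu, setT x -> 0 <= p n x <= c &
    forall n, \forall x \ae mu, setT x -> p n x <= p n.+1 x].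
Proof.
move=> c0 fc [pL pm pc]; split=> n.
- by apply/(Lp1P _ _ mT); have [] := pL n.
- apply: filterS2 (ae_foralln pm) pc => x h1 h2 _; rewrite fc in h2.
  have nd : nondecreasing_seq (p^~ x) by apply/nondecreasing_seqP => m; have /andP[] := h1 m.
  have /andP[-> _] /= := h1 n; rewrite -(cvg_lim _ h2)//; apply: nondecreasing_cvgn_le => //.
  by apply/cvg_ex; exists c.
- by apply: filterS (pm n) => x /andP[].
Qed.

Lemma pairing_limit u (p : nat -> E -> R) (f : E -> R) : L1 mu setT u -> (forall n, measurable_fun setT (p n)) ->
  measurable_fun setT f -> (forall n, \forall x \ae mu, setT x -> 0 <= p n x <= 1) ->
  (\forall x \ae mu, p n x @[n --> \oo] --> f x) ->
  \int[mu]_x (u x * p n x) @[n --> \oo] --> \int[mu]_x (u x * f x).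
Proof.
move=> Lu mp mf p1 pc; have mu' := L1_meas Lu.
have [] := @dominated_cvg_int _ _ _ mu setT (fun n x => u x * p n x) (fun x => u x * f x) (fun x => `|u x|) mT.
- by move=> n; exact: measurable_funM.
- exact: measurable_funM.
- exact: L1_abs.
- by apply: filterS pc => x h _; exact: cvgMr.
- move=> n; apply: filterS (p1 n) => x h Vx; have /andP[h1 h2] := h Vx.
  by rewrite normrM (ger0_norm h1) ler_piMr.
by move=> _; exact.
Qed.

(** For [u] the indicator of a cube, duality turns the integral of [1 - T'_t p_n] over the cube into
    that of [u] minus that of [T_t u] times [p_n], which tends to 0 by invariance as [p_n] increases
    to 1. Sequences approximating the negative part of 1 vanish almost everywhere. *)
Lemma invariant_conservative : invariant_measure mu T -> forall t, 0 < t -> conservative_at mu t T'.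
Proof.
move=> /invariantP inv t t0.
have oo1 : Lp mu +oo%E setT (cst 1 : E -> R).
  apply/(LpooP _ _ mT); split; first exact: measurable_cst.
  by exists 1; split => //; apply/nearW => x _; rewrite /cst normr1.
split => // p q Hp Hq.
have p1 x : (cst 1 : E -> R)^\+ x = 1 by rewrite /funrpos /= max_l.
have q0 x : (cst 1 : E -> R)^\- x = 0 by rewrite /funrneg /= max_r// lerN10.
have [Lp p01 pm] := monotone_approx_facts ler01 p1 Hp.
have [Lq q00 _] := monotone_approx_facts (lexx 0) q0 Hq.
have Tq n : \forall x \ae mu, setT x -> T' t (q n) x = 0.
  apply: (n1_0_ae mT (sg_L1 mT HT' t0 (Lq n))); apply/eqP; rewrite eq_le n1_ge0 andbT.
  apply: (le_trans (sg_contr mT HT' t0 (Lq n))).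
  rewrite (_ : n1 _ _ _ = 0)// -[RHS](int0 mu setT); apply: int_eq_ae => //.
    exact: L1_meas (L1_abs mT (Lq n)).
  by apply: filterS (q00 n) => x h /h; rewrite -eq_le => /eqP <-; rewrite normr0.
have Tp01 n := sg_bounded mT HT' t0 ltr01 (Lp n) (p01 n).
have Tpm n := sg_le mT HT' t0 (Lp n) (Lp n.+1) (pm n).
have LTp n := sg_L1 mT HT' t0 (Lp n).
pose h n x := 1 - T' t (p n) x.
have mh n : measurable_fun setT (h n) by apply: measurable_funB => //; exact: L1_meas (LTp n).
have Lh n k : L1 mu (cube k%:R) (h n).
  apply: (@L1_bounded _ _ _ _ _ _ 1) => //; first exact: measurable_cube.
    exact: measurable_funS (mh n).
  by apply: filterS (Tp01 n) => x hx _; have := hx I; rewrite /h ler_norml; lra.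
have hc k : \int[mu]_(x in cube k%:R) h n x @[n --> \oo] --> 0.
  have mc : measurable (cube k%:R : set E) by exact: measurable_cube.
  pose u : E -> R := \1_(cube k%:R).
  have L1c : L1 mu (cube k%:R) (fun=> 1 : R).
    by apply: (@L1_bounded _ _ _ _ _ _ 1) => //; apply/nearW => x _; rewrite normr1.
  have uin x : cube k%:R x -> u x = 1 by move=> xc; rewrite /u indicE mem_set.
  have uout x : ~ cube k%:R x -> u x = 0 by move=> xc; rewrite /u indicE memNset.
  have Lu : L1 mu setT u.
    by apply: (L1_ext mc uout); apply: (L1_eq mc _ L1c) => x /uin.
  have u01 x : 0 <= u x <= 1 by rewrite /u indicE; case: (_ \in _); rewrite ?lexx ler01.
  have uM : \forall x \ae mu, setT x -> `|u x| <= 1.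
    by apply/nearW => x _; have /andP[h1 h2] := u01 x; rewrite ger0_norm.
  have u0 : \forall x \ae mu, setT x -> 0 <= u x by apply/nearW => x _; have /andP[] := u01 x.
  have pM n : \forall x \ae mu, setT x -> `|p n x| <= 1.
    by apply: filterS (p01 n) => x hx /hx /andP[h1 h2]; rewrite ger0_norm.
  have [_ _ pc] := Hp.
  have pc1 : \forall x \ae mu, p n x @[n --> \oo] --> (1 : R) by apply: filterS pc => x; rewrite p1.
  have lim : \int[mu]_x (T t u x * p n x) @[n --> \oo] --> \int[mu]_x (T t u x * 1).
    apply: (@pairing_limit (T t u) p (fun=> 1)) => //; first exact: (sg_L1 mT HT t0 Lu).
    by move=> n; exact: L1_meas (Lp n).
  have e0 : \int[mu]_x (T t u x * 1) = \int[mu]_x u x.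
    rewrite -(inv t u 1 t0 ltr01 Lu uM u0); apply: int_eq => x _; by rewrite mulr1.
  rewrite e0 in lim.
  have e1 n : \int[mu]_(x in cube k%:R) h n x = \int[mu]_x u x - \int[mu]_x (T t u x * p n x).
    rewrite (dual ltr01 t0 Lu (Lp n) uM (pM n)).
    have I : L1 mu setT (fun x => u x * T' t (p n) x) by apply: L1_bM (L1_meas Lu) (LTp n) uM.
    rewrite -RintegralB// (@int_ext _ _ _ _ (cube k%:R)); last by move=> x /uout ->; rewrite mul0r subr0.
    by apply: int_eq => x /uin ->; rewrite mul1r.
  have : \int[mu]_x u x - \int[mu]_x (T t u x * p n x) @[n --> \oo] --> \int[mu]_x u x - \int[mu]_x u x.
    by apply: cvgB => //; exact: cvg_cst.
  by rewrite subrr; apply: cvg_trans; apply: near_eq_cvg; apply/nearW => n; rewrite e1.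
have hd n : \forall x \ae mu, 0 <= h n.+1 x <= h n x.
  by apply: filterS2 (Tp01 n.+1) (Tpm n) => x h1 h2; have := h1 I; have := h2 I; rewrite /h; lra.
apply: filterS2 (decreasing_to_zero mh hd Lh hc) (ae_foralln Tq) => x hx Tqx.
have : 1 - h n x @[n --> \oo] --> (1 - 0 : R) by apply: cvgB => //; exact: cvg_cst.
rewrite subr0; apply: cvg_trans; apply: near_eq_cvg; apply/nearW => n.
by rewrite /h Tqx// opprB addrC subrK subr0.
Qed.

Lemma invariant_iter t f M N : 0 < t -> 0 < M -> L1 mu setT f ->
  (\forall x \ae mu, setT x -> `|f x| <= M) -> (\forall x \ae mu, setT x -> 0 <= f x) ->
  (forall f, L1 mu setT f -> (\forall x \ae mu, setT x -> `|f x| <= M) ->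
    (\forall x \ae mu, setT x -> 0 <= f x) -> \int[mu]_x T (t / N.+1%:R) f x = \int[mu]_x f x) ->
  \int[mu]_x T t f x = \int[mu]_x f x.
Proof.
move=> t0 M0 Lf fM f0 H; set h := t / N.+1%:R in H; have h0 : 0 < h by rewrite divr_gt0.
have key n : \int[mu]_x iter n (T h) f x = \int[mu]_x f x.
  elim: n => [//|n IH]; rewrite -IH; apply: H.
  - exact: (it_L1 mT HT h0).
  - exact: (it_bounded mT HT h0).
  - exact: (it_ge0 mT HT h0).
rewrite -(key N.+1); apply: int_eq_ae => //.
- exact: L1_meas (sg_L1 mT HT t0 Lf).
- exact: L1_meas (it_L1 mT HT h0 N.+1 Lf).
- by have := it_sg mT HT h0 N Lf; rewrite /h it_total; apply: filterS => x e /e ->.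
Qed.

Lemma int_contr t f : 0 < t -> L1 mu setT f -> (\forall x \ae mu, setT x -> 0 <= f x) ->
  \int[mu]_x T t f x <= \int[mu]_x f x.
Proof.
move=> t0 Lf f0; have LTf := sg_L1 mT HT t0 Lf.
apply: (le_trans (ler_norm _)); apply: (le_trans (int_le_n1 mT LTf)).
apply: (le_trans (sg_contr mT HT t0 Lf)); apply: int_le_ae => //; first exact: L1_abs.
by apply: filterS f0 => x h /h h0; rewrite ger0_norm.
Qed.

(** Duality with indicators of cubes gives invariance at [t0]. The integral cannot increase along
    the semigroup, so equality at [t0] forces it at every smaller time; any other time is divided
    into steps shorter than [t0]. *)
Lemma conservative_invariant t0 : 0 < t0 -> conservative_at mu t0 T' -> invariant_measure mu T.
Proof.
move=> t00 [_ _ cons]; apply/invariantP.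
pose p n : E -> R := \1_(cube n%:R).
have mc n : measurable (cube n%:R : set E) by exact: measurable_cube.
have p01 n x : 0 <= p n x <= 1 by rewrite /p indicE; case: (_ \in _); rewrite ?lexx ler01.
have Lp n : L1 mu setT (p n).
  have L1c : L1 mu (cube n%:R) (fun=> 1 : R).
    by apply: (@L1_bounded _ _ _ _ _ _ 1) => //; apply/nearW => x _; rewrite normr1.
  apply: (@L1_ext _ _ _ _ (cube n%:R)) => //.
    by move=> x xc; rewrite /p indicE memNset.
  by apply: (L1_eq (mc n) _ L1c) => x xc; rewrite /p indicE mem_set.
have pM n : \forall x \ae mu, setT x -> `|p n x| <= 1.
  by apply/nearW => x _; have /andP[h1 h2] := p01 n x; rewrite ger0_norm.
have p1 x : p n x @[n --> \oo] --> (1 : R).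
  have [N xN] := cube_cover x; apply: cvg_near_cst; exists N => // n /= Nn.
  by rewrite /p indicE mem_set//; apply: (cube_le _ xN); rewrite ler_nat.
have Hp : monotone_approx mu ((cst 1 : E -> R)^\+) p.
  split=> [n|n|].
  - split; first by apply/(Lp1P _ _ mT).
    by apply/(LpooP _ _ mT); split; [exact: L1_meas (Lp n)|exists 1].
  - apply/nearW => x; have /andP[-> _] /= := p01 n x; rewrite /p !indicE.
    case: (boolP (x \in cube n%:R)) => [|_]; last by rewrite ler_nat.
    rewrite inE => xn; rewrite mem_set//; apply: (cube_le _ xn); by rewrite ler_nat.
  - apply/nearW => x; rewrite /funrpos /= max_l//; exact: p1.
have L0 : L1 mu setT (fun=> 0 : R) := L1_0 mu setT.
have Hq : monotone_approx mu ((cst 1 : E -> R)^\-) (fun _ _ => 0).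
  split=> [n|n|].
  - split; first by apply/(Lp1P _ _ mT).
    apply/(LpooP _ _ mT); split; first exact: measurable_cst.
    by exists 0; split => //; apply/nearW => x _; rewrite normr0.
  - by apply/nearW => x; rewrite lexx.
  - apply/nearW => x; rewrite /funrneg /= max_r ?lerN10//; exact: cvg_cst.
have T0 : \forall x \ae mu, setT x -> T' t0 (fun=> 0) x = 0.
  apply: (n1_0_ae mT (sg_L1 mT HT' t00 L0)); apply/eqP; rewrite eq_le n1_ge0 andbT.
  apply: (le_trans (sg_contr mT HT' t00 L0)).
  by rewrite (_ : n1 _ _ _ = 0)// -[RHS](int0 mu setT); apply: int_eq => x _; rewrite normr0.
have lim : \forall x \ae mu, T' t0 (p n) x @[n --> \oo] --> (1 : R).
  apply: filterS2 (cons p (fun _ _ => 0) Hp Hq) T0 => x h1 h2.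
  by move: h1; apply: cvg_trans; apply: near_eq_cvg; apply/nearW => n; rewrite h2// subr0.
have LTp n := sg_L1 mT HT' t00 (Lp n).
have Tp01 n : \forall x \ae mu, setT x -> 0 <= T' t0 (p n) x <= 1.
  by apply: (sg_bounded mT HT' t00 ltr01 (Lp n)); apply/nearW => x _; exact: p01.
have inv0 f M : 0 < M -> L1 mu setT f -> (\forall x \ae mu, setT x -> `|f x| <= M) ->
    \int[mu]_x T t0 f x = \int[mu]_x f x.
  move=> M0 Lf fM; have LTf := sg_L1 mT HT t00 Lf.
  have M10 : 0 < M + 1 by rewrite ltr_wpDl// ltW.
  have fM1 : \forall x \ae mu, setT x -> `|f x| <= M + 1.
    by apply: filterS fM => x h /h hx; apply: (le_trans hx); rewrite lerDl.
  have pM1 n : \forall x \ae mu, setT x -> `|p n x| <= M + 1.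
    by apply: filterS (pM n) => x h /h hx; apply: (le_trans hx); rewrite lerDr ltW.
  have c1 : \int[mu]_x (T t0 f x * p n x) @[n --> \oo] --> \int[mu]_x (T t0 f x * 1).
    apply: (@pairing_limit (T t0 f) p (fun=> 1)) => //.
    - by move=> n; exact: L1_meas (Lp n).
    - by move=> n; apply/nearW => x _; exact: p01.
    - by apply/nearW => x; exact: p1.
  have c2 : \int[mu]_x (f x * T' t0 (p n) x) @[n --> \oo] --> \int[mu]_x (f x * 1).
    apply: (@pairing_limit f (fun n => T' t0 (p n)) (fun=> 1)) => //.
    by move=> n; exact: L1_meas (LTp n).
  have {}c1 : \int[mu]_x (f x * T' t0 (p n) x) @[n --> \oo] --> \int[mu]_x (T t0 f x * 1).
    move: c1; apply: cvg_trans; apply: near_eq_cvg; apply/nearW => n.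
    exact: dual M10 t00 Lf (Lp n) fM1 (pM1 n).
  have := cvg_unique _ c1 c2; rewrite (@int_eq _ _ _ mu _ _ (T t0 f)) => [|x _]; last by rewrite mulr1.
  by move=> ->//; apply: int_eq => x _; rewrite mulr1.
have small t f M : 0 < t -> t < t0 -> 0 < M -> L1 mu setT f -> (\forall x \ae mu, setT x -> `|f x| <= M) ->
    (\forall x \ae mu, setT x -> 0 <= f x) -> \int[mu]_x T t f x = \int[mu]_x f x.
  move=> tp tt M0 Lf fM f0; apply/eqP; rewrite eq_le int_contr//=.
  have s0 : 0 < t0 - t by rewrite subr_gt0.
  rewrite -(inv0 f M M0 Lf fM); have LTf := sg_L1 mT HT tp Lf.
  have := int_contr s0 LTf (sg_ge0 mT HT tp Lf f0); congr (_ <= _).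
  apply: int_eq_ae => //; [exact: L1_meas (sg_L1 mT HT s0 LTf)|exact: L1_meas (sg_L1 mT HT t00 Lf)|].
  by have := sgD mT HT s0 tp Lf; rewrite subrK; apply: filterS => x e /e ->.
move=> t f M tp M0 Lf fM f0.
have [N hN] := nat_gt (t / t0).
apply: (@invariant_iter t f M N) => // g Lg gM g0; apply: (small _ g M) => //; first exact: divr_gt0.
by rewrite ltr_pdivrMr// mulrC -ltr_pdivrMr.
Qed.

End conservativeness.

(** Conservation of mass for a single [alpha] is enough, since every integrable [f] has a resolvent
    for it. *)
Lemma mass_invariant_measure {R : realType} {d : nat} (mu : {measure set 'rV[R]_d -> \bar R})
    (A : 'rV[R]_d -> 'M[R]_d) (B : 'rV[R]_d -> 'rV[R]_d) T (alpha : R) :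
  0 < alpha -> constructed_semigroup mu A B T ->
  (forall f g M, 0 < M -> resolvent mu setT T alpha f g -> (\forall x \ae mu, `|f x| <= M) ->
     (\forall x \ae mu, 0 <= f x) -> alpha * \int[mu]_x g x = \int[mu]_x f x) ->
  invariant_measure mu T.
Proof.
move=> a0 HT mass; apply/(invariantP HT.1) => t f M t0 M0 Lf fM f0.
have [g Hg] := resolvent_exists HT a0 Lf.
apply: (mass_invariant measurableT HT.1 M0 t0 Hg fM f0) => f' g' Hg' f'M f'0.
by apply: (mass _ _ _ M0 Hg'); [apply: filterS f'M => x; exact|apply: filterS f'0 => x; exact].
Qed.

Theorem proposition2p15 (R : realType) (d : nat)
    (mu : {measure set 'rV[R]_d -> \bar R}) (phi : 'rV[R]_d -> R)
    (A : 'rV[R]_d -> 'M[R]_d) (G : 'rV[R]_d -> 'rV[R]_d)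
    (T T' : R -> ('rV[R]_d -> R) -> 'rV[R]_d -> R)
    (rho := fun x => phi x ^+ 2)
    (b := beta mu rho A)
    (B := fun x => G x - b x) :
  (0 < d)%N ->
  (* (1) *)
  Hloc (lebesgue_rV d) phi ->
  (forall Y : set 'rV[R]_d, measurable Y ->
     mu Y = (\int[lebesgue_rV d]_(x in Y) (rho x)%:E)%E) ->
  (forall U : set 'rV[R]_d, open U -> U !=set0 -> (0 < mu U)%E) ->
  (* (2) *)
  (forall x, (A x)^T = A x) ->
  (forall i j, Hloc mu (fun x => A x i j)) ->
  locally_elliptic A ->
  (* (3) *)
  (forall i, Lploc mu 2%:E (fun x => G x ord0 i)) ->
  (* (4) *)
  (forall u, Cc_smooth setT u -> (\int[mu]_x (diffop A G u x)%:E = 0)%E) ->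
  (* the two semigroups *)
  constructed_semigroup mu A B T ->
  constructed_semigroup mu A (fun x => - B x) T' ->
  [/\ (* (i) *)
      (forall i j, Lp mu 1 setT (fun x => A x i j)) /\
      (forall i, Lp mu 1 setT (fun x => G x ord0 i - b x ord0 i)) ->
      invariant_measure mu T,
      (* (ii) *)
      (exists (u : 'rV[R]_d -> R) (alpha : R),
         [/\ Ck 2 u, 0 < alpha,
             forall K : R, exists r : R, forall x, r <= enorm x -> K <= u x &
             \forall x \ae mu,
               diffop A (fun y => b y - B y) u x <= alpha * u x]) ->
      invariant_measure mu T,
      (* (iii) *)
      (exists2 M : R, 0 <= M &
         \forall x \ae mu,
           - (mxdot (A x) x x / (enorm x ^+ 2 + 1)) + 2^-1 * \tr (A x) +
             dot (b x - B x) x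
           <= M * (enorm x ^+ 2 + 1) * (ln (enorm x ^+ 2 + 1) + 1)) ->
      invariant_measure mu T &
      [<-> invariant_measure mu T;
           forall t, 0 < t -> conservative_at mu t T';
           exists2 t, 0 < t & conservative_at mu t T']].
Proof.
move=> _ Hphi Hmu _ Asym HA Aell HG divG HT HT'.
have HE : elliptic mu A b B.
  split.
  - exact: mufin Hphi Hmu.
  - exact: Asym.
  - exact: (measurable_entry Hphi Hmu HA).
  - exact: (entry_bound_cube Asym Aell).
  (* Ellipticity is local: the form at [x] is read off on a ball containing [x]. *)
  - move=> x y; have [nu nu0 H] := Aell _ (relcompact_ball (`|x| + 1)).
    have xr : `|x| < `|x| + 1 by rewrite ltrDl.
    have /andP[h _] := H y x xr; apply: le_trans h; apply: mulr_ge0; last exact: dot_ge0.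
    by rewrite invr_ge0 ltW.
  - exact: (beta_L2 Hphi Hmu Asym HA Aell).
  - exact: (drift_L2 Hphi Hmu Asym HA Aell HG).
  - exact: (drift_div Hphi Hmu Asym HA Aell HG divG).
  - exact: (H0g_unique Hphi Hmu).
  - exact: (beta_ibp Hphi Hmu Asym HA).
have lyap (h : 'rV[R]_d -> R) alpha : Ck 2 h -> 0 < alpha -> (forall x, 0 <= h x) ->
    (forall K : R, exists r : R, forall x, r <= enorm x -> K <= h x) ->
    (\forall x \ae mu, diffop A (fun y => b y - B y) h x <= alpha * h x) -> invariant_measure mu T.
  move=> Ch a0 h0 hinf sub; apply: (mass_invariant_measure a0 HT) => f g M M0 Hg fM f0.
  exact: (lyapunov_mass HE Ch h0 hinf a0 sub HT M0 Hg fM f0).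
split.
- move=> [LA LB]; apply: (mass_invariant_measure ltr01 HT) => f g M M0 Hg fM _.
  apply: (integrable_mass HE _ _ HT ltr01 M0 Hg fM).
    by move=> i j; apply/(Lp1P _ _ measurableT).
  move=> i; have /(Lp1P _ _ measurableT) L := LB i.
  by apply: (L1_eq measurableT _ L) => x _; rewrite !mxE.
- move=> [u [alpha [Cu a0 uinf sub]]].
  have [h [Ch h0 hinf hsub]] := nonneg_lyapunov HE Cu a0 uinf sub.
  exact: lyap Ch a0 h0 hinf hsub.
- move=> [M1 M10 H]; have a0 : 0 < 2 * M1 + 1 by rewrite ltr_wpDl// mulr_ge0.
  apply: (mass_invariant_measure a0 HT) => f g M M0 Hg fM f0.
  exact: (log_mass HE M10 H HT M0 Hg fM f0).
have dual (u v : 'rV[R]_d -> R) (M t : R) : 0 < M -> 0 < t -> L1 mu setT u -> L1 mu setT v ->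
    (\forall x \ae mu, setT x -> `|u x| <= M) -> (\forall x \ae mu, setT x -> `|v x| <= M) ->
    \int[mu]_x (T t u x * v x) = \int[mu]_x (u x * T' t v x).
  apply: (semigroup_duality measurableT HT.1 HT'.1).
  - move=> a N f f' g g' a0 N0 Hg Hg' fN f'N.
    by apply: (resolvent_duality HE HT HT' a0 N0 Hg Hg'); [apply: filterS fN => x; exact|apply: filterS f'N => x; exact].
  - by move=> a f; exact: (resolvent_exists HT).
  - by move=> a f; exact: (resolvent_exists HT').
tfae.
- exact: (invariant_conservative (mufin Hphi Hmu) HT.1 HT'.1 dual).
- by move=> H; exists 1 => //; exact: H.
- by move=> [t t0]; exact: (conservative_invariant (mufin Hphi Hmu) HT.1 HT'.1 dual t0).
Qed.
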